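(* Let $\alpha\in(0,1)$ and $A\in\mathbb{R}^{d\times d}$. The inhomogeneous system \[ {}^{C}D^\alpha_{0+}x(t)=Ax(t)+f(t),\qquad t\ge0, \] has at least one solution bounded on $\mathbb{R}_{\ge0}$ for every $f\in C_\infty(\mathbb{R}_{\ge0};\mathbb{R}^d)$ if and only if $\sigma(A)\subset\Lambda_\alpha^u\cup\Lambda_\alpha^s$, i.e. $A$ has no eigenvalue $\lambda$ with $\lambda=0$ or $|\arg\lambda|=\alpha\pi/2$.
   Context: For $\alpha\in(0,1)$ the Caputo derivative of a sufficiently regular function on $[0,\infty)$ is ${}^{C}D^\alpha_{0+}x(t)=\frac{1}{\Gamma(1-\alpha)}\int_0^t(t-\tau)^{-\alpha}x'(\tau)\,d\tau$, applied componentwise. Arguments of nonzero complex numbers are in $(-\pi,\pi]$; $\Lambda_\alpha^u:=\{\lambda\in\mathbb{C}\setminus\{0\}:|\arg\lambda|<\alpha\pi/2\}$ and $\Lambda_\alpha^s:=\{\lambda\in\mathbb{C}\setminus\{0\}:|\arg\lambda|>\alpha\pi/2\}$; $\sigma(A)$ is the set of (complex) eigenvalues of $A$. $C_\infty(\mathbb{R}_{\ge0};\mathbb{R}^d)$ is the space of bounded continuous functions $\mathbb{R}_{\ge0}\to\mathbb{R}^d$. Solutions with initial value $x_0$ are given by $x(t)=E_\alpha(t^\alpha A)x_0+\int_0^t(t-\tau)^{\alpha-1}E_{\alpha,\alpha}((t-\tau)^\alpha A)f(\tau)\,d\tau$, where $E_{\alpha,\beta}(z)=\sum_{k\ge0}z^k/\Gamma(\alpha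 k+\beta)$, $E_\alpha=E_{\alpha,1}$. *)

(* Defs.v *)
From Stdlib Require Import Reals Lra ClassicalEpsilon.
Open Scope R_scope.

(* A "definite description" for reals: some l with P l (used only when P
   has exactly one witness). *)
Definition the_real (P : R -> Prop) : R := epsilon (inhabits 0) P.

(* Vectors in R^d / matrices in R^{d x d}: nat-indexed, only indices < d matter. *)
Fixpoint rsum (n : nat) (g : nat -> R) : R :=
  match n with O => 0 | S n => rsum n g + g n end.

Definition mmul (d : nat) (M N : nat -> nat -> R) : nat -> nat -> R :=
  fun i j => rsum d (fun k => M i k * N k j).
Definition mid : nat -> nat -> R := fun i j => if Nat.eqb i j then 1 else 0.
Fixpoint mpow (d : nat) (M : nat -> nat -> R) (k : nat) : nat -> nat -> R :=
  match k with O => mid | S k => mmul d M (mpow d M k) end.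
Definition mscale (c : R) (M : nat -> nat -> R) : nat -> nat -> R :=
  fun i j => c * M i j.
Definition mvec (d : nat) (M : nat -> nat -> R) (v : nat -> R) : nat -> R :=
  fun i => rsum d (fun j => M i j * v j).

Definition is_int_0inf (g : R -> R) (l : R) : Prop :=
  forall eps, 0 < eps -> exists delta Mb, 0 < delta /\
    forall c e, 0 < c < delta -> Mb < e ->
      exists pr : Riemann_integrable g c e, Rabs (RiemannInt pr - l) < eps.

Definition is_int_oo (g : R -> R) (a b l : R) : Prop :=
  forall eps, 0 < eps -> exists delta, 0 < delta /\
    forall c e, a < c < a + delta -> b - delta < e < b -> c <= e ->
      exists pr : Riemann_integrable g c e, Rabs (RiemannInt pr - l) < eps.

Definition Gamma (s : R) : R :=
  the_real (is_int_0inf (fun t => Rpower t (s - 1) * exp (- t))).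

Definition ML (d : nat) (alpha beta : R) (M : nat -> nat -> R) : nat -> nat -> R :=
  fun i j => the_real (Un_cv (fun n =>
     sum_f_R0 (fun k => mpow d M k i j / Gamma (alpha * INR k + beta)) n)).

(* x is the solution of  ^C D^alpha x = A x + f,  x(0) = x0, given by the
   variation-of-constants formula
   x(t) = E_alpha(t^alpha A) x0 + int_0^t (t-s)^(alpha-1) E_{alpha,alpha}((t-s)^alpha A) f(s) ds. *)
Definition is_solution (alpha : R) (d : nat) (A : nat -> nat -> R)
    (f : R -> nat -> R) (x0 : nat -> R) (x : R -> nat -> R) : Prop :=
  (forall i, (i < d)%nat -> x 0 i = x0 i) /\
  forall t, 0 < t -> forall i, (i < d)%nat ->
    is_int_oo
      (fun s => Rpower (t - s) (alpha - 1) *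
                mvec d (ML d alpha alpha (mscale (Rpower (t - s) alpha) A)) (f s) i)
      0 t
      (x t i - mvec d (ML d alpha 1 (mscale (Rpower t alpha) A)) x0 i).

Definition Cinf (d : nat) (f : R -> nat -> R) : Prop :=
  (forall i, (i < d)%nat -> forall t, 0 <= t -> forall eps, 0 < eps ->
     exists delta, 0 < delta /\ forall s, 0 <= s -> Rabs (s - t) < delta ->
       Rabs (f s i - f t i) < eps) /\
  (exists Mb, forall t, 0 <= t -> forall i, (i < d)%nat -> Rabs (f t i) <= Mb).

Definition bounded_on_nonneg (d : nat) (x : R -> nat -> R) : Prop :=
  exists Mb, forall t, 0 <= t -> forall i, (i < d)%nat -> Rabs (x t i) <= Mb.

(* lambda = a + i b is a (complex) eigenvalue of the real matrix A:
   A (u + i w) = (a + i b)(u + i w) for some nonzero u + i w in C^d. *)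
Definition is_eigenvalue (d : nat) (A : nat -> nat -> R) (a b : R) : Prop :=
  exists u w : nat -> R,
    (exists i, (i < d)%nat /\ (u i <> 0 \/ w i <> 0)) /\
    forall i, (i < d)%nat ->
      mvec d A u i = a * u i - b * w i /\ mvec d A w i = b * u i + a * w i.

(* Principal argument of a + i b in (-PI, PI] (value at 0 irrelevant). *)
Definition carg (a b : R) : R :=
  if Rlt_dec 0 a then atan (b / a)
  else if Rlt_dec a 0 then
    (if Rle_dec 0 b then atan (b / a) + PI else atan (b / a) - PI)
  else if Rlt_dec 0 b then PI / 2
  else if Rlt_dec b 0 then - (PI / 2) else 0.

Definition in_Lambda_u (alpha a b : R) : Prop :=
  (a <> 0 \/ b <> 0) /\ Rabs (carg a b) < alpha * PI / 2.
Definition in_Lambda_s (alpha a b : R) : Prop :=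
  (a <> 0 \/ b <> 0) /\ Rabs (carg a b) > alpha * PI / 2.

(* Main.v *)
(** Everything is decided on Laplace transforms at large real arguments, where a
    solution satisfies [s^alpha z^ = A z^ + (f + A x0)^]; by Lerch's theorem this
    determines the continuous function [z = x - x0].  For one eigenvalue
    [lambda = e^(l + i phi)], a contour integral (residue theorem on rectangles of a
    strip, in the variable [log s]) writes [1/(s^alpha - lambda)] as an absolutely
    integrable superposition of [1/(s - sigma)] with [Re sigma < 0], plus, unless
    [|phi|] is large, a term [c/(s - mu)] with [mu = lambda^(1/alpha)].  The superposition
    maps bounded functions to bounded functions; the remaining term is harmless if
    [Re mu < 0], is made bounded by the choice of the initial value if
    [Re mu > 0], and resonates with [cos (Im mu t)] if [Re mu = 0], which is the case
    [|phi| = alpha PI/2]; for [lambda = 0] the response to a constant is a multiple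
    of [t^alpha].  Systems are reduced to this scalar case by a triangular
    form of [A] over the complex numbers (sufficiency) and by a left eigenvector
    (necessity). *)
Require Import Defs.
From Stdlib Require Import Reals Lra Lia Classical ClassicalEpsilon.
From Coquelicot Require Import Coquelicot.
From mathcomp Require all_boot all_order all_algebra complex Rstruct.
Open Scope R_scope.

(** * Continuous functions and their integrals *)

(** The classical route uses sectorial asymptotics of Mittag-Leffler functions. Here only their
    power series on the half line and transforms at large real [s] are needed; Lerch's theorem
    carries boundedness back from transforms to functions. The initial value enters as forcing: the
    coefficients of E_al are integrated coefficients of E_(al,al), so E_al(t^al A) x0 - x0 is itself
    the response to the constant forcing A x0. Hence x - x0 starts at zero with forcing f + A x0,
    and choosing x0 means adding a constant to the forcing. On the contour, two horizontal lines at
    distance 2 PI carry the same sigma = e^w but different values of e^(al w); the difference of the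
    two integrands is the density of the superposition. The lines lie slightly off the heights -PI
    and PI, because mu may be a negative real number and would then sit on an edge. Limits are
    exchanged only through explicit tail bounds on finite ranges, so Fubini is needed only for
    continuous functions on rectangles. *)

Definition cont (f : R -> R) : Prop := forall x, continuous f x.
Definition cont2 (f : R -> R -> R) : Prop := forall x y, continuity_2d_pt f x y.

(* [RInt] leaves equations at the type [NormedModule.sort R_NormedModule], which [ring] rejects. *)
Ltac eqR := match goal with |- @eq _ ?a ?b => change (@eq R a b) end.

Lemma cont_const c : cont (fun _ => c).
Proof. intro x; apply continuous_const. Qed.
Lemma cont_id : cont (fun t => t).
Proof. intro x; apply continuous_id. Qed.
Lemma cont_plus f g : cont f -> cont g -> cont (fun t => f t + g t).
Proof. intros Hf Hg x; apply (continuous_plus f g x); auto. Qed.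
Lemma cont_opp f : cont f -> cont (fun t => - f t).
Proof. intros Hf x; apply (continuous_opp f x); auto. Qed.
Lemma cont_minus f g : cont f -> cont g -> cont (fun t => f t - g t).
Proof. intros Hf Hg x; apply (continuous_minus f g x); auto. Qed.
Lemma cont_mult f g : cont f -> cont g -> cont (fun t => f t * g t).
Proof. intros Hf Hg x; apply (continuous_mult f g x); auto. Qed.
Lemma cont_div_r f c : cont f -> cont (fun t => f t / c).
Proof. intros Hf; apply cont_mult; auto using cont_const. Qed.
Lemma cont_comp f g : cont f -> cont g -> cont (fun t => f (g t)).
Proof. intros Hf Hg x; apply (continuous_comp g f x); auto. Qed.
Lemma cont_exp f : cont f -> cont (fun t => exp (f t)).
Proof.
  intros Hf; apply (cont_comp exp f); auto.
  intro x; apply continuity_pt_filterlim, derivable_continuous_pt, derivable_pt_exp.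
Qed.
Lemma cont_cos f : cont f -> cont (fun t => cos (f t)).
Proof. intros Hf; apply (cont_comp cos f); auto; intro x; apply continuous_cos. Qed.
Lemma cont_sin f : cont f -> cont (fun t => sin (f t)).
Proof. intros Hf; apply (cont_comp sin f); auto; intro x; apply continuous_sin. Qed.
Lemma cont_abs f : cont f -> cont (fun t => Rabs (f t)).
Proof. intros Hf; apply (cont_comp Rabs f); auto; intro x; apply continuous_Rabs. Qed.
Lemma cont_pow f n : cont f -> cont (fun t => f t ^ n).
Proof.
  intros Hf; induction n as [|n IH]; simpl; [apply cont_const|].
  apply cont_mult; auto.
Qed.
Lemma cont_ext f g : (forall t, f t = g t) -> cont f -> cont g.
Proof. intros H Hf x; apply continuous_ext with f; auto. Qed.
Lemma cont_rsum n (g : nat -> R -> R) :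
  (forall j, (j < n)%nat -> cont (g j)) -> cont (fun t => rsum n (fun j => g j t)).
Proof.
  induction n as [|n IH]; simpl; intros H; [apply cont_const|].
  apply cont_plus; [apply IH; auto|apply H; lia].
Qed.

(** Data given only on [0, infinity) are extended by composition with [Rmax 0]; continuity and
    integrability can then be stated on the whole line without side conditions. *)
Lemma cont_Rmax0 : cont (fun t => Rmax 0 t).
Proof.
  apply (cont_ext (fun t => (t + Rabs t) / 2)).
  - intros t; unfold Rmax, Rabs; destruct (Rle_dec 0 t), (Rcase_abs t); lra.
  - apply cont_div_r, cont_plus; [apply cont_id|apply cont_abs, cont_id].
Qed.

Ltac ct := repeat lazymatch goal with
  | |- cont (fun _ => ?c) => apply (cont_const c)
  | |- cont (fun t => t) => apply cont_id
  | |- cont (fun t => @?f t + @?g t) => apply (cont_plus f g)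
  | |- cont (fun t => @?f t - @?g t) => apply (cont_minus f g)
  | |- cont (fun t => - @?f t) => apply (cont_opp f)
  | |- cont (fun t => @?f t * @?g t) => apply (cont_mult f g)
  | |- cont (fun t => @?f t / ?c) => apply (cont_div_r f c)
  | |- cont (fun t => exp (@?f t)) => apply (cont_exp f)
  | |- cont (fun t => cos (@?f t)) => apply (cont_cos f)
  | |- cont (fun t => sin (@?f t)) => apply (cont_sin f)
  | |- cont (fun t => Rabs (@?f t)) => apply (cont_abs f)
  | |- cont (fun t => @?f t ^ ?n) => apply (cont_pow f n)
  | |- cont _ => assumption
  end.

Lemma cont2_of1 f : cont f -> cont2 (fun x _ => f x).
Proof.
  intros Hf x y; apply (continuity_1d_2d_pt_comp f (fun u _ => u));
    [apply continuity_pt_filterlim, Hf|apply continuity_2d_pt_id1].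
Qed.
Lemma cont2_of2 f : cont f -> cont2 (fun _ y => f y).
Proof.
  intros Hf x y; apply (continuity_1d_2d_pt_comp f (fun _ u => u));
    [apply continuity_pt_filterlim, Hf|apply continuity_2d_pt_id2].
Qed.
Lemma cont2_comp f g : cont f -> cont2 g -> cont2 (fun x y => f (g x y)).
Proof.
  intros Hf Hg x y; apply (continuity_1d_2d_pt_comp f g); auto.
  apply continuity_pt_filterlim, Hf.
Qed.
Lemma cont2_plus f g : cont2 f -> cont2 g -> cont2 (fun x y => f x y + g x y).
Proof. intros Hf Hg x y; apply continuity_2d_pt_plus; auto. Qed.
Lemma cont2_minus f g : cont2 f -> cont2 g -> cont2 (fun x y => f x y - g x y).
Proof. intros Hf Hg x y; apply continuity_2d_pt_minus; auto. Qed.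
Lemma cont2_mult f g : cont2 f -> cont2 g -> cont2 (fun x y => f x y * g x y).
Proof. intros Hf Hg x y; apply continuity_2d_pt_mult; auto. Qed.
Lemma cont2_swap f : cont2 f -> cont2 (fun x y => f y x).
Proof.
  intros Hf x y eps. destruct (Hf y x eps) as [d Hd].
  exists d; intros u v Hu Hv; apply Hd; auto.
Qed.
Lemma cont2_fix1 f x : cont2 f -> cont (fun y => f x y).
Proof.
  intros Hf y; apply continuity_pt_filterlim; intros eps He.
  destruct (Hf x y (mkposreal _ He)) as [d Hd]; exists d; split; [apply cond_pos|].
  intros v [_ Hv]; apply (Hd x v); [|exact Hv].
  rewrite Rminus_diag, Rabs_R0; apply cond_pos.
Qed.
Lemma cont2_fix2 f y : cont2 f -> cont (fun x => f x y).
Proof. intros Hf; apply (cont2_fix1 (fun a b => f b a)), cont2_swap, Hf. Qed.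
Lemma cont2_ext f g : (forall x y, f x y = g x y) -> cont2 f -> cont2 g.
Proof. intros H Hf x y; apply continuity_2d_pt_ext with f; auto. Qed.

Lemma cont_ex_RInt f a b : cont f -> ex_RInt f a b.
Proof. intros Hf; apply (ex_RInt_continuous (V := R_CompleteNormedModule)); intros; apply Hf. Qed.

Lemma RInt_abs_le f g a b : a <= b -> ex_RInt f a b -> ex_RInt g a b ->
  (forall t, a <= t <= b -> Rabs (f t) <= g t) -> Rabs (RInt f a b) <= RInt g a b.
Proof.
  intros Hab Hf Hg H.
  apply (norm_RInt_le f g a b); auto; apply (RInt_correct (V := R_CompleteNormedModule)); auto.
Qed.

Lemma RInt_abs_le_const f M a b : a <= b -> ex_RInt f a b ->
  (forall t, a <= t <= b -> Rabs (f t) <= M) -> Rabs (RInt f a b) <= M * (b - a).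
Proof.
  intros Hab Hf H.
  replace (M * (b - a)) with (RInt (fun _ => M) a b).
  - apply RInt_abs_le; auto; apply ex_RInt_const.
  - rewrite RInt_const; unfold scal; simpl; unfold mult; simpl; ring.
Qed.

Lemma RInt_Ropp f a b : cont f -> RInt (fun t => - f t) a b = - RInt f a b.
Proof. intros Hf; apply (RInt_opp f a b), cont_ex_RInt, Hf. Qed.
Lemma RInt_Rscal c f a b : cont f -> RInt (fun t => c * f t) a b = c * RInt f a b.
Proof. intros Hf; apply (RInt_scal f a b c), cont_ex_RInt, Hf. Qed.
Lemma RInt_Rplus f g a b : cont f -> cont g ->
  RInt (fun t => f t + g t) a b = RInt f a b + RInt g a b.
Proof. intros Hf Hg; apply (RInt_plus f g a b); apply cont_ex_RInt; auto. Qed.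
Lemma RInt_sub (f g : R -> R) a b : ex_RInt f a b -> ex_RInt g a b ->
  RInt (fun t => f t - g t) a b = RInt f a b - RInt g a b.
Proof. intros Hf Hg; apply (RInt_minus f g a b Hf Hg). Qed.
Lemma ex_RInt_cts (f : R -> R) a b : (forall t, Rmin a b <= t <= Rmax a b -> continuous f t) -> ex_RInt f a b.
Proof. intros H; apply (ex_RInt_continuous (V := R_CompleteNormedModule)), H. Qed.
Lemma RInt_Rminus f g a b : cont f -> cont g ->
  RInt (fun t => f t - g t) a b = RInt f a b - RInt g a b.
Proof. intros Hf Hg; apply (RInt_minus f g a b); apply cont_ex_RInt; auto. Qed.
Lemma RInt_Rchasles f a b c : cont f -> RInt f a b + RInt f b c = RInt f a c.
Proof. intros Hf; apply (RInt_Chasles f a b c); apply cont_ex_RInt; auto. Qed.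
Lemma RInt_Rconst c a b : RInt (fun _ => c) a b = c * (b - a).
Proof. rewrite RInt_const; unfold scal; simpl; unfold mult; simpl; eqR; ring. Qed.
Lemma RInt_Rpoint f a : RInt f a a = 0.
Proof. apply (RInt_point a f). Qed.

Lemma cont_is_derive_RInt f a T : cont f -> is_derive (fun T => RInt f a T) T (f T).
Proof.
  intros Hf; apply (is_derive_RInt f (fun T => RInt f a T) a); [|apply Hf].
  apply filter_forall; intros x; apply (RInt_correct (V := R_CompleteNormedModule)), cont_ex_RInt, Hf.
Qed.

Lemma is_derive_cont f df : (forall x, is_derive f x (df x)) -> cont f.
Proof. intros H x; apply (ex_derive_continuous f); exists (df x); apply H. Qed.

Lemma cont_RInt f a : cont f -> cont (fun T => RInt f a T).
Proof. intros Hf; apply (is_derive_cont _ f); intros x; apply cont_is_derive_RInt, Hf. Qed.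

Lemma RInt_of_derive f df a b : (forall x, is_derive f x (df x)) -> cont df ->
  RInt df a b = f b - f a.
Proof.
  intros H Hd; apply is_RInt_unique, (is_RInt_derive f df); auto.
Qed.

(** Uniform continuity near the compact segment {x} x [a, b] makes the integrands uniformly close;
    the case b < a is reduced to this one by reversing the orientation. *)
Lemma cont_RInt_param f a b : cont2 f -> cont (fun x => RInt (f x) a b).
Proof.
  intros Hf.
  assert (W : forall a b, a <= b -> cont (fun x => RInt (f x) a b)).
  { clear a b; intros a b Hab x.
    apply continuity_pt_filterlim; intros eps He.
    (* The [+ 1] covers the case a = b and makes the final inequality strict. *)
    assert (He' : 0 < eps / (b - a + 1)) by (apply Rdiv_lt_0_compat; lra).
    destruct (uniform_continuity_2d_1d' f a b x) with (eps := mkposreal _ He') as [d Hd];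
      [intros; apply Hf|].
    exists d; split; [apply cond_pos|]; intros y [_ Hy].
    simpl in Hy |- *; unfold R_dist in *.
    assert (Hx1 : forall z, cont (f z)) by (intro z; apply cont2_fix1, Hf).
    rewrite <- (RInt_minus (f y) (f x)) by (apply cont_ex_RInt; auto).
    apply Rle_lt_trans with (eps / (b - a + 1) * (b - a)).
    - apply (RInt_abs_le_const _ _ a b Hab).
      + apply cont_ex_RInt, cont_minus; auto.
      + intros t Ht. apply Rlt_le, (Hd t x t y); auto.
        * split; generalize (cond_pos d); lra.
        * apply Rabs_lt_between' in Hy; lra.
        * rewrite Rminus_diag, Rabs_R0; apply cond_pos.
    - apply Rmult_lt_reg_r with (b - a + 1); [lra|].
      unfold Rdiv; replace (eps * / (b - a + 1) * (b - a) * (b - a + 1))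
        with (eps * (b - a)) by (field; lra).
      nra. }
  destruct (Rle_dec a b) as [Hab|Hab]; [apply W; auto|].
  apply cont_ext with (fun x => - RInt (f x) b a).
  - intros t; apply (opp_RInt_swap (f t)), cont_ex_RInt, cont2_fix1, Hf.
  - apply cont_opp, W; lra.
Qed.

(** The increment splits at the old upper limit: over [a, y] only the parameter changes, and over
    [y, v] the integrand is bounded by [B] close to (x, y), so that this piece is at most B |v -
    y|. *)
Lemma cont2_RInt f a : cont2 f -> cont2 (fun x y => RInt (f x) a y).
Proof.
  intros Hf x y eps.
  destruct (Hf x y (mkposreal 1 Rlt_0_1)) as [d1 H1]; simpl in H1.
  set (B := Rabs (f x y) + 1).
  assert (HB : 0 < B) by (unfold B; generalize (Rabs_pos (f x y)); lra).
  assert (Hc : cont (fun x => RInt (f x) a y)) by (apply cont_RInt_param, Hf).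
  destruct ((proj2 (continuity_pt_filterlim _ _) (Hc x)) (eps / 2)) as [d2 [Hd2 H2]];
    [generalize (cond_pos eps); lra|].
  set (d3 := eps / 2 / (B + 1)).
  assert (Hd3 : 0 < d3) by (unfold d3; generalize (cond_pos eps); intro; apply Rdiv_lt_0_compat; lra).
  assert (Hd : 0 < Rmin d1 (Rmin d2 d3)) by (repeat apply Rmin_case; auto; apply cond_pos).
  exists (mkposreal _ Hd); simpl; intros u v Hu Hv.
  assert (Hu1 : Rabs (u - x) < d1) by (apply Rlt_le_trans with (1 := Hu), Rmin_l).
  assert (Hu2 : Rabs (u - x) < d2)
    by (apply Rlt_le_trans with (1 := Hu); eapply Rle_trans; [apply Rmin_r|apply Rmin_l]).
  assert (Hv1 : Rabs (v - y) < d1) by (apply Rlt_le_trans with (1 := Hv), Rmin_l).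
  assert (Hv3 : Rabs (v - y) < d3)
    by (apply Rlt_le_trans with (1 := Hv); eapply Rle_trans; [apply Rmin_r|apply Rmin_r]).
  assert (Hcu : forall z, cont (f z)) by (intro z; apply cont2_fix1, Hf).
  rewrite <- (RInt_Chasles (f u) a y v) by (apply cont_ex_RInt; auto).
  unfold plus; simpl.
  replace (RInt (f u) a y + RInt (f u) y v - RInt (f x) a y)
    with ((RInt (f u) a y - RInt (f x) a y) + RInt (f u) y v) by ring.
  apply Rle_lt_trans with (1 := Rabs_triang _ _).
  assert (E1 : Rabs (RInt (f u) a y - RInt (f x) a y) < eps / 2).
  { destruct (Req_dec u x) as [->|Hne].
    - rewrite Rminus_diag, Rabs_R0; generalize (cond_pos eps); lra.
    - apply (H2 u); split; [split; [exact I|auto]|exact Hu2]. }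
  assert (E2 : Rabs (RInt (f u) y v) <= B * Rabs (v - y)).
  { assert (Hb : forall t, Rabs (t - y) < d1 -> Rabs (f u t) <= B).
    { intros t Ht. specialize (H1 u t Hu1 Ht). unfold B.
      replace (f u t) with ((f u t - f x y) + f x y) by ring.
      eapply Rle_trans; [apply Rabs_triang|lra]. }
    destruct (Rle_dec y v) as [Hyv|Hyv].
    - rewrite (Rabs_pos_eq (v - y)) in * by lra.
      apply RInt_abs_le_const; auto; [apply cont_ex_RInt; auto|].
      intros t Ht; apply Hb; rewrite Rabs_pos_eq; lra.
    - rewrite (Rabs_left (v - y)) in * by lra.
      rewrite <- (opp_RInt_swap (f u)) by (apply cont_ex_RInt; auto).
      unfold opp; simpl; rewrite Rabs_Ropp.
      replace (B * - (v - y)) with (B * (y - v)) by ring.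
      apply RInt_abs_le_const; [lra|apply cont_ex_RInt; auto|].
      intros t Ht; apply Hb; rewrite Rabs_left1; lra. }
  assert (E3 : B * Rabs (v - y) < eps / 2).
  { apply Rle_lt_trans with ((B + 1) * Rabs (v - y)).
    - generalize (Rabs_pos (v - y)); nra.
    - replace (eps / 2) with ((B + 1) * d3) by (unfold d3; field; lra).
      apply Rmult_lt_compat_l; lra. }
  lra.
Qed.

Lemma is_derive_0_eq (h : R -> R) a b :
  (forall x, is_derive h x 0) -> h a = h b.
Proof.
  intros H.
  assert (E : RInt (fun _ => 0) a b = h b - h a)
    by (apply (RInt_of_derive h (fun _ => 0)); [exact H|apply cont_const]).
  rewrite RInt_const in E. unfold scal in E; simpl in E; unfold mult in E; simpl in E. lra.
Qed.

Lemma is_derive_RInt_param_cont (f df : R -> R -> R) a b x :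
  (forall x t, is_derive (fun x => f x t) x (df x t)) ->
  cont2 df -> (forall x, cont (f x)) ->
  is_derive (fun x => RInt (f x) a b) x (RInt (df x) a b).
Proof.
  intros H1 H2 H3.
  rewrite (RInt_ext (df x) (fun t => Derive (fun u => f u t) x))
    by (intros t _; symmetry; apply is_derive_unique, H1).
  apply is_derive_RInt_param.
  - apply filter_forall; intros y t _; eexists; apply H1.
  - intros t _; apply continuity_2d_pt_ext with df; [|apply H2].
    intros u v; symmetry; apply is_derive_unique, H1.
  - apply filter_forall; intros y; apply cont_ex_RInt, H3.
Qed.

(** As functions of the upper limit [d], both iterated integrals have the same derivative, the
    integral of f x d over x, and both vanish at d = c. *)
Lemma RInt_swap f a b c d : cont2 f ->
  RInt (fun x => RInt (fun y => f x y) c d) a b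
  = RInt (fun y => RInt (fun x => f x y) a b) c d.
Proof.
  intros Hf.
  set (h := fun d => RInt (fun x => RInt (fun y => f x y) c d) a b
                    - RInt (fun y => RInt (fun x => f x y) a b) c d).
  assert (E : h c = h d).
  { apply is_derive_0_eq; intros z.
    replace 0 with (RInt (fun x => f x z) a b - RInt (fun x => f x z) a b) by ring.
    apply (is_derive_minus (fun d => RInt (fun x => RInt (fun y => f x y) c d) a b)).
    - apply (is_derive_RInt_param_cont (fun d x => RInt (fun y => f x y) c d) (fun d x => f x d)).
      + intros y t; apply (cont_is_derive_RInt (f t)), cont2_fix1, Hf.
      + apply cont2_swap, Hf.
      + intros y; apply (cont2_fix1 (fun d x => RInt (f x) c d)).
        apply cont2_swap, (cont2_RInt f c), Hf.
    - apply (cont_is_derive_RInt (fun y => RInt (fun x => f x y) a b)).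
      apply (cont_RInt_param (fun y x => f x y)), cont2_swap, Hf. }
  unfold h in E. rewrite (RInt_point c (fun y => RInt (fun x => f x y) a b)) in E.
  rewrite (RInt_ext (fun x => RInt (fun y => f x y) c c) (fun _ => 0)) in E
    by (intros; apply (RInt_point c (f x))).
  rewrite RInt_const in E. unfold scal, zero in E; simpl in E; unfold mult in E; simpl in E.
  lra.
Qed.

(** * Laplace transforms and Lerch's uniqueness theorem *)

Lemma is_lim_exp_decay C c : 0 < c -> is_lim (fun T => C * exp (- c * T)) p_infty 0.
Proof.
  intros Hc.
  replace (Finite 0) with (Rbar_mult C 0) by (simpl; f_equal; ring).
  apply (is_lim_scal_l (fun T => exp (- c * T)) C p_infty 0).
  apply (is_lim_comp exp (fun T => - c * T) p_infty 0 m_infty).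
  - apply is_lim_exp_m.
  - replace m_infty with (Rbar_mult (- c) p_infty).
    + apply (is_lim_scal_l (fun T => T)), is_lim_id.
    + simpl; destruct (Rle_dec 0 (- c)); [exfalso; lra|reflexivity].
  - exists 0; intros; discriminate.
Qed.

Lemma is_lim_le_tail (I B : R -> R) l :
  (forall T, 0 <= T -> Rabs (I T - l) <= B T) -> is_lim B p_infty 0 -> is_lim I p_infty l.
Proof.
  intros H HB. apply is_lim_spec; intros eps.
  apply is_lim_spec in HB; destruct (HB eps) as [T0 HT].
  exists (Rmax 0 T0); intros T HTT.
  assert (0 <= T) by (apply Rle_trans with (Rmax 0 T0); [apply Rmax_l|lra]).
  assert (T0 < T) by (apply Rle_lt_trans with (Rmax 0 T0); [apply Rmax_r|lra]).
  specialize (H T H0); specialize (HT T H1).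
  rewrite Rminus_0_r in HT. apply Rle_lt_trans with (1 := H).
  apply Rle_lt_trans with (2 := HT), Rle_abs.
Qed.

(** A Cauchy criterion that keeps the rate. The limit is taken along the integers; for a real T the
    bound is recovered by comparison with a distant integer beyond T. *)
Lemma tail_limit (I B : R -> R) :
  (forall T T', 0 <= T <= T' -> Rabs (I T' - I T) <= B T) -> is_lim B p_infty 0 ->
  exists l, forall T, 0 <= T -> Rabs (I T - l) <= B T.
Proof.
  intros H HB.
  assert (HB' := proj2 (is_lim_spec _ _ _) HB).
  assert (Hc : ex_finite_lim_seq (fun n => I (INR n))).
  { apply ex_lim_seq_cauchy_corr; intros eps.
    destruct (HB' eps) as [T0 HT0].
    destruct (nfloor_ex (Rmax 0 (T0 + 1))) as [N HN]; [apply Rmax_l|].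
    assert (HTN : T0 < INR (S N)).
    { rewrite S_INR; generalize (Rmax_r 0 (T0 + 1)); lra. }
    assert (W : forall n m, (S N <= n)%nat -> (n <= m)%nat -> Rabs (I (INR n) - I (INR m)) < eps).
    { intros n m Hn Hm. rewrite Rabs_minus_sym.
      assert (INR (S N) <= INR n) by (apply le_INR; auto).
      assert (INR n <= INR m) by (apply le_INR; auto).
      apply Rle_lt_trans with (1 := H (INR n) (INR m) (conj (pos_INR n) H1)).
      assert (HH : T0 < INR n) by lra.
      specialize (HT0 _ HH); rewrite Rminus_0_r in HT0.
      apply Rle_lt_trans with (2 := HT0), Rle_abs. }
    exists (S N); intros n m Hn Hm.
    destruct (Nat.le_ge_cases n m); [apply W; auto|].
    rewrite Rabs_minus_sym; apply W; auto. }
  destruct Hc as [l Hl]; exists l; intros T HT.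
  apply Rnot_lt_le; intros Hlt.
  apply is_lim_seq_spec in Hl.
  assert (Hd : 0 < Rabs (I T - l) - B T) by lra.
  destruct (Hl (mkposreal _ Hd)) as [N HN]; simpl in HN.
  destruct (nfloor_ex T HT) as [n Hn].
  set (m := Nat.max N (S n)).
  assert (Hm : T <= INR m).
  { apply Rle_trans with (INR (S n)); [rewrite S_INR; lra|apply le_INR; unfold m; lia]. }
  assert (HmN : (N <= m)%nat) by (unfold m; lia).
  specialize (HN m HmN). specialize (H T (INR m) (conj HT Hm)).
  assert (Rabs (I T - l) <= Rabs (I (INR m) - I T) + Rabs (I (INR m) - l)).
  { rewrite (Rabs_minus_sym (I (INR m))).
    replace (I T - l) with ((I T - I (INR m)) + (I (INR m) - l)) by ring. apply Rabs_triang. }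
  lra.
Qed.

Lemma RInt_exp_decay M c T T' : c <> 0 ->
  RInt (fun t => M * exp (- c * t)) T T' = M / c * (exp (- c * T) - exp (- c * T')).
Proof.
  intros Hc.
  rewrite (RInt_of_derive (fun t => - M / c * exp (- c * t))).
  - eqR; field; auto.
  - intros x. auto_derive; auto. field; auto.
  - ct.
Qed.

Definition lap (u : R -> R) (s l : R) : Prop :=
  is_lim (fun T => RInt (fun t => exp (- s * t) * u t) 0 T) p_infty l.

Definition bexp (b M : R) (u : R -> R) : Prop :=
  forall t, 0 <= t -> Rabs (u t) <= M * exp (b * t).

Lemma bexp_bounded M u : (forall t, 0 <= t -> Rabs (u t) <= M) -> bexp 0 M u.
Proof. intros H t Ht; rewrite Rmult_0_l, exp_0, Rmult_1_r; auto. Qed.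

Lemma lap_ex u b M s : cont u -> bexp b M u -> b < s ->
  exists l, lap u s l /\
    forall T, 0 <= T ->
      Rabs (RInt (fun t => exp (- s * t) * u t) 0 T - l) <= M / (s - b) * exp (- (s - b) * T).
Proof.
  intros Hu HM Hs.
  assert (M0 : 0 <= M).
  { specialize (HM 0 (Rle_refl 0)); rewrite Rmult_0_r, exp_0 in HM.
    generalize (Rabs_pos (u 0)); lra. }
  assert (Hl := is_lim_exp_decay (M / (s - b)) (s - b) ltac:(lra)).
  destruct (tail_limit (fun T => RInt (fun t => exp (- s * t) * u t) 0 T)
    (fun T => M / (s - b) * exp (- (s - b) * T))) as [l Hlim]; auto.
  - intros T T' [HT HT'].
    assert (Hc : cont (fun t => exp (- s * t) * u t)) by ct.
    rewrite <- (RInt_Chasles (fun t => exp (- s * t) * u t) 0 T T') by (apply cont_ex_RInt; auto).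
    unfold plus; simpl. rewrite Rplus_minus_l.
    apply Rle_trans with (RInt (fun t => M * exp (- (s - b) * t)) T T').
    + apply RInt_abs_le; auto.
      * apply cont_ex_RInt; auto.
      * apply cont_ex_RInt; ct.
      * intros t Ht. rewrite Rabs_mult, Rabs_pos_eq by (left; apply exp_pos).
        replace (- (s - b) * t) with (- s * t + b * t) by ring.
        rewrite exp_plus.
        assert (H := HM t ltac:(lra)).
        generalize (exp_pos (- s * t)); nra.
    + rewrite RInt_exp_decay by lra.
      apply Rmult_le_compat_l; [apply Rdiv_le_0_compat; lra|].
      generalize (exp_pos (- (s - b) * T')); lra.
  - exists l; split; auto. apply (is_lim_le_tail _ _ l Hlim Hl).
Qed.

Lemma lap_unique u s l l' : lap u s l -> lap u s l' -> l = l'.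
Proof.
  intros H H'. apply is_lim_unique in H; apply is_lim_unique in H'.
  rewrite H in H'; injection H'; auto.
Qed.

Lemma lap_ext u v s l : (forall t, 0 <= t -> u t = v t) -> lap u s l -> lap v s l.
Proof.
  intros H Hu. apply is_lim_ext_loc with (2 := Hu).
  exists 0; intros T HT. apply RInt_ext; intros t Ht.
  rewrite Rmin_left in Ht by lra. rewrite H; auto; lra.
Qed.

Lemma lap_plus u v s l l' : cont u -> cont v -> lap u s l -> lap v s l' ->
  lap (fun t => u t + v t) s (l + l').
Proof.
  intros Cu Cv Hu Hv.
  apply is_lim_ext with (fun T => RInt (fun t => exp (- s * t) * u t) 0 T
                                + RInt (fun t => exp (- s * t) * v t) 0 T).
  - intros T. rewrite <- (RInt_plus (fun t => exp (- s * t) * u t)) by (apply cont_ex_RInt; ct).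
    apply RInt_ext; intros; unfold plus; simpl; eqR; ring.
  - apply is_lim_plus'; auto.
Qed.

Lemma lap_scal c u s l : cont u -> lap u s l -> lap (fun t => c * u t) s (c * l).
Proof.
  intros Cu Hu.
  apply is_lim_ext with (fun T => c * RInt (fun t => exp (- s * t) * u t) 0 T).
  - intros T. rewrite <- (RInt_scal (fun t => exp (- s * t) * u t)) by (apply cont_ex_RInt; ct).
    apply RInt_ext; intros; unfold scal; simpl; unfold mult; simpl; eqR; ring.
  - replace (Finite (c * l)) with (Rbar_mult c l) by reflexivity.
    apply is_lim_scal_l; auto.
Qed.

Lemma lap_minus u v s l l' : cont u -> cont v -> lap u s l -> lap v s l' ->
  lap (fun t => u t - v t) s (l - l').
Proof.
  intros Cu Cv Hu Hv.
  replace (l - l') with (l + (-1) * l') by ring.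
  apply lap_ext with (fun t => u t + (-1) * v t); [intros; ring|].
  apply lap_plus; auto; [ct|]. apply lap_scal; auto.
Qed.

Lemma lap_rsum n (g : nat -> R -> R) (l : nat -> R) s :
  (forall j, (j < n)%nat -> cont (g j)) -> (forall j, (j < n)%nat -> lap (g j) s (l j)) ->
  lap (fun t => rsum n (fun j => g j t)) s (rsum n l).
Proof.
  induction n as [|n IH]; simpl; intros Hc H.
  - apply is_lim_ext with (fun _ => 0); [|apply is_lim_const].
    intros T; symmetry; rewrite (RInt_ext _ (fun _ => 0)) by (intros; eqR; ring).
    rewrite RInt_const; unfold scal; simpl; unfold mult; simpl; eqR; ring.
  - apply lap_plus; auto. apply cont_rsum; auto.
Qed.

(* For [P t = 1 + eta - (exp (-t) - tau)^2] the weights [exp (-s t) * P t ^ n] are linear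
   combinations of exponentials, hence annihilate [u], while they concentrate at [exp (-t) = tau]. *)
Lemma lap_zero_weight u s0 eta tau n : cont u -> (forall s, s0 < s -> lap u s 0) ->
  forall s, s0 < s -> lap (fun t => (1 + eta - (exp (- t) - tau) ^ 2) ^ n * u t) s 0.
Proof.
  intros Hc H; induction n as [|n IH]; intros s Hs.
  - apply lap_ext with u; [intros; simpl; ring|auto].
  - set (v := fun t => (1 + eta - (exp (- t) - tau) ^ 2) ^ n * u t) in *.
    assert (Cv : cont v) by (unfold v; ct).
    (* Multiplication by [exp (- t)] is a shift of [s] by 1, which preserves [s0 < s]; expanding the
       square calls for the shifts by 1 and by 2. *)
    assert (S1 : lap (fun t => exp (- t) * v t) s 0).
    { apply is_lim_ext with (2 := IH (s + 1) ltac:(lra)).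
      intros T; apply RInt_ext; intros t _. unfold v.
      replace (- (s + 1) * t) with (- s * t + - t) by ring. rewrite exp_plus; eqR; ring. }
    assert (S2 : lap (fun t => exp (- t) * (exp (- t) * v t)) s 0).
    { apply is_lim_ext with (2 := IH (s + 2) ltac:(lra)).
      intros T; apply RInt_ext; intros t _. unfold v.
      replace (- (s + 2) * t) with (- s * t + (- t + - t)) by ring. rewrite !exp_plus; eqR; ring. }
    apply lap_ext with (fun t => (1 + eta - tau ^ 2) * v t
       + (2 * tau * (exp (- t) * v t) + (-1) * (exp (- t) * (exp (- t) * v t)))).
    { intros t _. unfold v; simpl; ring. }
    replace 0 with ((1 + eta - tau ^ 2) * 0 + (2 * tau * 0 + (-1) * 0)) by ring.
    apply lap_plus; [ct|ct|apply lap_scal; auto; apply IH; auto|].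
    apply lap_plus; [ct|ct| |]; apply lap_scal; auto; ct.
Qed.

(** Near [t0] the weight [P t ^ n] is at least (1 + eta/2)^n, while at distance [d] and more it
    stays in [0, 1]. The weighted integral is therefore at least (1 + eta/2)^n q - K with [K]
    independent of [n], and it cannot have the limit 0 for every [n]. *)
Lemma lerch_pos u b M s0 t0 : cont u -> bexp b M u -> (forall s, s0 < s -> lap u s 0) ->
  0 < t0 -> 0 < u t0 -> False.
Proof.
  intros Hc HM H Ht0 Hu0.
  assert (M0 : 0 <= M).
  { assert (H0 := HM 0 (Rle_refl 0)); rewrite Rmult_0_r, exp_0 in H0.
    generalize (Rabs_pos (u 0)); lra. }
  destruct (proj2 (continuity_pt_filterlim _ _) (Hc t0) (u t0 / 2) ltac:(lra)) as [d0 [Hd0 Hd]].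
  set (d := Rmin (d0 / 2) (t0 / 2)).
  assert (Hdp : 0 < d) by (unfold d; apply Rmin_case; lra).
  assert (Hdd : d < d0) by (unfold d; generalize (Rmin_l (d0 / 2) (t0 / 2)); lra).
  assert (Hdt : d < t0) by (unfold d; generalize (Rmin_r (d0 / 2) (t0 / 2)); lra).
  assert (Hloc : forall t, Rabs (t - t0) <= d -> u t0 / 2 <= u t).
  { intros t Ht. destruct (Req_dec t t0) as [->|Hne]; [lra|].
    assert (HH := Hd t). simpl in HH; unfold R_dist in HH.
    assert (A : Rabs (u t - u t0) < u t0 / 2).
    { apply HH; split; [split; [exact I|auto]|lra]. }
    apply Rabs_lt_between in A; lra. }
  clear Hd.
  set (tau := exp (- t0)).
  assert (Htau : 0 < tau < 1).
  { unfold tau; split; [apply exp_pos|rewrite <- exp_0; apply exp_increasing; lra]. }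
  set (a := exp (- (t0 + d))).
  assert (Ha : 0 < a < tau) by (unfold a, tau; split; [apply exp_pos|apply exp_increasing; lra]).
  set (eta := (tau - a) ^ 2).
  assert (He : 0 < eta) by (unfold eta; nra).
  set (P := fun t => 1 + eta - (exp (- t) - tau) ^ 2).
  (* The concavity of [exp (-t)] makes [tau - a] the smaller of the two gaps. *)
  assert (Hout : forall t, 0 <= t -> d <= Rabs (t - t0) -> 0 <= P t <= 1).
  { intros t Ht Hdt'.
    assert (E1 : 0 < exp (- t) <= 1).
    { split; [apply exp_pos|]. rewrite <- exp_0.
      destruct (Req_dec t 0) as [->|]; [right; f_equal; ring|left; apply exp_increasing; lra]. }
    unfold P; split; [nra|].
    assert (eta <= (exp (- t) - tau) ^ 2); [|lra].
    unfold eta. destruct (Rle_dec t0 t) as [L|L].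
    - rewrite Rabs_pos_eq in Hdt' by lra.
      assert (exp (- t) <= a).
      { unfold a. destruct (Req_dec t (t0 + d)) as [->|]; [lra|left; apply exp_increasing; lra]. }
      nra.
    - rewrite Rabs_left in Hdt' by lra.
      assert (E2 : exp (- (t0 - d)) <= exp (- t)).
      { destruct (Req_dec t (t0 - d)) as [->|]; [lra|left; apply exp_increasing; lra]. }
      assert (E3 : exp (- (t0 - d)) * a = tau * tau).
      { unfold a, tau. rewrite <- !exp_plus. f_equal; ring. }
      assert (tau - a <= exp (- (t0 - d)) - tau); [|nra].
      assert (0 <= (tau - a) ^ 2) by nra. nra. }
  assert (HP0 : P t0 = 1 + eta) by (unfold P, tau; ring).
  assert (CP : cont P) by (unfold P; ct).
  destruct (proj2 (continuity_pt_filterlim _ _) (CP t0) (eta / 2) ltac:(lra)) as [d1 [Hd1 Hd2]].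
  set (d' := Rmin (d1 / 2) d).
  assert (Hd'p : 0 < d') by (unfold d'; apply Rmin_case; lra).
  assert (Hd'd : d' <= d) by (unfold d'; apply Rmin_r).
  assert (HPin : forall t, Rabs (t - t0) <= d' -> 1 + eta / 2 <= P t).
  { intros t Ht. destruct (Req_dec t t0) as [->|Hne]; [lra|].
    assert (HH := Hd2 t). simpl in HH; unfold R_dist in HH.
    assert (A : Rabs (P t - P t0) < eta / 2).
    { apply HH; split; [split; [exact I|auto]|].
      apply Rle_lt_trans with (1 := Ht).
      unfold d'; generalize (Rmin_l (d1 / 2) d); lra. }
    apply Rabs_lt_between in A; lra. }
  clear Hd2.
  (* One argument serves for all [n]: it lies where the transforms vanish, and beyond the
     exponential order [b], so that M exp (- c t) has the finite integral [K] over the half line. *)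
  set (s := Rmax s0 b + 1).
  assert (Hs : s0 < s /\ b < s)
    by (unfold s; generalize (Rmax_l s0 b) (Rmax_r s0 b); lra).
  set (c := s - b). assert (Hcp : 0 < c) by (unfold c; lra).
  set (m := Rmin (exp (- s * (t0 - d))) (exp (- s * (t0 + d)))).
  assert (Hm : 0 < m) by (unfold m; apply Rmin_case; apply exp_pos).
  assert (Hmle : forall t, Rabs (t - t0) <= d -> m <= exp (- s * t)).
  { intros t Ht. apply Rabs_le_between' in Ht. unfold m.
    destruct (Rle_dec 0 s) as [S|S].
    - apply Rle_trans with (1 := Rmin_r _ _).
      apply Rnot_lt_le; intros L; apply exp_lt_inv in L; nra.
    - apply Rle_trans with (1 := Rmin_l _ _).
      apply Rnot_lt_le; intros L; apply exp_lt_inv in L; nra. }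
  set (q := m * (u t0 / 2) * (2 * d')).
  assert (Hq : 0 < q) by (unfold q; repeat apply Rmult_lt_0_compat; lra).
  set (K := M / c).
  assert (HK : 0 <= K) by (unfold K; apply Rdiv_le_0_compat; lra).
  assert (Key : forall n T, t0 + d < T ->
     (1 + eta / 2) ^ n * q - K <= RInt (fun t => exp (- s * t) * (P t ^ n * u t)) 0 T).
  { intros n T HT.
    set (g := fun t => exp (- s * t) * (P t ^ n * u t)).
    assert (Cg : cont g) by (unfold g; ct).
    set (h := fun t => M * exp (- c * t)).
    assert (Ch : cont h) by (unfold h; ct).
    assert (B1 : forall x y, 0 <= x <= y ->
        (forall t, x <= t <= y -> d <= Rabs (t - t0) \/ 0 <= P t /\ 0 <= u t) ->
        - RInt h x y <= RInt g x y).
    { intros x y Hxy Hxt.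
      assert (E : RInt (fun t => - h t) x y <= RInt g x y).
      { apply RInt_le; [lra|apply cont_ex_RInt; ct|apply cont_ex_RInt; auto|].
        intros t Ht. unfold h, g.
        assert (E0 := exp_pos (- s * t)).
        assert (Eh : 0 <= M * exp (- c * t)) by (generalize (exp_pos (- c * t)); nra).
        destruct (Hxt t ltac:(lra)) as [D|[D1 D2]].
        - assert (EP := Hout t ltac:(lra) D).
          assert (EPn : 0 <= P t ^ n <= 1).
          { split; [apply pow_le; lra|]. rewrite <- (pow1 n). apply pow_incr; lra. }
          assert (Eu := HM t ltac:(lra)).
          apply Rabs_le_between in Eu.
          replace (- c * t) with (- s * t + b * t) in * by (unfold c; ring).
          rewrite exp_plus in *.
          assert (E1 := exp_pos (b * t)).
          assert (- (M * exp (b * t)) <= P t ^ n * u t).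
          { assert (0 <= M * exp (b * t)) by nra.
            destruct (Rle_dec 0 (u t)); nra. }
          nra.
        - apply Rle_trans with 0; [lra|].
          repeat apply Rmult_le_pos; auto; [lra|apply pow_le; auto]. }
      rewrite RInt_Ropp in E by auto. exact E. }
    assert (I1 : - RInt h 0 (t0 - d) <= RInt g 0 (t0 - d)).
    { apply B1; [lra|]. intros t Ht; left. rewrite Rabs_left1; lra. }
    assert (I3 : - RInt h (t0 + d) T <= RInt g (t0 + d) T).
    { apply B1; [lra|]. intros t Ht; left. rewrite Rabs_pos_eq; lra. }
    assert (PosP : forall t, 0 <= t -> 0 <= P t).
    { intros t Ht. unfold P.
      assert (E1 : 0 < exp (- t) <= 1).
      { split; [apply exp_pos|]. rewrite <- exp_0.
        destruct (Req_dec t 0) as [->|]; [right; f_equal; ring|left; apply exp_increasing; lra]. }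
      nra. }
    assert (B2 : forall x y, t0 - d <= x <= y -> y <= t0 + d -> 0 <= RInt g x y).
    { intros x y Hx Hy. apply RInt_ge_0; [lra|apply cont_ex_RInt; auto|].
      intros t Ht. unfold g. assert (Hl := Hloc t ltac:(apply Rabs_le_between'; lra)).
      repeat apply Rmult_le_pos; [left; apply exp_pos|apply pow_le, PosP; lra|lra]. }
    assert (I2 := B2 (t0 - d) (t0 - d') ltac:(lra) ltac:(lra)).
    assert (I2' := B2 (t0 + d') (t0 + d) ltac:(lra) ltac:(lra)).
    assert (I4 : (1 + eta / 2) ^ n * q <= RInt g (t0 - d') (t0 + d')).
    { replace ((1 + eta / 2) ^ n * q) with
        (RInt (fun _ => m * ((1 + eta / 2) ^ n * (u t0 / 2))) (t0 - d') (t0 + d')).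
      - apply RInt_le; [lra|apply ex_RInt_const|apply cont_ex_RInt; auto|].
        intros t Ht. unfold g.
        assert (Hl := Hloc t ltac:(apply Rabs_le_between'; lra)).
        assert (Hl2 := HPin t ltac:(apply Rabs_le_between'; lra)).
        assert (Hl3 := Hmle t ltac:(apply Rabs_le_between'; lra)).
        assert (Hl4 : 0 <= (1 + eta / 2) ^ n <= P t ^ n).
        { split; [apply pow_le; lra|apply pow_incr; lra]. }
        apply Rmult_le_compat; [lra| |auto|].
        + apply Rmult_le_pos; lra.
        + apply Rmult_le_compat; lra.
      - rewrite RInt_const; unfold scal; simpl; unfold mult; simpl; unfold q; eqR; ring. }
    assert (Eg : RInt g 0 T = RInt g 0 (t0 - d) + (RInt g (t0 - d) (t0 - d')
        + (RInt g (t0 - d') (t0 + d') + (RInt g (t0 + d') (t0 + d) + RInt g (t0 + d) T)))).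
    { rewrite <- (RInt_Chasles g 0 (t0 - d) T) by (apply cont_ex_RInt; auto).
      rewrite <- (RInt_Chasles g (t0 - d) (t0 - d') T) by (apply cont_ex_RInt; auto).
      rewrite <- (RInt_Chasles g (t0 - d') (t0 + d') T) by (apply cont_ex_RInt; auto).
      rewrite <- (RInt_Chasles g (t0 + d') (t0 + d) T) by (apply cont_ex_RInt; auto).
      reflexivity. }
    assert (Eh : RInt h 0 (t0 - d) + RInt h (t0 + d) T <= K).
    { unfold h. rewrite !RInt_exp_decay by lra. fold K.
      rewrite Rmult_0_r, exp_0.
      assert (exp (- c * (t0 + d)) <= exp (- c * (t0 - d))).
      { left; apply exp_increasing; nra. }
      generalize (exp_pos (- c * T)); nra. }
    unfold g in *; lra. }
  assert (Hb : forall n, (1 + eta / 2) ^ n * q <= K + 1).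
  { intros n. assert (L := lap_zero_weight u s0 eta tau n Hc H s (proj1 Hs)).
    apply is_lim_spec in L. destruct (L (mkposreal 1 Rlt_0_1)) as [T0 HT0]; simpl in HT0.
    set (T := Rmax (T0 + 1) (t0 + d + 1)).
    assert (HT : T0 < T /\ t0 + d < T).
    { unfold T; generalize (Rmax_l (T0 + 1) (t0 + d + 1)) (Rmax_r (T0 + 1) (t0 + d + 1)); lra. }
    assert (A := HT0 T (proj1 HT)). assert (A2 := Key n T (proj2 HT)).
    fold P in A. rewrite Rminus_0_r in A. apply Rabs_lt_between in A.
    assert (A3 : RInt (fun t => exp (- s * t) * (P t ^ n * u t)) 0 T < 1) by (apply A).
    lra. }
  destruct (Pow_x_infinity (1 + eta / 2)) with (b := (K + 2) / q) as [N HN].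
  { rewrite Rabs_pos_eq; lra. }
  specialize (HN N (Nat.le_refl N)).
  rewrite Rabs_pos_eq in HN by (apply pow_le; lra).
  assert ((K + 2) / q * q <= (1 + eta / 2) ^ N * q) by (apply Rmult_le_compat_r; lra).
  replace ((K + 2) / q * q) with (K + 2) in H0 by (field; lra).
  specialize (Hb N); lra.
Qed.

(** The positive case is applied to [u] and to [-u]; the value at 0 then follows from continuity. *)
Lemma lerch u b M s0 : cont u -> bexp b M u -> (forall s, s0 < s -> lap u s 0) ->
  forall t, 0 <= t -> u t = 0.
Proof.
  intros Hc HM H.
  assert (P : forall t, 0 < t -> u t = 0).
  { intros t Ht. destruct (Rtotal_order (u t) 0) as [L|[E|L]]; auto; exfalso.
    - apply (lerch_pos (fun t => (-1) * u t) b M s0 t); auto; try lra; [ct| |].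
      + intros x Hx; rewrite Rabs_mult, (Rabs_left (-1)) by lra; specialize (HM x Hx); lra.
      + intros s Hs. replace 0 with (-1 * 0) by ring. apply lap_scal; auto.
    - apply (lerch_pos u b M s0 t); auto. }
  intros t Ht. destruct (Req_dec t 0) as [->|]; [|apply P; lra].
  apply NNPP; intros Hne.
  assert (Ha : 0 < Rabs (u 0)) by (apply Rabs_pos_lt; auto).
  destruct (proj2 (continuity_pt_filterlim _ _) (Hc 0) (Rabs (u 0)) Ha) as [d [Hd HH]].
  assert (A := HH (d / 2)). simpl in A; unfold R_dist in A.
  rewrite (P (d / 2)) in A by lra. rewrite Rminus_0_l, Rabs_Ropp in A.
  apply (Rlt_irrefl (Rabs (u 0))), A. split; [split; [exact I|lra]|].
  rewrite Rminus_0_r, Rabs_pos_eq; lra.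
Qed.

(** * Complex integrals and the residue theorem on rectangles *)

Definition CI (f : R -> C) (a b : R) : C :=
  (RInt (fun t => fst (f t)) a b, RInt (fun t => snd (f t)) a b).
Definition exCI (f : R -> C) (a b : R) : Prop :=
  ex_RInt (fun t => fst (f t)) a b /\ ex_RInt (fun t => snd (f t)) a b.

Lemma C_eq (z w : C) : fst z = fst w -> snd z = snd w -> z = w.
Proof. destruct z, w; simpl; congruence. Qed.

Lemma Cmod2 z : Cmod z ^ 2 = fst z ^ 2 + snd z ^ 2.
Proof. unfold Cmod; rewrite pow2_sqrt; auto; nra. Qed.

Lemma Rabs_fst_Cmod z : Rabs (fst z) <= Cmod z.
Proof. apply Rle_trans with (2 := Rmax_Cmod z), Rmax_l. Qed.
Lemma Rabs_snd_Cmod z : Rabs (snd z) <= Cmod z.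
Proof. apply Rle_trans with (2 := Rmax_Cmod z), Rmax_r. Qed.
Lemma Cmod_le_abs z : Cmod z <= Rabs (fst z) + Rabs (snd z).
Proof.
  unfold Cmod. rewrite <- (pow2_abs (fst z)), <- (pow2_abs (snd z)).
  generalize (Rabs_pos (fst z)) (Rabs_pos (snd z)); intros P Q.
  rewrite <- (sqrt_pow2 (Rabs (fst z) + Rabs (snd z))) by lra.
  apply sqrt_le_1_alt; nra.
Qed.

Lemma Cmod_minus_sym z w : Cmod (z - w)%C = Cmod (w - z)%C.
Proof. rewrite <- Cmod_opp; f_equal; ring. Qed.

Lemma Cmod_triangle_rev z w : Cmod z - Cmod w <= Cmod (z - w)%C.
Proof.
  assert (H := Cmod_triangle (z - w) w).
  replace (z - w + w)%C with z in H by ring. lra.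
Qed.

Lemma CI_ext f g a b : (forall t, Rmin a b < t < Rmax a b -> f t = g t) -> CI f a b = CI g a b.
Proof. intros H; apply C_eq; simpl; apply RInt_ext; intros; rewrite H; auto. Qed.

Lemma exCI_ext f g a b : (forall t, Rmin a b < t < Rmax a b -> f t = g t) ->
  exCI f a b -> exCI g a b.
Proof.
  intros H [H1 H2]; split; [apply ex_RInt_ext with (2 := H1)|apply ex_RInt_ext with (2 := H2)];
  intros; rewrite H; auto.
Qed.

Lemma CI_plus f g a b : exCI f a b -> exCI g a b ->
  CI (fun t => f t + g t)%C a b = (CI f a b + CI g a b)%C.
Proof.
  intros [F1 F2] [G1 G2]; apply C_eq; simpl.
  - apply (RInt_plus (fun t => fst (f t)) (fun t => fst (g t))); auto.
  - apply (RInt_plus (fun t => snd (f t)) (fun t => snd (g t))); auto.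
Qed.

Lemma exCI_plus f g a b : exCI f a b -> exCI g a b -> exCI (fun t => f t + g t)%C a b.
Proof.
  intros [F1 F2] [G1 G2]; split; simpl.
  - apply (ex_RInt_plus (fun t => fst (f t)) (fun t => fst (g t))); auto.
  - apply (ex_RInt_plus (fun t => snd (f t)) (fun t => snd (g t))); auto.
Qed.

Lemma exCI_scal c f a b : exCI f a b -> exCI (fun t => c * f t)%C a b.
Proof.
  intros [F1 F2]; split; simpl.
  - apply (ex_RInt_minus (fun t => fst c * fst (f t)) (fun t => snd c * snd (f t)));
      apply (ex_RInt_scal (V := R_NormedModule)); auto.
  - apply (ex_RInt_plus (fun t => fst c * snd (f t)) (fun t => snd c * fst (f t)));
      apply (ex_RInt_scal (V := R_NormedModule)); auto.
Qed.

Lemma CI_scal c f a b : exCI f a b -> CI (fun t => c * f t)%C a b = (c * CI f a b)%C.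
Proof.
  intros [F1 F2].
  assert (S : forall k g, ex_RInt g a b -> RInt (fun t => k * g t) a b = k * RInt g a b)
    by (intros k g Hg; apply (RInt_scal g a b k Hg)).
  assert (X : forall k g, ex_RInt g a b -> ex_RInt (fun t => k * g t) a b)
    by (intros k g Hg; apply (ex_RInt_scal (V := R_NormedModule)); auto).
  apply C_eq; simpl.
  - rewrite <- !S by auto.
    apply (RInt_minus (fun t => fst c * fst (f t)) (fun t => snd c * snd (f t))); auto.
  - rewrite <- !S by auto.
    apply (RInt_plus (fun t => fst c * snd (f t)) (fun t => snd c * fst (f t))); auto.
Qed.

Lemma CI_minus f g a b : exCI f a b -> exCI g a b ->
  CI (fun t => f t - g t)%C a b = (CI f a b - CI g a b)%C.
Proof.
  intros F G. transitivity (CI (fun t => f t + (-1) * g t)%C a b).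
  - apply CI_ext; intros; ring.
  - rewrite CI_plus, CI_scal; auto using exCI_scal. ring.
Qed.

Lemma CI_Chasles f a b c : exCI f a b -> exCI f b c -> (CI f a b + CI f b c)%C = CI f a c.
Proof.
  intros [F1 F2] [G1 G2]; apply C_eq; simpl.
  - apply (RInt_Chasles (fun t => fst (f t))); auto.
  - apply (RInt_Chasles (fun t => snd (f t))); auto.
Qed.

(** Estimating the components separately would lose a factor. With z the integral itself, |z|^2 is
    the integral of the real part of conj(z) f, hence at most |z| times the integral of [g], and one
    factor |z| cancels. *)
Lemma CI_bound f g a b : a <= b -> exCI f a b -> ex_RInt g a b ->
  (forall t, a <= t <= b -> Cmod (f t) <= g t) -> Cmod (CI f a b) <= RInt g a b.
Proof.
  intros Hab [F1 F2] Hg H. set (z := CI f a b).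
  assert (X : forall k h, ex_RInt h a b -> ex_RInt (fun t => k * h t) a b)
    by (intros k h Hh; apply (ex_RInt_scal (V := R_NormedModule)); auto).
  assert (E : fst z * fst z + snd z * snd z
              = RInt (fun t => fst z * fst (f t) + snd z * snd (f t)) a b).
  { transitivity (fst z * RInt (fun t => fst (f t)) a b + snd z * RInt (fun t => snd (f t)) a b).
    - reflexivity.
    - symmetry. etransitivity.
      + apply (RInt_plus (fun t => fst z * fst (f t)) (fun t => snd z * snd (f t))); auto.
      + unfold plus; simpl. f_equal.
        * apply (RInt_scal (fun t => fst (f t)) a b (fst z)); auto.
        * apply (RInt_scal (fun t => snd (f t)) a b (snd z)); auto. }
  assert (L : RInt (fun t => fst z * fst (f t) + snd z * snd (f t)) a b
              <= RInt (fun t => Cmod z * g t) a b).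
  { apply RInt_le; auto.
    - apply (ex_RInt_plus (fun t => fst z * fst (f t)) (fun t => snd z * snd (f t))); auto.
    - intros t Ht. specialize (H t ltac:(lra)).
      apply Rle_trans with (Cmod z * Cmod (f t)).
      + apply Rle_trans with (1 := Rle_abs _).
        replace (fst z * fst (f t) + snd z * snd (f t)) with (fst (Cconj z * f t)%C)
          by (destruct z, (f t); unfold Cconj; simpl; ring).
        rewrite <- (Cmod_conj z), <- Cmod_mult. apply Rabs_fst_Cmod.
      + apply Rmult_le_compat_l; auto using Cmod_ge_0. }
  rewrite <- E in L.
  replace (RInt (fun t => Cmod z * g t) a b) with (Cmod z * RInt g a b) in L
    by (symmetry; apply (RInt_scal g a b (Cmod z)); auto).
  replace (fst z * fst z + snd z * snd z) with (Cmod z * Cmod z) in L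
    by (transitivity (Cmod z ^ 2); [ring|rewrite Cmod2; ring]).
  (* For z = 0 nothing can be cancelled; what remains is that the integral of [g] is nonnegative. *)
  destruct (Cmod_ge_0 z) as [P|P]; [apply Rmult_le_reg_l with (Cmod z); auto|]. rewrite <- P.
  rewrite <- (Rmult_0_l (b - a)), <- RInt_Rconst. apply RInt_le; auto; [apply ex_RInt_const|].
  intros t Ht. apply Rle_trans with (2 := H t ltac:(lra)), Cmod_ge_0.
Qed.

Lemma CI_bound_const f M a b : a <= b -> exCI f a b ->
  (forall t, a <= t <= b -> Cmod (f t) <= M) -> Cmod (CI f a b) <= M * (b - a).
Proof.
  intros Hab Hf H. rewrite <- RInt_Rconst. apply CI_bound; auto. apply ex_RInt_const.
Qed.

(** * Complex differentiability and Cauchy's theorem on rectangles *)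

Definition cc2 (F : R -> R -> C) (x y : R) : Prop :=
  continuity_2d_pt (fun u v => fst (F u v)) x y /\ continuity_2d_pt (fun u v => snd (F u v)) x y.

(* [F] is complex differentiable at [x + i y] with derivative [dF x y]: the partial derivatives
   exist and satisfy the Cauchy-Riemann equations. *)
Definition hol (F dF : R -> R -> C) (x y : R) : Prop :=
  (is_derive (fun t => fst (F t y)) x (fst (dF x y)) /\
   is_derive (fun t => snd (F t y)) x (snd (dF x y))) /\
  (is_derive (fun t => fst (F x t)) y (- snd (dF x y)) /\
   is_derive (fun t => snd (F x t)) y (fst (dF x y))).

Lemma cc2_const c x y : cc2 (fun _ _ => c) x y.
Proof. split; apply continuity_2d_pt_const. Qed.
Lemma cc2_minus F G x y : cc2 F x y -> cc2 G x y -> cc2 (fun x y => F x y - G x y)%C x y.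
Proof. intros [A B] [A' B']; split; simpl; apply continuity_2d_pt_plus; auto; apply continuity_2d_pt_opp; auto. Qed.
Lemma cc2_plus F G x y : cc2 F x y -> cc2 G x y -> cc2 (fun x y => F x y + G x y)%C x y.
Proof. intros [A B] [A' B']; split; simpl; apply continuity_2d_pt_plus; auto. Qed.
Lemma cc2_mult F G x y : cc2 F x y -> cc2 G x y -> cc2 (fun x y => F x y * G x y)%C x y.
Proof.
  intros [A B] [A' B']; split; simpl.
  - apply continuity_2d_pt_minus; apply continuity_2d_pt_mult; auto.
  - apply continuity_2d_pt_plus; apply continuity_2d_pt_mult; auto.
Qed.

Lemma C_neq0_sq (z : C) : z <> 0%C -> fst z ^ 2 + snd z ^ 2 <> 0.
Proof.
  intros H E; apply H, C_eq; simpl; nra.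
Qed.

Lemma cc2_inv F x y : cc2 F x y -> F x y <> 0%C -> cc2 (fun x y => / F x y)%C x y.
Proof.
  intros [A B] N. apply C_neq0_sq in N.
  assert (D : continuity_2d_pt (fun u v => / (fst (F u v) ^ 2 + snd (F u v) ^ 2)) x y).
  { apply continuity_2d_pt_inv; auto. simpl.
    apply continuity_2d_pt_plus; repeat apply continuity_2d_pt_mult; auto;
      apply continuity_2d_pt_const. }
  split; simpl.
  - apply continuity_2d_pt_mult; auto.
  - apply continuity_2d_pt_mult; auto. apply continuity_2d_pt_opp; auto.
Qed.

Lemma hol_const c x y : hol (fun _ _ => c) (fun _ _ => 0%C) x y.
Proof.
  split; split; simpl; try rewrite Ropp_0; apply (is_derive_const (K := R_AbsRing) (V := R_NormedModule)).
Qed.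

Lemma hol_minus F dF G dG x y : hol F dF x y -> hol G dG x y ->
  hol (fun x y => F x y - G x y)%C (fun x y => dF x y - dG x y)%C x y.
Proof.
  intros [[A B] [C D]] [[A' B'] [C' D']]; split; split; simpl.
  - apply (is_derive_minus (fun t => fst (F t y)) (fun t => fst (G t y))); auto.
  - apply (is_derive_minus (fun t => snd (F t y)) (fun t => snd (G t y))); auto.
  - replace (- (snd (dF x y) + - snd (dG x y))) with (- snd (dF x y) - - snd (dG x y)) by ring.
    apply (is_derive_minus (fun t => fst (F x t)) (fun t => fst (G x t))); auto.
  - apply (is_derive_minus (fun t => snd (F x t)) (fun t => snd (G x t))); auto.
Qed.

Lemma is_derive_Rmult (f g : R -> R) x a b : is_derive f x a -> is_derive g x b ->
  is_derive (fun t => f t * g t) x (a * g x + f x * b).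
Proof.
  intros Hf Hg; apply (is_derive_mult f g x a b); auto. intros; apply Rmult_comm.
Qed.

Lemma hol_mult F dF G dG x y : hol F dF x y -> hol G dG x y ->
  hol (fun x y => F x y * G x y)%C (fun x y => dF x y * G x y + F x y * dG x y)%C x y.
Proof.
  assert (M : forall (f1 f2 g1 g2 : R -> R) t a1 a2 b1 b2 c, is_derive f1 t a1 ->
     is_derive f2 t a2 -> is_derive g1 t b1 -> is_derive g2 t b2 ->
     c = a1 * g1 t + f1 t * b1 - (a2 * g2 t + f2 t * b2) ->
     is_derive (fun t => f1 t * g1 t - f2 t * g2 t) t c).
  { intros f1 f2 g1 g2 t a1 a2 b1 b2 c H1 H2 H3 H4 ->.
    apply (is_derive_minus (fun t => f1 t * g1 t) (fun t => f2 t * g2 t));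
      apply is_derive_Rmult; auto. }
  assert (P : forall (f1 f2 g1 g2 : R -> R) t a1 a2 b1 b2 c, is_derive f1 t a1 ->
     is_derive f2 t a2 -> is_derive g1 t b1 -> is_derive g2 t b2 ->
     c = a1 * g1 t + f1 t * b1 + (a2 * g2 t + f2 t * b2) ->
     is_derive (fun t => f1 t * g1 t + f2 t * g2 t) t c).
  { intros f1 f2 g1 g2 t a1 a2 b1 b2 c H1 H2 H3 H4 ->.
    apply (is_derive_plus (fun t => f1 t * g1 t) (fun t => f2 t * g2 t));
      apply is_derive_Rmult; auto. }
  intros [[A B] [C D]] [[A' B'] [C' D']]; split; split; simpl.
  - eapply M; [exact A|exact B|exact A'|exact B'|simpl; ring].
  - eapply P; [exact A|exact B|exact B'|exact A'|simpl; ring].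
  - eapply M; [exact C|exact D|exact C'|exact D'|simpl; ring].
  - eapply P; [exact C|exact D|exact D'|exact C'|simpl; ring].
Qed.

Lemma hol_inv F dF x y : hol F dF x y -> F x y <> 0%C ->
  hol (fun x y => / F x y)%C (fun x y => - dF x y * (/ F x y * / F x y))%C x y.
Proof.
  intros [[A B] [C D]] N. apply C_neq0_sq in N.
  assert (N' : fst (F x y) * fst (F x y) + snd (F x y) * snd (F x y) <> 0)
    by (intro E; apply N; rewrite <- E; ring).
  assert (Q : forall (f g h : R -> R) t a b e c, is_derive f t a -> is_derive g t b ->
     is_derive h t e -> f t ^ 2 + g t ^ 2 <> 0 ->
     c = e / (f t ^ 2 + g t ^ 2) - h t * (2 * f t * a + 2 * g t * b) / (f t ^ 2 + g t ^ 2) ^ 2 ->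
     is_derive (fun t => h t / (f t ^ 2 + g t ^ 2)) t c).
  { intros f g h t a b e c H1 H2 H3 H4 ->.
    assert (E1 := is_derive_unique _ _ _ H1); assert (E2 := is_derive_unique _ _ _ H2);
    assert (E3 := is_derive_unique _ _ _ H3).
    auto_derive.
    - repeat split; try (eexists; eassumption); auto.
    - change (fun x0 : R => h x0) with h; change (fun x0 : R => f x0) with f;
      change (fun x0 : R => g x0) with g. rewrite E1, E2, E3. field.
      auto. }
  assert (B' := is_derive_opp _ _ _ B). assert (D' := is_derive_opp _ _ _ D).
  split; split; simpl.
  - apply (Q (fun t => fst (F t y)) (fun t => snd (F t y)) (fun t => fst (F t y)) x _ _ _ _ A B A); auto.
    field; auto.
  - apply (Q (fun t => fst (F t y)) (fun t => snd (F t y)) (fun t => - snd (F t y)) x _ _ _ _ A B B'); auto.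
    unfold opp; simpl; field; auto.
  - apply (Q (fun t => fst (F x t)) (fun t => snd (F x t)) (fun t => fst (F x t)) y _ _ _ _ C D C); auto.
    field; auto.
  - apply (Q (fun t => fst (F x t)) (fun t => snd (F x t)) (fun t => - snd (F x t)) y _ _ _ _ C D D'); auto.
    unfold opp; simpl; field; auto.
Qed.

Lemma hol_cc2_line1 F dF x y : hol F dF x y ->
  continuous (fun t => fst (F t y)) x /\ continuous (fun t => snd (F t y)) x.
Proof.
  intros [[A B] _]; split.
  - apply (ex_derive_continuous (fun t => fst (F t y))); eexists; exact A.
  - apply (ex_derive_continuous (fun t => snd (F t y))); eexists; exact B.
Qed.
Lemma hol_cc2_line2 F dF x y : hol F dF x y ->
  continuous (fun t => fst (F x t)) y /\ continuous (fun t => snd (F x t)) y.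
Proof.
  intros [_ [A B]]; split.
  - apply (ex_derive_continuous (fun t => fst (F x t))); eexists; exact A.
  - apply (ex_derive_continuous (fun t => snd (F x t))); eexists; exact B.
Qed.

Lemma exCI_of_continuous f a b : (forall t, Rmin a b <= t <= Rmax a b ->
   continuous (fun t => fst (f t)) t /\ continuous (fun t => snd (f t)) t) -> exCI f a b.
Proof.
  intros H; split; apply ex_RInt_cts; intros t Ht; apply (H t Ht).
Qed.

(** [W] is both the y-derivative of [U] and the x-derivative of [V]. Differentiating the integral of
    [U] over [A, B] in y gives the integral of [W], which is V B y - V A y; integrating this in y
    yields the identity. Joint continuity is asked of [W] only, continuity along lines suffices for
    [U] and [V]. *)
Lemma green (U V W : R -> R -> R) a b c d A B y1 y2 :
  a < A -> A <= B -> B < b -> c < y1 -> y1 <= y2 -> y2 < d ->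
  (forall x y, a < x < b -> c < y < d ->
     is_derive (fun t => U x t) y (W x y) /\ is_derive (fun t => V t y) x (W x y) /\
     continuity_2d_pt W x y /\ continuous (fun t => U t y) x /\ continuous (fun t => V x t) y) ->
  RInt (fun x => U x y2) A B - RInt (fun x => U x y1) A B
  = RInt (fun y => V B y - V A y) y1 y2.
Proof.
  intros HA HAB HB Hc Hy Hd H.
  symmetry.
  assert (E : is_RInt (fun y => V B y - V A y) y1 y2
     (minus (RInt (fun x => U x y2) A B) (RInt (fun x => U x y1) A B))).
  { apply (is_RInt_derive (fun y => RInt (fun x => U x y) A B)).
    - intros y Hyy. rewrite Rmin_left, Rmax_right in Hyy by lra.
      replace (V B y - V A y) with (RInt (fun x => Derive (fun t => U x t) y) A B).
      + apply (is_derive_RInt_param (fun y x => U x y)).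
        * assert (Hop : locally y (fun z => c < z < d)).
          { apply (open_and (fun z => c < z) (fun z => z < d)); [apply open_gt|apply open_lt|lra]. }
          revert Hop; apply filter_imp; intros z Hz x Hx.
          rewrite Rmin_left, Rmax_right in Hx by lra.
          exists (W x z); apply H; lra.
        * intros x Hx. rewrite Rmin_left, Rmax_right in Hx by lra.
          destruct (H x y ltac:(lra) ltac:(lra)) as [_ [_ [CW _]]].
          assert (Loc : locally_2d (fun u v => W v u = Derive (fun z => U v z) u) y x).
          { assert (e0 : 0 < Rmin (Rmin (y - c) (d - y)) (Rmin (x - a) (b - x)))
              by (repeat apply Rmin_case; lra).
            exists (mkposreal _ e0); simpl; intros u v Hu Hv.
            symmetry; apply is_derive_unique, H; apply Rabs_lt_between' in Hu, Hv;
            generalize (Rmin_l (Rmin (y - c) (d - y)) (Rmin (x - a) (b - x)))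
              (Rmin_r (Rmin (y - c) (d - y)) (Rmin (x - a) (b - x)))
              (Rmin_l (y - c) (d - y)) (Rmin_r (y - c) (d - y))
              (Rmin_l (x - a) (b - x)) (Rmin_r (x - a) (b - x)); lra. }
          apply continuity_2d_pt_ext_loc with (1 := Loc).
          intros eps; destruct (CW eps) as [dl Hdl]; exists dl; intros u v Hu Hv; apply Hdl; auto.
        * assert (Hop : locally y (fun z => c < z < d)).
          { apply (open_and (fun z => c < z) (fun z => z < d)); [apply open_gt|apply open_lt|lra]. }
          revert Hop; apply filter_imp; intros z Hz.
          apply (ex_RInt_continuous (V := R_CompleteNormedModule)); intros x Hx.
          rewrite Rmin_left, Rmax_right in Hx by lra. apply H; lra.
      + rewrite (RInt_ext _ (fun x => W x y)).
        * apply is_RInt_unique, (is_RInt_derive (fun x => V x y)).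
          -- intros x Hx. rewrite Rmin_left, Rmax_right in Hx by lra. apply H; lra.
          -- intros x Hx. rewrite Rmin_left, Rmax_right in Hx by lra.
             destruct (H x y ltac:(lra) ltac:(lra)) as [_ [_ [CW _]]].
             apply continuity_pt_filterlim; intros eps He.
             destruct (CW (mkposreal _ He)) as [dl Hdl].
             exists dl; split; [apply cond_pos|]. intros z [_ Hz]. apply (Hdl z y); auto.
             rewrite Rminus_diag, Rabs_R0; apply cond_pos.
        * intros x Hx. rewrite Rmin_left, Rmax_right in Hx by lra.
          apply is_derive_unique, H; lra.
    - intros y Hyy. rewrite Rmin_left, Rmax_right in Hyy by lra.
      apply (continuous_minus (fun y => V B y) (fun y => V A y)); apply H; lra. }
  apply (is_RInt_unique (V := R_CompleteNormedModule)) in E. exact E.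
Qed.

(** The counterclockwise boundary integral: bottom edge forward, top edge backward, and dz = i dy on
    the right edge upward and the left edge downward. *)
Definition rect (F : R -> R -> C) (A B y1 y2 : R) : C :=
  (CI (fun x => F x y1) A B - CI (fun x => F x y2) A B
   + Ci * (CI (fun y => F B y) y1 y2 - CI (fun y => F A y) y1 y2))%C.

(** The Cauchy-Riemann equations allow Green's formula for the pairs (Re F, -Im F) and (Im F, Re F);
    the two results are the imaginary and real parts of the boundary integral. *)
Lemma cauchy_rect F dF a b c d A B y1 y2 :
  a < A -> A <= B -> B < b -> c < y1 -> y1 <= y2 -> y2 < d ->
  (forall x y, a < x < b -> c < y < d -> hol F dF x y /\ cc2 dF x y) ->
  rect F A B y1 y2 = 0%C.
Proof.
  intros HA HAB HB Hc Hy Hd H.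
  assert (XV : forall x, a < x < b -> exCI (fun y => F x y) y1 y2).
  { intros x Hx; apply exCI_of_continuous; intros t Ht.
    rewrite Rmin_left, Rmax_right in Ht by lra.
    apply (hol_cc2_line2 F dF), H; lra. }
  assert (G1 := green (fun x y => fst (F x y)) (fun x y => - snd (F x y)) (fun x y => - snd (dF x y))
    a b c d A B y1 y2 HA HAB HB Hc Hy Hd).
  assert (G2 := green (fun x y => snd (F x y)) (fun x y => fst (F x y)) (fun x y => fst (dF x y))
    a b c d A B y1 y2 HA HAB HB Hc Hy Hd).
  assert (D : forall x y, a < x < b -> c < y < d ->
     is_derive (fun t => - snd (F t y)) x (- snd (dF x y))).
  { intros x y Hx Hy'. destruct (H x y Hx Hy') as [[[_ D] _] _].
    apply (is_derive_opp (fun t => snd (F t y)) x _ D). }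
  assert (E1 : RInt (fun x => fst (F x y2)) A B - RInt (fun x => fst (F x y1)) A B
               = RInt (fun y => - snd (F B y) - - snd (F A y)) y1 y2).
  { apply G1; intros x y Hx Hy'. destruct (H x y Hx Hy') as [Hh Hc'].
    split; [apply Hh|]. split; [apply D; auto|]. split; [apply continuity_2d_pt_opp, Hc'|].
    split; [apply (hol_cc2_line1 F dF _ _ Hh)|].
    apply (continuous_opp (fun t => snd (F x t))), (hol_cc2_line2 F dF _ _ Hh). }
  assert (E2 : RInt (fun x => snd (F x y2)) A B - RInt (fun x => snd (F x y1)) A B
               = RInt (fun y => fst (F B y) - fst (F A y)) y1 y2).
  { apply G2; intros x y Hx Hy'. destruct (H x y Hx Hy') as [Hh Hc'].
    split; [apply Hh|]. split; [apply Hh|]. split; [apply Hc'|].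
    split; [apply (hol_cc2_line1 F dF _ _ Hh)|apply (hol_cc2_line2 F dF _ _ Hh)]. }
  rewrite (RInt_ext (fun y => - snd (F B y) - - snd (F A y)) (fun y => snd (F A y) - snd (F B y))) in E1 by (intros; eqR; ring).
  assert (XA := XV A ltac:(lra)). assert (XB := XV B ltac:(lra)).
  rewrite (RInt_sub (fun y => snd (F A y)) (fun y => snd (F B y)) _ _ (proj2 XA) (proj2 XB)) in E1.
  rewrite (RInt_sub (fun y => fst (F B y)) (fun y => fst (F A y)) _ _ (proj1 XB) (proj1 XA)) in E2.
  apply C_eq; unfold rect, CI; simpl; lra.
Qed.

Lemma rect_split_y F A B y1 y y2 :
  exCI (fun t => F A t) y1 y -> exCI (fun t => F A t) y y2 ->
  exCI (fun t => F B t) y1 y -> exCI (fun t => F B t) y y2 ->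
  rect F A B y1 y2 = (rect F A B y1 y + rect F A B y y2)%C.
Proof.
  intros H1 H2 H3 H4; unfold rect.
  rewrite <- (CI_Chasles (fun t => F A t) y1 y y2), <- (CI_Chasles (fun t => F B t) y1 y y2) by auto.
  ring.
Qed.

Lemma rect_split_x F A x B y1 y2 :
  exCI (fun t => F t y1) A x -> exCI (fun t => F t y1) x B ->
  exCI (fun t => F t y2) A x -> exCI (fun t => F t y2) x B ->
  rect F A B y1 y2 = (rect F A x y1 y2 + rect F x B y1 y2)%C.
Proof.
  intros H1 H2 H3 H4; unfold rect.
  rewrite <- (CI_Chasles (fun t => F t y1) A x B), <- (CI_Chasles (fun t => F t y2) A x B) by auto.
  ring.
Qed.

(** * Residues at simple poles *)

Definition cpt (x y : R) : C := (x, y).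

Lemma sum_sq_neq0 u d : 0 < d -> u ^ 2 + d ^ 2 <> 0.
Proof. intros Hd; generalize (pow2_ge_0 u) (pow_lt d 2 Hd); lra. Qed.

(** The values of 1/(z - p) on opposite sides of a square combine to this Poisson kernel. The side
    spans the angles from -PI/4 to PI/4, and the primitive 2 atan gives exactly PI. *)
Lemma RInt_poisson_square p d : 0 < d ->
  RInt (fun x => 2 * d / ((x - p) ^ 2 + d ^ 2)) (p - d) (p + d) = PI.
Proof.
  intros Hd.
  assert (N : forall x, (x - p) ^ 2 + d ^ 2 <> 0) by (intros x; apply sum_sq_neq0, Hd).
  etransitivity.
  - apply (RInt_of_derive (fun x => 2 * atan ((x - p) / d))).
    + intros x. auto_derive; [auto|]. field. split; [|lra].
      intro E; apply (N x); rewrite <- E; ring.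
    + intros x. apply (ex_derive_continuous (fun x => 2 * d / ((x - p) ^ 2 + d ^ 2))).
      auto_derive. apply N.
  - replace ((p + d - p) / d) with 1 by (field; lra).
    replace ((p - d - p) / d) with (-(1)) by (field; lra).
    rewrite atan_opp, atan_1. eqR; field.
Qed.

Lemma poisson_square_exCI p d (c : C) : 0 < d ->
  exCI (fun x => c * RtoC (2 * d / ((x - p) ^ 2 + d ^ 2)))%C (p - d) (p + d) /\
  CI (fun x => c * RtoC (2 * d / ((x - p) ^ 2 + d ^ 2)))%C (p - d) (p + d) = (c * PI)%C.
Proof.
  intros Hd.
  assert (N : forall x, (x - p) ^ 2 + d ^ 2 <> 0) by (intros x; apply sum_sq_neq0, Hd).
  assert (X : exCI (fun x => RtoC (2 * d / ((x - p) ^ 2 + d ^ 2))) (p - d) (p + d)).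
  { split; simpl; [|apply ex_RInt_const].
    apply (ex_RInt_continuous (V := R_CompleteNormedModule)); intros x _.
    apply (ex_derive_continuous (fun x => 2 * d / ((x - p) ^ 2 + d ^ 2))).
    auto_derive. apply N. }
  split; [apply exCI_scal, X|]. rewrite CI_scal by apply X. f_equal.
  apply C_eq; unfold cpt; simpl; [apply RInt_poisson_square, Hd|].
  rewrite RInt_Rconst; ring.
Qed.

Lemma Cmod_pt_pos (u v : R) d : 0 < d -> d <= Rabs u \/ d <= Rabs v -> d <= Cmod (cpt u v).
Proof.
  intros Hd [H|H]; apply Rle_trans with (1 := H).
  - apply (Rabs_fst_Cmod (cpt u v)).
  - apply (Rabs_snd_Cmod (cpt u v)).
Qed.

(** On the boundary |z - p| >= d, so F differs from a/(z - p) by at most eta/d, and the perimeter is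
    8 d. The polar part is integrated exactly: each pair of opposite sides contributes PI i a. *)
Lemma rect_square_residue F (a : C) px py d eta : 0 < d ->
  exCI (fun t => F t (py - d)%R) (px - d)%R (px + d)%R ->
  exCI (fun t => F t (py + d)%R) (px - d)%R (px + d)%R ->
  exCI (fun t => F (px - d)%R t) (py - d)%R (py + d)%R ->
  exCI (fun t => F (px + d)%R t) (py - d)%R (py + d)%R ->
  (forall x y, Rabs (x - px) <= d -> Rabs (y - py) <= d -> d <= Cmod (cpt (x - px) (y - py)) ->
     Cmod ((cpt (x - px) (y - py)) * F x y - a)%C <= eta) ->
  Cmod (rect F (px - d)%R (px + d)%R (py - d)%R (py + d)%R - 2 * PI * Ci * a)%C <= 8 * eta.
Proof.
  intros Hd X1 X2 X3 X4 H.
  assert (Hn : forall x y, Rabs (x - px) <= d -> Rabs (y - py) <= d ->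
     d <= Rabs (x - px) \/ d <= Rabs (y - py) ->
     Cmod (F x y - a / (cpt (x - px) (y - py)))%C <= eta / d).
  { intros x y Hx Hy Hor. assert (Hm := Cmod_pt_pos _ _ d Hd Hor).
    assert (Nz : (cpt (x - px) (y - py)) <> 0%C).
    { intro E; rewrite E, Cmod_0 in Hm; lra. }
    replace (F x y - a / (cpt (x - px) (y - py)))%C
      with (((cpt (x - px) (y - py)) * F x y - a) / (cpt (x - px) (y - py)))%C by (field; auto).
    rewrite Cmod_div by auto.
    apply Rle_trans with (eta / Cmod (cpt (x - px) (y - py))).
    - apply Rmult_le_compat_r; [left; apply Rinv_0_lt_compat; lra|auto].
    - assert (0 <= eta) by (apply Rle_trans with (2 := H x y Hx Hy Hm), Cmod_ge_0).
      apply Rmult_le_compat_l; auto. apply Rinv_le_contravar; auto. }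
  assert (Ab : Rabs (- d) = d) by (rewrite Rabs_Ropp, Rabs_pos_eq; lra).
  assert (Ab' : Rabs d = d) by (rewrite Rabs_pos_eq; lra).
  assert (Q : forall u, RtoC (u ^ 2 + d ^ 2) <> 0%C).
  { intros u E. apply RtoC_inj in E. apply (sum_sq_neq0 u d Hd E). }
  destruct (poisson_square_exCI px d (a * Ci) Hd) as [Z1 Z2].
  destruct (poisson_square_exCI py d a Hd) as [W1 W2].
  assert (S1 : Cmod (CI (fun x => F x (py - d)%R - F x (py + d)%R)%C (px - d)%R (px + d)%R
                     - a * Ci * PI)%C <= 4 * eta).
  { assert (X : exCI (fun x => F x (py - d)%R - F x (py + d)%R)%C (px - d)%R (px + d)%R).
    { apply exCI_ext with (fun x => F x (py - d)%R + (-1) * F x (py + d)%R)%C; [intros; ring|].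
      apply exCI_plus; auto. apply exCI_scal; auto. }
    rewrite <- Z2, <- CI_minus by auto.
    replace (4 * eta) with (2 * (eta / d) * (px + d - (px - d)%R)) by (field; lra).
    apply CI_bound_const; [lra| |].
    - apply exCI_ext with (fun x => (F x (py - d)%R - F x (py + d)%R)
         + (-1) * (a * Ci * RtoC (2 * d / ((x - px) ^ 2 + d ^ 2))))%C; [intros; ring|].
      apply exCI_plus; auto. apply exCI_scal; auto.
    - intros x Hx.
      assert (Hx' : Rabs (x - px) <= d) by (apply Rabs_le; lra).
      assert (B1 := Hn x (py - d)%R Hx'). assert (B2 := Hn x (py + d)%R Hx').
      replace (py - d - py) with (- d) in B1 by ring. replace (py + d - py) with d in B2 by ring.
      specialize (B1 ltac:(lra) ltac:(lra)). specialize (B2 ltac:(lra) ltac:(lra)).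
      replace (F x (py - d)%R - F x (py + d)%R - a * Ci * RtoC (2 * d / ((x - px) ^ 2 + d ^ 2)))%C
        with ((F x (py - d)%R - a / (cpt (x - px) (- d))) - (F x (py + d)%R - a / (cpt (x - px) d)))%C.
      + eapply Rle_trans; [apply Cmod_triangle|]. rewrite Cmod_opp. lra.
      + set (u := x - px).
        assert (E1 : (/ (cpt u (- d)))%C = ((cpt u d) / RtoC (u ^ 2 + d ^ 2))%C).
        { apply C_eq; unfold cpt; simpl; field; nra. }
        assert (E2 : (/ (cpt u d))%C = ((cpt u (- d)) / RtoC (u ^ 2 + d ^ 2))%C).
        { apply C_eq; unfold cpt; simpl; field; nra. }
        assert (E3 : ((cpt u d) - (cpt u (- d)) = Ci * RtoC (2 * d))%C) by (apply C_eq; unfold cpt; simpl; ring).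
        unfold Cdiv at 1 2. rewrite E1, E2.
        rewrite (RtoC_div (2 * d)) by apply sum_sq_neq0, Hd.
        replace (a * Ci * (RtoC (2 * d) / RtoC (u ^ 2 + d ^ 2)))%C
          with (a * (((cpt u d) - (cpt u (- d))) / RtoC (u ^ 2 + d ^ 2)))%C
          by (rewrite E3; field; auto).
        generalize (Q u); set (D := RtoC (u ^ 2 + d ^ 2)); clearbody D; intros QD. field; auto. }
  assert (S2 : Cmod (CI (fun y => F (px + d)%R y - F (px - d)%R y)%C (py - d)%R (py + d)%R
                     - a * PI)%C <= 4 * eta).
  { assert (X : exCI (fun y => F (px + d)%R y - F (px - d)%R y)%C (py - d)%R (py + d)%R).
    { apply exCI_ext with (fun y => F (px + d)%R y + (-1) * F (px - d)%R y)%C; [intros; ring|].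
      apply exCI_plus; auto. apply exCI_scal; auto. }
    rewrite <- W2, <- CI_minus by auto.
    replace (4 * eta) with (2 * (eta / d) * (py + d - (py - d)%R)) by (field; lra).
    apply CI_bound_const; [lra| |].
    - apply exCI_ext with (fun y => (F (px + d)%R y - F (px - d)%R y)
         + (-1) * (a * RtoC (2 * d / ((y - py) ^ 2 + d ^ 2))))%C; [intros; ring|].
      apply exCI_plus; auto. apply exCI_scal; auto.
    - intros y Hy.
      assert (Hy' : Rabs (y - py) <= d) by (apply Rabs_le; lra).
      assert (B1 := fun h => Hn (px - d)%R y h Hy'). assert (B2 := fun h => Hn (px + d)%R y h Hy').
      replace (px - d - px) with (- d) in B1 by ring. replace (px + d - px) with d in B2 by ring.
      specialize (B1 ltac:(lra) ltac:(lra)). specialize (B2 ltac:(lra) ltac:(lra)).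
      replace (F (px + d)%R y - F (px - d)%R y - a * RtoC (2 * d / ((y - py) ^ 2 + d ^ 2)))%C
        with ((F (px + d)%R y - a / (cpt d (y - py))) - (F (px - d)%R y - a / (cpt (- d) (y - py))))%C.
      + eapply Rle_trans; [apply Cmod_triangle|]. rewrite Cmod_opp. lra.
      + set (u := y - py).
        assert (E1 : (/ (cpt (- d) u))%C = ((cpt (- d) (- u)) / RtoC (u ^ 2 + d ^ 2))%C).
        { apply C_eq; unfold cpt; simpl; field; nra. }
        assert (E2 : (/ (cpt d u))%C = ((cpt d (- u)) / RtoC (u ^ 2 + d ^ 2))%C).
        { apply C_eq; unfold cpt; simpl; field; nra. }
        assert (E3 : ((cpt d (- u)) - (cpt (- d) (- u)) = RtoC (2 * d))%C) by (apply C_eq; unfold cpt; simpl; ring).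
        unfold Cdiv at 1 2. rewrite E1, E2.
        rewrite (RtoC_div (2 * d)) by apply sum_sq_neq0, Hd.
        generalize (Q u); set (D := RtoC (u ^ 2 + d ^ 2)); clearbody D; intros QD.
        rewrite <- E3. field; auto. }
  unfold rect. rewrite <- !CI_minus by auto.
  match goal with |- Cmod (?X + Ci * ?Y - _)%C <= _ =>
    replace (X + Ci * Y - 2 * PI * Ci * a)%C
      with ((X - a * Ci * PI) + Ci * (Y - a * PI))%C by ring end.
  eapply Rle_trans; [apply Cmod_triangle|]. rewrite Cmod_mult, Cmod_Ci. lra.
Qed.

(** Cauchy's theorem discards everything outside a small square centred at the pole. The remaining
    estimate by 8 eta holds for every eta, hence the difference is zero. *)
Lemma residue_rect F dF (a : C) xa xb ya yb px py A B y1 y2 :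
  xa < A -> A < px -> px < B -> B < xb -> ya < y1 -> y1 < py -> py < y2 -> y2 < yb ->
  (forall x y, xa < x < xb -> ya < y < yb -> x <> px \/ y <> py -> hol F dF x y /\ cc2 dF x y) ->
  (forall eta, 0 < eta -> exists d0, 0 < d0 /\ forall x y,
     0 < Cmod (cpt (x - px) (y - py)) < d0 -> Cmod ((cpt (x - px) (y - py)) * F x y - a)%C <= eta) ->
  rect F A B y1 y2 = (2 * PI * Ci * a)%C.
Proof.
  intros HA HpA HpB HB Hy1 Hp1 Hp2 Hy2 H Hlim.
  assert (G : forall eta, 0 < eta -> Cmod (rect F A B y1 y2 - 2 * PI * Ci * a)%C <= 8 * eta).
  { intros eta He. destruct (Hlim eta He) as [d0 [Hd0 Hd]].
    (* A boundary point of the square is at distance at most 2 d from the pole, so a third of [d0]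
       suffices; the other entries keep the square strictly inside the rectangle. *)
    set (d := Rmin (d0 / 3) (Rmin (Rmin (px - A) (B - px)) (Rmin (py - y1) (y2 - py)) / 2)).
    assert (Hd' : 0 < d /\ 2 * d < d0 /\ d < px - A /\ d < B - px /\ d < py - y1 /\ d < y2 - py).
    { unfold d.
      set (m := Rmin (Rmin (px - A) (B - px)) (Rmin (py - y1) (y2 - py))).
      assert (0 < m) by (unfold m; repeat apply Rmin_case; lra).
      assert (m <= px - A /\ m <= B - px /\ m <= py - y1 /\ m <= y2 - py).
      { unfold m. set (m1 := Rmin (px - A) (B - px)). set (m2 := Rmin (py - y1) (y2 - py)).
        generalize (Rmin_l m1 m2) (Rmin_r m1 m2) (Rmin_l (px - A) (B - px))
          (Rmin_r (px - A) (B - px)) (Rmin_l (py - y1) (y2 - py)) (Rmin_r (py - y1) (y2 - py)).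
        fold m1 m2. lra. }
      generalize (Rmin_l (d0 / 3) (m / 2)) (Rmin_r (d0 / 3) (m / 2)).
      assert (0 < Rmin (d0 / 3) (m / 2)) by (apply Rmin_case; lra). lra. }
    clearbody d. destruct Hd' as [D0 [D1 [D2 [D3 [D4 D5]]]]].
    assert (XV : forall x z1 z2, xa < x < xb -> x <> px -> ya < z1 -> z1 <= z2 -> z2 < yb ->
       exCI (fun t => F x t) z1 z2).
    { intros x z1 z2 Hx Hne L1 L2 L3; apply exCI_of_continuous; intros t Ht.
      rewrite Rmin_left, Rmax_right in Ht by lra.
      apply (hol_cc2_line2 F dF), H; auto; lra. }
    assert (XH : forall y z1 z2, ya < y < yb -> y <> py -> xa < z1 -> z1 <= z2 -> z2 < xb ->
       exCI (fun t => F t y) z1 z2).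
    { intros y z1 z2 Hy Hne L1 L2 L3; apply exCI_of_continuous; intros t Ht.
      rewrite Rmin_left, Rmax_right in Ht by lra.
      apply (hol_cc2_line1 F dF), H; auto; lra. }
    (* Each of the four rectangles below, above, left and right of the square lies in an open part
       of the domain cut off at the pole's coordinate, where F has no singularity. *)
    assert (R1 : rect F A B y1 (py - d)%R = 0%C).
    { apply (cauchy_rect F dF xa xb ya py); try lra. intros x y Hx Hy; apply H; lra. }
    assert (R2 : rect F A B (py + d)%R y2 = 0%C).
    { apply (cauchy_rect F dF xa xb py yb); try lra. intros x y Hx Hy; apply H; lra. }
    assert (R3 : rect F A (px - d)%R (py - d)%R (py + d)%R = 0%C).
    { apply (cauchy_rect F dF xa px ya yb); try lra. intros x y Hx Hy; apply H; lra. }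
    assert (R4 : rect F (px + d)%R B (py - d)%R (py + d)%R = 0%C).
    { apply (cauchy_rect F dF px xb ya yb); try lra. intros x y Hx Hy; apply H; lra. }
    replace (rect F A B y1 y2) with (rect F (px - d)%R (px + d)%R (py - d)%R (py + d)%R).
    - apply rect_square_residue; [lra|apply XH; lra|apply XH; lra|apply XV; lra|apply XV; lra|].
      intros x y Hx Hy Hm. apply Hd. split; [lra|].
      apply Rle_lt_trans with (1 := Cmod_le_abs _). simpl. lra.
    - rewrite (rect_split_y F A B y1 (py - d)%R y2) by (apply XV; lra).
      rewrite (rect_split_y F A B (py - d)%R (py + d)%R y2) by (apply XV; lra).
      rewrite (rect_split_x F A (px - d)%R B (py - d)%R (py + d)%R) by (apply XH; lra).
      rewrite (rect_split_x F (px - d)%R (px + d)%R B (py - d)%R (py + d)%R) by (apply XH; lra).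
      rewrite R1, R2, R3, R4. ring. }
  set (z := (rect F A B y1 y2 - 2 * PI * Ci * a)%C) in *.
  assert (Z : z = 0%C).
  { apply Cmod_eq_0. apply Rle_antisym; [|apply Cmod_ge_0].
    apply Rnot_lt_le; intros L. specialize (G (Cmod z / 16) ltac:(lra)). lra. }
  unfold z in Z. transitivity (z + 2 * PI * Ci * a)%C; [unfold z; ring|].
  unfold z; rewrite Z; ring.
Qed.

(** * The complex exponential and the spectral representation of [1 / (s^alpha - lambda)] *)

Definition cexp (x y : R) : C := (exp x * cos y, exp x * sin y).

Lemma Cmod_cexp x y : Cmod (cexp x y) = exp x.
Proof.
  unfold Cmod, cexp; simpl.
  replace (exp x * cos y * (exp x * cos y * 1) + exp x * sin y * (exp x * sin y * 1))
    with (exp x ^ 2 * (Rsqr (sin y) + Rsqr (cos y))) by (unfold Rsqr; ring).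
  rewrite sin2_cos2, Rmult_1_r. apply sqrt_pow2; left; apply exp_pos.
Qed.

Lemma cexp_neq0 x y : cexp x y <> 0%C.
Proof. intro E; assert (H := Cmod_cexp x y); rewrite E, Cmod_0 in H; generalize (exp_pos x); lra. Qed.

Lemma cexp_plus x y x' y' : cexp (x + x') (y + y') = (cexp x y * cexp x' y')%C.
Proof. apply C_eq; unfold cexp; simpl; rewrite exp_plus, ?cos_plus, ?sin_plus; ring. Qed.

Lemma cexp_real x : cexp x 0 = RtoC (exp x).
Proof. apply C_eq; unfold cexp; simpl; rewrite ?cos_0, ?sin_0; ring. Qed.

Lemma cexp_2PI x y : cexp x (y + 2 * PI) = cexp x y.
Proof. unfold cexp; rewrite cos_plus, sin_plus, cos_2PI, sin_2PI; f_equal; ring. Qed.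

Lemma cos_eq_1 t : Rabs t < 2 * PI -> cos t = 1 -> t = 0.
Proof.
  intros Ht Hc.
  assert (S : sin (t / 2) = 0).
  { assert (E : cos t = 1 - 2 * sin (t / 2) * sin (t / 2))
      by (rewrite <- cos_2a_sin; f_equal; field). nra. }
  apply Rabs_lt_between in Ht.
  destruct (Rtotal_order t 0) as [L|[L|L]]; auto; exfalso.
  - generalize (sin_lt_0_var (t / 2) ltac:(lra) ltac:(lra)); lra.
  - generalize (sin_gt_0 (t / 2) ltac:(lra) ltac:(lra)); lra.
Qed.

(** Equal moduli give equal real parts; then cos (y - y') = 1, which for |y - y'| < 2 PI leaves only
    y = y'. *)
Lemma cexp_inj_strip x y x' y' : Rabs (y - y') < 2 * PI -> cexp x y = cexp x' y' ->
  x = x' /\ y = y'.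
Proof.
  intros Hy E.
  assert (Ex : exp x = exp x') by (rewrite <- (Cmod_cexp x y), E; apply Cmod_cexp).
  apply exp_inv in Ex; subst x'. split; auto.
  assert (E1 := f_equal fst E). assert (E2 := f_equal snd E). simpl in E1, E2.
  assert (P := exp_pos x).
  assert (C1 : cos y = cos y') by (apply Rmult_eq_reg_l with (exp x); lra).
  assert (S1 : sin y = sin y') by (apply Rmult_eq_reg_l with (exp x); lra).
  assert (H : y - y' = 0); [|lra]. apply cos_eq_1; auto.
  rewrite cos_minus, C1, S1. generalize (sin2_cos2 y'); unfold Rsqr; lra.
Qed.

Lemma hol_cexp b x y :
  hol (fun x y => cexp (b * x) (b * y)) (fun x y => b * cexp (b * x) (b * y))%C x y.
Proof.
  split; split; simpl; auto_derive; auto; ring.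
Qed.

Lemma cc2_cexp b x y : cc2 (fun x y => cexp (b * x) (b * y)) x y.
Proof.
  assert (E : cont2 (fun x _ => exp (b * x))) by (apply (cont2_of1 (fun x => exp (b * x))); ct).
  assert (S : cont2 (fun _ y => sin (b * y))) by (apply (cont2_of2 (fun x => sin (b * x))); ct).
  assert (K : cont2 (fun _ y => cos (b * y))) by (apply (cont2_of2 (fun x => cos (b * x))); ct).
  split; simpl; [apply (cont2_mult _ _ E K)|apply (cont2_mult _ _ E S)].
Qed.

(** * Local expansions and limits at a pole *)

Lemma exp_taylor1 x : Rabs x <= 1 / 2 -> Rabs (exp x - 1 - x) <= 2 * x ^ 2.
Proof.
  intros H. apply Rabs_le_between in H.
  assert (H1 := exp_ineq1_le x). assert (H2 := exp_ineq1_le (- x)).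
  (* From exp (- x) >= 1 - x. Together with (1 + x + 2 x^2)(1 - x) = 1 + x^2 (1 - 2 x) >= 1 for x <=
     1/2 this is the upper bound. *)
  assert (H3 : exp x * (1 - x) <= 1).
  { replace 1 with (exp x * exp (- x)) at 2
      by (rewrite <- exp_plus, Rplus_opp_r; apply exp_0).
    apply Rmult_le_compat_l; [left; apply exp_pos|lra]. }
  rewrite Rabs_pos_eq by lra.
  assert (exp x * (1 - x) <= (1 + x + 2 * x ^ 2) * (1 - x)) by nra.
  apply Rmult_le_reg_r in H0; lra.
Qed.

Lemma cos_taylor0 y : Rabs (cos y - 1) <= y ^ 2 / 2.
Proof.
  assert (E : cos y = 1 - 2 * sin (y / 2) * sin (y / 2)) by (rewrite <- cos_2a_sin; f_equal; field).
  assert (S : Rabs (sin (y / 2)) <= Rabs (y / 2)).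
  { assert (B := bounded_variation sin cos 1 0 (y / 2)). rewrite sin_0, !Rminus_0_r, Rmult_1_l in B.
    apply B. intros t _; split; [auto_derive; auto; ring|apply Rabs_le, COS_bound]. }
  rewrite E, Rabs_left1 by nra.
  assert (sin (y / 2) ^ 2 <= (y / 2) ^ 2).
  { rewrite <- (pow2_abs (sin (y / 2))), <- (pow2_abs (y / 2)).
    apply pow_incr; split; auto; apply Rabs_pos. }
  nra.
Qed.

Lemma sin_taylor1 y : Rabs y <= 1 -> Rabs (sin y - y) <= y ^ 2.
Proof.
  intros Hy.
  assert (B := bounded_variation (fun t => sin t - t) (fun t => cos t - 1) (Rabs y) 0 y).
  cbv beta in B; rewrite sin_0, !Rminus_0_r in B.
  replace (y ^ 2) with (Rabs y * Rabs y) by (rewrite <- (pow2_abs y); ring).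
  apply B. intros t Ht. rewrite Rminus_0_r in Ht.
  split; [auto_derive; auto; ring|].
  apply Rle_trans with (1 := cos_taylor0 t). rewrite <- (pow2_abs t).
  generalize (Rabs_pos t); nra.
Qed.

Lemma cexp_taylor1 x y : Rabs x <= 1 / 2 -> Rabs y <= 1 ->
  Cmod (cexp x y - 1 - cpt x y)%C <= 6 * Cmod (cpt x y) ^ 2.
Proof.
  intros Hx Hy. apply Rle_trans with (1 := Cmod_le_abs _).
  rewrite Cmod2. unfold cpt, cexp; simpl.
  assert (X := exp_taylor1 x Hx). assert (K := cos_taylor0 y). assert (S := sin_taylor1 y Hy).
  apply Rabs_le_between in X, K, S.
  assert (Hx' := Hx); assert (Hy' := Hy). apply Rabs_le_between in Hx', Hy'.
  assert (Hx1 : Rabs (exp x - 1) <= 2 * Rabs x).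
  { replace (exp x - 1) with ((exp x - 1 - x) + x) by ring.
    apply Rle_trans with (1 := Rabs_triang _ _).
    assert (Rabs (exp x - 1 - x) <= 2 * x ^ 2) by (apply exp_taylor1, Hx).
    rewrite <- (pow2_abs x) in H. generalize (Rabs_pos x); nra. }
  assert (Hs : Rabs (sin y) <= 2 * Rabs y).
  { replace (sin y) with ((sin y - y) + y) by ring.
    apply Rle_trans with (1 := Rabs_triang _ _).
    assert (Rabs (sin y - y) <= y ^ 2) by (apply sin_taylor1, Hy).
    rewrite <- (pow2_abs y) in H. generalize (Rabs_pos y); nra. }
  assert (A : Rabs (exp x * cos y + - (1) + - x) <= 2 * x ^ 2 + y ^ 2).
  { replace (exp x * cos y + - (1) + - x) with ((exp x - 1 - x) + exp x * (cos y - 1)) by ring.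
    apply Rabs_le. assert (x ^ 2 <= 1 / 4) by nra.
    assert (Ex : 0 < exp x <= 2) by (split; [apply exp_pos|lra]).
    assert (Cy : 0 <= 1 - cos y <= y ^ 2 / 2) by (generalize (COS_bound y); lra).
    assert (0 <= exp x * (1 - cos y) <= 2 * (y ^ 2 / 2)).
    { split; [apply Rmult_le_pos; lra|apply Rmult_le_compat; lra]. }
    lra. }
  assert (B : Rabs (exp x * sin y + - 0 + - y) <= 4 * Rabs x * Rabs y + y ^ 2).
  { replace (exp x * sin y + - 0 + - y) with ((exp x - 1) * sin y + (sin y - y)) by ring.
    apply Rle_trans with (1 := Rabs_triang _ _). rewrite Rabs_mult.
    assert (Rabs (sin y - y) <= y ^ 2) by (apply sin_taylor1, Hy).
    assert (Rabs (exp x - 1) * Rabs (sin y) <= (2 * Rabs x) * (2 * Rabs y))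
      by (apply Rmult_le_compat; auto; apply Rabs_pos).
    lra. }
  assert (4 * Rabs x * Rabs y <= 2 * x ^ 2 + 2 * y ^ 2).
  { rewrite <- (pow2_abs x), <- (pow2_abs y). generalize (pow2_ge_0 (Rabs x - Rabs y)); lra. }
  lra.
Qed.

(** The limit is punctured because the kernel takes a meaningless default value at its poles. For G
    = (z - p) F this unfolds to the limit hypothesis of [residue_rect]. *)
Definition clim (G : R -> R -> C) (px py : R) (l : C) : Prop :=
  forall eta, 0 < eta -> exists d0, 0 < d0 /\ forall x y,
    0 < Cmod (cpt (x - px) (y - py)) < d0 -> Cmod (G x y - l)%C <= eta.

Lemma clim_of_cc2 G px py : cc2 G px py -> clim G px py (G px py).
Proof.
  intros [H1 H2] eta He. assert (He2 : 0 < eta / 2) by lra.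
  destruct (H1 (mkposreal _ He2)) as [d1 D1]. destruct (H2 (mkposreal _ He2)) as [d2 D2].
  simpl in D1, D2.
  exists (Rmin d1 d2); split; [apply Rmin_case; apply cond_pos|].
  intros x y [_ H]. apply Rle_trans with (1 := Cmod_le_abs _). simpl.
  assert (Hx := Rabs_fst_Cmod (cpt (x - px) (y - py))).
  assert (Hy := Rabs_snd_Cmod (cpt (x - px) (y - py))). simpl in Hx, Hy.
  assert (M1 := Rmin_l d1 d2). assert (M2 := Rmin_r d1 d2).
  specialize (D1 x y ltac:(lra) ltac:(lra)). specialize (D2 x y ltac:(lra) ltac:(lra)).
  unfold Rminus in D1, D2. lra.
Qed.

Lemma clim_ext G H px py l : (forall x y, 0 < Cmod (cpt (x - px) (y - py)) -> G x y = H x y) ->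
  clim G px py l -> clim H px py l.
Proof.
  intros E L eta He. destruct (L eta He) as [d [Hd D]]. exists d; split; auto.
  intros x y [P Q]. rewrite <- E by auto. apply D; auto.
Qed.

Lemma clim_mult G H px py l m : clim G px py l -> clim H px py m ->
  clim (fun x y => G x y * H x y)%C px py (l * m)%C.
Proof.
  intros LG LH eta He.
  set (e := Rmin 1 (eta / (Cmod l + Cmod m + 1))).
  assert (Pl := Cmod_ge_0 l). assert (Pm := Cmod_ge_0 m).
  assert (Hq : 0 < eta / (Cmod l + Cmod m + 1)) by (apply Rdiv_lt_0_compat; lra).
  assert (Hee : 0 < e) by (unfold e; apply Rmin_case; lra).
  destruct (LG e Hee) as [d1 [Hd1 D1]]. destruct (LH e Hee) as [d2 [Hd2 D2]].
  exists (Rmin d1 d2); split; [apply Rmin_case; auto|].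
  intros x y [P Q].
  specialize (D1 x y (conj P (Rlt_le_trans _ _ _ Q (Rmin_l _ _)))).
  specialize (D2 x y (conj P (Rlt_le_trans _ _ _ Q (Rmin_r _ _)))).
  replace (G x y * H x y - l * m)%C
    with ((G x y - l) * (H x y - m) + (l * (H x y - m) + m * (G x y - l)))%C by ring.
  eapply Rle_trans; [apply Cmod_triangle|].
  eapply Rle_trans; [apply Rplus_le_compat_l, Cmod_triangle|]. rewrite !Cmod_mult.
  assert (E1 : e <= 1) by (unfold e; apply Rmin_l).
  assert (E2 : e * (Cmod l + Cmod m + 1) <= eta).
  { apply Rle_trans with (eta / (Cmod l + Cmod m + 1) * (Cmod l + Cmod m + 1)); [|right; field; lra].
    apply Rmult_le_compat_r; [lra|unfold e; apply Rmin_r]. }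
  generalize (Cmod_ge_0 (G x y - l)) (Cmod_ge_0 (H x y - m)); nra.
Qed.

Lemma clim_inv G px py (l : C) : l <> 0%C -> clim G px py l -> clim (fun x y => / G x y)%C px py (/ l)%C.
Proof.
  intros Nl L eta He. assert (Pl := proj1 (Cmod_gt_0 l) Nl).
  set (m := Cmod l) in *.
  set (e := Rmin (m / 2) (eta * m ^ 2 / 2)).
  assert (Hm2 : 0 < m ^ 2) by (apply pow_lt; auto).
  assert (Hee : 0 < e) by (unfold e; apply Rmin_case; [lra|nra]).
  destruct (L e Hee) as [d [Hd D]]. exists d; split; auto. intros x y P.
  specialize (D x y P).
  assert (E1 : e <= m / 2) by apply Rmin_l. assert (E2 : e <= eta * m ^ 2 / 2) by apply Rmin_r.
  assert (G0 : m / 2 <= Cmod (G x y)).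
  { assert (T := Cmod_triangle_rev l (l - G x y)). rewrite <- (Cmod_minus_sym (G x y) l) in T.
    replace (l - (l - G x y))%C with (G x y) in T by ring. fold m in T. lra. }
  assert (GN : G x y <> 0%C) by (intro E; rewrite E, Cmod_0 in G0; lra).
  replace (/ G x y - / l)%C with ((l - G x y) / (G x y * l))%C by (field; auto).
  rewrite Cmod_div by (apply Cmult_neq_0; auto). rewrite Cmod_mult. fold m.
  rewrite Cmod_minus_sym.
  apply Rmult_le_reg_r with (Cmod (G x y) * m); [nra|].
  unfold Rdiv. rewrite Rmult_assoc, Rinv_l, Rmult_1_r by nra. nra.
Qed.

(** Factoring out the value at p leaves (e^(b z) - 1)/z, to which the Taylor bound applies since b
    <= 1. The inverse of this limit is what turns a simple zero of a denominator into a residue. *)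
Lemma clim_cexp_quotient b px py : 0 < b <= 1 ->
  clim (fun x y => (cexp (b * x) (b * y) - cexp (b * px) (b * py)) / cpt (x - px) (y - py))%C
    px py (b * cexp (b * px) (b * py))%C.
Proof.
  intros Hb eta He. set (m := exp (b * px)). assert (Hm : 0 < m) by apply exp_pos.
  exists (Rmin (1 / 2) (eta / (6 * m))); split.
  - apply Rmin_case; [lra|]. apply Rdiv_lt_0_compat; lra.
  - intros x y [P Q]. set (z := cpt (x - px) (y - py)) in *.
    assert (Nz : z <> 0%C) by (apply Cmod_gt_0; auto).
    assert (Q1 : Cmod z < 1 / 2) by (apply Rlt_le_trans with (1 := Q), Rmin_l).
    assert (Q2 : Cmod z < eta / (6 * m)) by (apply Rlt_le_trans with (1 := Q), Rmin_r).
    assert (Hx := Rabs_fst_Cmod z). assert (Hy := Rabs_snd_Cmod z). simpl in Hx, Hy.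
    assert (E : cexp (b * x) (b * y) = (cexp (b * px) (b * py) * cexp (b * (x - px)) (b * (y - py)))%C).
    { rewrite <- cexp_plus. f_equal; ring. }
    assert (Ez : cpt (b * (x - px)) (b * (y - py)) = (b * z)%C)
      by (apply C_eq; unfold z, cpt; simpl; ring).
    rewrite E.
    replace ((cexp (b * px) (b * py) * cexp (b * (x - px)) (b * (y - py)) - cexp (b * px) (b * py)) / z
       - b * cexp (b * px) (b * py))%C
      with (cexp (b * px) (b * py) * (cexp (b * (x - px)) (b * (y - py)) - 1 - b * z) / z)%C
      by (field; auto).
    rewrite Cmod_div, Cmod_mult, Cmod_cexp by auto. fold m.
    assert (T := cexp_taylor1 (b * (x - px)) (b * (y - py))).
    rewrite Ez, Cmod_mult, Cmod_R, (Rabs_pos_eq b) in T by lra.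
    assert (T' : Cmod (cexp (b * (x - px)) (b * (y - py)) - 1 - b * z)%C <= 6 * Cmod z ^ 2).
    { eapply Rle_trans; [apply T|].
      - rewrite Rabs_mult, (Rabs_pos_eq b) by lra. generalize (Rabs_pos (x - px)); nra.
      - rewrite Rabs_mult, (Rabs_pos_eq b) by lra. generalize (Rabs_pos (y - py)); nra.
      - rewrite Rpow_mult_distr. assert (b ^ 2 <= 1) by nra. generalize (pow2_ge_0 (Cmod z)); nra. }
    apply Rmult_le_reg_r with (Cmod z); auto.
    unfold Rdiv. rewrite Rmult_assoc, Rinv_l, Rmult_1_r by lra.
    assert (6 * m * Cmod z <= eta).
    { replace eta with (6 * m * (eta / (6 * m))) by (field; lra).
      apply Rmult_le_compat_l; lra. }
    nra.
Qed.

(** The lines [y1] and [y2] bound the contour, and (ya, yb) is a slightly larger open strip on which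
    the integrand must be controlled. The limits 2 PI leave Im w = 0 as the only height of a zero of
    s - e^w. The conditions on al ya and al yb, with phi in (-PI, PI], leave w = (l + i phi)/al as
    the only possible zero of e^(al w) - lambda; the last clause puts it between the lines or
    outside the larger strip. Finally cos y2 < 0 makes e^w run on both lines through a ray with
    negative real part. *)
Definition strip (al phi ya y1 y2 yb : R) : Prop :=
  0 < al < 1 /\ - PI < phi <= PI /\ ya < y1 /\ y1 < 0 /\ 0 < y2 /\ y2 < yb /\ y2 = y1 + 2 * PI /\
  - 2 * PI < ya /\ yb < 2 * PI /\ - PI <= al * ya /\ al * yb <= PI /\ cos y2 < 0 /\
  (y1 < phi / al < y2 \/ phi / al <= ya \/ yb <= phi / al).

(* With [w = x + i y] and [lambda = cexp l phi], this is [e^w / ((s - e^w) (e^(al w) - lambda))]. *)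
Definition KF (al l phi s x y : R) : C :=
  (cexp (1 * x) (1 * y) * / (s - cexp (1 * x) (1 * y))
   * / (cexp (al * x) (al * y) - cexp l phi))%C.

Definition dKF (al l phi s x y : R) : C :=
  ((1 * cexp (1 * x) (1 * y) * / (s - cexp (1 * x) (1 * y))
    + cexp (1 * x) (1 * y) * (- (0 - 1 * cexp (1 * x) (1 * y))
        * (/ (s - cexp (1 * x) (1 * y)) * / (s - cexp (1 * x) (1 * y)))))
   * / (cexp (al * x) (al * y) - cexp l phi)
   + cexp (1 * x) (1 * y) * / (s - cexp (1 * x) (1 * y))
     * (- (al * cexp (al * x) (al * y) - 0)
        * (/ (cexp (al * x) (al * y) - cexp l phi) * / (cexp (al * x) (al * y) - cexp l phi))))%C.

Lemma hol_KF al l phi (s x y : R) :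
  (s - cexp (1 * x) (1 * y) <> 0)%C -> (cexp (al * x) (al * y) - cexp l phi <> 0)%C ->
  hol (KF al l phi s) (dKF al l phi s) x y /\ cc2 (dKF al l phi s) x y.
Proof.
  intros N1 N2. split.
  - unfold KF, dKF.
    apply (hol_mult (fun x y => cexp (1 * x) (1 * y) * / (s - cexp (1 * x) (1 * y)))%C
      (fun x y => 1 * cexp (1 * x) (1 * y) * / (s - cexp (1 * x) (1 * y))
        + cexp (1 * x) (1 * y) * (- (0 - 1 * cexp (1 * x) (1 * y))
        * (/ (s - cexp (1 * x) (1 * y)) * / (s - cexp (1 * x) (1 * y)))))%C
      (fun x y => / (cexp (al * x) (al * y) - cexp l phi))%C
      (fun x y => - (al * cexp (al * x) (al * y) - 0)
        * (/ (cexp (al * x) (al * y) - cexp l phi) * / (cexp (al * x) (al * y) - cexp l phi)))%C).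
    + apply (hol_mult (fun x y => cexp (1 * x) (1 * y)) (fun x y => 1 * cexp (1 * x) (1 * y))%C
        (fun x y => / (s - cexp (1 * x) (1 * y)))%C
        (fun x y => - (0 - 1 * cexp (1 * x) (1 * y))
        * (/ (s - cexp (1 * x) (1 * y)) * / (s - cexp (1 * x) (1 * y))))%C); [apply hol_cexp|].
      apply (hol_inv (fun x y => s - cexp (1 * x) (1 * y))%C (fun x y => 0 - 1 * cexp (1 * x) (1 * y))%C);
        auto.
      apply (hol_minus (fun _ _ => RtoC s) (fun _ _ => 0%C)); [apply hol_const|apply hol_cexp].
    + apply (hol_inv (fun x y => cexp (al * x) (al * y) - cexp l phi)%C
        (fun x y => al * cexp (al * x) (al * y) - 0)%C); auto.
      apply (hol_minus (fun x y => cexp (al * x) (al * y)) (fun x y => al * cexp (al * x) (al * y))%C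
        (fun _ _ => cexp l phi) (fun _ _ => 0%C)); [apply hol_cexp|apply hol_const].
  - assert (E1 := cc2_cexp 1 x y). assert (E2 := cc2_cexp al x y).
    assert (I1 : cc2 (fun x y => / (s - cexp (1 * x) (1 * y)))%C x y).
    { apply (cc2_inv (fun x y => s - cexp (1 * x) (1 * y))%C); auto.
      apply (cc2_minus (fun _ _ => RtoC s)); auto. apply cc2_const. }
    assert (I2 : cc2 (fun x y => / (cexp (al * x) (al * y) - cexp l phi))%C x y).
    { apply (cc2_inv (fun x y => cexp (al * x) (al * y) - cexp l phi)%C); auto.
      apply (cc2_minus _ (fun _ _ => cexp l phi)); auto. apply cc2_const. }
    unfold dKF.
    assert (Op : forall F, cc2 F x y -> cc2 (fun x y => - F x y)%C x y).
    { intros F [A B]; split; simpl; apply continuity_2d_pt_opp; auto. }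
    repeat first [assumption | apply cc2_const | apply cc2_plus | apply cc2_minus
      | apply cc2_mult | apply Op].
Qed.

Lemma KF_den1 ls x y : Rabs y < 2 * PI -> x <> ls \/ y <> 0 ->
  (RtoC (exp ls) - cexp (1 * x) (1 * y) <> 0)%C.
Proof.
  intros Hy Hor E. rewrite !Rmult_1_l in E.
  assert (E' : cexp x y = cexp ls 0) by (rewrite cexp_real; transitivity (RtoC (exp ls)
    - (exp ls - cexp x y))%C; [ring|rewrite E; ring]).
  apply cexp_inj_strip in E'; [lra|rewrite Rminus_0_r; auto].
Qed.

Lemma KF_den2 al l phi x y : 0 < al -> Rabs (al * y - phi) < 2 * PI ->
  x <> l / al \/ y <> phi / al -> (cexp (al * x) (al * y) - cexp l phi <> 0)%C.
Proof.
  intros Ha Hy Hor E.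
  assert (E' : cexp (al * x) (al * y) = cexp l phi)
    by (transitivity (cexp (al * x) (al * y) - cexp l phi + cexp l phi)%C; [ring|rewrite E; ring]).
  apply cexp_inj_strip in E'; auto. destruct E' as [E1 E2].
  destruct Hor as [H|H]; apply H; [rewrite <- E1|rewrite <- E2]; field; lra.
Qed.

Lemma strip_den1 al phi ya y1 y2 yb y : strip al phi ya y1 y2 yb -> ya < y < yb -> Rabs y < 2 * PI.
Proof. unfold strip; intros H Hy; apply Rabs_def1; lra. Qed.

Lemma strip_den2 al phi ya y1 y2 yb y : strip al phi ya y1 y2 yb -> ya < y < yb ->
  Rabs (al * y - phi) < 2 * PI.
Proof.
  unfold strip; intros H Hy. assert (al * ya < al * y < al * yb) by (split; apply Rmult_lt_compat_l; lra).
  apply Rabs_def1; lra.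
Qed.

Lemma Cinv_of_0 : (/ RtoC 0)%C = 0%C.
Proof. apply C_eq; unfold Cinv; simpl; unfold Rdiv; ring. Qed.

(** The zero of s - e^w at w = log s is simple with derivative -s, and the numerator e^w = s cancels
    it. This is where 1/(s^al - lambda) comes from, with s^al written as [exp (al * ls)]. *)
Lemma clim_KF_s al l phi ls : 0 < al < 1 -> (RtoC (exp (al * ls)) - cexp l phi <> 0)%C ->
  clim (fun x y => cpt (x - ls) (y - 0) * KF al l phi (exp ls) x y)%C ls 0
    (- / (RtoC (exp (al * ls)) - cexp l phi))%C.
Proof.
  intros Ha N.
  assert (E0 : cexp (1 * ls) (1 * 0) = RtoC (exp ls)) by (rewrite !Rmult_1_l; apply cexp_real).
  assert (Ea : cexp (al * ls) (al * 0) = RtoC (exp (al * ls))) by (rewrite Rmult_0_r; apply cexp_real).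
  assert (Ne : RtoC (exp ls) <> 0%C) by (rewrite <- cexp_real; apply cexp_neq0).
  assert (NQ : (RtoC 1 * cexp (1 * ls) (1 * 0) <> 0)%C)
    by (rewrite E0; apply Cmult_neq_0; [intro X; apply RtoC_inj in X; lra|exact Ne]).
  assert (Q := clim_inv _ _ _ _ NQ (clim_cexp_quotient 1 ls 0 ltac:(lra))).
  assert (L2 : clim (fun x y => / (cexp (al * x) (al * y) - cexp l phi))%C ls 0
     (/ (cexp (al * ls) (al * 0) - cexp l phi))%C).
  { apply (clim_of_cc2 (fun x y => / (cexp (al * x) (al * y) - cexp l phi))%C).
    apply (cc2_inv (fun x y => cexp (al * x) (al * y) - cexp l phi)%C); [|rewrite Ea; auto].
    apply (cc2_minus _ (fun _ _ => cexp l phi)); [apply cc2_cexp|apply cc2_const]. }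
  assert (L1 := clim_of_cc2 _ _ _ (cc2_cexp 1 ls 0)).
  assert (L0 := clim_of_cc2 (fun _ _ => (-1)%C) ls 0 (cc2_const _ _ _)).
  assert (L := clim_mult _ _ _ _ _ _ (clim_mult _ _ _ _ _ _ (clim_mult _ _ _ _ _ _ L0 L1) Q) L2).
  cbv beta in L. rewrite Ea, E0 in L.
  replace (- / (RtoC (exp (al * ls)) - cexp l phi))%C
    with (-1 * exp ls * / (1 * exp ls) * / (exp (al * ls) - cexp l phi))%C by (field; auto).
  refine (clim_ext _ _ _ _ _ _ L). intros x y Hp. unfold KF.
  set (z := cpt (x - ls) (y - 0)) in *. assert (Nz : z <> 0%C) by (apply Cmod_gt_0; auto).
  (* The equality is required at every point other than the pole, also at the translates by
     multiples of 2 PI i where the denominator vanishes again; there both sides are 0 because the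
     inverse of 0 is 0. *)
  destruct (classic (cexp (1 * x) (1 * y) = RtoC (exp ls))) as [E|E].
  - rewrite E. rewrite (Cplus_opp_r (exp ls) : (RtoC (exp ls) - exp ls = 0)%C).
    unfold Cdiv. rewrite Cmult_0_l.
    rewrite Cinv_of_0. ring.
  - assert (N1 : (cexp (1 * x) (1 * y) - exp ls <> 0)%C).
    { intro X; apply E. transitivity (cexp (1 * x) (1 * y) - exp ls + exp ls)%C; [ring|rewrite X; ring]. }
    assert (N2 : (exp ls - cexp (1 * x) (1 * y) <> 0)%C).
    { intro X; apply N1. transitivity (- (exp ls - cexp (1 * x) (1 * y)))%C; [ring|rewrite X; ring]. }
    set (D := (/ (cexp (al * x) (al * y) - cexp l phi))%C).
    field. auto.
Qed.

(** At w = (l + i phi)/al the factor e^(al w) - lambda has a simple zero with derivative al lambda,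
    and e^w takes the value mu. *)
Lemma clim_KF_mu al l phi (s : R) : 0 < al < 1 -> (s - cexp (l / al) (phi / al) <> 0)%C ->
  clim (fun x y => cpt (x - l / al) (y - phi / al) * KF al l phi s x y)%C (l / al) (phi / al)
    (cexp (l / al) (phi / al) / (al * cexp l phi) / (s - cexp (l / al) (phi / al)))%C.
Proof.
  intros Ha N.
  assert (E0 : cexp (1 * (l / al)) (1 * (phi / al)) = cexp (l / al) (phi / al)) by (rewrite !Rmult_1_l; auto).
  assert (Ea : cexp (al * (l / al)) (al * (phi / al)) = cexp l phi) by (f_equal; field; lra).
  assert (Ne : (al * cexp l phi)%C <> 0%C).
  { apply Cmult_neq_0; [|apply cexp_neq0]. intro X; apply RtoC_inj in X; lra. }
  assert (NQ : (RtoC al * cexp (al * (l / al)) (al * (phi / al)) <> 0)%C) by (rewrite Ea; exact Ne).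
  assert (Q := clim_inv _ _ _ _ NQ (clim_cexp_quotient al (l / al) (phi / al) ltac:(lra))).
  assert (L2 : clim (fun x y => / (s - cexp (1 * x) (1 * y)))%C (l / al) (phi / al)
     (/ (s - cexp (1 * (l / al)) (1 * (phi / al))))%C).
  { apply (clim_of_cc2 (fun x y => / (s - cexp (1 * x) (1 * y)))%C).
    apply (cc2_inv (fun x y => s - cexp (1 * x) (1 * y))%C); [|rewrite E0; auto].
    apply (cc2_minus (fun _ _ => RtoC s)); [apply cc2_const|apply cc2_cexp]. }
  assert (L1 := clim_of_cc2 _ _ _ (cc2_cexp 1 (l / al) (phi / al))).
  assert (L := clim_mult _ _ _ _ _ _ (clim_mult _ _ _ _ _ _ L1 Q) L2).
  cbv beta in L. rewrite Ea, E0 in L.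
  assert (N3 : cexp l phi <> 0%C) by apply cexp_neq0.
  assert (N4 : RtoC al <> 0%C) by (intro X; apply RtoC_inj in X; lra).
  replace (cexp (l / al) (phi / al) / (al * cexp l phi) / (s - cexp (l / al) (phi / al)))%C
    with (cexp (l / al) (phi / al) * / (al * cexp l phi) * / (s - cexp (l / al) (phi / al)))%C
    by (field; auto).
  refine (clim_ext _ _ _ _ _ _ L). intros x y Hp. unfold KF.
  set (z := cpt (x - l / al) (y - phi / al)) in *. assert (Nz : z <> 0%C) by (apply Cmod_gt_0; auto).
  set (D := (/ (s - cexp (1 * x) (1 * y)))%C).
  destruct (classic (cexp (al * x) (al * y) = cexp l phi)) as [E|E].
  - rewrite E. rewrite (Cplus_opp_r (cexp l phi) : (cexp l phi - cexp l phi = 0)%C).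
    unfold Cdiv. rewrite Cmult_0_l.
    rewrite Cinv_of_0. ring.
  - assert (N1 : (cexp (al * x) (al * y) - cexp l phi <> 0)%C).
    { intro X; apply E. transitivity (cexp (al * x) (al * y) - cexp l phi + cexp l phi)%C;
        [ring|rewrite X; ring]. }
    field. auto.
Qed.

Lemma exp_1_ge_2 : 2 <= exp 1.
Proof. generalize (exp_ineq1_le 1); lra. Qed.

Lemma exp_ge_double a b : a + 1 <= b -> 2 * exp a <= exp b.
Proof.
  intros H. apply Rle_trans with (exp (a + 1)).
  - rewrite exp_plus. generalize (exp_pos a) exp_1_ge_2; nra.
  - destruct (Req_dec (a + 1) b) as [->|]; [lra|left; apply exp_increasing; lra].
Qed.

(** A distance of 1 between exponents means a factor of at least 2, so each denominator is at least
    half of its dominant exponential. Then e^N cancels and e^(-al N) remains. *)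
Lemma KF_bound_right al l phi ls N y : 0 < al -> ls + 1 <= N -> l + 1 <= al * N ->
  Cmod (KF al l phi (exp ls) N y) <= 4 * exp (- al * N).
Proof.
  intros Ha H1 H2. assert (D1 := exp_ge_double _ _ H1). assert (D2 := exp_ge_double _ _ H2).
  unfold KF. rewrite !Rmult_1_l.
  assert (A : exp N / 2 <= Cmod (exp ls - cexp N y)%C).
  { rewrite Cmod_minus_sym. assert (T := Cmod_triangle_rev (cexp N y) (exp ls)).
    rewrite Cmod_cexp, Cmod_R, Rabs_pos_eq in T by (left; apply exp_pos). lra. }
  assert (B : exp (al * N) / 2 <= Cmod (cexp (al * N) (al * y) - cexp l phi)%C).
  { assert (T := Cmod_triangle_rev (cexp (al * N) (al * y)) (cexp l phi)).
    rewrite !Cmod_cexp in T. lra. }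
  assert (P := exp_pos N). assert (P' := exp_pos (al * N)).
  rewrite !Cmod_mult, Cmod_cexp.
  rewrite !Cmod_inv by (apply Cmod_gt_0; lra).
  replace (- al * N) with (- (al * N)) by ring. rewrite exp_Ropp.
  apply Rle_trans with (exp N * / (exp N / 2) * / (exp (al * N) / 2)); [|right; field; lra].
  apply Rmult_le_compat.
  - apply Rmult_le_pos; [lra|left; apply Rinv_0_lt_compat; lra].
  - left; apply Rinv_0_lt_compat; lra.
  - apply Rmult_le_compat_l; [lra|apply Rinv_le_contravar; lra].
  - apply Rinv_le_contravar; lra.
Qed.

(** On the far left the constants s and lambda dominate the denominators, and the decay is that of
    the numerator e^w. *)
Lemma KF_bound_left al l phi ls N y : 0 < al -> - N + 1 <= ls -> - al * N + 1 <= l ->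
  Cmod (KF al l phi (exp ls) (- N) y) <= 4 / (exp ls * exp l) * exp (- (1) * N).
Proof.
  intros Ha H1 H2. assert (D1 := exp_ge_double _ _ H1). assert (D2 := exp_ge_double _ _ H2).
  unfold KF. rewrite !Rmult_1_l.
  replace (al * - N) with (- al * N) by ring. replace (- (1) * N) with (- N) by ring.
  assert (A : exp ls / 2 <= Cmod (exp ls - cexp (- N) y)%C).
  { assert (T := Cmod_triangle_rev (exp ls) (cexp (- N) y)).
    rewrite Cmod_cexp, Cmod_R, Rabs_pos_eq in T by (left; apply exp_pos). lra. }
  assert (B : exp l / 2 <= Cmod (cexp (- al * N) (al * y) - cexp l phi)%C).
  { rewrite Cmod_minus_sym. assert (T := Cmod_triangle_rev (cexp l phi) (cexp (- al * N) (al * y))).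
    rewrite !Cmod_cexp in T. lra. }
  assert (P := exp_pos (- N)). assert (P' := exp_pos ls). assert (P'' := exp_pos l).
  rewrite !Cmod_mult, Cmod_cexp.
  rewrite !Cmod_inv by (apply Cmod_gt_0; lra).
  apply Rle_trans with (exp (- N) * / (exp ls / 2) * / (exp l / 2)); [|right; field; lra].
  apply Rmult_le_compat.
  - apply Rmult_le_pos; [lra|left; apply Rinv_0_lt_compat; lra].
  - left; apply Rinv_0_lt_compat; lra.
  - apply Rmult_le_compat_l; [lra|apply Rinv_le_contravar; lra].
  - apply Rinv_le_contravar; lra.
Qed.

(** The residue at w = (l + i phi)/al, which counts only if this point lies between the two edges of
    the contour. *)
Definition pole_term (al l phi y1 y2 s : R) : C :=
  if excluded_middle_informative (y1 < phi / al < y2)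
  then (cexp (l / al) (phi / al) / (al * cexp l phi) / (s - cexp (l / al) (phi / al)))%C
  else 0%C.

Lemma KF_exCI al l phi ya y1 y2 yb s y a b : strip al phi ya y1 y2 yb -> 0 < s ->
  y = y1 \/ y = y2 -> exCI (fun x => KF al l phi s x y) a b.
Proof.
  intros Hs Ps Hy. apply exCI_of_continuous; intros t _.
  assert (B : ya < y < yb /\ y <> 0 /\ y <> phi / al) by (unfold strip in Hs; destruct Hy; subst y; lra).
  apply (hol_cc2_line1 _ (dKF al l phi s)), hol_KF.
  - rewrite <- (exp_ln s) by auto. apply KF_den1; [apply (strip_den1 _ _ _ _ _ _ _ Hs)|]; tauto.
  - apply KF_den2; [apply Hs|apply (strip_den2 _ _ _ _ _ _ _ Hs)|]; tauto.
Qed.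

(** A variant of Kato's formula for the resolvent of a fractional power. The condition
    [l / al < ls], that is s > |mu|, separates the two poles by their real parts, so the rectangle
    can be cut between them and each half contains at most one pole. The vertical sides vanish in
    the limit, and the top edge minus the bottom edge remains. *)
Lemma kato_identity al l phi ya y1 y2 yb ls : strip al phi ya y1 y2 yb -> l / al < ls ->
  forall eps, 0 < eps -> exists N0, forall N, N0 <= N ->
    Cmod (CI (fun x => KF al l phi (exp ls) x y2 - KF al l phi (exp ls) x y1) (- N) N
      - 2 * PI * Ci * (/ (RtoC (exp (al * ls)) - cexp l phi) - pole_term al l phi y1 y2 (exp ls)))%C <= eps.
Proof.
  intros Hs Hls eps He. assert (Hs' := Hs). unfold strip in Hs'.
  destruct Hs' as [Ha [Hphi [A1 [A2 [A3 [A4 [A5 [A6 [A7 [A8 [A9 [A10 A11]]]]]]]]]]]].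
  assert (Ps := exp_pos ls). assert (PP := PI_RGT_0).
  (* The cut runs midway between the real parts of the two poles. *)
  set (m := (l / al + ls) / 2).
  set (F := KF al l phi (exp ls)).
  assert (HF : forall x y, ya < y < yb -> x <> ls \/ y <> 0 -> x <> l / al \/ y <> phi / al ->
    hol F (dKF al l phi (exp ls)) x y /\ cc2 (dKF al l phi (exp ls)) x y).
  { intros x y Hy H1 H2. apply hol_KF.
    - apply KF_den1; auto. apply (strip_den1 _ _ _ _ _ _ _ Hs Hy).
    - apply KF_den2; auto; [lra|]. apply (strip_den2 _ _ _ _ _ _ _ Hs Hy). }
  assert (R1 : forall N, m < N -> ls < N -> rect F m N y1 y2
     = (2 * PI * Ci * - / (RtoC (exp (al * ls)) - cexp l phi))%C).
  { intros N HN HN'. apply (residue_rect F (dKF al l phi (exp ls)) _ (l / al) (N + 1) ya yb ls 0);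
      try (unfold m; lra).
    - intros x y Hx Hy Hor. apply HF; auto. left; lra.
    - apply clim_KF_s; [lra|]. intro E.
      assert (E2 : cexp (al * ls) (al * 0) = cexp l phi).
      { rewrite Rmult_0_r, cexp_real.
        transitivity (RtoC (exp (al * ls)) - cexp l phi + cexp l phi)%C; [ring|rewrite E; ring]. }
      apply cexp_inj_strip in E2.
      + assert (l / al = ls) by (rewrite <- (proj1 E2); field; lra). lra.
      + rewrite Rmult_0_r, Rminus_0_l, Rabs_Ropp. apply Rabs_def1; lra. }
  assert (R2 : forall N, - N < m -> - N < l / al -> rect F (- N)%R m y1 y2
     = (2 * PI * Ci * pole_term al l phi y1 y2 (exp ls))%C).
  { intros N HN HN'. unfold pole_term.
    destruct (excluded_middle_informative (y1 < phi / al < y2)) as [Hin|Hout].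
    - apply (residue_rect F (dKF al l phi (exp ls)) _ (- N - 1) ls ya yb (l / al) (phi / al));
        try (unfold m; lra).
      + intros x y Hx Hy Hor. apply HF; auto. left; lra.
      + apply clim_KF_mu; [lra|]. intro E.
        assert (E2 : cexp ls 0 = cexp (l / al) (phi / al)).
        { rewrite cexp_real.
          transitivity (RtoC (exp ls) - cexp (l / al) (phi / al) + cexp (l / al) (phi / al))%C;
            [ring|rewrite E; ring]. }
        apply (f_equal Cmod) in E2. rewrite !Cmod_cexp in E2. apply exp_inv in E2. lra.
    - rewrite (cauchy_rect F (dKF al l phi (exp ls)) (- N - 1) ls ya yb); try (unfold m; lra).
      + ring.
      + intros x y Hx Hy. apply HF; auto; [left; lra|right; lra]. }
  assert (L1 := is_lim_exp_decay 4 al ltac:(lra)).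
  assert (L2 := is_lim_exp_decay (4 / (exp ls * exp l)) 1 ltac:(lra)).
  apply is_lim_spec in L1, L2.
  (* Each of the two vertical sides has length 2 PI and may contribute eps/2. *)
  assert (He' : 0 < eps / (4 * PI)) by (apply Rdiv_lt_0_compat; lra).
  destruct (L1 (mkposreal _ He')) as [N1 HN1]. destruct (L2 (mkposreal _ He')) as [N2 HN2].
  simpl in HN1, HN2.
  set (N0 := Rabs ls + Rabs l + Rabs m + Rabs (l / al) + (Rabs l + 1) / al + Rabs N1 + Rabs N2 + 1).
  exists N0. intros N HN.
  assert (T : N1 < N /\ N2 < N /\ - N < m /\ - N < l / al /\ m < N /\ ls < N /\ ls + 1 <= N /\ - N + 1 <= ls
     /\ (Rabs l + 1) / al <= N).
  { unfold N0 in HN. assert (0 <= (Rabs l + 1) / al) by (apply Rdiv_le_0_compat; [generalize (Rabs_pos l)|]; lra).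
    generalize (Rle_abs ls) (Rle_abs (- ls)) (Rabs_Ropp ls) (Rabs_pos l) (Rle_abs m) (Rle_abs (- m))
      (Rabs_Ropp m) (Rle_abs (l / al)) (Rle_abs (- (l / al))) (Rabs_Ropp (l / al)) (Rle_abs N1)
      (Rle_abs N2) (Rabs_pos N1) (Rabs_pos N2) (Rabs_pos ls) (Rabs_pos m) (Rabs_pos (l / al)).
    lra. }
  destruct T as [T1 [T2 [T3 [T4 [T5 [T6 [T7 [T8 T9]]]]]]]].
  assert (T10 : Rabs l + 1 <= al * N).
  { apply Rmult_le_compat_l with (r := al) in T9; [|lra].
    replace (al * ((Rabs l + 1) / al)) with (Rabs l + 1) in T9 by (field; lra). auto. }
  assert (T11 := Rle_abs l). assert (T12 := Rle_abs (- l)). rewrite Rabs_Ropp in T12.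
  specialize (HN1 N T1). specialize (HN2 N T2). rewrite Rminus_0_r in HN1, HN2.
  apply Rabs_lt_between in HN1, HN2.
  assert (X : forall y a b, y = y1 \/ y = y2 -> exCI (fun x => F x y) a b).
  { intros y a b Hy. apply (KF_exCI al l phi ya y1 y2 yb); auto. }
  assert (V : forall x, x <> ls -> x <> l / al -> exCI (fun y => F x y) y1 y2).
  { intros x Hx1 Hx2. apply exCI_of_continuous; intros t Ht.
    rewrite Rmin_left, Rmax_right in Ht by lra.
    apply (hol_cc2_line2 F (dKF al l phi (exp ls))), HF; auto; lra. }
  assert (LN : l / al < N) by (unfold m in T5; lra).
  assert (B1 : Cmod (CI (fun y => F N y) y1 y2) <= 4 * exp (- al * N) * (y2 - y1)).
  { apply CI_bound_const; [lra|apply V; lra|]. intros t Ht. apply KF_bound_right; lra. }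
  assert (B2 : Cmod (CI (fun y => F (- N)%R y) y1 y2)
     <= 4 / (exp ls * exp l) * exp (- (1) * N) * (y2 - y1)).
  { apply CI_bound_const; [lra|apply V; lra|]. intros t Ht. apply KF_bound_left; lra. }
  rewrite CI_minus by (apply X; auto).
  assert (R := rect_split_x F (- N) m N y1 y2 ltac:(auto) ltac:(auto) ltac:(auto) ltac:(auto)).
  rewrite (R1 N T5 T6), (R2 N T3 T4) in R. unfold rect in R.
  set (I1 := CI (fun x => F x y1) (- N) N) in *. set (I2 := CI (fun x => F x y2) (- N) N) in *.
  set (V1 := CI (fun y => F N y) y1 y2) in *. set (V2 := CI (fun y => F (- N)%R y) y1 y2) in *.
  set (p1 := (/ (exp (al * ls) - cexp l phi))%C) in *.
  set (p2 := pole_term al l phi y1 y2 (exp ls)) in *.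
  replace (I2 - I1 - 2 * PI * Ci * (p1 - p2))%C with (Ci * (V1 - V2))%C.
  - rewrite Cmod_mult, Cmod_Ci, Rmult_1_l.
    eapply Rle_trans; [apply Cmod_triangle|]. rewrite Cmod_opp.
    replace (y2 - y1) with (2 * PI) in B1, B2 by lra.
    assert (E1 : 4 * exp (- al * N) * (2 * PI) <= eps / (4 * PI) * (2 * PI))
      by (apply Rmult_le_compat_r; lra).
    assert (E2 : 4 / (exp ls * exp l) * exp (- (1) * N) * (2 * PI) <= eps / (4 * PI) * (2 * PI))
      by (apply Rmult_le_compat_r; lra).
    replace (eps / (4 * PI) * (2 * PI)) with (eps / 2) in E1, E2 by (field; lra). lra.
  - transitivity (I2 - I1 + (I1 - I2 + Ci * (V1 - V2)) + 2 * PI * Ci * (- p1 + p2)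
      - (2 * PI * Ci * p2 + 2 * PI * Ci * - p1) - 2 * PI * Ci * (p1 - p2) - 2 * PI * Ci * (- p1 + p2))%C;
      [|rewrite R; ring].
    ring_simplify. ring.
Qed.

(** * Scalar fractional equations *)

Definition ccont (f : R -> C) : Prop := cont (fun t => fst (f t)) /\ cont (fun t => snd (f t)).
Definition ccont2 (f : R -> R -> C) : Prop :=
  cont2 (fun x t => fst (f x t)) /\ cont2 (fun x t => snd (f x t)).

Lemma ccont_exCI f a b : ccont f -> exCI f a b.
Proof. intros [H1 H2]; split; apply cont_ex_RInt; auto. Qed.
Lemma ccont_plus f g : ccont f -> ccont g -> ccont (fun t => f t + g t)%C.
Proof. intros [A B] [C D]; split; simpl; apply cont_plus; auto. Qed.
Lemma ccont_opp f : ccont f -> ccont (fun t => - f t)%C.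
Proof. intros [A B]; split; simpl; apply cont_opp; auto. Qed.
Lemma ccont_minus f g : ccont f -> ccont g -> ccont (fun t => f t - g t)%C.
Proof. intros A B; apply (ccont_plus f (fun t => - g t)%C); auto; apply ccont_opp; auto. Qed.
Lemma ccont_mult f g : ccont f -> ccont g -> ccont (fun t => f t * g t)%C.
Proof.
  intros [A B] [C D]; split; simpl; [apply cont_minus|apply cont_plus]; apply cont_mult; auto.
Qed.
Lemma ccont_const c : ccont (fun _ => c).
Proof. split; apply cont_const. Qed.
Lemma ccont_RtoC f : cont f -> ccont (fun t => RtoC (f t)).
Proof. intros H; split; simpl; [auto|apply cont_const]. Qed.
Lemma ccont_cexp f g : cont f -> cont g -> ccont (fun t => cexp (f t) (g t)).
Proof. intros Hf Hg; split; simpl; ct. Qed.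
Lemma ccont_CI f a : ccont f -> ccont (fun t => CI f a t).
Proof. intros [A B]; split; simpl; apply cont_RInt; auto. Qed.
Lemma ccont2_mult f g : ccont2 f -> ccont2 g -> ccont2 (fun x t => f x t * g x t)%C.
Proof.
  intros [A B] [C D]; split; simpl; [apply cont2_minus|apply cont2_plus]; apply cont2_mult; auto.
Qed.
Lemma ccont2_of1 f : ccont f -> ccont2 (fun x _ => f x).
Proof. intros [A B]; split; [apply (cont2_of1 _ A)|apply (cont2_of1 _ B)]. Qed.
Lemma ccont2_of2 f : ccont f -> ccont2 (fun _ t => f t).
Proof. intros [A B]; split; [apply (cont2_of2 _ A)|apply (cont2_of2 _ B)]. Qed.
Lemma ccont2_CI f a : ccont2 f -> ccont2 (fun x t => CI (f x) a t).
Proof.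
  intros [A B]; split; simpl;
  [apply (cont2_RInt (fun x t => fst (f x t)))|apply (cont2_RInt (fun x t => snd (f x t)))]; auto.
Qed.
Lemma ccont2_cexp f g : cont2 f -> cont2 g -> ccont2 (fun x t => cexp (f x t) (g x t)).
Proof.
  intros Hf Hg.
  assert (E : cont2 (fun x t => exp (f x t))) by (apply (cont2_comp exp f); auto; apply cont_exp, cont_id).
  assert (K : cont2 (fun x t => cos (g x t))) by (apply (cont2_comp cos g); auto; apply cont_cos, cont_id).
  assert (S : cont2 (fun x t => sin (g x t))) by (apply (cont2_comp sin g); auto; apply cont_sin, cont_id).
  split; simpl; [apply (cont2_mult _ _ E K)|apply (cont2_mult _ _ E S)].
Qed.
Lemma ccont2_fix2 f t : ccont2 f -> ccont (fun x => f x t).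
Proof.
  intros [A B]; split; [apply (cont2_fix2 (fun x t => fst (f x t)))|apply (cont2_fix2 (fun x t => snd (f x t)))]; auto.
Qed.
Lemma ccont_CI_param f a b : ccont2 f -> ccont (fun t => CI (fun x => f x t) a b).
Proof.
  intros [A B]; split; simpl.
  - apply (cont_RInt_param (fun t x => fst (f x t))), cont2_swap, A.
  - apply (cont_RInt_param (fun t x => snd (f x t))), cont2_swap, B.
Qed.
Lemma CI_swap f a b c d : ccont2 f ->
  CI (fun x => CI (fun t => f x t) c d) a b = CI (fun t => CI (fun x => f x t) a b) c d.
Proof.
  intros [A B]; apply C_eq; simpl.
  - apply (RInt_swap (fun x t => fst (f x t))), A.
  - apply (RInt_swap (fun x t => snd (f x t))), B.
Qed.

Ltac cct := repeat lazymatch goal with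
  | |- ccont (fun _ => ?c) => apply (ccont_const c)
  | |- ccont (fun t => Cplus (@?f t) (@?g t)) => apply (ccont_plus f g)
  | |- ccont (fun t => Cminus (@?f t) (@?g t)) => apply (ccont_minus f g)
  | |- ccont (fun t => Copp (@?f t)) => apply (ccont_opp f)
  | |- ccont (fun t => Cmult (@?f t) (@?g t)) => apply (ccont_mult f g)
  | |- ccont (fun t => RtoC (@?f t)) => apply (ccont_RtoC f)
  | |- ccont (fun t => cexp (@?f t) (@?g t)) => apply (ccont_cexp f g)
  | |- ccont _ => assumption
  | |- cont _ => progress ct
  end.

Definition clap (u : R -> C) (s : R) (l : C) : Prop :=
  lap (fun t => fst (u t)) s (fst l) /\ lap (fun t => snd (u t)) s (snd l).

Definition LT (u : R -> C) (s T : R) : C := CI (fun t => exp (- s * t) * u t)%C 0 T.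

Lemma LT_parts u s T : LT u s T = (RInt (fun t => exp (- s * t) * fst (u t)) 0 T,
                                   RInt (fun t => exp (- s * t) * snd (u t)) 0 T).
Proof. apply C_eq; simpl; apply RInt_ext; intros; eqR; ring. Qed.

Lemma clap_iff u s l : clap u s l <->
  forall eps, 0 < eps -> exists T0, forall T, T0 <= T -> Cmod (LT u s T - l)%C <= eps.
Proof.
  split.
  - intros [H1 H2] eps He. apply is_lim_spec in H1, H2.
    assert (He2 : 0 < eps / 2) by lra.
    destruct (H1 (mkposreal _ He2)) as [T1 HT1]. destruct (H2 (mkposreal _ He2)) as [T2 HT2].
    simpl in HT1, HT2. exists (Rmax T1 T2 + 1). intros T HT.
    assert (A := Rmax_l T1 T2). assert (B := Rmax_r T1 T2).
    specialize (HT1 T ltac:(lra)). specialize (HT2 T ltac:(lra)).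
    rewrite LT_parts. apply Rle_trans with (1 := Cmod_le_abs _). simpl.
    unfold Rminus in *. lra.
  - intros H. split; apply is_lim_spec; intros eps;
      destruct (H (eps / 2)) as [T0 HT]; try (generalize (cond_pos eps); lra);
      exists T0; intros T HTT; specialize (HT T ltac:(lra)).
    + assert (A := Rabs_fst_Cmod (LT u s T - l)%C). assert (E := f_equal fst (LT_parts u s T)).
      simpl in A, E. rewrite E in A. unfold Rminus. generalize (cond_pos eps); lra.
    + assert (A := Rabs_snd_Cmod (LT u s T - l)%C). assert (E := f_equal snd (LT_parts u s T)).
      simpl in A, E. rewrite E in A. unfold Rminus. generalize (cond_pos eps); lra.
Qed.

Lemma clap_ext u v s l : (forall t, 0 <= t -> u t = v t) -> clap u s l -> clap v s l.
Proof.
  intros E [A B]; split; [apply lap_ext with (2 := A)|apply lap_ext with (2 := B)];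
    intros t Ht; rewrite E; auto.
Qed.

Lemma clap_plus u v s l m : ccont u -> ccont v -> clap u s l -> clap v s m ->
  clap (fun t => u t + v t)%C s (l + m)%C.
Proof. intros [U1 U2] [V1 V2] [A B] [A' B']; split; simpl; apply lap_plus; auto. Qed.

Lemma clap_scal c u s l : ccont u -> clap u s l -> clap (fun t => c * u t)%C s (c * l)%C.
Proof.
  intros [U1 U2] [A B]; split; simpl.
  - apply (lap_minus (fun t => fst c * fst (u t)) (fun t => snd c * snd (u t)));
      [ct|ct|apply lap_scal; auto|apply lap_scal; auto].
  - apply (lap_plus (fun t => fst c * snd (u t)) (fun t => snd c * fst (u t)));
      [ct|ct|apply lap_scal; auto|apply lap_scal; auto].
Qed.

Lemma clap_unique u s l m : clap u s l -> clap u s m -> l = m.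
Proof. intros [A B] [A' B']; apply C_eq; eapply lap_unique; eassumption. Qed.

Definition cbounded (M : R) (u : R -> C) : Prop := forall t, 0 <= t -> Cmod (u t) <= M.

Lemma cbounded_bexp M u : cbounded M u ->
  bexp 0 M (fun t => fst (u t)) /\ bexp 0 M (fun t => snd (u t)).
Proof.
  intros H; split; apply bexp_bounded; intros t Ht; apply Rle_trans with (2 := H t Ht);
    [apply Rabs_fst_Cmod|apply Rabs_snd_Cmod].
Qed.

Lemma clap_ex u M s : ccont u -> cbounded M u -> 0 < s -> exists l, clap u s l.
Proof.
  intros [U1 U2] HM Hs. destruct (cbounded_bexp _ _ HM) as [B1 B2].
  destruct (lap_ex _ _ _ s U1 B1 Hs) as [l1 [L1 _]]. destruct (lap_ex _ _ _ s U2 B2 Hs) as [l2 [L2 _]].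
  exists (l1, l2); split; auto.
Qed.

(* The solution of [y' = (a + i b) y + G], [y 0 = 0]. *)
Definition Rres (a b : R) (G : R -> C) (t : R) : C :=
  (cexp (a * t) (b * t) * CI (fun v => cexp (- a * v) (- b * v) * G v) 0 t)%C.

Lemma ccont_Rres a b G : ccont G -> ccont (Rres a b G).
Proof.
  intros HG; unfold Rres; apply ccont_mult; [cct|].
  apply ccont_CI; cct.
Qed.

Lemma Rres_bound a b G M t : a <> 0 -> ccont G -> cbounded M G -> 0 <= t ->
  Cmod (Rres a b G t) <= M / a * (exp (a * t) - 1).
Proof.
  intros Ha HG HM Ht. unfold Rres. rewrite Cmod_mult, Cmod_cexp.
  assert (B : Cmod (CI (fun v => cexp (- a * v) (- b * v) * G v)%C 0 t)
     <= RInt (fun v => M * exp (- a * v)) 0 t).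
  { apply CI_bound; auto.
    - apply ccont_exCI; cct.
    - apply cont_ex_RInt; ct.
    - intros v Hv. rewrite Cmod_mult, Cmod_cexp, Rmult_comm.
      apply Rmult_le_compat_r; [left; apply exp_pos|apply HM; lra]. }
  rewrite RInt_exp_decay in B by auto. rewrite Rmult_0_r, exp_0 in B.
  apply Rmult_le_compat_l with (r := exp (a * t)) in B; [|left; apply exp_pos].
  apply Rle_trans with (1 := B). right.
  assert (E : exp (a * t) * exp (- a * t) = 1)
    by (rewrite <- exp_plus, <- exp_0; f_equal; ring).
  transitivity (M / a * (exp (a * t) - exp (a * t) * exp (- a * t))); [field; auto|rewrite E; auto].
Qed.

Lemma Rres_bound_neg a b G M t : a < 0 -> ccont G -> cbounded M G -> 0 <= t ->
  Cmod (Rres a b G t) <= M / - a.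
Proof.
  intros Ha HG HM Ht.
  eapply Rle_trans; [apply (Rres_bound a b G M); auto; apply Rlt_not_eq, Ha|].
  assert (0 <= M) by (apply Rle_trans with (2 := HM 0 (Rle_refl 0)), Cmod_ge_0).
  replace (M / a * (exp (a * t) - 1)) with (M / - a * (1 - exp (a * t))) by (field; lra).
  assert (0 <= M / - a) by (apply Rdiv_le_0_compat; lra).
  generalize (exp_pos (a * t)); nra.
Qed.

Lemma Rres_ode a b G t : ccont G ->
  is_derive (fun t => fst (Rres a b G t)) t (a * fst (Rres a b G t) - b * snd (Rres a b G t) + fst (G t)) /\
  is_derive (fun t => snd (Rres a b G t)) t (b * fst (Rres a b G t) + a * snd (Rres a b G t) + snd (G t)).
Proof.
  intros HG.
  set (h := fun v => (cexp (- a * v) (- b * v) * G v)%C).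
  assert (Hh : ccont h) by (unfold h; cct).
  set (J1 := fun t => RInt (fun v => fst (h v)) 0 t). set (J2 := fun t => RInt (fun v => snd (h v)) 0 t).
  assert (D1 : is_derive J1 t (fst (h t))) by (apply (cont_is_derive_RInt (fun v => fst (h v))), Hh).
  assert (D2 : is_derive J2 t (snd (h t))) by (apply (cont_is_derive_RInt (fun v => snd (h v))), Hh).
  assert (E : exp (a * t) * exp (- a * t) = 1) by (rewrite <- exp_plus, <- exp_0; f_equal; ring).
  assert (S : sin (b * t) * sin (b * t) + cos (b * t) * cos (b * t) = 1) by apply sin2_cos2.
  assert (Q1 : exp (a * t) * (cos (b * t) * fst (h t) - sin (b * t) * snd (h t)) = fst (G t)).
  { unfold h, cexp; simpl. replace (- b * t) with (- (b * t)) by ring. rewrite cos_neg, sin_neg.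
    transitivity (exp (a * t) * exp (- a * t) * (sin (b * t) * sin (b * t) + cos (b * t) * cos (b * t))
      * fst (G t)); [ring|rewrite E, S; ring]. }
  assert (Q2 : exp (a * t) * (cos (b * t) * snd (h t) + sin (b * t) * fst (h t)) = snd (G t)).
  { unfold h, cexp; simpl. replace (- b * t) with (- (b * t)) by ring. rewrite cos_neg, sin_neg.
    transitivity (exp (a * t) * exp (- a * t) * (sin (b * t) * sin (b * t) + cos (b * t) * cos (b * t))
      * snd (G t)); [ring|rewrite E, S; ring]. }
  assert (U1 := is_derive_unique _ _ _ D1). assert (U2 := is_derive_unique _ _ _ D2).
  assert (X1 : ex_derive J1 t) by exact (ex_intro _ _ D1).
  assert (X2 : ex_derive J2 t) by exact (ex_intro _ _ D2).
  assert (R1 : fst (Rres a b G t) = exp (a * t) * cos (b * t) * J1 t - exp (a * t) * sin (b * t) * J2 t)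
    by reflexivity.
  assert (R2 : snd (Rres a b G t) = exp (a * t) * cos (b * t) * J2 t + exp (a * t) * sin (b * t) * J1 t)
    by reflexivity.
  split.
  - apply is_derive_ext with
      (fun t => exp (a * t) * cos (b * t) * J1 t - exp (a * t) * sin (b * t) * J2 t); [reflexivity|].
    auto_derive; [auto|]. change (fun x : R => J1 x) with J1. change (fun x : R => J2 x) with J2.
    rewrite U1, U2, <- Q1. rewrite R1, R2. ring.
  - apply is_derive_ext with
      (fun t => exp (a * t) * cos (b * t) * J2 t + exp (a * t) * sin (b * t) * J1 t); [reflexivity|].
    auto_derive; [auto|]. change (fun x : R => J1 x) with J1. change (fun x : R => J2 x) with J2.
    rewrite U1, U2, <- Q2. rewrite R1, R2. ring.
Qed.

Lemma Rres_0 a b G : Rres a b G 0 = 0%C.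
Proof.
  unfold Rres, CI. apply C_eq; simpl; rewrite !RInt_Rpoint; ring.
Qed.

(** The derivative of exp (- s t) times the response is integrated over [0, T]. The form with finite
    T is kept because it is integrated over the superposition parameter before T tends to
    infinity. *)
Lemma LT_Rres a b G s T : ccont G ->
  ((RtoC s - (a, b)) * LT (Rres a b G) s T = LT G s T - exp (- s * T) * Rres a b G T)%C.
Proof.
  intros HG. assert (HR := ccont_Rres a b G HG). destruct HG as [G1 G2]; destruct HR as [R1 R2].
  assert (D := fun t => Rres_ode a b G t (conj G1 G2)).
  set (u := fun t => fst (Rres a b G t)) in *. set (v := fun t => snd (Rres a b G t)) in *.
  assert (E1 : RInt (fun t => exp (- s * t) * ((a - s) * u t - b * v t + fst (G t))) 0 T
     = exp (- s * T) * u T).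
  { etransitivity; [apply (RInt_of_derive (fun t => exp (- s * t) * u t))|].
    - intros t. assert (Dt : is_derive u t (a * u t - b * v t + fst (G t))) by exact (proj1 (D t)).
      assert (U := is_derive_unique _ _ _ Dt).
      auto_derive; [exact (ex_intro _ _ Dt)|]. change (fun x : R => u x) with u. rewrite U. ring.
    - ct.
    - unfold u at 2. rewrite Rres_0. simpl. eqR; ring. }
  assert (E2 : RInt (fun t => exp (- s * t) * (b * u t + (a - s) * v t + snd (G t))) 0 T
     = exp (- s * T) * v T).
  { etransitivity; [apply (RInt_of_derive (fun t => exp (- s * t) * v t))|].
    - intros t. assert (Dt : is_derive v t (b * u t + a * v t + snd (G t))) by exact (proj2 (D t)).
      assert (U := is_derive_unique _ _ _ Dt).
      auto_derive; [exact (ex_intro _ _ Dt)|]. change (fun x : R => v x) with v. rewrite U. ring.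
    - ct.
    - unfold v at 2. rewrite Rres_0. simpl. eqR; ring. }
  set (U := RInt (fun t => exp (- s * t) * u t) 0 T).
  set (V := RInt (fun t => exp (- s * t) * v t) 0 T).
  set (g1 := RInt (fun t => exp (- s * t) * fst (G t)) 0 T).
  set (g2 := RInt (fun t => exp (- s * t) * snd (G t)) 0 T).
  assert (F1 : exp (- s * T) * u T = (a - s) * U - b * V + g1).
  { rewrite <- E1. unfold U, V, g1. rewrite <- !RInt_Rscal, <- RInt_Rminus, <- RInt_Rplus by ct.
    apply RInt_ext; intros; eqR; ring. }
  assert (F2 : exp (- s * T) * v T = b * U + (a - s) * V + g2).
  { rewrite <- E2. unfold U, V, g2. rewrite <- !RInt_Rscal, <- !RInt_Rplus by ct.
    apply RInt_ext; intros; eqR; ring. }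
  change (u T) with (fst (Rres a b G T)) in F1. change (v T) with (snd (Rres a b G T)) in F2.
  rewrite (LT_parts (Rres a b G) s T : _ = (U, V)), (LT_parts G s T : _ = (g1, g2)).
  clearbody U V g1 g2. set (R := Rres a b G T) in *. clearbody R.
  apply C_eq; simpl; lra.
Qed.

Lemma fun_choice {A B : Type} (P : A -> B -> Prop) :
  (forall x, exists y, P x y) -> exists f, forall x, P x (f x).
Proof.
  intros H; exists (fun x => proj1_sig (constructive_indefinite_description _ (H x))).
  intros x; apply proj2_sig.
Qed.

Lemma cont_unif_limit (f : R -> R) :
  (forall eps, 0 < eps -> exists g, cont g /\ forall t, Rabs (f t - g t) <= eps) -> cont f.
Proof.
  intros H x. apply continuity_pt_filterlim; intros eps He.
  destruct (H (eps / 4)) as [g [Cg Hg]]; [lra|].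
  destruct (proj2 (continuity_pt_filterlim _ _) (Cg x) (eps / 4)) as [d [Hd HH]]; [lra|].
  exists d; split; auto. intros y Hy. specialize (HH y Hy).
  simpl in HH |- *; unfold R_dist in *.
  assert (A := Hg x). assert (B := Hg y).
  replace (f y - f x) with ((f y - g y) + ((g y - g x) + - (f x - g x))) by ring.
  eapply Rle_lt_trans; [apply Rabs_triang|].
  eapply Rle_lt_trans; [apply Rplus_le_compat_l, Rabs_triang|].
  rewrite Rabs_Ropp; lra.
Qed.

Lemma ccont_cont2_Rmax0 f : ccont f -> ccont (fun t => f (Rmax 0 t)).
Proof.
  intros [A B]; split;
    [apply (cont_comp (fun t => fst (f t)) (Rmax 0))|apply (cont_comp (fun t => snd (f t)) (Rmax 0))];
    auto using cont_Rmax0.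
Qed.

(** Integrals over the whole line are limits over symmetric intervals, matching the rectangles of
    the contour; the constant comes from the two exponential tails. *)
Lemma sym_tail w B al N N' : 0 < al -> ccont w ->
  (forall x, Cmod (w x) <= B * exp (- al * Rabs x)) -> 0 <= N <= N' ->
  Cmod (CI w (- N') N' - CI w (- N) N)%C <= 2 * B / al * exp (- al * N).
Proof.
  intros Ha Hw HB HN.
  assert (X : forall a b, exCI w a b) by (intros; apply ccont_exCI, Hw).
  assert (B0 : 0 <= B).
  { specialize (HB 0); rewrite Rabs_R0, Rmult_0_r, exp_0 in HB. generalize (Cmod_ge_0 (w 0)); lra. }
  rewrite <- (CI_Chasles w (- N')%R (- N)%R N'), <- (CI_Chasles w (- N)%R N N') by auto.
  replace (CI w (- N')%R (- N)%R + (CI w (- N)%R N + CI w N N') - CI w (- N)%R N)%C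
    with (CI w (- N')%R (- N)%R + CI w N N')%C by ring.
  eapply Rle_trans; [apply Cmod_triangle|].
  assert (E1 : Cmod (CI w N N') <= B / al * exp (- al * N)).
  { apply Rle_trans with (RInt (fun x => B * exp (- al * x)) N N').
    - apply CI_bound; [lra|auto|apply cont_ex_RInt; ct|].
      intros t Ht. rewrite <- (Rabs_pos_eq t) at 2 by lra. apply HB.
    - rewrite RInt_exp_decay by lra. apply Rmult_le_compat_l; [apply Rdiv_le_0_compat; lra|].
      generalize (exp_pos (- al * N')); lra. }
  assert (E2 : Cmod (CI w (- N')%R (- N)%R) <= B / al * exp (- al * N)).
  { apply Rle_trans with (RInt (fun x => B * exp (- - al * x)) (- N') (- N)).
    - apply CI_bound; [lra|auto|apply cont_ex_RInt; ct|].
      intros t Ht. replace (- - al * t) with (- al * Rabs t) by (rewrite Rabs_left1; lra). apply HB.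
    - rewrite RInt_exp_decay by lra.
      replace (B / - al * (exp (- - al * - N') - exp (- - al * - N)))
        with (B / al * (exp (- al * N) - exp (- - al * - N')))
        by (replace (- - al * - N) with (- al * N) by ring; field; lra).
      apply Rmult_le_compat_l; [apply Rdiv_le_0_compat; lra|].
      generalize (exp_pos (- - al * - N')); lra. }
  lra.
Qed.

Lemma sym_bound w B al N : 0 < al -> ccont w ->
  (forall x, Cmod (w x) <= B * exp (- al * Rabs x)) -> 0 <= N -> Cmod (CI w (- N) N) <= 2 * B / al.
Proof.
  intros Ha Hw HB HN. assert (H := sym_tail w B al 0 N Ha Hw HB (conj (Rle_refl 0) HN)).
  rewrite Rmult_0_r, exp_0, Rmult_1_r in H.
  assert (Z : CI w (- 0) 0 = 0%C) by (rewrite Ropp_0; apply C_eq; simpl; apply RInt_Rpoint).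
  rewrite Z in H. replace (CI w (- N) N - 0)%C with (CI w (- N) N) in H by ring. exact H.
Qed.

Lemma sym_limit w B al : 0 < al -> ccont w ->
  (forall x, Cmod (w x) <= B * exp (- al * Rabs x)) ->
  exists l, forall N, 0 <= N -> Cmod (CI w (- N) N - l)%C <= 4 * B / al * exp (- al * N).
Proof.
  intros Ha Hw HB.
  assert (L := is_lim_exp_decay (2 * B / al) al Ha).
  destruct (tail_limit (fun N => fst (CI w (- N) N)) (fun N => 2 * B / al * exp (- al * N))) as [l1 H1]; auto.
  { intros T T' HT. eapply Rle_trans; [|apply (sym_tail w B al T T'); auto].
    apply (Rabs_fst_Cmod (CI w (- T') T' - CI w (- T) T)%C). }
  destruct (tail_limit (fun N => snd (CI w (- N) N)) (fun N => 2 * B / al * exp (- al * N))) as [l2 H2]; auto.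
  { intros T T' HT. eapply Rle_trans; [|apply (sym_tail w B al T T'); auto].
    apply (Rabs_snd_Cmod (CI w (- T') T' - CI w (- T) T)%C). }
  exists (l1, l2); intros N HN. eapply Rle_trans; [apply Cmod_le_abs|].
  specialize (H1 N HN). specialize (H2 N HN).
  replace (4 * B / al * exp (- al * N)) with (2 * B / al * exp (- al * N) + 2 * B / al * exp (- al * N))
    by (field; lra).
  apply Rplus_le_compat; [exact H1|exact H2].
Qed.

(** The density of the superposition: 1/(2 PI i) times the jump of 1/(e^(al w) - lambda) between the
    two edges, times e^w, which is the derivative of sigma = e^w with respect to x. The value of e^w
    is the same on both edges. *)
Definition kappa (al l phi y1 y2 x : R) : C :=
  (/ (2 * PI * Ci) * (cexp x y2 * (/ (cexp (al * x) (al * y2) - cexp l phi)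
                                   - / (cexp (al * x) (al * y1) - cexp l phi))))%C.

(** With K the cosine of the angle between r e^(i al y) and p e^(i phi), the squared distance r^2 +
    p^2 - 2 r p K exceeds (1 - K)/2 (r + p)^2 by (1 + K)/2 (r - p)^2. The line avoids the pole, so K
    < 1. *)
Lemma den_lower al y l phi : Rabs (al * y - phi) < 2 * PI -> al * y <> phi ->
  exists c, 0 < c /\ forall x,
    c * (exp (al * x) + exp l) <= Cmod (cexp (al * x) (al * y) - cexp l phi)%C.
Proof.
  intros H Hn. set (K := cos (al * y - phi)).
  assert (HK : 0 < 1 - K).
  { assert (K <= 1) by apply COS_bound. assert (K <> 1); [|lra].
    intro E. apply cos_eq_1 in E; auto. apply Hn; lra. }
  exists (sqrt ((1 - K) / 2)); split; [apply sqrt_lt_R0; lra|].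
  intros x. set (r := exp (al * x)). set (p := exp l).
  assert (Pr : 0 < r) by apply exp_pos. assert (Pp : 0 < p) by apply exp_pos.
  rewrite <- (sqrt_pow2 (r + p)) by lra. rewrite <- sqrt_mult by nra.
  unfold Cmod. apply sqrt_le_1_alt. unfold cexp. cbn [fst snd Cminus Cplus Copp].
  fold r p.
  replace ((r * cos (al * y) + - (p * cos phi)) ^ 2 + (r * sin (al * y) + - (p * sin phi)) ^ 2)
    with (r ^ 2 * ((sin (al * y))² + (cos (al * y))²) + p ^ 2 * ((sin phi)² + (cos phi)²)
          - 2 * r * p * K) by (unfold K; rewrite cos_minus; unfold Rsqr; ring).
  rewrite !sin2_cos2.
  assert (0 <= (1 + K) * (r - p) ^ 2).
  { apply Rmult_le_pos; [generalize (COS_bound (al * y - phi)); fold K; lra|apply pow2_ge_0]. }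
  nra.
Qed.

Lemma strip_lines al phi ya y1 y2 yb y : strip al phi ya y1 y2 yb -> y = y1 \/ y = y2 ->
  Rabs (al * y - phi) < 2 * PI /\ al * y <> phi.
Proof.
  intros H Hy. split.
  - apply (strip_den2 _ _ _ _ _ _ _ H). unfold strip in H; destruct Hy; subst y; lra.
  - intro E. assert (E' : y = phi / al) by (rewrite <- E; field; unfold strip in H; lra).
    unfold strip in H; destruct Hy; subst y; lra.
Qed.

Lemma ccont_inv_line al l phi y : 0 < al -> Rabs (al * y - phi) < 2 * PI -> al * y <> phi ->
  ccont (fun x => / (cexp (al * x) (al * y) - cexp l phi))%C.
Proof.
  intros Ha H1 H2.
  assert (H : forall x, hol (fun x y => / (cexp (al * x) (al * y) - cexp l phi))%C
     (fun x y => - (al * cexp (al * x) (al * y) - 0)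
        * (/ (cexp (al * x) (al * y) - cexp l phi) * / (cexp (al * x) (al * y) - cexp l phi)))%C x y).
  { intros x. apply (hol_inv (fun x y => cexp (al * x) (al * y) - cexp l phi)%C
        (fun x y => al * cexp (al * x) (al * y) - 0)%C).
    - apply (hol_minus (fun x y => cexp (al * x) (al * y)) (fun x y => al * cexp (al * x) (al * y))%C
        (fun _ _ => cexp l phi) (fun _ _ => 0%C)); [apply hol_cexp|apply hol_const].
    - apply KF_den2; auto. right; intro E; apply H2; rewrite E; field; lra. }
  split; intros x; apply (hol_cc2_line1 _ _ _ _ (H x)).
Qed.

Lemma ccont_kappa al l phi ya y1 y2 yb : strip al phi ya y1 y2 yb -> ccont (kappa al l phi y1 y2).
Proof.
  intros H. assert (Ha : 0 < al) by apply H. unfold kappa.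
  destruct (strip_lines _ _ _ _ _ _ y1 H) as [A1 A2]; auto.
  destruct (strip_lines _ _ _ _ _ _ y2 H) as [B1 B2]; auto.
  assert (I1 := ccont_inv_line al l phi y1 Ha A1 A2).
  assert (I2 := ccont_inv_line al l phi y2 Ha B1 B2).
  apply ccont_mult; [apply ccont_const|]. apply ccont_mult; [apply ccont_cexp; ct|].
  apply ccont_minus; auto.
Qed.

Lemma Cmod_2PIi : Cmod (2 * PI * Ci)%C = 2 * PI.
Proof.
  rewrite !Cmod_mult, Cmod_Ci, !Cmod_R, !Rabs_pos_eq by (generalize PI_RGT_0; lra). ring.
Qed.

Lemma C2PIi_neq0 : (2 * PI * Ci)%C <> 0%C.
Proof. apply Cmod_gt_0. rewrite Cmod_2PIi. generalize PI_RGT_0; lra. Qed.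

(** With r = e^(al x) and p = |lambda| the jump is at most a constant times r/(r + p)^2, which
    decays like 1/r on the right and like r on the left. On the left each inverse alone tends to a
    nonzero constant, so the decay there is due to the cancellation in the difference. *)
Lemma kappa_bound al l phi ya y1 y2 yb : strip al phi ya y1 y2 yb ->
  exists K, 0 <= K /\ forall x, Cmod (kappa al l phi y1 y2 x) <= K * exp x * exp (- al * Rabs x).
Proof.
  intros H. assert (Ha : 0 < al) by apply H.
  destruct (strip_lines _ _ _ _ _ _ y1 H) as [A1 A2]; auto.
  destruct (strip_lines _ _ _ _ _ _ y2 H) as [B1 B2]; auto.
  destruct (den_lower al y1 l phi A1 A2) as [c1 [P1 D1]].
  destruct (den_lower al y2 l phi B1 B2) as [c2 [P2 D2]].
  set (p := exp l). assert (Pp : 0 < p) by apply exp_pos.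
  exists (1 / (c1 * c2) * (2 / p ^ 2 + 2)).
  assert (Q : 0 < / (c1 * c2)) by (apply Rinv_0_lt_compat; nra).
  assert (Q2 : 0 < 2 / p ^ 2) by (apply Rdiv_lt_0_compat; [lra|apply pow_lt; auto]).
  split; [unfold Rdiv; rewrite Rmult_1_l; apply Rmult_le_pos; lra|].
  intros x. unfold kappa. specialize (D1 x). specialize (D2 x). fold p in D1, D2.
  set (r := exp (al * x)) in *. assert (Pr : 0 < r) by apply exp_pos.
  set (e1 := (cexp (al * x) (al * y1) - cexp l phi)%C) in *.
  set (e2 := (cexp (al * x) (al * y2) - cexp l phi)%C) in *.
  assert (M1 : 0 < Cmod e1) by (apply Rlt_le_trans with (2 := D1), Rmult_lt_0_compat; lra).
  assert (M2 : 0 < Cmod e2) by (apply Rlt_le_trans with (2 := D2), Rmult_lt_0_compat; lra).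
  assert (N1 : e1 <> 0%C) by (apply Cmod_gt_0; auto).
  assert (N2 : e2 <> 0%C) by (apply Cmod_gt_0; auto).
  rewrite !Cmod_mult, Cmod_cexp.
  replace (/ e2 - / e1)%C with ((cexp (al * x) (al * y1) - cexp (al * x) (al * y2)) * / (e1 * e2))%C.
  2:{ replace (cexp (al * x) (al * y1) - cexp (al * x) (al * y2))%C with (e1 - e2)%C
        by (unfold e1, e2; ring). field; auto. }
  rewrite Cmod_mult, !Cmod_inv, Cmod_2PIi by (auto using C2PIi_neq0, Cmult_neq_0).
  rewrite Cmod_mult.
  assert (T : Cmod (cexp (al * x) (al * y1) - cexp (al * x) (al * y2))%C <= 2 * r).
  { eapply Rle_trans; [apply Cmod_triangle|]. rewrite Cmod_opp, !Cmod_cexp. fold r; lra. }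
  assert (I : / (Cmod e1 * Cmod e2) <= / (c1 * c2) * / (r + p) ^ 2).
  { rewrite <- Rinv_mult. apply Rinv_le_contravar.
    - apply Rmult_lt_0_compat; [nra|apply pow_lt; lra].
    - replace (c1 * c2 * (r + p) ^ 2) with ((c1 * (r + p)) * (c2 * (r + p))) by ring.
      apply Rmult_le_compat; auto; apply Rmult_le_pos; lra. }
  assert (S : 2 * r * / (r + p) ^ 2 <= (2 / p ^ 2 + 2) * exp (- al * Rabs x)).
  { destruct (Rle_dec 0 x) as [X|X].
    - rewrite (Rabs_pos_eq x) by auto. replace (- al * x) with (- (al * x)) by ring.
      rewrite exp_Ropp. fold r.
      apply Rle_trans with (2 * / r).
      + assert (E : / (r + p) ^ 2 <= / r ^ 2) by (apply Rinv_le_contravar; [apply pow_lt; auto|nra]).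
        apply Rle_trans with (2 * r * / r ^ 2); [apply Rmult_le_compat_l; lra|right; field; lra].
      + apply Rmult_le_compat_r; [left; apply Rinv_0_lt_compat; auto|lra].
    - rewrite (Rabs_left x) by lra. replace (- al * - x) with (al * x) by ring. fold r.
      assert (E : / (r + p) ^ 2 <= / p ^ 2) by (apply Rinv_le_contravar; [apply pow_lt; auto|nra]).
      apply Rle_trans with (2 * r * / p ^ 2); [apply Rmult_le_compat_l; lra|].
      replace (2 * r * / p ^ 2) with (2 / p ^ 2 * r) by (unfold Rdiv; ring).
      apply Rmult_le_compat_r; lra. }
  assert (Px := exp_pos x).
  assert (W : Cmod (cexp (al * x) (al * y1) - cexp (al * x) (al * y2))%C * / (Cmod e1 * Cmod e2)
     <= / (c1 * c2) * ((2 / p ^ 2 + 2) * exp (- al * Rabs x))).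
  { apply Rle_trans with (2 * r * (/ (c1 * c2) * / (r + p) ^ 2)).
    - apply Rmult_le_compat; auto; [apply Cmod_ge_0|left; apply Rinv_0_lt_compat; nra].
    - replace (2 * r * (/ (c1 * c2) * / (r + p) ^ 2)) with (/ (c1 * c2) * (2 * r * / (r + p) ^ 2)) by ring.
      apply Rmult_le_compat_l; lra. }
  set (A := Cmod (cexp (al * x) (al * y1) - cexp (al * x) (al * y2))%C * / (Cmod e1 * Cmod e2)) in *.
  assert (A0 : 0 <= A) by (unfold A; apply Rmult_le_pos; [apply Cmod_ge_0|left; apply Rinv_0_lt_compat; nra]).
  assert (P2' : / (2 * PI) <= 1).
  { rewrite <- Rinv_1. apply Rinv_le_contravar; [lra|]. generalize PI2_1; lra. }
  assert (P2'' : 0 < / (2 * PI)) by (apply Rinv_0_lt_compat; generalize PI_RGT_0; lra).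
  apply Rle_trans with (1 * (exp x * A)).
  - apply Rmult_le_compat_r; [apply Rmult_le_pos; lra|auto].
  - replace (1 / (c1 * c2) * (2 / p ^ 2 + 2) * exp x * exp (- al * Rabs x))
      with (1 * (exp x * (/ (c1 * c2) * ((2 / p ^ 2 + 2) * exp (- al * Rabs x)))))
      by (unfold Rdiv; ring).
    apply Rmult_le_compat_l; [lra|]. apply Rmult_le_compat_l; lra.
Qed.

(** * The superposition of first-order responses *)

Lemma ccont_inv f : ccont f -> (forall x, f x <> 0%C) -> ccont (fun x => / f x)%C.
Proof.
  intros Hf Hn. destruct (ccont2_of1 f Hf) as [A B].
  assert (H : forall x y, cc2 (fun x _ => / f x)%C x y).
  { intros x y; apply (cc2_inv (fun x _ => f x)); [split; [apply A|apply B]|apply Hn]. }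
  split; [apply (cont2_fix2 (fun x _ => fst (/ f x)%C) 0)|apply (cont2_fix2 (fun x _ => snd (/ f x)%C) 0)];
    intros x y; apply H.
Qed.

Lemma ccont2_Rres (a b : R -> R) G : cont a -> cont b -> ccont G ->
  ccont2 (fun x t => Rres (a x) (b x) G t).
Proof.
  intros Ha Hb HG. unfold Rres.
  assert (P : forall f, cont f -> cont2 (fun x t => f x * t)).
  { intros f Hf; apply cont2_mult; [apply (cont2_of1 f Hf)|apply (cont2_of2 _ cont_id)]. }
  apply (ccont2_mult (fun x t => cexp (a x * t) (b x * t))).
  - apply (ccont2_cexp (fun x t => a x * t) (fun x t => b x * t)); apply P; auto.
  - apply (ccont2_CI (fun x v => cexp (- a x * v) (- b x * v) * G v)%C).
    apply (ccont2_mult (fun x v => cexp (- a x * v) (- b x * v)) (fun _ v => G v)).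
    + apply (ccont2_cexp (fun x t => - a x * t) (fun x t => - b x * t));
        apply (P (fun x => - _ x)); ct.
    + apply (ccont2_of2 G HG).
Qed.

Lemma exp_decay_small C c eps : 0 < c -> 0 < eps ->
  exists N0, 0 <= N0 /\ forall N, N0 <= N -> C * exp (- c * N) <= eps.
Proof.
  intros Hc He. assert (L := is_lim_exp_decay C c Hc). apply is_lim_spec in L.
  destruct (L (mkposreal _ He)) as [N0 HN]. simpl in HN.
  exists (Rmax 0 (N0 + 1)); split; [apply Rmax_l|]. intros N H.
  assert (A := Rmax_r 0 (N0 + 1)). specialize (HN N ltac:(lra)).
  rewrite Rminus_0_r in HN. apply Rle_trans with (1 := Rle_abs _); lra.
Qed.

Lemma RInt_exp_le s T : 0 < s -> 0 <= T -> RInt (fun t => exp (- s * t)) 0 T <= / s.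
Proof.
  intros Hs HT.
  rewrite (RInt_ext _ (fun t => 1 * exp (- s * t))) by (intros; eqR; ring).
  rewrite RInt_exp_decay by lra. rewrite Rmult_0_r, exp_0.
  generalize (exp_pos (- s * T)). assert (0 < / s) by (apply Rinv_0_lt_compat; auto).
  unfold Rdiv. nra.
Qed.

(** Here z t is the integral over x of kappa times the response of y' = sigma y + G with sigma =
    e^(x + i y2). Such a response is bounded by M/|Re sigma|, and kappa divided by |sigma| is
    absolutely integrable, so z is bounded. Its transform is obtained by transforming under the
    integral and applying the contour identity. *)
Lemma scalar_rep al l phi ya y1 y2 yb G M : strip al phi ya y1 y2 yb -> ccont G -> cbounded M G ->
  exists z B, ccont z /\ cbounded B z /\ forall ls g, l / al < ls -> clap G (exp ls) g ->
    clap z (exp ls) (g * (/ (RtoC (exp (al * ls)) - cexp l phi)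
                          - pole_term al l phi y1 y2 (exp ls)))%C.
Proof.
  intros Hs HG HM. assert (Ha : 0 < al) by apply Hs.
  assert (Hc : cos y2 < 0) by apply Hs.
  destruct (kappa_bound al l phi ya y1 y2 yb Hs) as [K [K0 HK]].
  assert (M0 : 0 <= M) by (apply Rle_trans with (2 := HM 0 (Rle_refl 0)), Cmod_ge_0).
  assert (Ck := ccont_kappa al l phi ya y1 y2 yb Hs).
  set (k := kappa al l phi y1 y2) in *.
  set (a := fun x => exp x * cos y2). set (b := fun x => exp x * sin y2).
  assert (Ca : cont a) by (unfold a; ct). assert (Cb : cont b) by (unfold b; ct).
  set (u := fun x t => (k x * Rres (a x) (b x) G t)%C).
  assert (Cu : ccont2 u).
  { unfold u; apply ccont2_mult; [apply (ccont2_of1 k Ck)|apply ccont2_Rres; auto]. }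
  set (B := K * (M / - cos y2)).
  assert (B0 : 0 <= B) by (unfold B; apply Rmult_le_pos; auto; apply Rdiv_le_0_compat; lra).
  assert (Bu : forall x t, 0 <= t -> Cmod (u x t) <= B * exp (- al * Rabs x)).
  { intros x t Ht. unfold u. rewrite Cmod_mult.
    assert (Px := exp_pos x).
    assert (Hax : a x < 0) by (unfold a; nra).
    assert (R1 := Rres_bound_neg (a x) (b x) G M t Hax HG HM Ht).
    (* The growth e^x in the bound for the density is cancelled by |Re sigma| = e^x |cos y2|. *)
    apply Rle_trans with (K * exp x * exp (- al * Rabs x) * (M / - a x)).
    - apply Rmult_le_compat; auto; apply Cmod_ge_0.
    - right. unfold B, a. field. lra. }
  assert (Cw : forall t, ccont (fun x => u x t)) by (intros t; apply ccont2_fix2, Cu).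
  destruct (fun_choice (fun t l => forall N, 0 <= N ->
      Cmod (CI (fun x => u x (Rmax 0 t)) (- N) N - l)%C <= 4 * B / al * exp (- al * N))) as [z Hz].
  { intros t. apply sym_limit; auto. intros x; apply Bu, Rmax_l. }
  assert (CN : forall N, ccont (fun t => CI (fun x => u x (Rmax 0 t)) (- N) N)).
  { intros N. apply (ccont_cont2_Rmax0 (fun t => CI (fun x => u x t) (- N) N)).
    apply ccont_CI_param, Cu. }
  assert (Cz : ccont z).
  { split; apply cont_unif_limit; intros eps He;
      destruct (exp_decay_small (4 * B / al) al eps Ha He) as [N [HN0 HN]].
    - exists (fun t => fst (CI (fun x => u x (Rmax 0 t)) (- N) N)); split; [exact (proj1 (CN N))|].
      intros t. rewrite Rabs_minus_sym. apply Rle_trans with (2 := HN N (Rle_refl N)).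
      apply Rle_trans with (2 := Hz t N HN0).
      apply (Rabs_fst_Cmod (CI (fun x => u x (Rmax 0 t)) (- N) N - z t)%C).
    - exists (fun t => snd (CI (fun x => u x (Rmax 0 t)) (- N) N)); split; [exact (proj2 (CN N))|].
      intros t. rewrite Rabs_minus_sym. apply Rle_trans with (2 := HN N (Rle_refl N)).
      apply Rle_trans with (2 := Hz t N HN0).
      apply (Rabs_snd_Cmod (CI (fun x => u x (Rmax 0 t)) (- N) N - z t)%C). }
  assert (Bz : cbounded (4 * B / al) z).
  { intros t _. assert (H := Hz t 0 (Rle_refl 0)).
    rewrite Rmult_0_r, exp_0, Rmult_1_r in H.
    assert (Z : CI (fun x => u x (Rmax 0 t)) (- 0) 0 = 0%C)
      by (rewrite Ropp_0; apply C_eq; simpl; apply RInt_Rpoint).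
    rewrite Z in H. replace (0 - z t)%C with (- z t)%C in H by ring. rewrite Cmod_opp in H. exact H. }
  exists z, (4 * B / al). split; [exact Cz|]. split; [exact Bz|].
  intros ls g Hls Hg. set (s := exp ls) in *. assert (Ps : 0 < s) by apply exp_pos.
  set (tau := (/ (RtoC (exp (al * ls)) - cexp l phi) - pole_term al l phi y1 y2 s)%C).
  set (d := fun x => (RtoC s - cexp x y2)%C).
  (* Since Re sigma < 0, the real part of s - sigma is at least s. *)
  assert (Hd : forall x, s <= Cmod (d x)).
  { intros x. apply Rle_trans with (2 := Rabs_fst_Cmod (d x)). unfold d, cexp; simpl.
    generalize (exp_pos x); intro Px. rewrite Rabs_pos_eq; nra. }
  assert (Nd : forall x, d x <> 0%C) by (intros x; apply Cmod_gt_0; specialize (Hd x); lra).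
  assert (Cd : ccont (fun x => / d x)%C).
  { apply ccont_inv; auto. unfold d. apply ccont_minus; [apply ccont_const|apply ccont_cexp; ct]. }
  assert (Ckd : ccont (fun x => k x * / d x)%C) by (apply ccont_mult; auto).
  assert (LTu : forall x T, LT (u x) s T
     = (k x * / d x * LT G s T - exp (- s * T) * (u x T * / d x))%C).
  { intros x T.
    assert (E : LT (u x) s T = (k x * LT (Rres (a x) (b x) G) s T)%C).
    { unfold LT. rewrite <- CI_scal.
      - apply CI_ext; intros t _; unfold u; ring.
      - apply ccont_exCI. apply ccont_mult; [cct|apply ccont_Rres; auto]. }
    assert (E2 := LT_Rres (a x) (b x) G s T HG).
    replace (RtoC s - (a x, b x))%C with (d x) in E2 by reflexivity.
    rewrite E. unfold u.
    transitivity (k x * / d x * (d x * LT (Rres (a x) (b x) G) s T))%C; [field; auto|].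
    rewrite E2. ring. }
  (* Truncating the superposition to [-N, N] costs an error uniform in T, and Fubini is applied on a
     compact rectangle. *)
  assert (HA : forall N T, 0 <= N -> 0 <= T ->
     Cmod (LT z s T - CI (fun x => LT (u x) s T) (- N) N)%C <= 4 * B / al / s * exp (- al * N)).
  { intros N T HN HT.
    assert (E : CI (fun x => LT (u x) s T) (- N) N
       = CI (fun t => exp (- s * t) * CI (fun x => u x t) (- N) N)%C 0 T).
    { unfold LT. rewrite (CI_swap (fun x t => exp (- s * t) * u x t)%C).
      - apply CI_ext; intros t _. apply CI_scal, ccont_exCI, Cw.
      - apply (ccont2_mult (fun _ t => RtoC (exp (- s * t)))); auto.
        apply (ccont2_of2 (fun t => RtoC (exp (- s * t)))); cct. }
    rewrite E. unfold LT. rewrite <- CI_minus.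
    - apply Rle_trans with (RInt (fun t => 4 * B / al * exp (- al * N) * exp (- s * t)) 0 T).
      + apply CI_bound; auto.
        * apply ccont_exCI. apply ccont_minus; apply ccont_mult; cct.
          apply (ccont_CI_param u), Cu.
        * apply cont_ex_RInt; ct.
        * intros t Ht.
          replace (exp (- s * t) * z t - exp (- s * t) * CI (fun x => u x t) (- N) N)%C
            with (exp (- s * t) * (z t - CI (fun x => u x t) (- N) N))%C by ring.
          rewrite Cmod_mult, Cmod_R, Rabs_pos_eq by (left; apply exp_pos).
          rewrite Rmult_comm. apply Rmult_le_compat_r; [left; apply exp_pos|].
          rewrite Cmod_minus_sym. specialize (Hz t N HN).
          rewrite (Rmax_right 0 t) in Hz by lra. exact Hz.
      + rewrite RInt_Rscal by ct.
        replace (4 * B / al / s * exp (- al * N)) with (4 * B / al * exp (- al * N) * / s)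
          by (unfold Rdiv; ring).
        apply Rmult_le_compat_l; [|apply RInt_exp_le; auto].
        apply Rmult_le_pos; [apply Rdiv_le_0_compat; lra|left; apply exp_pos].
    - apply ccont_exCI. apply ccont_mult; cct.
    - apply ccont_exCI. apply ccont_mult; cct. apply (ccont_CI_param u), Cu. }
  (* Transforming each response leaves the boundary term at T, whose factor exp (- s T) gives an
     error uniform in N. *)
  assert (HB : forall N T, 0 <= N -> 0 <= T ->
     Cmod (CI (fun x => LT (u x) s T) (- N) N - CI (fun x => k x * / d x)%C (- N) N * LT G s T)%C
       <= 2 * (B / s) / al * exp (- s * T)).
  { intros N T HN HT.
    assert (Cv : ccont (fun x => u x T * / d x)%C) by (apply ccont_mult; auto).
    assert (E : CI (fun x => LT (u x) s T) (- N) N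
       = (LT G s T * CI (fun x => k x * / d x)%C (- N) N - exp (- s * T) * CI (fun x => u x T * / d x)%C (- N) N)%C).
    { rewrite <- !CI_scal by (apply ccont_exCI; auto).
      rewrite <- CI_minus by (apply exCI_scal, ccont_exCI; auto).
      apply CI_ext; intros x _. rewrite LTu. ring. }
    rewrite E.
    match goal with |- Cmod ?X <= _ =>
      replace X with (- (exp (- s * T) * CI (fun x => u x T * / d x)%C (- N)%R N))%C by ring end.
    rewrite Cmod_opp, Cmod_mult, Cmod_R, Rabs_pos_eq by (left; apply exp_pos).
    rewrite Rmult_comm. apply Rmult_le_compat_r; [left; apply exp_pos|].
    apply (sym_bound (fun x => u x T * / d x)%C (B / s) al); auto.
    intros x. rewrite Cmod_mult, Cmod_inv by auto.
    replace (B / s * exp (- al * Rabs x)) with (B * exp (- al * Rabs x) * / s) by (unfold Rdiv; ring).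
    apply Rmult_le_compat; [apply Cmod_ge_0|left; apply Rinv_0_lt_compat; specialize (Hd x); lra|auto|].
    apply Rinv_le_contravar; auto. }
  assert (HK2 : forall eps, 0 < eps -> exists N0, forall N, N0 <= N ->
     Cmod (CI (fun x => k x * / d x)%C (- N) N - tau)%C <= eps).
  { intros eps He.
    destruct (kato_identity al l phi ya y1 y2 yb ls Hs Hls (2 * PI * eps)) as [N0 HN0].
    { generalize PI_RGT_0; intro; nra. }
    exists N0; intros N HN. specialize (HN0 N HN). fold s in HN0. fold tau in HN0.
    assert (E : CI (fun x => KF al l phi s x y2 - KF al l phi s x y1)%C (- N) N
       = (2 * PI * Ci * CI (fun x => k x * / d x)%C (- N) N)%C).
    { rewrite <- CI_scal by (apply ccont_exCI; auto).
      apply CI_ext; intros x _. unfold KF, k, kappa, d. rewrite !Rmult_1_l.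
      (* The edges are 2 PI apart, so only the second denominator distinguishes them. *)
      assert (E1 : cexp x y1 = cexp x y2).
      { rewrite <- (cexp_2PI x y1). f_equal. symmetry; apply Hs. }
      rewrite E1.
      set (i1 := (/ (cexp (al * x) (al * y1) - cexp l phi))%C).
      set (i2 := (/ (cexp (al * x) (al * y2) - cexp l phi))%C).
      set (q := (2 * PI * Ci)%C). assert (Nq : q <> 0%C) by apply C2PIi_neq0.
      assert (Ndx := Nd x). unfold d in Ndx. field. split; auto. }
    rewrite E in HN0.
    replace (2 * PI * Ci * CI (fun x => k x * / d x) (- N)%R N - 2 * PI * Ci * tau)%C
      with (2 * PI * Ci * (CI (fun x => k x * / d x) (- N)%R N - tau))%C in HN0 by ring.
    rewrite Cmod_mult, Cmod_2PIi in HN0.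
    apply Rmult_le_reg_l with (2 * PI); [generalize PI_RGT_0; lra|]. exact HN0. }
  apply clap_iff. intros eps He.
  (* T is fixed before N: the admissible error of the truncated contour integral is divided by the
     size of [LT G s T]. Four errors of eps/4 add up. *)
  assert (Q : 0 < eps / 4 / (Cmod tau + 1)).
  { apply Rdiv_lt_0_compat; [lra|generalize (Cmod_ge_0 tau); lra]. }
  destruct (proj1 (clap_iff G s g) Hg _ Q) as [T1 HT1].
  destruct (exp_decay_small (2 * (B / s) / al) s (eps / 4) Ps ltac:(lra)) as [T2 [HT20 HT2]].
  exists (Rmax T1 T2). intros T HT.
  assert (TA := Rmax_l T1 T2). assert (TB := Rmax_r T1 T2).
  specialize (HT1 T ltac:(lra)). specialize (HT2 T ltac:(lra)).
  assert (Q2 : 0 < eps / 4 / (Cmod (LT G s T) + 1)).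
  { apply Rdiv_lt_0_compat; [lra|generalize (Cmod_ge_0 (LT G s T)); lra]. }
  destruct (HK2 _ Q2) as [N1 HN1].
  destruct (exp_decay_small (4 * B / al / s) al (eps / 4) Ha ltac:(lra)) as [N2 [HN20 HN2]].
  set (N := Rmax N1 N2). assert (NA := Rmax_l N1 N2). assert (NB := Rmax_r N1 N2).
  fold N in NA, NB. specialize (HN1 N NA). specialize (HN2 N NB).
  specialize (HA N T ltac:(lra) ltac:(lra)). specialize (HB N T ltac:(lra) ltac:(lra)).
  set (X1 := CI (fun x => LT (u x) s T) (- N) N) in *.
  set (X2 := CI (fun x => k x * / d x)%C (- N) N) in *.
  replace (LT z s T - g * tau)%C
    with ((LT z s T - X1) + ((X1 - X2 * LT G s T) + ((X2 - tau) * LT G s T + tau * (LT G s T - g))))%C by ring.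
  eapply Rle_trans; [apply Cmod_triangle|].
  eapply Rle_trans; [apply Rplus_le_compat_l, Cmod_triangle|].
  eapply Rle_trans; [apply Rplus_le_compat_l, Rplus_le_compat_l, Cmod_triangle|].
  rewrite !Cmod_mult.
  assert (F1 : Cmod (X2 - tau)%C * Cmod (LT G s T) <= eps / 4).
  { assert (P := Cmod_ge_0 (LT G s T)).
    apply Rle_trans with (eps / 4 / (Cmod (LT G s T) + 1) * (Cmod (LT G s T) + 1)).
    - apply Rmult_le_compat; auto using Cmod_ge_0; lra.
    - right; field; lra. }
  assert (F2 : Cmod tau * Cmod (LT G s T - g)%C <= eps / 4).
  { assert (P := Cmod_ge_0 tau). rewrite Rmult_comm.
    apply Rle_trans with (eps / 4 / (Cmod tau + 1) * (Cmod tau + 1)).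
    - apply Rmult_le_compat; auto using Cmod_ge_0; lra.
    - right; field; lra. }
  lra.
Qed.

(** The edges are placed at -PI - e and PI - e. If phi/al lies in [-PI, PI), a small e puts the pole
    between them; otherwise e is taken so small that the pole stays outside with the margin e/2
    required by the larger strip. *)
Lemma strip_exists al phi : 0 < al < 1 -> - PI < phi <= PI ->
  exists ya y1 y2 yb, strip al phi ya y1 y2 yb /\ - (3 * PI / 2) < y1 < - (PI / 2) /\ PI / 2 < y2.
Proof.
  intros Ha Hp. assert (PP := PI_RGT_0).
  (* The second entry uses al < 1 to guarantee al (PI + 2 h) <= PI; PI/8 keeps the upper edge above
     PI/2 and the lower one above -3 PI/2. *)
  set (h := Rmin (PI / 8) ((PI / al - PI) / 2)).
  assert (Pa : PI < PI / al).
  { apply Rmult_lt_reg_r with al; [lra|]. unfold Rdiv. rewrite Rmult_assoc, Rinv_l, Rmult_1_r by lra. nra. }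
  assert (H0 : 0 < h) by (unfold h; apply Rmin_case; lra).
  assert (H1 : h <= PI / 8) by apply Rmin_l.
  assert (H2 : al * (PI + 2 * h) <= PI).
  { assert (h <= (PI / al - PI) / 2) by apply Rmin_r.
    replace PI with (al * (PI / al)) at 2 by (field; lra). apply Rmult_le_compat_l; lra. }
  clearbody h.
  set (q := phi / al).
  assert (W : forall e, 0 < e -> e <= h ->
     (- PI - e < q < PI - e \/ q <= - PI - e - e / 2 \/ PI - e + e / 2 <= q) ->
     exists ya y1 y2 yb, strip al phi ya y1 y2 yb /\ - (3 * PI / 2) < y1 < - (PI / 2) /\ PI / 2 < y2).
  { intros e E1 E2 E3. exists (- PI - e - e / 2), (- PI - e), (PI - e), (PI - e + e / 2).
    assert (al * (PI + e + e / 2) <= al * (PI + 2 * h)) by (apply Rmult_le_compat_l; lra).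
    assert (al * (PI - e + e / 2) <= al * (PI + 2 * h)) by (apply Rmult_le_compat_l; lra).
    unfold strip. fold q. repeat (split; [lra|]). split; [|lra].
    repeat (split; [lra || nra|]). split; [|exact E3].
    apply cos_lt_0; lra. }
  destruct (Rle_dec PI q) as [C1|C1]; [apply (W h); lra|].
  destruct (Rle_dec (- PI) q) as [C2|C2].
  - assert (E1 := Rmin_l h ((PI - q) / 2)). assert (E2 := Rmin_r h ((PI - q) / 2)).
    assert (E3 : 0 < Rmin h ((PI - q) / 2)) by (apply Rmin_case; lra).
    apply (W (Rmin h ((PI - q) / 2))); auto. left; lra.
  - assert (E1 := Rmin_l h ((- PI - q) / 2)). assert (E2 := Rmin_r h ((- PI - q) / 2)).
    assert (E3 : 0 < Rmin h ((- PI - q) / 2)) by (apply Rmin_case; lra).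
    apply (W (Rmin h ((- PI - q) / 2))); auto. right; left; lra.
Qed.

(** * The scalar equation: bounded and resonant responses *)

Lemma lap_const k s : 0 < s -> lap (fun _ => k) s (k * / s).
Proof.
  intros Hs. apply is_lim_le_tail with (fun T => Rabs (k / s) * exp (- s * T)).
  - intros T HT.
    rewrite (RInt_ext _ (fun t => k * exp (- s * t))) by (intros; eqR; ring).
    rewrite RInt_exp_decay, Rmult_0_r, exp_0 by lra.
    replace (k / s * (1 - exp (- s * T)) - k * / s) with (- (k / s * exp (- s * T)))
      by (unfold Rdiv; ring).
    rewrite Rabs_Ropp, Rabs_mult, (Rabs_pos_eq (exp _)); [lra|left; apply exp_pos].
  - apply is_lim_exp_decay, Hs.
Qed.

Lemma clap_const (c : C) s : 0 < s -> clap (fun _ => c) s (c * / s)%C.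
Proof.
  intros Hs. replace (c * / s)%C with ((fst c * / s, snd c * / s) : C).
  - split; simpl; now apply lap_const.
  - rewrite <- RtoC_inv by lra. apply C_eq; simpl; ring.
Qed.

(** A crude bound that also covers a = 0 and a > 0, where the response need not be bounded; it
    suffices for the existence of the transform. *)
Lemma Rres_bound_gen a b G M t : ccont G -> cbounded M G -> 0 <= t ->
  Cmod (Rres a b G t) <= M * t * exp (Rmax a 0 * t).
Proof.
  intros HG HM Ht. assert (M0 : 0 <= M) by (apply Rle_trans with (2 := HM 0 (Rle_refl 0)), Cmod_ge_0).
  unfold Rres. rewrite <- CI_scal by (apply ccont_exCI; cct).
  replace (M * t * exp (Rmax a 0 * t)) with (M * exp (Rmax a 0 * t) * (t - 0)) by ring.
  apply CI_bound_const; auto; [apply ccont_exCI; cct|].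
  intros v Hv. rewrite !Cmod_mult, !Cmod_cexp, <- Rmult_assoc, <- exp_plus, Rmult_comm.
  apply Rmult_le_compat; [apply Cmod_ge_0|left; apply exp_pos|apply HM; lra|].
  assert (Hl := Rmax_l a 0). assert (Hr := Rmax_r a 0).
  apply Rnot_lt_le; intros L; apply exp_lt_inv in L. nra.
Qed.

Lemma clap_Rres a b G M s g : ccont G -> cbounded M G -> Rmax a 0 < s -> clap G s g ->
  clap (Rres a b G) s (g * / (RtoC s - (a, b)))%C.
Proof.
  intros HG HM Hs Hg. assert (M0 : 0 <= M) by (apply Rle_trans with (2 := HM 0 (Rle_refl 0)), Cmod_ge_0).
  assert (Hl := Rmax_l a 0). assert (Hr := Rmax_r a 0).
  set (w := (RtoC s - (a, b))%C).
  assert (Nw : w <> 0%C) by (intro E; apply (f_equal fst) in E; unfold w in E; simpl in E; lra).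
  assert (Pw := proj1 (Cmod_gt_0 w) Nw).
  apply clap_iff. intros eps He.
  assert (Q : 0 < eps * Cmod w / 2) by nra.
  destruct (proj1 (clap_iff G s g) Hg _ Q) as [T1 HT1].
  (* Half of the gap between s and the growth rate absorbs the factor T through T <= exp (d T)/d;
     the other half gives the decay. *)
  set (d := (s - Rmax a 0) / 2). assert (Pd : 0 < d) by (unfold d; lra).
  destruct (exp_decay_small (M / d) d (eps * Cmod w / 2) Pd Q) as [T2 [HT20 HT2]].
  exists (Rmax T1 T2). intros T HT.
  assert (TA := Rmax_l T1 T2). assert (TB := Rmax_r T1 T2).
  specialize (HT1 T ltac:(lra)). specialize (HT2 T ltac:(lra)).
  assert (E := LT_Rres a b G s T HG). fold w in E.
  replace (LT (Rres a b G) s T - g * / w)%C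
    with ((w * LT (Rres a b G) s T - g) * / w)%C by (field; auto).
  rewrite E, Cmod_mult, Cmod_inv by auto.
  apply Rmult_le_reg_r with (Cmod w); auto. rewrite Rmult_assoc, Rinv_l, Rmult_1_r by lra.
  replace (LT G s T - exp (- s * T) * Rres a b G T - g)%C
    with ((LT G s T - g) + - (exp (- s * T) * Rres a b G T))%C by ring.
  eapply Rle_trans; [apply Cmod_triangle|].
  rewrite Cmod_opp, Cmod_mult, Cmod_R, Rabs_pos_eq by (left; apply exp_pos).
  assert (F : exp (- s * T) * Cmod (Rres a b G T) <= M / d * exp (- d * T)).
  { assert (B := Rres_bound_gen a b G M T HG HM ltac:(lra)).
    apply Rle_trans with (exp (- s * T) * (M * T * exp (Rmax a 0 * T))).
    - apply Rmult_le_compat_l; [left; apply exp_pos|auto].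
    - assert (X : T <= / d * exp (d * T)).
      { generalize (exp_ineq1_le (d * T)); intro I.
        apply Rmult_le_reg_l with d; auto. rewrite <- Rmult_assoc, Rinv_r, Rmult_1_l by lra. lra. }
      replace (exp (- s * T) * (M * T * exp (Rmax a 0 * T)))
        with (M * T * exp (- (2 * d) * T))
        by (replace (- (2 * d) * T) with (- s * T + Rmax a 0 * T) by (unfold d; field);
            rewrite exp_plus; ring).
      replace (M / d * exp (- d * T)) with (M * (/ d * exp (d * T)) * exp (- (2 * d) * T)).
      + apply Rmult_le_compat_r; [left; apply exp_pos|]. apply Rmult_le_compat_l; auto.
      + replace (- d * T) with (d * T + - (2 * d) * T) by ring. rewrite exp_plus. unfold Rdiv; ring. }
  lra.
Qed.

(* For an unstable [a] the solution through a suitable initial value stays bounded: [c] cancels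
   the coefficient of the growing exponential. *)
Lemma Rres_shift_bounded a b G M : 0 < a -> ccont G -> cbounded M G ->
  exists c B, cbounded B (Rres a b (fun t => G t + c)%C).
Proof.
  intros Ha HG HM. assert (M0 : 0 <= M) by (apply Rle_trans with (2 := HM 0 (Rle_refl 0)), Cmod_ge_0).
  set (e := fun v => cexp (- a * v) (- b * v)). set (h := fun v => (e v * G v)%C).
  assert (Ce : ccont e) by (unfold e; cct). assert (Ch : ccont h) by (unfold h; cct).
  set (J := fun T => CI h 0 T).
  assert (Tl : forall T T', 0 <= T <= T' -> Cmod (J T' - J T)%C <= M / a * exp (- a * T)).
  { intros T T' HT. unfold J. rewrite <- (CI_Chasles h 0 T T') by (apply ccont_exCI; auto).
    replace (CI h 0 T + CI h T T' - CI h 0 T)%C with (CI h T T') by ring.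
    apply Rle_trans with (RInt (fun v => M * exp (- a * v)) T T').
    - apply CI_bound; [lra|apply ccont_exCI; auto|apply cont_ex_RInt; ct|].
      intros v Hv. unfold h, e. rewrite Cmod_mult, Cmod_cexp, Rmult_comm.
      apply Rmult_le_compat_r; [left; apply exp_pos|apply HM; lra].
    - rewrite RInt_exp_decay by lra. apply Rmult_le_compat_l; [apply Rdiv_le_0_compat; lra|].
      generalize (exp_pos (- a * T')); lra. }
  assert (L := is_lim_exp_decay (M / a) a Ha).
  destruct (tail_limit (fun T => fst (J T)) (fun T => M / a * exp (- a * T))) as [l1 H1]; auto.
  { intros T T' HT. apply Rle_trans with (2 := Tl T T' HT), (Rabs_fst_Cmod (J T' - J T)%C). }
  destruct (tail_limit (fun T => snd (J T)) (fun T => M / a * exp (- a * T))) as [l2 H2]; auto.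
  { intros T T' HT. apply Rle_trans with (2 := Tl T T' HT), (Rabs_snd_Cmod (J T' - J T)%C). }
  set (I := ((l1, l2) : C)). set (mu := ((a, b) : C)).
  assert (Nm : mu <> 0%C) by (intro E; apply (f_equal fst) in E; simpl in E; lra).
  (* Here I is the integral of e^(-mu v) G over the half line. The constant -mu I contributes I
     (e^(-mu t) - 1), so the bracket becomes the tail J t - I plus I e^(-mu t), both of order e^(-a
     t), which the prefactor e^(mu t) exactly compensates. *)
  exists (- mu * I)%C, (2 * (M / a) + Cmod I).
  intros t Ht. unfold Rres.
  assert (E1 : CI (fun v => - mu * e v)%C 0 t = (e t - 1)%C).
  { apply C_eq; unfold CI, e, mu, cexp; cbn [fst snd Cmult Copp Cminus Cplus RtoC].
    - etransitivity; [apply (RInt_of_derive (fun v => exp (- a * v) * cos (- b * v)))|].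
      + intros v. auto_derive; auto. ring.
      + ct.
      + rewrite !Rmult_0_r, exp_0, cos_0. eqR; ring.
    - etransitivity; [apply (RInt_of_derive (fun v => exp (- a * v) * sin (- b * v)))|].
      + intros v. auto_derive; auto. ring.
      + ct.
      + rewrite !Rmult_0_r, exp_0, sin_0. eqR; ring. }
  assert (E2 : CI (fun v => cexp (- a * v) (- b * v) * (G v + - mu * I))%C 0 t = (J t - I + I * e t)%C).
  { transitivity (CI (fun v => h v + I * (- mu * e v))%C 0 t).
    - apply CI_ext; intros v _; unfold h, e; ring.
    - rewrite CI_plus, CI_scal by (apply ccont_exCI; cct). rewrite E1. unfold J. ring. }
  rewrite E2, Cmod_mult, Cmod_cexp.
  assert (B1 : Cmod (J t - I)%C <= 2 * (M / a) * exp (- a * t)).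
  { eapply Rle_trans; [apply Cmod_le_abs|]. specialize (H1 t Ht). specialize (H2 t Ht).
    change (Rabs (fst (J t) - l1) + Rabs (snd (J t) - l2) <= 2 * (M / a) * exp (- a * t)). lra. }
  assert (B2 : Cmod (J t - I + I * e t)%C <= (2 * (M / a) + Cmod I) * exp (- a * t)).
  { eapply Rle_trans; [apply Cmod_triangle|]. rewrite Cmod_mult. unfold e. rewrite Cmod_cexp. lra. }
  apply Rmult_le_compat_l with (r := exp (a * t)) in B2; [|left; apply exp_pos].
  apply Rle_trans with (1 := B2). right.
  assert (E : exp (a * t) * exp (- a * t) = 1) by (rewrite <- exp_plus, <- exp_0; f_equal; ring).
  transitivity ((2 * (M / a) + Cmod I) * (exp (a * t) * exp (- a * t))); [ring|rewrite E; ring].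
Qed.

(** The branch of lambda^(1/al) with angle phi/al, which may exceed PI in modulus and is then not
    the principal one. *)
Definition mu_of (al l phi : R) : C := cexp (l / al) (phi / al).

Lemma pole_residue_neq0 al l phi : 0 < al -> (mu_of al l phi / (al * cexp l phi) <> 0)%C.
Proof.
  intros Ha E.
  assert (Na : RtoC al <> 0%C) by (intro X; apply RtoC_inj in X; lra).
  assert (H : (mu_of al l phi / (al * cexp l phi) * (al * cexp l phi) = mu_of al l phi)%C)
    by (field; split; [apply cexp_neq0|auto]).
  rewrite E, Cmult_0_l in H. apply (cexp_neq0 (l / al) (phi / al)). auto.
Qed.

(** The coefficient [c] depends on lambda only and is fixed before the forcing. If it is not zero,
    the angle of mu stays below 3 PI/2, so that Re mu can vanish only at the angles -PI/2 and PI/2.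
    In the critical case these angles lie between the edges, and [c] is a nonzero residue. *)
Lemma scalar_rep_Rpower al l phi : 0 < al < 1 -> - PI < phi <= PI ->
  exists c : C, (c = 0%C \/ c = (mu_of al l phi / (al * cexp l phi))%C
                           /\ Rabs (phi / al) < 3 * PI / 2) /\
   (c = 0%C -> Rabs phi <> al * PI / 2) /\
   forall G M, ccont G -> cbounded M G ->
    exists z B s0, ccont z /\ cbounded B z /\ 0 < s0 /\ fst (mu_of al l phi) < s0 /\
      forall s g, s0 < s -> clap G s g ->
        clap (fun t => z t + c * Rres (fst (mu_of al l phi)) (snd (mu_of al l phi)) G t)%C s
             (g * / (RtoC (Rpower s al) - cexp l phi))%C.
Proof.
  intros Ha Hp. assert (PP := PI_RGT_0).
  destruct (strip_exists al phi Ha Hp) as [ya [y1 [y2 [yb [Hs [Hy1 Hy2]]]]]].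
  set (c := if excluded_middle_informative (y1 < phi / al < y2)
            then (mu_of al l phi / (al * cexp l phi))%C else 0%C).
  exists c. split; [|split].
  - unfold c. destruct (excluded_middle_informative _) as [Hin|]; [right|left; auto].
    split; auto. unfold strip in Hs. apply Rabs_def1; lra.
  - unfold c. destruct (excluded_middle_informative _) as [Hin|Hout].
    + intros E; destruct (pole_residue_neq0 al l phi ltac:(lra) E).
    + intros _ E. apply Hout.
      assert (X : Rabs (phi / al) = PI / 2).
      { unfold Rdiv at 1. rewrite Rabs_mult, E, Rabs_inv, (Rabs_pos_eq al) by lra. field; lra. }
      assert (Y : - (PI / 2) <= phi / al <= PI / 2) by (apply Rabs_le_between; lra). lra.
  - intros G M HG HM.
    destruct (scalar_rep al l phi ya y1 y2 yb G M Hs HG HM) as [z [B [Cz [Bz Hz]]]].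
    set (mu := mu_of al l phi) in *.
    exists z, B, (exp (l / al) + 1). split; [auto|]. split; [auto|].
    assert (Pl := exp_pos (l / al)).
    assert (Fm : fst mu <= exp (l / al)).
    { unfold mu, mu_of, cexp; simpl. generalize (COS_bound (phi / al)); nra. }
    split; [lra|]. split; [lra|].
    intros s g Hss Hg.
    assert (Es : s = exp (ln s)) by (symmetry; apply exp_ln; lra).
    assert (Hls : l / al < ln s) by (apply exp_lt_inv; rewrite <- Es; lra).
    assert (H := Hz (ln s) g Hls). rewrite <- Es in H. specialize (H Hg).
    fold (Rpower s al) in H.
    assert (HR := clap_Rres (fst mu) (snd mu) G M s g HG HM
      ltac:(apply Rmax_case; lra) Hg).
    rewrite <- (surjective_pairing mu) in HR.
    assert (CR := ccont_Rres (fst mu) (snd mu) G HG).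
    assert (X := clap_plus _ _ _ _ _ Cz (ccont_mult _ _ (ccont_const c) CR) H (clap_scal c _ _ _ CR HR)).
    cbv beta in X.
    match goal with |- clap _ _ ?r => match type of X with clap _ _ ?r' =>
      replace r with r'; [exact X|] end end.
    unfold pole_term. unfold c. fold (mu_of al l phi). fold mu.
    destruct (excluded_middle_informative _); [|ring].
    unfold Cdiv. ring.
Qed.

Lemma cos_neq0 y : Rabs y < 3 * PI / 2 -> Rabs y <> PI / 2 -> cos y <> 0.
Proof.
  intros H1 H2.
  assert (E : cos y = cos (Rabs y)) by (unfold Rabs; destruct (Rcase_abs y); [rewrite cos_neg|]; auto).
  rewrite E. assert (P := Rabs_pos y). destruct (Rlt_dec (Rabs y) (PI / 2)).
  - apply Rgt_not_eq, cos_gt_0; lra.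
  - apply Rlt_not_eq, cos_lt_0; lra.
Qed.

(** Outside the critical angle either there is no pole term, or Re mu < 0 and the response is
    bounded, or Re mu > 0 and a constant k added to the forcing stabilizes it. Since an initial
    value c0 acts as the forcing lambda c0, the choice is c0 = k/lambda. *)
Lemma scalar_bounded al l phi G M : 0 < al < 1 -> - PI < phi <= PI -> Rabs phi <> al * PI / 2 ->
  ccont G -> cbounded M G ->
  exists (c0 : C) z B s0, ccont z /\ cbounded B z /\ forall s g, s0 < s -> clap G s g ->
    clap z s ((g + cexp l phi * c0 * / s) * / (RtoC (Rpower s al) - cexp l phi))%C.
Proof.
  intros Ha Hp Hcrit HG HM.
  assert (M0 : 0 <= M) by (apply Rle_trans with (2 := HM 0 (Rle_refl 0)), Cmod_ge_0).
  destruct (scalar_rep_Rpower al l phi Ha Hp) as [c [Hc [_ Hrep]]].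
  set (mu := mu_of al l phi) in *.
  assert (Hk : exists (k : C) B1, cbounded B1 (fun t => c * Rres (fst mu) (snd mu) (fun t => G t + k) t)%C).
  { destruct Hc as [->|[Hc Hin]].
    - exists 0%C, 0. intros t _. rewrite Cmult_0_l, Cmod_0. lra.
    - assert (Hmu : fst mu <> 0).
      { unfold mu, mu_of, cexp; simpl. apply Rmult_integral_contrapositive_currified.
        - apply Rgt_not_eq, exp_pos.
        - apply cos_neq0; auto. intro E; apply Hcrit.
          assert (X : Rabs phi = al * Rabs (phi / al)).
          { unfold Rdiv. rewrite Rabs_mult, Rabs_inv, (Rabs_pos_eq al) by lra. field; lra. }
          rewrite X, E. field. }
      assert (W : exists (k : C) B1, cbounded B1 (Rres (fst mu) (snd mu) (fun t => G t + k)%C)).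
      { destruct (Rdichotomy _ _ Hmu) as [Neg|Pos].
        - exists 0%C, (M / - fst mu). intros t Ht. apply Rres_bound_neg; auto.
          + apply ccont_plus; cct.
          + intros x Hx. rewrite Cplus_0_r. auto.
        - apply Rres_shift_bounded with M; auto; lra. }
      destruct W as [k [B1 HB1]]. exists k, (Cmod c * B1). intros t Ht. rewrite Cmod_mult.
      apply Rmult_le_compat_l; [apply Cmod_ge_0|auto]. }
  destruct Hk as [k [B1 HB1]].
  assert (CG' : ccont (fun t => G t + k)%C) by cct.
  assert (BG' : cbounded (M + Cmod k) (fun t => G t + k)%C).
  { intros t Ht. eapply Rle_trans; [apply Cmod_triangle|]. specialize (HM t Ht); lra. }
  destruct (Hrep _ _ CG' BG') as [z [B [s0 [Cz [Bz [Hs0 [Hs1 Hz]]]]]]].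
  exists (k / cexp l phi)%C, (fun t => z t + c * Rres (fst mu) (snd mu) (fun t => G t + k) t)%C, (B + B1), s0.
  split; [|split].
  - apply ccont_plus; auto. apply ccont_mult; [cct|apply ccont_Rres; auto].
  - intros t Ht. eapply Rle_trans; [apply Cmod_triangle|].
    specialize (Bz t Ht). specialize (HB1 t Ht). cbv beta in HB1. lra.
  - intros s g Hs Hg.
    replace (cexp l phi * (k / cexp l phi))%C with k by (field; apply cexp_neq0).
    apply Hz; auto. apply clap_plus; auto; [apply ccont_const|apply clap_const; lra].
Qed.

(** Here mu = i b, and the forcing p cos (b t) contains the frequency of the undamped mode, so the
    response grows like p t/2. The constant [q] is arbitrary because it stands for the unknown
    initial value, which cannot cancel this growth. By uniqueness of transforms [Z] contains the
    growing term. *)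
Lemma resonance_unbounded al l phi (p q : C) Z B s1 : 0 < al < 1 -> - PI < phi <= PI ->
  Rabs phi = al * PI / 2 -> p <> 0%C -> ccont Z -> cbounded B Z ->
  (forall s g, s1 < s -> clap (fun t => q + p * cos (snd (mu_of al l phi) * t))%C s g ->
     clap Z s (g * / (RtoC (Rpower s al) - cexp l phi))%C) -> False.
Proof.
  intros Ha Hp Hcrit Np CZ BZ HZ. assert (PP := PI_RGT_0).
  destruct (scalar_rep_Rpower al l phi Ha Hp) as [c [Hc [Hc0 Hrep]]].
  assert (Nc : c <> 0%C) by (intro E; apply (Hc0 E), Hcrit).
  assert (X : Rabs (phi / al) = PI / 2).
  { unfold Rdiv at 1. rewrite Rabs_mult, Hcrit, Rabs_inv, (Rabs_pos_eq al) by lra. field; lra. }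
  set (mu := mu_of al l phi) in *. set (b := snd mu) in *.
  assert (Fa : fst mu = 0).
  { unfold mu, mu_of, cexp; simpl. unfold Rabs in X. destruct (Rcase_abs (phi / al)).
    - replace (phi / al) with (- (PI / 2)) by lra. rewrite cos_neg, cos_PI2. ring.
    - rewrite X, cos_PI2. ring. }
  assert (Nb : b <> 0).
  { intro E. assert (Em : mu = 0%C) by (apply C_eq; auto). apply (cexp_neq0 (l / al) (phi / al) Em). }
  set (G := fun t => (q + p * cos (b * t))%C).
  assert (CG : ccont G) by (unfold G; cct).
  assert (BG : cbounded (Cmod q + Cmod p) G).
  { intros t _. eapply Rle_trans; [apply Cmod_triangle|]. rewrite Cmod_mult, Cmod_R.
    assert (Rabs (cos (b * t)) <= 1) by apply Rabs_le, COS_bound.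
    generalize (Cmod_ge_0 p); nra. }
  destruct (Hrep G _ CG BG) as [z [B2 [s0 [Cz [Bz [Hs0 [Hs1 Hz]]]]]]].
  rewrite Fa in Hz. fold b in Hz.
  set (W := fun t => (z t + c * Rres 0 b G t)%C) in *.
  assert (CR := ccont_Rres 0 b G CG).
  assert (CW : ccont W) by (unfold W; apply ccont_plus; auto; apply ccont_mult; auto; cct).
  (* [c R] itself is not yet known to be bounded, so Lerch is applied with an exponential weight. *)
  assert (EW : forall t, 0 <= t -> W t = Z t).
  { assert (Bd : exists M', bexp 1 M' (fun t => fst (W t) - fst (Z t)) /\ bexp 1 M' (fun t => snd (W t) - snd (Z t))).
    { exists (B2 + Cmod c * (Cmod q + Cmod p) + B).
      assert (Y : forall t, 0 <= t -> Cmod (W t - Z t)%C <= (B2 + Cmod c * (Cmod q + Cmod p) + B) * exp (1 * t)).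
      { intros t Ht. rewrite Rmult_1_l.
        assert (E1 : 1 + t <= exp t) by apply exp_ineq1_le.
        assert (R1 := Rres_bound_gen 0 b G _ t CG BG Ht).
        rewrite Rmax_left, Rmult_0_l, exp_0, Rmult_1_r in R1 by lra.
        assert (Z1 := BZ t Ht). assert (z1 := Bz t Ht).
        assert (C1 := Cmod_ge_0 c). assert (C2 := Cmod_ge_0 q). assert (C3 := Cmod_ge_0 p).
        assert (C4 := Cmod_ge_0 (Z t)). assert (C5 := Cmod_ge_0 (z t)).
        eapply Rle_trans; [apply Cmod_triangle|]. rewrite Cmod_opp. unfold W.
        eapply Rle_trans; [apply Rplus_le_compat_r, Cmod_triangle|]. rewrite Cmod_mult.
        assert (T1 : Cmod c * Cmod (Rres 0 b G t) <= Cmod c * (Cmod q + Cmod p) * exp t).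
        { rewrite Rmult_assoc. apply Rmult_le_compat_l; auto.
          apply Rle_trans with (1 := R1). apply Rmult_le_compat_l; lra. }
        assert (B2 <= B2 * exp t) by nra. assert (B <= B * exp t) by nra. lra. }
      split; intros t Ht; apply Rle_trans with (2 := Y t Ht).
      - apply (Rabs_fst_Cmod (W t - Z t)%C).
      - apply (Rabs_snd_Cmod (W t - Z t)%C). }
    destruct Bd as [M' [Bd1 Bd2]].
    assert (HL : forall s, Rmax s0 s1 < s -> exists r, clap W s r /\ clap Z s r).
    { intros s Hs. assert (A1 := Rmax_l s0 s1). assert (A2 := Rmax_r s0 s1).
      destruct (clap_ex G _ s CG BG ltac:(lra)) as [g Hg].
      exists (g * / (RtoC (Rpower s al) - cexp l phi))%C. split; [apply Hz|apply HZ]; auto; lra. }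
    intros t Ht. destruct CW as [CW1 CW2]. destruct CZ as [CZ1 CZ2].
    apply C_eq.
    - assert (E : fst (W t) - fst (Z t) = 0); [|lra].
      apply (lerch (fun t => fst (W t) - fst (Z t)) 1 M' (Rmax s0 s1)); auto; [ct|].
      intros s Hs. destruct (HL s Hs) as [r [[r1 _] [r2 _]]].
      replace 0 with (fst r - fst r) by ring. apply lap_minus; auto.
    - assert (E : snd (W t) - snd (Z t) = 0); [|lra].
      apply (lerch (fun t => snd (W t) - snd (Z t)) 1 M' (Rmax s0 s1)); auto; [ct|].
      intros s Hs. destruct (HL s Hs) as [r [[_ r1] [_ r2]]].
      replace 0 with (snd r - snd r) by ring. apply lap_minus; auto. }
  assert (Nab : 0 < Rabs b) by (apply Rabs_pos_lt; auto).
  (* Sampling after full periods removes the contribution of [q] and the oscillating part, leaving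
     exactly p t/2. *)
  assert (Val : forall n, Rres 0 b G (2 * PI * INR n / Rabs b)
     = (p * RtoC (2 * PI * INR n / Rabs b / 2))%C).
  { intros n. set (t := 2 * PI * INR n / Rabs b).
    assert (SC : sin (b * t) = 0 /\ cos (b * t) = 1).
    { unfold t, Rabs. destruct (Rcase_abs b).
      - replace (b * (2 * PI * INR n / - b)) with (- (0 + 2 * INR n * PI)) by (field; lra).
        rewrite sin_neg, cos_neg, sin_period, cos_period, sin_0, cos_0. split; ring.
      - replace (b * (2 * PI * INR n / b)) with (0 + 2 * INR n * PI) by (field; lra).
        rewrite sin_period, cos_period, sin_0, cos_0. auto. }
    destruct SC as [Sb Cb].
    unfold Rres. rewrite Rmult_0_l.
    assert (E1 : cexp 0 (b * t) = 1%C) by (apply C_eq; unfold cexp; simpl; rewrite exp_0, ?Cb, ?Sb; ring).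
    rewrite E1.
    assert (E2 : CI (fun v => cexp (- 0 * v) (- b * v))%C 0 t = 0%C).
    { assert (Ex : forall v, exp (- 0 * v) = 1) by (intros v; rewrite Ropp_0, Rmult_0_l; apply exp_0).
      apply C_eq; unfold CI, cexp; cbn [fst snd RtoC].
      - etransitivity; [apply (RInt_ext _ (fun v => cos (b * v)))|].
        + intros v _. rewrite Ex, <- (cos_neg (b * v)). eqR. rewrite Rmult_1_l. f_equal; ring.
        + etransitivity; [apply (RInt_of_derive (fun v => sin (b * v) / b))|].
          * intros v. auto_derive; auto. field; auto.
          * ct.
          * rewrite Sb, Rmult_0_r, sin_0. eqR; field; auto.
      - etransitivity; [apply (RInt_ext _ (fun v => - sin (b * v)))|].
        + intros v _. rewrite Ex, <- (sin_neg (b * v)). eqR. rewrite Rmult_1_l. f_equal; ring.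
        + etransitivity; [apply (RInt_of_derive (fun v => cos (b * v) / b))|].
          * intros v. auto_derive; auto. field; auto.
          * ct.
          * rewrite Cb, Rmult_0_r, cos_0. eqR; field; auto. }
    assert (E3 : CI (fun v => cexp (- 0 * v) (- b * v) * cos (b * v))%C 0 t = RtoC (t / 2)).
    { assert (Ex : forall v, exp (- 0 * v) = 1) by (intros v; rewrite Ropp_0, Rmult_0_l; apply exp_0).
      assert (En : forall v, - b * v = - (b * v)) by (intros; ring).
      apply C_eq; unfold CI, cexp; cbn [fst snd RtoC Cmult].
      - etransitivity; [apply (RInt_ext _ (fun v => cos (b * v) * cos (b * v)))|].
        + intros v _. rewrite Ex, En, cos_neg. eqR; ring.
        + etransitivity; [apply (RInt_of_derive (fun v => v / 2 + sin (b * v) * cos (b * v) / (2 * b)))|].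
          * intros v. auto_derive; auto.
            assert (S := sin2_cos2 (b * v)). unfold Rsqr in S.
            transitivity ((sin (b * v) * sin (b * v) + cos (b * v) * cos (b * v)) / 2
              + (cos (b * v) * cos (b * v) - sin (b * v) * sin (b * v)) / 2); [|field].
            rewrite S. field; auto.
          * ct.
          * rewrite Sb, Rmult_0_r, sin_0. eqR; field; auto.
      - etransitivity; [apply (RInt_ext _ (fun v => - (sin (b * v) * cos (b * v))))|].
        + intros v _. rewrite Ex, En, sin_neg. eqR; ring.
        + etransitivity; [apply (RInt_of_derive (fun v => - (sin (b * v) * sin (b * v)) / (2 * b)))|].
          * intros v. auto_derive; auto. field; auto.
          * ct.
          * rewrite Sb, (Rmult_0_r b), sin_0. eqR; field; auto. }
    transitivity (CI (fun v => q * cexp (- 0 * v) (- b * v) + p * (cexp (- 0 * v) (- b * v) * cos (b * v)))%C 0 t).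
    - rewrite Cmult_1_l. apply CI_ext; intros v _; unfold G; ring.
    - rewrite CI_plus, !CI_scal by (apply ccont_exCI; cct). rewrite E2, E3. ring. }
  assert (Pc := proj1 (Cmod_gt_0 c) Nc). assert (Pp := proj1 (Cmod_gt_0 p) Np).
  assert (K : 0 < Cmod c * Cmod p * (PI / Rabs b)).
  { apply Rmult_lt_0_compat; [apply Rmult_lt_0_compat; auto|apply Rdiv_lt_0_compat; lra]. }
  (* At the (n+1)-th period the resonant term has modulus (n + 1) |c| |p| PI/|b|, which has to
     exceed B + B2, the bound for |Z - z|. *)
  destruct (nfloor_ex ((B + B2 + 1) / (Cmod c * Cmod p * (PI / Rabs b)))) as [n [_ Hn]].
  { apply Rdiv_le_0_compat.
    - generalize (Cmod_ge_0 (Z 0)) (BZ 0 (Rle_refl 0)) (Cmod_ge_0 (z 0)) (Bz 0 (Rle_refl 0)); lra.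
    - exact K. }
  set (t := 2 * PI * INR (S n) / Rabs b).
  assert (Pt : 0 <= t).
  { unfold t. apply Rdiv_le_0_compat; auto. generalize (pos_INR (S n)); nra. }
  assert (Q := EW t Pt). unfold W in Q. assert (Vn := Val (S n)). fold t in Vn. rewrite Vn in Q.
  assert (E : (c * (p * (t / 2)%R) = Z t - z t)%C) by (rewrite <- Q; ring).
  apply (f_equal Cmod) in E. rewrite !Cmod_mult, Cmod_R, Rabs_pos_eq in E by lra.
  assert (U := Cmod_triangle (Z t) (- z t)). rewrite Cmod_opp in U. unfold Cminus in E.
  assert (V1 := BZ t Pt). assert (V2 := Bz t Pt).
  apply Rmult_lt_compat_r with (r := Cmod c * Cmod p * (PI / Rabs b)) in Hn; auto.
  unfold Rdiv at 1 in Hn. rewrite Rmult_assoc, Rinv_l, Rmult_1_r in Hn by lra.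
  assert (F : Cmod c * (Cmod p * (t / 2)) = (INR n + 1) * (Cmod c * Cmod p * (PI / Rabs b))).
  { unfold t. rewrite S_INR. field. lra. }
  lra.
Qed.

(** * The Gamma function *)

Lemma exp_le x y : x <= y -> exp x <= exp y.
Proof. intros [H| ->]; [left; apply exp_increasing, H|lra]. Qed.
Lemma exp_le_1 x : x <= 0 -> exp x <= 1.
Proof. intros H; rewrite <- exp_0; apply exp_le, H. Qed.

Lemma Rpower_pos x y : 0 < Rpower x y.
Proof. apply exp_pos. Qed.

Lemma Rpower_le_base x y a : 0 <= a -> 0 < x <= y -> Rpower x a <= Rpower y a.
Proof. intros Ha H; apply Rle_Rpower_l; auto. Qed.

Definition Gint (b t : R) : R := Rpower t (b - 1) * exp (- t).

Lemma Gint_pos b t : 0 < Gint b t.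
Proof. apply Rmult_lt_0_compat; apply exp_pos. Qed.

Lemma is_derive_Rpower a t : 0 < t -> is_derive (fun t => Rpower t a) t (a * Rpower t (a - 1)).
Proof. intros Ht. apply is_derive_Reals, derivable_pt_lim_power, Ht. Qed.

Lemma continuous_Rpower a t : 0 < t -> continuous (fun t => Rpower t a) t.
Proof.
  intros Ht; apply (ex_derive_continuous (fun t => Rpower t a)); eexists; apply is_derive_Rpower, Ht.
Qed.

Lemma Gint_continuous b t : 0 < t -> continuous (Gint b) t.
Proof.
  intros Ht; apply (continuous_mult (fun t => Rpower t (b - 1)) (fun t => exp (- t))).
  - apply continuous_Rpower, Ht.
  - apply (cont_exp (fun t => - t)); ct.
Qed.

Lemma Gint_ex_RInt b c e : 0 < c -> 0 < e -> ex_RInt (Gint b) c e.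
Proof.
  intros Hc He. apply ex_RInt_cts; intros t Ht; apply Gint_continuous.
  apply Rlt_le_trans with (2 := proj1 Ht). apply Rmin_case; auto.
Qed.

Lemma Gint_mono b c c' e e' : 0 < c' -> c' <= c -> c <= e -> e <= e' ->
  RInt (Gint b) c e <= RInt (Gint b) c' e'.
Proof.
  intros H0 H1 H2 H3.
  rewrite <- (RInt_Chasles (Gint b) c' c e') by (apply Gint_ex_RInt; lra).
  rewrite <- (RInt_Chasles (Gint b) c e e') by (apply Gint_ex_RInt; lra).
  assert (P : forall x y, 0 < x <= y -> 0 <= RInt (Gint b) x y).
  { intros x y Hxy. apply RInt_ge_0; [lra|apply Gint_ex_RInt; lra|].
    intros; left; apply Gint_pos. }
  assert (A := P c' c ltac:(lra)). assert (B := P e e' ltac:(lra)).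
  unfold plus; simpl. lra.
Qed.

(** The inequality ln u <= u at u = t/(2 m), multiplied by m >= |b|, turns the power into at most
    exp (t/2) times a constant. *)
Lemma Rpower_exp_dominated b : exists C, 0 < C /\ forall t, 1 <= t -> Rpower t b <= C * exp (t / 2).
Proof.
  set (m := Rabs b + 1). assert (Hm : 1 <= m) by (unfold m; generalize (Rabs_pos b); lra).
  exists (exp (m * ln (2 * m))); split; [apply exp_pos|]. intros t Ht.
  assert (L0 : 0 <= ln t) by (rewrite <- ln_1; apply ln_le; lra).
  rewrite <- exp_plus. unfold Rpower.
  assert (H : b * ln t <= m * ln (2 * m) + t / 2).
  { apply Rle_trans with (m * ln t).
    - apply Rmult_le_compat_r; auto. unfold m; generalize (Rle_abs b); lra.
    - assert (E : ln t = ln (2 * m) + ln (t / (2 * m))).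
      { rewrite <- ln_mult; [f_equal; field; lra|lra|apply Rdiv_lt_0_compat; lra]. }
      assert (E2 : ln (t / (2 * m)) <= t / (2 * m)).
      { assert (P : 0 < t / (2 * m)) by (apply Rdiv_lt_0_compat; lra).
        generalize (exp_ineq1_le (ln (t / (2 * m)))). rewrite exp_ln by auto. lra. }
      rewrite E. apply Rmult_le_compat_l with (r := m) in E2; [|lra].
      replace (m * (t / (2 * m))) with (t / 2) in E2 by (field; lra). lra. }
  apply exp_le, H.
Qed.

Lemma Gint_bounded b : 0 < b -> exists K, forall c e, 0 < c <= 1 -> 1 <= e -> RInt (Gint b) c e <= K.
Proof.
  intros Hb. destruct (Rpower_exp_dominated (b - 1)) as [C [HC HH]].
  exists (/ b + 2 * C). intros c e Hc He.
  rewrite <- (RInt_Chasles (Gint b) c 1 e) by (apply Gint_ex_RInt; lra). unfold plus; simpl.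
  apply Rplus_le_compat.
  - assert (D : is_RInt (fun t => Rpower t (b - 1)) c 1 (Rpower 1 b / b - Rpower c b / b)).
    { apply (is_RInt_derive (fun t => Rpower t b / b)); intros t Ht;
        rewrite Rmin_left, Rmax_right in Ht by lra.
      - apply is_derive_ext with (fun t => / b * Rpower t b); [intros; apply Rmult_comm|].
        replace (Rpower t (b - 1)) with (/ b * (b * Rpower t (b - 1))) by (field; lra).
        apply is_derive_scal, is_derive_Rpower; lra.
      - apply continuous_Rpower; lra. }
    apply Rle_trans with (RInt (fun t => Rpower t (b - 1)) c 1).
    + apply RInt_le; [lra|apply Gint_ex_RInt; lra|eexists; exact D|].
      intros t Ht. unfold Gint. rewrite <- (Rmult_1_r (Rpower t (b - 1))) at 2.
      apply Rmult_le_compat_l; [left; apply Rpower_pos|].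
      apply exp_le_1; lra.
    + rewrite (is_RInt_unique _ _ _ _ D).
      replace (Rpower 1 b) with 1 by (unfold Rpower; rewrite ln_1, Rmult_0_r, exp_0; auto).
      assert (0 < Rpower c b / b) by (apply Rdiv_lt_0_compat; [apply Rpower_pos|auto]).
      unfold Rdiv at 1. lra.
  - apply Rle_trans with (RInt (fun t => C * exp (- (1 / 2) * t)) 1 e).
    + apply RInt_le; [lra|apply Gint_ex_RInt; lra|apply cont_ex_RInt; ct|].
      intros t Ht. unfold Gint. specialize (HH t ltac:(lra)).
      replace (- (1 / 2) * t) with (t / 2 + - t) by field. rewrite exp_plus, <- Rmult_assoc.
      apply Rmult_le_compat_r; [left; apply exp_pos|auto].
    + rewrite RInt_exp_decay by lra.
      assert (exp (- (1 / 2) * 1) <= 1) by (apply exp_le_1; lra).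
      generalize (exp_pos (- (1 / 2) * e)). intros. replace (C / (1 / 2)) with (2 * C) by field.
      rewrite <- (Rmult_1_r (2 * C)) at 2. apply Rmult_le_compat_l; lra.
Qed.

(** [Gamma] is a chosen value, so a limit must exist before anything can be said about it. The
    integrand is positive, hence truncated integrals increase with the interval and their supremum
    is a limit. The normalization d <= 1 <= Mb is for convenience of use. *)
Lemma Gamma_limit b : 0 < b -> forall eps, 0 < eps -> exists d Mb, 0 < d /\ d <= 1 /\ 1 <= Mb /\
  forall c e, 0 < c < d -> Mb < e -> Rabs (RInt (Gint b) c e - Gamma b) < eps.
Proof.
  intros Hb.
  assert (Ex : exists l, is_int_0inf (Gint b) l).
  { destruct (Gint_bounded b Hb) as [K HK].
    destruct (completeness (fun v => exists c e, 0 < c <= 1 /\ 1 <= e /\ v = RInt (Gint b) c e)) as [l [Hl1 Hl2]].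
    - exists K. intros v [c [e [Hc [He ->]]]]. apply HK; auto.
    - exists (RInt (Gint b) 1 1), 1, 1. repeat split; lra.
    - exists l. intros eps He.
      assert (Hx : exists c0 e0, 0 < c0 <= 1 /\ 1 <= e0 /\ l - eps < RInt (Gint b) c0 e0).
      { apply NNPP; intros Hn. assert (l <= l - eps); [|lra].
        apply Hl2. intros v [c [e [Hc [He' ->]]]]. apply Rnot_lt_le; intros L. apply Hn.
        exists c, e; auto. }
      destruct Hx as [c0 [e0 [H1 [H2 H3]]]].
      exists c0, e0; split; [lra|]. intros c e Hc He'.
      assert (X : ex_RInt (Gint b) c e) by (apply Gint_ex_RInt; lra).
      exists (ex_RInt_Reals_0 _ _ _ X). rewrite <- RInt_Reals.
      assert (M := Gint_mono b c0 c e0 e ltac:(lra) ltac:(lra) ltac:(lra) ltac:(lra)).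
      assert (U : RInt (Gint b) c e <= l) by (apply Hl1; exists c, e; repeat split; lra).
      apply Rabs_def1; lra. }
  assert (S := epsilon_spec (inhabits 0) (is_int_0inf (Gint b)) Ex).
  change (epsilon (inhabits 0) (is_int_0inf (Gint b))) with (Gamma b) in S.
  intros eps He. destruct (S eps He) as [d [Mb [Hd H]]].
  exists (Rmin d 1), (Rmax Mb 1). split; [apply Rmin_case; lra|].
  split; [apply Rmin_r|]. split; [apply Rmax_r|].
  intros c e Hc He'. assert (A := Rmin_l d 1). assert (B := Rmax_l Mb 1).
  destruct (H c e ltac:(lra) ltac:(lra)) as [pr Hpr]. rewrite RInt_Reals with (pr := pr). exact Hpr.
Qed.

Lemma Gamma_ge_RInt b c e : 0 < b -> 0 < c -> c <= e -> RInt (Gint b) c e <= Gamma b.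
Proof.
  intros Hb Hc He. apply le_epsilon; intros eps Heps.
  destruct (Gamma_limit b Hb eps Heps) as [d [Mb [Hd [Hd1 [HM H]]]]].
  assert (D1 := Rmin_l (d / 2) c). assert (D2 := Rmin_r (d / 2) c).
  assert (D3 : 0 < Rmin (d / 2) c) by (apply Rmin_case; lra).
  assert (E1 := Rmax_l (Mb + 1) e). assert (E2 := Rmax_r (Mb + 1) e).
  specialize (H (Rmin (d / 2) c) (Rmax (Mb + 1) e) ltac:(lra) ltac:(lra)).
  assert (M := Gint_mono b c (Rmin (d / 2) c) e (Rmax (Mb + 1) e) D3 D2 He E2).
  apply Rabs_lt_between in H. lra.
Qed.

(** Only the window [r, r + 1] of the integral is kept. Since r is free, this replaces Stirling's
    formula: growth in b faster than any geometric rate. *)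
Lemma Gamma_lower b r : 0 < b -> 0 < r -> Rpower r b / ((r + 1) * exp (r + 1)) <= Gamma b.
Proof.
  intros Hb Hr.
  apply Rle_trans with (2 := Gamma_ge_RInt b r (r + 1) Hb Hr ltac:(lra)).
  replace (Rpower r b / ((r + 1) * exp (r + 1)))
    with (RInt (fun _ => Rpower r b / (r + 1) * exp (- (r + 1))) r (r + 1)).
  - apply RInt_le; [lra|apply ex_RInt_const|apply Gint_ex_RInt; lra|].
    intros t Ht. unfold Gint. apply Rmult_le_compat.
    + left; apply Rdiv_lt_0_compat; [apply Rpower_pos|lra].
    + left; apply exp_pos.
    + unfold Rminus. rewrite Rpower_plus, Rpower_Ropp, Rpower_1 by lra.
      apply Rmult_le_compat; [left; apply Rpower_pos|left; apply Rinv_0_lt_compat; lra| |].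
      * apply Rpower_le_base; lra.
      * apply Rinv_le_contravar; lra.
    + left; apply exp_increasing; lra.
  - rewrite RInt_Rconst, exp_Ropp. eqR; field. split; [apply Rgt_not_eq, exp_pos|lra].
Qed.

Lemma Gamma_pos b : 0 < b -> 0 < Gamma b.
Proof.
  intros Hb. apply Rlt_le_trans with (2 := Gamma_lower b 1 Hb Rlt_0_1).
  apply Rdiv_lt_0_compat; [apply Rpower_pos|]. generalize (exp_pos (1 + 1)); nra.
Qed.

Lemma Rpower_small a eps : 0 < a -> 0 < eps -> exists d, 0 < d /\ forall c, 0 < c < d -> Rpower c a < eps.
Proof.
  intros Ha He. exists (Rpower eps (/ a)); split; [apply Rpower_pos|]. intros c Hc.
  apply Rlt_le_trans with (Rpower (Rpower eps (/ a)) a).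
  - apply Rlt_Rpower_l; auto.
  - rewrite Rpower_mult, Rinv_l, Rpower_1 by lra. lra.
Qed.

(** Integration by parts on [c, e], with boundary terms vanishing at both ends. It is needed to
    relate the coefficients of E_al to those of E_(al,al). *)
Lemma Gamma_S b : 0 < b -> Gamma (b + 1) = b * Gamma b.
Proof.
  intros Hb.
  assert (P : forall c e, 0 < c <= e -> RInt (Gint (b + 1)) c e
     = Rpower c b * exp (- c) - Rpower e b * exp (- e) + b * RInt (Gint b) c e).
  { intros c e Hce.
    assert (D : is_RInt (fun t => b * Gint b t - Gint (b + 1) t) c e
       (Rpower e b * exp (- e) - Rpower c b * exp (- c))).
    { apply (is_RInt_derive (fun t => Rpower t b * exp (- t))); intros t Ht;
        rewrite Rmin_left, Rmax_right in Ht by lra.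
      - unfold Gint. replace (b + 1 - 1) with b by ring.
        replace (b * (Rpower t (b - 1) * exp (- t)) - Rpower t b * exp (- t))
          with (b * Rpower t (b - 1) * exp (- t) + Rpower t b * (- exp (- t))) by ring.
        apply (is_derive_Rmult (fun t => Rpower t b) (fun t => exp (- t))).
        + apply is_derive_Rpower; lra.
        + auto_derive; auto. ring.
      - apply (continuous_minus (fun t => b * Gint b t) (Gint (b + 1))).
        + apply (continuous_scal_r b (Gint b)), Gint_continuous; lra.
        + apply Gint_continuous; lra. }
    apply (is_RInt_unique (V := R_CompleteNormedModule)) in D.
    rewrite (RInt_sub (fun t => b * Gint b t) (Gint (b + 1))) in D.
    - assert (S : RInt (fun t => b * Gint b t) c e = b * RInt (Gint b) c e)
        by (apply (RInt_scal (Gint b) c e b), Gint_ex_RInt; lra).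
      rewrite S in D. lra.
    - apply (ex_RInt_scal (Gint b) c e b), Gint_ex_RInt; lra.
    - apply Gint_ex_RInt; lra. }
  destruct (Rpower_exp_dominated b) as [C [HC HD]].
  assert (Q : forall eps, 0 < eps -> Rabs (Gamma (b + 1) - b * Gamma b) <= (3 + b) * eps).
  { intros eps He.
    destruct (Gamma_limit b Hb eps He) as [d1 [M1 [Hd1 [Hd11 [HM1 H1]]]]].
    destruct (Gamma_limit (b + 1) ltac:(lra) eps He) as [d2 [M2 [Hd2 [_ [HM2 H2]]]]].
    destruct (Rpower_small b eps Hb He) as [d3 [Hd3 H3]].
    destruct (exp_decay_small C (1 / 2) eps ltac:(lra) He) as [M3 [HM3 H4]].
    set (c := Rmin d1 (Rmin d2 d3) / 2). set (e := M1 + M2 + M3 + 1).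
    assert (Hc : 0 < c /\ c < d1 /\ c < d2 /\ c < d3).
    { assert (0 < Rmin d1 (Rmin d2 d3)) by (repeat apply Rmin_case; lra).
      generalize (Rmin_l d1 (Rmin d2 d3)) (Rmin_r d1 (Rmin d2 d3)) (Rmin_l d2 d3) (Rmin_r d2 d3).
      unfold c; lra. }
    destruct Hc as [C0 [C1 [C2 C3]]].
    specialize (H1 c e ltac:(lra) ltac:(unfold e; lra)). specialize (H2 c e ltac:(lra) ltac:(unfold e; lra)).
    specialize (H3 c ltac:(lra)). specialize (H4 e ltac:(unfold e; lra)).
    assert (He1 : 1 <= e) by (unfold e; lra). specialize (HD e He1).
    assert (Hce : c <= e) by lra.
    rewrite (P c e ltac:(lra)) in H2.
    assert (S1 : 0 <= Rpower c b * exp (- c) <= eps).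
    { assert (exp (- c) <= 1) by (apply exp_le_1; lra).
      generalize (Rpower_pos c b) (exp_pos (- c)); intros; split; nra. }
    assert (S2 : 0 <= Rpower e b * exp (- e) <= eps).
    { split; [left; apply Rmult_lt_0_compat; apply exp_pos|].
      apply Rle_trans with (2 := H4). apply Rle_trans with (C * exp (e / 2) * exp (- e)).
      - apply Rmult_le_compat_r; [left; apply exp_pos|auto].
      - rewrite Rmult_assoc, <- exp_plus. right; do 2 f_equal; field. }
    apply Rabs_lt_between in H1, H2. apply Rabs_le. nra. }
  assert (Z : Rabs (Gamma (b + 1) - b * Gamma b) = 0).
  { apply Rle_antisym; [|apply Rabs_pos]. apply Rnot_lt_le; intros L.
    set (w := Rabs (Gamma (b + 1) - b * Gamma b)) in *.
    specialize (Q (w / (2 * (3 + b))) ltac:(apply Rdiv_lt_0_compat; lra)).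
    replace ((3 + b) * (w / (2 * (3 + b)))) with (w / 2) in Q by (field; lra). lra. }
  destruct (Req_dec (Gamma (b + 1) - b * Gamma b) 0) as [E|E]; [lra|].
  apply Rabs_pos_lt in E. lra.
Qed.

Lemma Gamma_1 : Gamma 1 = 1.
Proof.
  assert (P : forall c e, 0 < c <= e -> RInt (Gint 1) c e = exp (- c) - exp (- e)).
  { intros c e Hc. rewrite (RInt_ext _ (fun t => 1 * exp (- (1) * t))).
    - rewrite RInt_exp_decay by lra. replace (- (1) * c) with (- c) by ring.
      replace (- (1) * e) with (- e) by ring. eqR; field.
    - intros t Ht. rewrite Rmin_left in Ht by lra. unfold Gint. rewrite Rminus_diag, Rpower_O by lra.
      f_equal. f_equal; ring. }
  apply Rle_antisym; apply le_epsilon; intros eps He;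
    destruct (Gamma_limit 1 Rlt_0_1 (eps / 2) ltac:(lra)) as [d [Mb [Hd [Hd1 [HM H]]]]].
  - specialize (H (d / 2) (Mb + 1) ltac:(lra) ltac:(lra)). rewrite P in H by lra.
    assert (exp (- (d / 2)) <= 1) by (apply exp_le_1; lra).
    generalize (exp_pos (- (Mb + 1))); intros. apply Rabs_lt_between in H. lra.
  - set (c := Rmin (d / 2) (eps / 4)).
    assert (Hc : 0 < c) by (apply Rmin_case; lra).
    assert (C1 : c <= d / 2) by apply Rmin_l. assert (C2 : c <= eps / 4) by apply Rmin_r.
    destruct (exp_decay_small 1 1 (eps / 4) Rlt_0_1 ltac:(lra)) as [N [HN0 HN]].
    specialize (HN (N + Mb + 1) ltac:(lra)).
    specialize (H c (N + Mb + 1) ltac:(lra) ltac:(lra)). rewrite P in H by lra.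
    replace (- (1) * (N + Mb + 1)) with (- (N + Mb + 1)) in HN by ring.
    assert (E := exp_ineq1_le (- c)). apply Rabs_lt_between in H. lra.
Qed.

(** * Real powers extended by zero *)

(** [Rpower t a] equals 1 for t <= 0, since [ln] is 0 there; the value 0 makes the power continuous
    on the whole line for a > 0. *)
Definition pw (t a : R) : R := if Rle_dec t 0 then 0 else Rpower t a.

Lemma pw_pos t a : 0 < t -> pw t a = Rpower t a.
Proof. intros H; unfold pw; destruct (Rle_dec t 0); lra. Qed.
Lemma pw_neg t a : t <= 0 -> pw t a = 0.
Proof. intros H; unfold pw; destruct (Rle_dec t 0); lra. Qed.
Lemma pw_ge_0 t a : 0 <= pw t a.
Proof. unfold pw; destruct (Rle_dec t 0); [lra|left; apply Rpower_pos]. Qed.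

Lemma cont_pw a : 0 < a -> cont (fun t => pw t a).
Proof.
  intros Ha t. destruct (Rtotal_order t 0) as [L|[E|L]].
  - apply continuous_ext_loc with (fun _ => 0); [|apply continuous_const].
    apply (locally_interval _ t m_infty 0); simpl; auto.
    intros y _ Hy; symmetry; apply pw_neg; lra.
  - subst t. apply continuity_pt_filterlim. intros eps He.
    destruct (Rpower_small a eps Ha He) as [d [Hd H]].
    exists d; split; auto. intros y [_ Hy]. simpl in *; unfold R_dist in *.
    rewrite (pw_neg 0) by lra. rewrite Rminus_0_r in *.
    destruct (Rle_dec y 0); [rewrite pw_neg, Rabs_R0; auto|].
    rewrite pw_pos, Rabs_pos_eq by (try left; try apply Rpower_pos; lra).
    apply H. rewrite Rabs_pos_eq in Hy; lra.
  - apply continuous_ext_loc with (fun t => Rpower t a); [|apply continuous_Rpower, L].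
    apply (locally_interval _ t 0 p_infty); simpl; auto.
    intros y Hy _; symmetry; apply pw_pos, Hy.
Qed.

Lemma pw_le t u a : 0 < a -> t <= u -> pw t a <= pw u a.
Proof.
  intros Ha H. destruct (Rle_dec t 0); [rewrite pw_neg by auto; apply pw_ge_0|].
  rewrite !pw_pos by lra. apply Rpower_le_base; lra.
Qed.

Lemma pw_inv t a : 0 < a -> 0 <= t -> pw (pw t a) (/ a) = t.
Proof.
  intros Ha [H| <-]; [|rewrite (pw_neg 0), pw_neg; lra].
  rewrite (pw_pos t), pw_pos by (auto using Rpower_pos).
  rewrite Rpower_mult, Rinv_r, Rpower_1 by lra. auto.
Qed.

Lemma pw_inv' t a : 0 < a -> 0 <= t -> pw (pw t (/ a)) a = t.
Proof.
  intros Ha H. rewrite <- (Rinv_inv a) at 2. apply pw_inv; auto. apply Rinv_0_lt_compat; auto.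
Qed.

Lemma pw_le_exp t a : 0 < a < 1 -> 0 <= t -> pw t a <= exp t.
Proof.
  intros Ha Ht. destruct (Rle_dec t 0); [rewrite pw_neg by auto; left; apply exp_pos|].
  rewrite pw_pos by lra. unfold Rpower.
  assert (ln t <= t).
  { generalize (exp_ineq1_le (ln t)). rewrite exp_ln by lra. lra. }
  assert (H1 : a * ln t <= t) by (destruct (Rle_dec 0 (ln t)); nra).
  apply exp_le, H1.
Qed.

(** This is the Laplace transform of t^(al (k+1) - 1) after the substitution v = t^al, obtained from
    the integral for [Gamma] at the variable s v^(1/al). The singular power has become v^k, and the
    lower limit 0 is harmless. *)
Lemma gamma_laplace al k s : 0 < al -> 0 < s ->
  is_lim (fun V => / al * RInt (fun v => v ^ k * exp (- s * pw v (/ al))) 0 V) p_infty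
    (Gamma (al * (INR k + 1)) * Rpower s (- (al * (INR k + 1)))).
Proof.
  intros Ha Hs. set (b := al * (INR k + 1)).
  assert (Hb : 0 < b) by (unfold b; generalize (pos_INR k); nra).
  assert (Hia : 0 < / al) by (apply Rinv_0_lt_compat; auto).
  set (h := fun v => v ^ k * exp (- s * pw v (/ al))).
  assert (Cp := cont_pw (/ al) Hia).
  assert (Ch : cont h) by (unfold h; ct).
  set (g := fun v => s * Rpower v (/ al)).
  assert (Sub : forall c V, 0 < c <= V -> RInt (Gint b) (g c) (g V) = Rpower s b / al * RInt h c V).
  { intros c V Hc. rewrite <- RInt_Rscal by auto.
    rewrite <- (RInt_comp (Gint b) g (fun v => s * (/ al * Rpower v (/ al - 1)))).
    - apply RInt_ext. intros v Hv. rewrite Rmin_left in Hv by lra.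
      unfold scal; simpl; unfold mult; simpl. unfold Gint, g, h.
      rewrite pw_pos by lra. replace (- (s * Rpower v (/ al))) with (- s * Rpower v (/ al)) by ring.
      rewrite <- Rmult_assoc, <- (Rmult_assoc _ (v ^ k)). eqR. f_equal.
      rewrite Rpower_mult_distr || rewrite <- Rpower_mult_distr by (auto; apply Rpower_pos).
      rewrite Rpower_mult, <- Rpower_pow by lra.
      unfold Rdiv. rewrite <- (Rpower_1 s) at 1 by auto.
      replace (Rpower s 1 * (/ al * Rpower v (/ al - 1)) * (Rpower s (b - 1) * Rpower v (/ al * (b - 1))))
        with (/ al * (Rpower s 1 * Rpower s (b - 1)) * (Rpower v (/ al - 1) * Rpower v (/ al * (b - 1)))) by ring.
      rewrite <- !Rpower_plus. replace (1 + (b - 1)) with b by ring.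
      replace (/ al - 1 + / al * (b - 1)) with (INR k) by (unfold b; field; lra). ring.
    - intros v Hv. rewrite Rmin_left, Rmax_right in Hv by lra. apply Gint_continuous.
      unfold g. apply Rmult_lt_0_compat; auto. apply Rpower_pos.
    - intros v Hv. rewrite Rmin_left, Rmax_right in Hv by lra. split.
      + unfold g. apply is_derive_scal, is_derive_Rpower; lra.
      + apply (continuous_scal_r s (fun v => / al * Rpower v (/ al - 1))).
        apply (continuous_scal_r (/ al) (fun v => Rpower v (/ al - 1))). apply continuous_Rpower; lra. }
  assert (Hg : forall v, 0 < v -> 0 < g v) by (intros; unfold g; apply Rmult_lt_0_compat; auto; apply Rpower_pos).
  assert (Lim : forall eps, 0 < eps -> exists V0, forall V, V0 <= V ->
     Rabs (Rpower s b / al * RInt h 0 V - Gamma b) <= 2 * eps).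
  { intros eps He.
    destruct (Gamma_limit b Hb eps He) as [d [Mb [Hd [Hd1 [HM H]]]]].
    destruct (Rpower_small (/ al) (d / s) Hia ltac:(apply Rdiv_lt_0_compat; lra)) as [c1 [Hc1 H1]].
    set (q := Rpower s b / al). assert (Hq : 0 < q) by (apply Rdiv_lt_0_compat; [apply Rpower_pos|auto]).
    (* The three entries ensure that g c is small enough for the limit defining [Gamma], that the
       integrand is at most 1 on [0, c], and that the omitted piece, multiplied by q, stays below
       eps. *)
    set (c := Rmin (Rmin (c1 / 2) 1) (eps / q)).
    assert (Hq2 : 0 < eps / q) by (apply Rdiv_lt_0_compat; lra).
    assert (Hc : 0 < c) by (unfold c; repeat apply Rmin_case; lra).
    assert (A1 : c <= Rmin (c1 / 2) 1) by apply Rmin_l.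
    assert (A2 : c <= c1 / 2) by (apply Rle_trans with (1 := A1), Rmin_l).
    assert (A3 : c <= 1) by (apply Rle_trans with (1 := A1), Rmin_r).
    assert (A4 : c <= eps / q) by apply Rmin_r.
    exists (Rmax 1 (Rpower ((Mb + 1) / s) al)). intros V HV.
    assert (V1 := Rmax_l 1 (Rpower ((Mb + 1) / s) al)). assert (V2 := Rmax_r 1 (Rpower ((Mb + 1) / s) al)).
    assert (GV : Mb < g V).
    { unfold g. apply Rlt_le_trans with (Mb + 1); [lra|].
      replace (Mb + 1) with (s * ((Mb + 1) / s)) by (field; lra). apply Rmult_le_compat_l; [lra|].
      apply Rle_trans with (Rpower (Rpower ((Mb + 1) / s) al) (/ al)).
      - rewrite Rpower_mult, Rinv_r, Rpower_1 by (try lra; apply Rdiv_lt_0_compat; lra). lra.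
      - apply Rpower_le_base; [lra|]. split; [apply Rpower_pos|lra]. }
    assert (Gc : g c < d).
    { unfold g. apply Rlt_le_trans with (s * (d / s)); [|right; field; lra].
      apply Rmult_lt_compat_l; auto. apply H1; lra. }
    specialize (H (g c) (g V) (conj (Hg c Hc) Gc) GV).
    rewrite (Sub c V ltac:(lra)) in H. fold q in H |- *.
    rewrite <- (RInt_Rchasles h 0 c V) by auto.
    assert (S0 : Rabs (RInt h 0 c) <= c).
    { replace c with (1 * (c - 0)) at 2 by ring. apply RInt_abs_le_const; [lra|apply cont_ex_RInt; auto|].
      intros t Ht. unfold h. rewrite Rabs_mult, (Rabs_pos_eq (exp _)) by (left; apply exp_pos).
      rewrite <- RPow_abs, (Rabs_pos_eq t) by lra. rewrite <- (Rmult_1_r 1).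
      apply Rmult_le_compat; [apply pow_le; lra|left; apply exp_pos| |].
      - rewrite <- (pow1 k). apply pow_incr; lra.
      - apply exp_le_1. generalize (pw_ge_0 t (/ al)); nra. }
    assert (S1 : Rabs (q * RInt h 0 c) <= eps).
    { rewrite Rabs_mult, (Rabs_pos_eq q) by lra.
      apply Rle_trans with (q * (eps / q)); [|right; field; lra]. apply Rmult_le_compat_l; lra. }
    replace (q * (RInt h 0 c + RInt h c V) - Gamma b)
      with (q * RInt h 0 c + (q * RInt h c V - Gamma b)) by ring.
    eapply Rle_trans; [apply Rabs_triang|]. lra. }
  apply is_lim_spec; intros eps.
  assert (Hr : 0 < Rpower s b) by apply Rpower_pos.
  destruct (Lim (eps * Rpower s b / 4)) as [V0 HV0].
  { generalize (cond_pos eps); intro. apply Rdiv_lt_0_compat; [|lra]. apply Rmult_lt_0_compat; auto. }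
  exists V0. intros V HV. specialize (HV0 V ltac:(lra)). fold h. rewrite Rpower_Ropp.
  replace (/ al * RInt h 0 V - Gamma b * / Rpower s b)
    with ((Rpower s b / al * RInt h 0 V - Gamma b) * / Rpower s b) by (field; lra).
  rewrite Rabs_mult, (Rabs_pos_eq (/ _)) by (left; apply Rinv_0_lt_compat; auto).
  apply Rmult_lt_reg_r with (Rpower s b); auto. rewrite Rmult_assoc, Rinv_l, Rmult_1_r by lra.
  apply Rle_lt_trans with (1 := HV0). generalize (cond_pos eps); intro. nra.
Qed.

(** * Convolution with a weakly singular kernel *)

Lemma cont2_diag h g : cont2 h -> cont g -> cont (fun t => h t (g t)).
Proof.
  intros Hh Hg t. apply continuity_pt_filterlim. intros eps He.
  destruct (Hh t (g t) (mkposreal _ He)) as [d Hd]. simpl in Hd.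
  destruct (proj2 (continuity_pt_filterlim _ _) (Hg t) d (cond_pos d)) as [e [He' HH]].
  exists (Rmin d e); split; [apply Rmin_case; [apply cond_pos|auto]|].
  intros y [Hy1 Hy2]. simpl in *; unfold R_dist in *. apply Hd.
  - apply Rlt_le_trans with (1 := Hy2), Rmin_l.
  - apply HH. split; auto. apply Rlt_le_trans with (1 := Hy2), Rmin_r.
Qed.

Lemma is_derive_RInt_bound (k dk : R -> R -> R) (b : R -> R) T db :
  (forall x v, is_derive (fun x => k x v) x (dk x v)) -> cont2 k -> cont2 dk -> is_derive b T db ->
  is_derive (fun x => RInt (k x) 0 (b x)) T (RInt (dk T) 0 (b T) + k T (b T) * db).
Proof.
  intros Hd Ck Cdk Hb.
  assert (Cx : forall x, cont (k x)) by (intros x; apply cont2_fix1, Ck).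
  assert (E : forall x v, Derive (fun u => k u v) x = dk x v) by (intros; apply is_derive_unique, Hd).
  assert (CD : cont2 (fun u v => Derive (fun z => k z v) u)).
  { apply cont2_ext with dk; auto. }
  rewrite (RInt_ext (dk T) (fun t => Derive (fun u => k u t) T)) by (intros; symmetry; apply E).
  apply (is_derive_RInt_param_bound_comp_aux3 k 0 b T db); auto.
  - apply filter_forall; intros y; apply cont_ex_RInt, Cx.
  - exists (mkposreal 1 Rlt_0_1). apply filter_forall; intros y; apply cont_ex_RInt, Cx.
  - exists (mkposreal 1 Rlt_0_1). apply filter_forall; intros y t _; eexists; apply Hd.
  - exists (mkposreal 1 Rlt_0_1). intros; apply CD.
  - apply continuity_pt_filterlim, Cx.
Qed.

(* After the substitution [v = (t - s)^al] the integral [int_0^t (t-s)^(al-1) Psi ((t-s)^al) F s ds]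
   loses its singularity. *)
Definition convk (al : R) (Psi F : R -> R) (t : R) : R :=
  / al * RInt (fun v => Psi v * F (t - pw v (/ al))) 0 (pw t al).

Lemma cont_convk al Psi F : 0 < al -> cont Psi -> cont F -> cont (convk al Psi F).
Proof.
  intros Ha CP CF. unfold convk. apply (cont_mult (fun _ => / al)); [apply cont_const|].
  assert (Hia : 0 < / al) by (apply Rinv_0_lt_compat; auto).
  apply (cont2_diag (fun t w => RInt (fun v => Psi v * F (t - pw v (/ al))) 0 w) (fun t => pw t al)).
  - apply (cont2_RInt (fun t v => Psi v * F (t - pw v (/ al)))).
    apply (cont2_mult (fun _ v => Psi v)); [apply (cont2_of2 Psi CP)|].
    apply (cont2_comp F (fun t v => t - pw v (/ al))); auto.
    apply cont2_minus; [apply (cont2_of1 _ cont_id)|apply (cont2_of2 _ (cont_pw (/ al) Hia))].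
  - apply cont_pw, Ha.
Qed.

Lemma convk_le_0 al Psi F t : t <= 0 -> convk al Psi F t = 0.
Proof. intros H; unfold convk; rewrite pw_neg, RInt_Rpoint by auto; ring. Qed.

Lemma pw_root_le al v t : 0 < al -> 0 <= t -> v <= pw t al -> pw v (/ al) <= t.
Proof.
  intros Ha Ht Hv. rewrite <- (pw_inv t al) by auto. apply pw_le; auto. apply Rinv_0_lt_compat; auto.
Qed.

Lemma convk_bound al Psi F D c M : 0 < al < 1 -> cont Psi -> cont F -> 0 <= c ->
  (forall v, 0 <= v -> Rabs (Psi v) <= D * exp (c * pw v (/ al))) ->
  (forall t, Rabs (F t) <= M) -> bexp (c + 1) (/ al * (D * M)) (convk al Psi F).
Proof.
  intros Ha CP CF Hc HP HF t Ht. unfold convk.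
  assert (Hia : 0 < / al) by (apply Rinv_0_lt_compat; lra).
  assert (Cp := cont_pw (/ al) Hia).
  assert (D0 : 0 <= D).
  { specialize (HP 0 (Rle_refl 0)). rewrite (pw_neg 0), Rmult_0_r, exp_0 in HP by lra.
    generalize (Rabs_pos (Psi 0)); lra. }
  assert (M0 : 0 <= M) by (apply Rle_trans with (2 := HF 0), Rabs_pos).
  rewrite Rabs_mult, (Rabs_pos_eq (/ al)) by lra. rewrite Rmult_assoc.
  apply Rmult_le_compat_l; [lra|].
  apply Rle_trans with (D * exp (c * t) * M * (pw t al - 0)).
  - apply RInt_abs_le_const; [apply pw_ge_0| |].
    + apply cont_ex_RInt, cont_mult; auto. apply (cont_comp F); auto. ct.
    + intros v Hv. rewrite Rabs_mult. apply Rmult_le_compat; try apply Rabs_pos; auto.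
      apply Rle_trans with (1 := HP v ltac:(lra)). apply Rmult_le_compat_l; auto.
      apply exp_le, Rmult_le_compat_l; auto. apply pw_root_le; lra.
  - rewrite Rmult_plus_distr_r, exp_plus, Rmult_1_l, Rminus_0_r.
    assert (P := pw_le_exp t al Ha Ht). assert (0 < exp (c * t)) by apply exp_pos.
    replace (D * exp (c * t) * M * pw t al) with (D * M * exp (c * t) * pw t al) by ring.
    rewrite <- Rmult_assoc. apply Rmult_le_compat_l; auto.
    apply Rmult_le_pos; [apply Rmult_le_pos; auto|lra].
Qed.

(** The convolution theorem at finite T: both sides vanish at T = 0 and have the same derivative for
    T > 0, because exp (- s T) splits as exp (- s r) exp (- s (T - r)) with r = v^(1/al). *)
Lemma RInt_convk al Psi F s T : 0 < al < 1 -> cont Psi -> cont F -> 0 <= T ->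
  RInt (fun t => exp (- s * t) * convk al Psi F t) 0 T
  = / al * RInt (fun v => Psi v * exp (- s * pw v (/ al))
                          * RInt (fun w => exp (- s * w) * F w) 0 (T - pw v (/ al))) 0 (pw T al).
Proof.
  intros Ha CP CF HT.
  assert (Hia : 0 < / al) by (apply Rinv_0_lt_compat; lra).
  assert (Cp := cont_pw (/ al) Hia). assert (Cpa := cont_pw al (proj1 Ha)).
  assert (Cz := cont_convk al Psi F (proj1 Ha) CP CF).
  set (z := convk al Psi F) in *.
  set (G := fun x => RInt (fun w => exp (- s * w) * F w) 0 x).
  assert (Cg : cont (fun w => exp (- s * w) * F w)) by ct.
  assert (DG : forall x, is_derive G x (exp (- s * x) * F x)).
  { intros x; apply (cont_is_derive_RInt (fun w => exp (- s * w) * F w) 0 x Cg). }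
  assert (CG : cont G) by (apply (is_derive_cont _ _ DG)).
  set (k := fun T v => Psi v * exp (- s * pw v (/ al)) * G (T - pw v (/ al))).
  set (dk := fun T v => Psi v * exp (- s * pw v (/ al))
     * (exp (- s * (T - pw v (/ al))) * F (T - pw v (/ al)))).
  assert (Csub : cont2 (fun t v => t - pw v (/ al))).
  { apply cont2_minus; [apply (cont2_of1 _ cont_id)|apply (cont2_of2 _ Cp)]. }
  assert (C0 : cont2 (fun _ v => Psi v * exp (- s * pw v (/ al)))).
  { apply (cont2_of2 (fun v => Psi v * exp (- s * pw v (/ al)))). ct. }
  assert (Ck : cont2 k).
  { unfold k. apply (cont2_mult _ _ C0). apply (cont2_comp G _ CG Csub). }
  assert (Cdk : cont2 dk).
  { unfold dk. apply (cont2_mult _ _ C0).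
    apply (cont2_comp (fun x => exp (- s * x) * F x) _ Cg Csub). }
  set (H := fun T => RInt (fun t => exp (- s * t) * z t) 0 T - / al * RInt (k T) 0 (pw T al)).
  assert (CH : cont H).
  { unfold H. apply cont_minus; [apply cont_RInt; ct|].
    apply (cont_mult (fun _ => / al)); [apply cont_const|].
    apply (cont2_diag (fun t w => RInt (k t) 0 w) (fun t => pw t al)); auto. apply (cont2_RInt k 0 Ck). }
  assert (DH : forall x, 0 < x -> is_derive H x 0).
  { intros x Hx.
    assert (Db : is_derive (fun t => pw t al) x (al * Rpower x (al - 1))).
    { apply is_derive_ext_loc with (fun t => Rpower t al); [|apply is_derive_Rpower, Hx].
      apply (locally_interval _ x 0 p_infty); simpl; auto. intros y Hy _; symmetry; apply pw_pos, Hy. }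
    assert (D1 := is_derive_RInt_bound k dk (fun t => pw t al) x _
      ltac:(intros y v; unfold k, dk; apply is_derive_scal;
            replace (exp (- s * (y - pw v (/ al))) * F (y - pw v (/ al)))
              with (1 * (exp (- s * (y - pw v (/ al))) * F (y - pw v (/ al)))) by ring;
            apply (is_derive_comp G (fun y => y - pw v (/ al)));
            [apply DG|auto_derive; auto; ring]) Ck Cdk Db).
    (* The moving endpoint contributes nothing: there the inner integral runs over an empty
       range. *)
    assert (Z : k x (pw x al) = 0).
    { unfold k. rewrite pw_inv by lra. rewrite Rminus_diag. unfold G. rewrite RInt_Rpoint. ring. }
    cbv beta in D1. rewrite Z, Rmult_0_l, Rplus_0_r in D1.
    assert (E : RInt (dk x) 0 (pw x al) = exp (- s * x) * (al * z x)).
    { unfold z, convk. rewrite <- (Rmult_assoc al), Rinv_r, Rmult_1_l by lra.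
      rewrite <- RInt_Rscal.
      - apply RInt_ext; intros v _. unfold dk. eqR.
        replace (exp (- s * x)) with (exp (- s * pw v (/ al)) * exp (- s * (x - pw v (/ al))))
          by (rewrite <- exp_plus; f_equal; ring). ring.
      - apply cont_mult; auto. apply (cont_comp F); auto. ct. }
    rewrite E in D1.
    assert (D2 : is_derive (fun T => RInt (fun t => exp (- s * t) * z t) 0 T) x (exp (- s * x) * z x)).
    { apply (cont_is_derive_RInt (fun t => exp (- s * t) * z t)). ct. }
    replace 0 with (exp (- s * x) * z x - / al * (exp (- s * x) * (al * z x))) by (field; lra).
    apply (is_derive_minus (fun T => RInt (fun t => exp (- s * t) * z t) 0 T)
      (fun T => / al * RInt (k T) 0 (pw T al)) x _ _ D2).
    apply is_derive_scal. exact D1. }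
  assert (H00 : H 0 = 0).
  { unfold H. rewrite (pw_neg 0), !RInt_Rpoint by lra. ring. }
  assert (HT0 : H T = 0).
  { destruct HT as [HT| <-]; auto.
    (* The power t^al is not differentiable at 0, so the mean value theorem is used with derivatives
       in the open interval and continuity at the endpoint. *)
    destruct (MVT_gen H 0 T (fun _ => 0)) as [c [_ Hc]].
    - intros x Hx. rewrite Rmin_left in Hx by lra. apply DH; lra.
    - intros x _. apply continuity_pt_filterlim, CH.
    - rewrite H00 in Hc. lra. }
  unfold H in HT0. apply Rminus_diag_uniq. exact HT0.
Qed.

(** The inner transform up to T - r is replaced by its limit [fh], which gives the product. The
    error at r is of order exp (c r - s r - s (T - r)) <= exp ((c - s) T), and the range of
    integration has length T^al <= exp T; this explains the condition c + 1 < s. *)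
Lemma convk_lap al Psi F D c M (s phi fh : R) : 0 < al < 1 -> cont Psi -> cont F -> 0 <= c -> c + 1 < s ->
  (forall v, 0 <= v -> Rabs (Psi v) <= D * exp (c * pw v (/ al))) ->
  (forall t, Rabs (F t) <= M) ->
  is_lim (fun V => / al * RInt (fun v => Psi v * exp (- s * pw v (/ al))) 0 V) p_infty phi ->
  lap F s fh -> lap (convk al Psi F) s (phi * fh).
Proof.
  intros Ha CP CF Hc Hs HP HF Hphi HFh.
  assert (Hia : 0 < / al) by (apply Rinv_0_lt_compat; lra).
  assert (Cp := cont_pw (/ al) Hia).
  assert (D0 : 0 <= D).
  { specialize (HP 0 (Rle_refl 0)). rewrite (pw_neg 0), Rmult_0_r, exp_0 in HP by lra.
    generalize (Rabs_pos (Psi 0)); lra. }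
  assert (M0 : 0 <= M) by (apply Rle_trans with (2 := HF 0), Rabs_pos).
  destruct (lap_ex F 0 M s CF (bexp_bounded M F ltac:(auto)) ltac:(lra)) as [fh' [L1 L2]].
  assert (E : fh' = fh) by (apply (lap_unique F s); auto). subst fh'.
  rewrite Rminus_0_r in L2.
  assert (Cps : cont (fun v => Psi v * exp (- s * pw v (/ al)))) by ct.
  assert (Cg : cont (fun w => exp (- s * w) * F w)) by ct.
  set (G := fun x => RInt (fun w => exp (- s * w) * F w) 0 x) in *.
  assert (CG : cont G) by (apply cont_RInt, Cg).
  apply is_lim_ext_loc with (fun T =>
     / al * RInt (fun v => Psi v * exp (- s * pw v (/ al))) 0 (pw T al) * fh
     + / al * RInt (fun v => Psi v * exp (- s * pw v (/ al)) * (G (T - pw v (/ al)) - fh)) 0 (pw T al)).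
  { exists 0; intros T HT. rewrite RInt_convk by (auto; lra).
    assert (CC : cont (fun v => G (T - pw v (/ al)))) by (apply (cont_comp G); auto; ct).
    rewrite (RInt_ext (fun v => Psi v * exp (- s * pw v (/ al)) * (G (T - pw v (/ al)) - fh))
      (fun v => Psi v * exp (- s * pw v (/ al)) * G (T - pw v (/ al))
       - fh * (Psi v * exp (- s * pw v (/ al))))) by (intros; eqR; ring).
    rewrite RInt_Rminus, RInt_Rscal by ct. unfold G. ring. }
  replace (Finite (phi * fh)) with (Finite (phi * fh + 0)) by (f_equal; ring).
  apply is_lim_plus'.
  - replace (Finite (phi * fh)) with (Rbar_mult phi fh) by reflexivity.
    apply (is_lim_scal_r (fun T => / al * RInt (fun v => Psi v * exp (- s * pw v (/ al))) 0 (pw T al))).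
    apply (is_lim_comp (fun V => / al * RInt (fun v => Psi v * exp (- s * pw v (/ al))) 0 V)
      (fun T => pw T al) p_infty phi p_infty); auto.
    + apply is_lim_spec. intros K. exists (Rmax 1 (Rpower (Rmax K 1 + 1) (/ al))). intros T HT.
      assert (A := Rmax_l 1 (Rpower (Rmax K 1 + 1) (/ al))). assert (B := Rmax_r 1 (Rpower (Rmax K 1 + 1) (/ al))).
      assert (K1 := Rmax_l K 1). assert (K2 := Rmax_r K 1).
      rewrite pw_pos by lra. apply Rlt_le_trans with (Rmax K 1 + 1); [lra|].
      apply Rle_trans with (Rpower (Rpower (Rmax K 1 + 1) (/ al)) al).
      * rewrite Rpower_mult, Rinv_l, Rpower_1 by lra. lra.
      * apply Rpower_le_base; [lra|]. split; [apply Rpower_pos|lra].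
    + exists 0; intros; discriminate.
  - apply is_lim_le_tail with (fun T => / al * (D * (M / s)) * exp (- (s - c - 1) * T)).
    + intros T HT. rewrite Rminus_0_r, Rabs_mult, (Rabs_pos_eq (/ al)) by lra.
      rewrite Rmult_assoc. apply Rmult_le_compat_l; [lra|].
      apply Rle_trans with (D * (M / s) * exp (c * T - s * T) * (pw T al - 0)).
      * apply RInt_abs_le_const; [apply pw_ge_0| |].
        -- apply cont_ex_RInt. assert (CC : cont (fun v => G (T - pw v (/ al)))) by (apply (cont_comp G); auto; ct). ct.
        -- intros v Hv. assert (Hr : pw v (/ al) <= T) by (apply pw_root_le; lra).
           rewrite !Rabs_mult, (Rabs_pos_eq (exp _)) by (left; apply exp_pos).
           assert (B1 := HP v ltac:(lra)). assert (B2 := L2 (T - pw v (/ al)) ltac:(lra)).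
           fold (G (T - pw v (/ al))) in B2.
           apply Rle_trans with (D * exp (c * pw v (/ al)) * exp (- s * pw v (/ al))
             * (M / s * exp (- s * (T - pw v (/ al))))).
           ++ apply Rmult_le_compat; auto; try apply Rabs_pos.
              ** apply Rmult_le_pos; [apply Rabs_pos|left; apply exp_pos].
              ** apply Rmult_le_compat_r; [left; apply exp_pos|auto].
           ++ replace (D * exp (c * pw v (/ al)) * exp (- s * pw v (/ al)) * (M / s * exp (- s * (T - pw v (/ al)))))
                with (D * (M / s) * (exp (c * pw v (/ al)) * (exp (- s * pw v (/ al)) * exp (- s * (T - pw v (/ al))))))
                by ring.
              rewrite <- !exp_plus. apply Rmult_le_compat_l.
              ** apply Rmult_le_pos; auto. apply Rdiv_le_0_compat; lra.
              ** apply exp_le. assert (c * pw v (/ al) <= c * T) by (apply Rmult_le_compat_l; auto). lra.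
      * assert (P := pw_le_exp T al Ha HT). rewrite Rminus_0_r.
        replace (- (s - c - 1) * T) with ((c * T - s * T) + T) by ring.
        rewrite exp_plus, <- Rmult_assoc. apply Rmult_le_compat_l; auto.
        apply Rmult_le_pos; [apply Rmult_le_pos; auto; apply Rdiv_le_0_compat; lra|left; apply exp_pos].
    + apply is_lim_exp_decay; lra.
Qed.

(** * Matrix Mittag-Leffler functions *)

Lemma rsum_ext n f g : (forall k, (k < n)%nat -> f k = g k) -> rsum n f = rsum n g.
Proof.
  induction n as [|n IH]; simpl; intros H; auto.
  rewrite IH, H; auto.
Qed.
Lemma rsum_plus n f g : rsum n (fun k => f k + g k) = rsum n f + rsum n g.
Proof. induction n as [|n IH]; simpl; [ring|rewrite IH; ring]. Qed.
Lemma rsum_scal n c f : rsum n (fun k => c * f k) = c * rsum n f.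
Proof. induction n as [|n IH]; simpl; [ring|rewrite IH; ring]. Qed.
Lemma rsum_0 n : rsum n (fun _ => 0) = 0.
Proof. induction n as [|n IH]; simpl; [auto|rewrite IH; ring]. Qed.
Lemma rsum_swap n m (f : nat -> nat -> R) :
  rsum n (fun i => rsum m (fun j => f i j)) = rsum m (fun j => rsum n (fun i => f i j)).
Proof.
  induction n as [|n IH]; simpl; [symmetry; apply rsum_0|].
  rewrite IH, <- rsum_plus. reflexivity.
Qed.
Lemma rsum_le n f g : (forall k, (k < n)%nat -> f k <= g k) -> rsum n f <= rsum n g.
Proof. induction n as [|n IH]; simpl; intros H; [lra|apply Rplus_le_compat; auto]. Qed.
Lemma rsum_abs n f : Rabs (rsum n f) <= rsum n (fun k => Rabs (f k)).
Proof.
  induction n as [|n IH]; simpl; [rewrite Rabs_R0; lra|].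
  eapply Rle_trans; [apply Rabs_triang|lra].
Qed.
Lemma rsum_const n c : rsum n (fun _ => c) = INR n * c.
Proof. induction n as [|n IH]; [simpl; ring|rewrite S_INR; simpl; rewrite IH; ring]. Qed.
Lemma rsum_mid n i f : (i < n)%nat -> rsum n (fun j => mid i j * f j) = f i.
Proof.
  assert (Z : forall m, (m <= i)%nat -> rsum m (fun j => mid i j * f j) = 0).
  { induction m as [|m IH]; intros Hm; simpl; auto. rewrite IH by lia.
    unfold mid. destruct (Nat.eqb_spec i m); [lia|ring]. }
  induction n as [|n IH]; intros Hi; [lia|]. simpl.
  destruct (Nat.eq_dec i n) as [->|Hn].
  - rewrite Z by auto. unfold mid. rewrite Nat.eqb_refl. ring.
  - rewrite IH by lia. unfold mid. destruct (Nat.eqb_spec i n); [lia|ring].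
Qed.

Lemma row_bound d (A : nat -> nat -> R) : exists a, 1 <= a /\
  forall i, (i < d)%nat -> rsum d (fun j => Rabs (A i j)) <= a.
Proof.
  assert (H : forall n, exists a, 1 <= a /\ forall i, (i < n)%nat -> rsum d (fun j => Rabs (A i j)) <= a).
  { induction n as [|n [a [Ha IH]]]; [exists 1; split; [lra|intros; lia]|].
    exists (Rmax a (rsum d (fun j => Rabs (A n j)))). split.
    - apply Rle_trans with (1 := Ha), Rmax_l.
    - intros i Hi. destruct (Nat.eq_dec i n) as [->|]; [apply Rmax_r|].
      apply Rle_trans with (2 := Rmax_l _ _), IH; lia. }
  apply H.
Qed.

Lemma mpow_bound d A a : 1 <= a -> (forall i, (i < d)%nat -> rsum d (fun j => Rabs (A i j)) <= a) ->
  forall k i j, (i < d)%nat -> Rabs (mpow d A k i j) <= a ^ k.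
Proof.
  intros Ha HA. induction k as [|k IH]; intros i j Hi; simpl.
  - unfold mid. destruct (Nat.eqb i j); [rewrite Rabs_R1|rewrite Rabs_R0]; lra.
  - unfold mmul. eapply Rle_trans; [apply rsum_abs|].
    apply Rle_trans with (rsum d (fun l => a ^ k * Rabs (A i l))).
    + apply rsum_le; intros l Hl. rewrite Rabs_mult, Rmult_comm.
      apply Rmult_le_compat_r; [apply Rabs_pos|auto].
    + rewrite rsum_scal, Rmult_comm. apply Rmult_le_compat_r; [apply pow_le; lra|auto].
Qed.

Lemma mpow_mscale d A c k i j : mpow d (mscale c A) k i j = c ^ k * mpow d A k i j.
Proof.
  revert i j. induction k as [|k IH]; intros i j; simpl; [ring|].
  unfold mmul. rewrite <- rsum_scal. apply rsum_ext; intros l _.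
  rewrite IH. unfold mscale. ring.
Qed.

(* Taking [R = b (1 + u)] with [b^al = 2 a] in [Gamma_lower] trades a fixed exponential factor
   for geometric decay in [k]. *)
Lemma ML_term_bound al a : 0 < al < 1 -> 1 <= a -> exists D c, 0 <= D /\ 0 < c /\
  (forall s, c < s -> a * Rpower s (- al) <= 1 / 2) /\
  forall k v, 0 <= v -> a ^ k * v ^ k / Gamma (al * INR k + al) <= D * exp (c * pw v (/ al)) * (1 / 2) ^ k.
Proof.
  intros Ha H1.
  set (b := Rpower (2 * a) (/ al)). assert (Pb : 0 < b) by apply Rpower_pos.
  assert (Eb : Rpower b al = 2 * a) by (unfold b; rewrite Rpower_mult, Rinv_l, Rpower_1; lra).
  (* With r = b (1 + u) and r + 1 <= exp r, the factor (r + 1) exp (r + 1) is at most exp (2 r + 1)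
     = exp (2 b + 1) exp (2 b u). *)
  exists (exp (2 * b + 1)), (2 * b). split; [left; apply exp_pos|]. split; [lra|]. split.
  - intros s Hs. rewrite Rpower_Ropp.
    assert (2 * a <= Rpower s al) by (rewrite <- Eb; apply Rpower_le_base; lra).
    apply Rle_trans with (a * / (2 * a)); [|right; field; lra].
    apply Rmult_le_compat_l; [lra|apply Rinv_le_contravar; lra].
  - intros k v Hv. set (u := pw v (/ al)). assert (Pu : 0 <= u) by apply pw_ge_0.
    set (r := b * (1 + u)). assert (Pr : 0 < r) by (unfold r; nra).
    (* Since be = al (k + 1), the power b^be is (2 a)^(k+1): against a^k it leaves at most 2^(-k),
       while (1 + u)^be absorbs v^k. *)
    set (be := al * INR k + al). assert (Pbe : 0 < be) by (unfold be; generalize (pos_INR k); nra).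
    assert (G := Gamma_lower be r Pbe Pr). assert (PG := Gamma_pos be Pbe).
    assert (Prb := Rpower_pos r be). assert (Pe := exp_pos (r + 1)).
    assert (Er : Rpower r be = (2 * a) ^ S k * Rpower (1 + u) be).
    { unfold r. rewrite Rpower_mult_distr || rewrite <- Rpower_mult_distr by lra.
      f_equal. rewrite <- Eb, <- Rpower_pow, Rpower_mult by apply Rpower_pos.
      f_equal. unfold be. rewrite S_INR. ring. }
    assert (Ev : v ^ k <= Rpower (1 + u) be).
    { assert (V : v ^ k <= Rpower (1 + u) (al * INR k)).
      { rewrite <- (pw_inv' v al) by lra. fold u.
        rewrite <- Rpower_mult, Rpower_pow by apply Rpower_pos.
        apply pow_incr. split; [apply pw_ge_0|].
        destruct (Rle_dec u 0) as [U|U]; [rewrite pw_neg by auto; left; apply Rpower_pos|].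
        rewrite pw_pos by lra. apply Rpower_le_base; lra. }
      apply Rle_trans with (1 := V). apply Rle_Rpower; [lra|unfold be; lra]. }
    assert (Pu1 := Rpower_pos (1 + u) be).
    assert (Pk : 0 < (2 * a) ^ S k) by (apply pow_lt; lra).
    assert (Pa : 0 < a ^ k) by (apply pow_lt; lra).
    assert (Pvk : 0 <= v ^ k) by (apply pow_le; auto).
    apply Rle_trans with (a ^ k * v ^ k * ((r + 1) * exp (r + 1) / Rpower r be)).
    + apply Rmult_le_compat_l; [nra|].
      replace ((r + 1) * exp (r + 1) / Rpower r be) with (/ (Rpower r be / ((r + 1) * exp (r + 1))))
        by (field; repeat split; lra).
      apply Rinv_le_contravar; auto. apply Rdiv_lt_0_compat; auto. apply Rmult_lt_0_compat; lra.
    + rewrite Er.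
      apply Rle_trans with ((r + 1) * exp (r + 1) * (1 / 2) ^ k).
      * replace (a ^ k * v ^ k * ((r + 1) * exp (r + 1) / ((2 * a) ^ S k * Rpower (1 + u) be)))
          with ((r + 1) * exp (r + 1) * (a ^ k / (2 * a) ^ S k) * (v ^ k / Rpower (1 + u) be))
          by (field; split; lra).
        assert (E1 : a ^ k / (2 * a) ^ S k <= (1 / 2) ^ k).
        { simpl. rewrite Rpow_mult_distr. replace ((1 / 2) ^ k) with (/ 2 ^ k)
            by (rewrite <- pow_inv; f_equal; field).
          assert (P2 : 0 < 2 ^ k) by (apply pow_lt; lra).
          replace (a ^ k / (2 * a * (2 ^ k * a ^ k))) with (/ (2 * a) * / 2 ^ k) by (field; repeat split; lra).
          rewrite <- (Rmult_1_l (/ 2 ^ k)) at 2. apply Rmult_le_compat_r; [left; apply Rinv_0_lt_compat; auto|].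
          rewrite <- Rinv_1. apply Rinv_le_contravar; lra. }
        assert (E2 : v ^ k / Rpower (1 + u) be <= 1).
        { apply Rmult_le_reg_r with (Rpower (1 + u) be); auto.
          unfold Rdiv. rewrite Rmult_assoc, Rinv_l, Rmult_1_r by lra. lra. }
        rewrite <- (Rmult_1_r ((r + 1) * exp (r + 1) * (1 / 2) ^ k)).
        apply Rmult_le_compat; auto.
        -- apply Rmult_le_pos; [apply Rmult_le_pos; lra|apply Rdiv_le_0_compat; lra].
        -- apply Rdiv_le_0_compat; auto.
        -- apply Rmult_le_compat_l; auto. apply Rmult_le_pos; lra.
      * apply Rmult_le_compat_r; [apply pow_le; lra|].
        rewrite <- exp_plus. apply Rle_trans with (exp r * exp (r + 1)).
        -- apply Rmult_le_compat_r; [lra|]. generalize (exp_ineq1_le r); lra.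
        -- rewrite <- exp_plus. apply exp_le. unfold r. lra.
Qed.

Lemma series_half_bound (a : nat -> R) C : (forall k, Rabs (a k) <= C * (1 / 2) ^ k) ->
  ex_series a /\ Rabs (Series a) <= 2 * C /\ forall n, Rabs (Series a - sum_n a n) <= C * (1 / 2) ^ n.
Proof.
  intros H.
  assert (G : forall K, is_series (fun k => K * (1 / 2) ^ k) (2 * K)).
  { intros K. replace (2 * K) with (K * / (1 - 1 / 2)) by field.
    apply (is_series_scal K (fun k => (1 / 2) ^ k)), is_series_geom. rewrite Rabs_pos_eq; lra. }
  assert (W : forall b K, (forall k, Rabs (b k) <= K * (1 / 2) ^ k) -> ex_series b /\ Rabs (Series b) <= 2 * K).
  { intros b K Hb.
    assert (Ea : ex_series (fun k => Rabs (b k))).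
    { apply (ex_series_le (fun k => Rabs (b k)) (fun k => K * (1 / 2) ^ k)); [|eexists; apply G].
      intros k. unfold norm; simpl; unfold abs; simpl. rewrite Rabs_Rabsolu. auto. }
    split; [apply ex_series_Rabs, Ea|].
    apply Rle_trans with (Series (fun k => Rabs (b k))); [apply Series_Rabs, Ea|].
    rewrite <- (is_series_unique _ _ (G K)). apply Series_le; [|eexists; apply G].
    intros k; split; [apply Rabs_pos|auto]. }
  destruct (W a C H) as [E1 E2]. split; [|split]; auto.
  intros n. rewrite (Series_incr_n a (S n)) by (auto; lia). simpl pred.
  rewrite <- sum_n_Reals. replace (sum_n a n + Series (fun k => a (S n + k)%nat) - sum_n a n)
    with (Series (fun k => a (S n + k)%nat)) by ring.
  replace (C * (1 / 2) ^ n) with (2 * (C * (1 / 2) ^ S n)) by (simpl; field).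
  apply W. intros k. rewrite Rmult_assoc, <- pow_add. apply H.
Qed.

Definition Mser (al : R) (d : nat) (A : nat -> nat -> R) (i j k : nat) : R :=
  mpow d A k i j / Gamma (al * INR k + al).

(** An entry of E_(al,al)(v A) as a real power series in v, which stands for t^al. *)
Definition Mker (al : R) (d : nat) (A : nat -> nat -> R) (i j : nat) : R -> R := PSeries (Mser al d A i j).

Lemma CV_radius_of_bounded a : (forall r, exists M, forall n, Rabs (a n * r ^ n) <= M) ->
  CV_radius a = p_infty.
Proof.
  intros H. destruct (CV_radius_bounded a) as [U _].
  destruct (CV_radius a) as [r| |] eqn:E; auto.
  - destruct (H (r + 1)) as [M HM]. assert (X := U (r + 1) (ex_intro _ M HM)). simpl in X. lra.
  - destruct (H 0) as [M HM]. destruct (U 0 (ex_intro _ M HM)).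
Qed.

Lemma pos_series_bound al a D c (m : nat -> R) v :
  0 < al < 1 -> 0 <= v -> (forall k, Rabs (m k) <= a ^ k) ->
  (forall k v, 0 <= v -> a ^ k * v ^ k / Gamma (al * INR k + al) <= D * exp (c * pw v (/ al)) * (1 / 2) ^ k) ->
  forall k w, Rabs w <= v -> Rabs (m k / Gamma (al * INR k + al) * w ^ k) <= D * exp (c * pw v (/ al)) * (1 / 2) ^ k.
Proof.
  intros Ha Hv Hm HD k w Hw. apply Rle_trans with (2 := HD k v Hv).
  assert (PG : 0 < Gamma (al * INR k + al)) by (apply Gamma_pos; generalize (pos_INR k); nra).
  unfold Rdiv. rewrite !Rabs_mult, (Rabs_pos_eq (/ _)), <- RPow_abs by (left; apply Rinv_0_lt_compat; auto).
  replace (a ^ k * v ^ k * / Gamma (al * INR k + al)) with (a ^ k * / Gamma (al * INR k + al) * v ^ k) by ring.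
  assert (0 < / Gamma (al * INR k + al)) by (apply Rinv_0_lt_compat; auto).
  apply Rmult_le_compat.
  - apply Rmult_le_pos; [apply Rabs_pos|lra].
  - apply pow_le, Rabs_pos.
  - apply Rmult_le_compat_r; [lra|auto].
  - apply pow_incr; split; [apply Rabs_pos|auto].
Qed.

(** The transform is computed on partial sums, term by term; the remainder after n terms is at most
    C1 2^(-n) uniformly in the upper limit V, so the limits in n and V commute. The resulting series
    q (I + q A + q^2 A^2 + ...) with q = s^(-al) is the resolvent of A at s^al. One pair of
    constants serves all entries. *)
Lemma Mker_facts al d A : 0 < al < 1 -> exists D c, 0 <= D /\ 0 < c /\
  forall i j, (i < d)%nat -> (j < d)%nat ->
   CV_radius (Mser al d A i j) = p_infty /\ cont (Mker al d A i j) /\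
   (forall v, 0 <= v -> Rabs (Mker al d A i j v) <= D * exp (c * pw v (/ al))) /\
   forall s, c < s ->
     ex_series (fun k => mpow d A k i j * Rpower s (- al) ^ k) /\
     is_lim (fun V => / al * RInt (fun v => Mker al d A i j v * exp (- s * pw v (/ al))) 0 V) p_infty
       (Rpower s (- al) * Series (fun k => mpow d A k i j * Rpower s (- al) ^ k)).
Proof.
  intros Ha. destruct (row_bound d A) as [a [Ha1 HA]].
  destruct (ML_term_bound al a Ha Ha1) as [D [c [HD [Hc [Hgeo HT]]]]].
  exists (2 * D), c. split; [lra|]. split; auto. intros i j Hi Hj.
  assert (Hm : forall k, Rabs (mpow d A k i j) <= a ^ k) by (intros k; apply mpow_bound; auto).
  assert (B : forall v, 0 <= v -> forall k w, Rabs w <= v ->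
     Rabs (Mser al d A i j k * w ^ k) <= D * exp (c * pw v (/ al)) * (1 / 2) ^ k).
  { intros v Hv. apply (pos_series_bound al a D c (fun k => mpow d A k i j) v); auto. }
  assert (CV : CV_radius (Mser al d A i j) = p_infty).
  { apply CV_radius_of_bounded. intros r. exists (D * exp (c * pw (Rabs r) (/ al))). intros n.
    apply Rle_trans with (1 := B (Rabs r) (Rabs_pos r) n r (Rle_refl _)).
    rewrite <- (Rmult_1_r (D * _)) at 2. apply Rmult_le_compat_l.
    - apply Rmult_le_pos; [lra|left; apply exp_pos].
    - apply Rle_trans with (1 ^ n); [apply pow_incr; lra|rewrite pow1; lra]. }
  assert (Ck : cont (Mker al d A i j)).
  { intros x. apply continuity_pt_filterlim, PSeries_continuity. rewrite CV. exact I. }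
  assert (Sm : forall v, 0 <= v -> Rabs (Mker al d A i j v) <= 2 * (D * exp (c * pw v (/ al))) /\
     forall n, Rabs (Mker al d A i j v - sum_n (fun k => Mser al d A i j k * v ^ k) n)
        <= D * exp (c * pw v (/ al)) * (1 / 2) ^ n).
  { intros v Hv.
    destruct (series_half_bound (fun k => Mser al d A i j k * v ^ k) (D * exp (c * pw v (/ al)))) as [_ [S1 S2]].
    - intros k. apply B; auto. rewrite Rabs_pos_eq; lra.
    - split; auto. }
  split; [auto|]. split; [auto|]. split.
  { intros v Hv. rewrite Rmult_assoc. apply Sm, Hv. }
  intros s Hs. set (q := Rpower s (- al)). assert (Pq : 0 < q) by apply Rpower_pos.
  assert (Hia : 0 < / al) by (apply Rinv_0_lt_compat; lra).
  assert (Cp := cont_pw (/ al) Hia).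
  destruct (series_half_bound (fun k => mpow d A k i j * q ^ k) 1) as [Es [_ Sn]].
  { intros k. rewrite Rabs_mult, (Rabs_pos_eq (q ^ k)) by (apply pow_le; lra).
    rewrite Rmult_1_l. apply Rle_trans with (a ^ k * q ^ k).
    - apply Rmult_le_compat_r; [apply pow_le; lra|auto].
    - rewrite <- Rpow_mult_distr. apply pow_incr. split; [nra|]. apply Hgeo, Hs. }
  split; [exact Es|].
  set (S := Series (fun k => mpow d A k i j * q ^ k)) in *.
  set (e := fun v => exp (- s * pw v (/ al))). assert (Ce : cont e) by (unfold e; ct).
  set (P := fun (n : nat) (v : R) => sum_n (fun k => Mser al d A i j k * v ^ k) n : R).
  assert (CP : forall n, cont (P n)).
  { intros n. unfold P. induction n as [|n IH].
    - apply cont_ext with (fun v => Mser al d A i j 0 * v ^ 0); [intros t; rewrite sum_O; reflexivity|].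
      apply cont_mult; [apply cont_const|apply cont_pow, cont_id].
    - apply cont_ext with (fun v => sum_n (fun k => Mser al d A i j k * v ^ k) n + Mser al d A i j (Datatypes.S n) * v ^ (Datatypes.S n)).
      + intros t; rewrite sum_Sn; reflexivity.
      + apply cont_plus; auto. apply cont_mult; [apply cont_const|apply cont_pow, cont_id]. }
  assert (LP : forall n, is_lim (fun V => / al * RInt (fun v => P n v * e v) 0 V) p_infty
     (q * sum_n (fun k => mpow d A k i j * q ^ k) n)).
  { assert (L1 : forall k, is_lim (fun V => / al * RInt (fun v => Mser al d A i j k * v ^ k * e v) 0 V) p_infty
       (q * (mpow d A k i j * q ^ k))).
    { intros k. assert (L := gamma_laplace al k s (proj1 Ha) ltac:(lra)).
      apply is_lim_ext with (fun V => Mser al d A i j k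
         * (/ al * RInt (fun v => v ^ k * exp (- s * pw v (/ al))) 0 V)).
      - intros V. rewrite <- Rmult_assoc, (Rmult_comm _ (/ al)), Rmult_assoc, <- RInt_Rscal by ct.
        f_equal. apply RInt_ext; intros; unfold e; eqR; ring.
      - replace (Finite (q * (mpow d A k i j * q ^ k))) with (Rbar_mult (Mser al d A i j k)
          (Gamma (al * (INR k + 1)) * Rpower s (- (al * (INR k + 1))))); [apply is_lim_scal_l, L|].
        simpl. f_equal. unfold Mser. replace (al * INR k + al) with (al * (INR k + 1)) by ring.
        assert (PG : 0 < Gamma (al * (INR k + 1))) by (apply Gamma_pos; generalize (pos_INR k); nra).
        assert (Eq : Rpower s (- (al * (INR k + 1))) = q ^ k * q).
        { unfold q. rewrite <- Rpower_pow by apply Rpower_pos. rewrite Rpower_mult, <- Rpower_plus.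
          f_equal; ring. }
        rewrite Eq. field. lra. }
    induction n as [|n IH].
    - rewrite sum_O. apply is_lim_ext with (2 := L1 0%nat). intros V. f_equal.
      apply RInt_ext; intros v _. unfold P. rewrite sum_O. reflexivity.
    - apply is_lim_ext with (fun V => / al * RInt (fun v => P n v * e v) 0 V
         + / al * RInt (fun v => Mser al d A i j (Datatypes.S n) * v ^ (Datatypes.S n) * e v) 0 V).
      + intros V. rewrite <- Rmult_plus_distr_l. rewrite <- RInt_Rplus by (specialize (CP n); ct).
        f_equal. apply RInt_ext; intros v _. unfold P. rewrite sum_Sn. unfold plus; simpl; eqR; ring.
      + assert (L2 := is_lim_plus' _ _ _ _ _ IH (L1 (Datatypes.S n))).
        rewrite sum_Sn. cbv [plus]. rewrite <- Rmult_plus_distr_l in L2. exact L2. }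
  set (c1 := s - c). assert (Hc1 : 0 < c1) by (unfold c1; lra).
  set (C1 := / al * (D * (exp c1 / c1))).
  assert (HC1 : 0 <= C1).
  { unfold C1. repeat apply Rmult_le_pos; try lra; [left; apply exp_pos|left; apply Rinv_0_lt_compat; lra]. }
  assert (Ap : forall n V, 0 <= V -> Rabs (/ al * RInt (fun v => Mker al d A i j v * e v) 0 V
       - / al * RInt (fun v => P n v * e v) 0 V) <= C1 * (1 / 2) ^ n).
  { intros n V HV. assert (Cn := CP n).
    rewrite <- Rmult_minus_distr_l, <- RInt_Rminus by ct.
    rewrite Rabs_mult, (Rabs_pos_eq (/ al)) by lra. unfold C1. rewrite !Rmult_assoc.
    apply Rmult_le_compat_l; [lra|].
    apply Rle_trans with (RInt (fun v => D * (1 / 2) ^ n * exp c1 * exp (- c1 * v)) 0 V).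
    - apply RInt_abs_le; auto; [apply cont_ex_RInt; ct|apply cont_ex_RInt; ct|].
      intros v Hv. replace (Mker al d A i j v * e v - P n v * e v) with ((Mker al d A i j v - P n v) * e v) by ring.
      unfold e at 1. rewrite Rabs_mult, (Rabs_pos_eq (exp _)) by (left; apply exp_pos).
      apply Rle_trans with (D * exp (c * pw v (/ al)) * (1 / 2) ^ n * exp (- s * pw v (/ al))).
      + apply Rmult_le_compat_r; [left; apply exp_pos|]. apply Sm; lra.
      + replace (D * exp (c * pw v (/ al)) * (1 / 2) ^ n * exp (- s * pw v (/ al)))
          with (D * (1 / 2) ^ n * (exp (c * pw v (/ al)) * exp (- s * pw v (/ al)))) by ring.
        rewrite (Rmult_assoc (D * (1 / 2) ^ n) (exp c1)), <- !exp_plus. apply Rmult_le_compat_l.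
        * apply Rmult_le_pos; [lra|apply pow_le; lra].
        * apply exp_le.
          (* As 1/al > 1, this turns exp (- c1 v^(1/al)) into exp c1 times the integrable exp (- c1
             v). *)
          assert (Hpw : v - 1 <= pw v (/ al)).
          { destruct (Rle_dec v 1) as [V1|V1]; [generalize (pw_ge_0 v (/ al)); lra|].
            rewrite pw_pos by lra. apply Rle_trans with (Rpower v 1); [rewrite Rpower_1; lra|].
            apply Rle_Rpower; [lra|]. rewrite <- Rinv_1. apply Rinv_le_contravar; lra. }
          unfold c1. nra.
    - rewrite RInt_exp_decay by lra. rewrite Rmult_0_r, exp_0.
      replace (D * (exp c1 / c1 * (1 / 2) ^ n)) with (D * (1 / 2) ^ n * exp c1 / c1 * 1) by (field; lra).
      apply Rmult_le_compat_l; [|generalize (exp_pos (- c1 * V)); lra].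
      apply Rdiv_le_0_compat; auto. repeat apply Rmult_le_pos; try lra; [apply pow_le; lra|left; apply exp_pos]. }
  apply is_lim_spec; intros eps.
  assert (Pe := cond_pos eps).
  destruct (pow_lt_1_zero (1 / 2) ltac:(rewrite Rabs_pos_eq; lra) (eps / (3 * (C1 + q + 1)))
    ltac:(apply Rdiv_lt_0_compat; lra)) as [n Hn].
  specialize (Hn n (Nat.le_refl n)). rewrite Rabs_pos_eq in Hn by (apply pow_le; lra).
  assert (Hn' : (C1 + q) * (1 / 2) ^ n < eps / 3).
  { apply Rle_lt_trans with ((C1 + q + 1) * (1 / 2) ^ n).
    - apply Rmult_le_compat_r; [apply pow_le; lra|lra].
    - replace (eps / 3) with ((C1 + q + 1) * (eps / (3 * (C1 + q + 1)))) by (field; lra).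
      apply Rmult_lt_compat_l; lra. }
  assert (L := LP n). apply is_lim_spec in L.
  destruct (L (mkposreal (eps / 3) ltac:(lra))) as [V0 HV0]. simpl in HV0.
  exists (Rmax 0 V0). intros V HV.
  assert (A1 := Rmax_l 0 V0). assert (A2 := Rmax_r 0 V0).
  specialize (HV0 V ltac:(lra)). specialize (Ap n V ltac:(lra)). specialize (Sn n). fold e.
  change (fun v => Mker al d A i j v * exp (- s * pw v (/ al))) with (fun v => Mker al d A i j v * e v).
  set (X := / al * RInt (fun v => Mker al d A i j v * e v) 0 V) in *.
  set (Y := / al * RInt (fun v => P n v * e v) 0 V) in *.
  set (T := sum_n (fun k => mpow d A k i j * q ^ k) n) in *.
  replace (X - q * S) with ((X - Y) + ((Y - q * T) + q * - (S - T))) by ring.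
  eapply Rle_lt_trans; [apply Rabs_triang|].
  eapply Rle_lt_trans; [apply Rplus_le_compat_l, Rabs_triang|].
  rewrite (Rabs_mult q), (Rabs_pos_eq q), Rabs_Ropp by lra.
  assert (q * Rabs (S - T) <= q * (1 / 2) ^ n).
  { apply Rmult_le_compat_l; [lra|]. rewrite Rmult_1_l in Sn. exact Sn. }
  lra.
Qed.

(** * The variation-of-constants formula *)

Lemma the_real_unique (P : R -> Prop) l : P l -> (forall l', P l' -> l' = l) -> the_real P = l.
Proof. intros H U. apply U, (epsilon_spec (inhabits 0) P). exists l; auto. Qed.

Lemma the_real_series (a : nat -> R) l : is_series a l -> the_real (Un_cv (fun n => sum_f_R0 a n)) = l.
Proof.
  intros H. apply is_series_Reals in H. apply the_real_unique; [exact H|].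
  intros l' H'. apply (UL_sequence _ _ _ H' H).
Qed.

Lemma ML_alpha al d A i j v : 0 < al < 1 -> (i < d)%nat -> (j < d)%nat ->
  ML d al al (mscale v A) i j = Mker al d A i j v.
Proof.
  intros Ha Hi Hj. unfold ML. apply the_real_series.
  destruct (Mker_facts al d A Ha) as [D [c [_ [_ H]]]]. destruct (H i j Hi Hj) as [CV _].
  apply is_series_ext with (fun k => Mser al d A i j k * v ^ k).
  - intros k. rewrite mpow_mscale. unfold Mser. eqR. unfold Rdiv. ring.
  - apply (proj1 (is_pseries_R (Mser al d A i j) v (Mker al d A i j v))).
    apply PSeries_correct, CV_radius_inside. rewrite CV. exact I.
Qed.

Lemma is_series_Rscal c (a : nat -> R) (l : R) : is_series a l -> is_series (fun k => c * a k) (c * l).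
Proof. intros H; apply (is_series_scal (K := R_AbsRing) (V := R_NormedModule) c a l H). Qed.

Lemma is_series_rsum d (t : nat -> nat -> R) (l : nat -> R) :
  (forall m, (m < d)%nat -> is_series (t m) (l m)) ->
  is_series (fun k => rsum d (fun m => t m k)) (rsum d l).
Proof.
  induction d as [|d IH]; simpl; intros H.
  - assert (H0 : is_series (fun k => 0 * (1 / 2) ^ k) (0 * / (1 - 1 / 2))).
    { apply (is_series_Rscal 0 (fun k => (1 / 2) ^ k)), is_series_geom. rewrite Rabs_pos_eq; lra. }
    rewrite Rmult_0_l in H0. apply is_series_ext with (2 := H0). intros; eqR; ring.
  - apply (is_series_plus (fun k => rsum d (fun m => t m k)) (t d)); [apply IH|]; intros; apply H; lia.
Qed.

Lemma mpow_comm d A k i j : (i < d)%nat -> (j < d)%nat ->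
  mpow d A (S k) i j = rsum d (fun l => mpow d A k i l * A l j).
Proof.
  revert i j. induction k as [|k IH]; intros i j Hi Hj.
  - simpl. rewrite (rsum_mid d i (fun l => A l j)) by auto. unfold mmul.
    rewrite (rsum_ext d _ (fun l => mid j l * A i l)); [apply (rsum_mid d j (fun l => A i l)), Hj|].
    intros l _. unfold mid. rewrite Nat.eqb_sym. ring.
  - change (mpow d A (S (S k)) i j) with (rsum d (fun m => A i m * mpow d A (S k) m j)).
    rewrite (rsum_ext d _ (fun m => rsum d (fun l => A i m * (mpow d A k m l * A l j)))).
    2:{ intros m Hm. rewrite rsum_scal, IH by auto. reflexivity. }
    rewrite rsum_swap. apply rsum_ext; intros l _. simpl. unfold mmul.
    rewrite Rmult_comm, <- rsum_scal. apply rsum_ext; intros; ring.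
Qed.

(** Since Gamma(al (k+1) + 1) = al (k+1) Gamma(al k + al), the coefficient of order k + 1 of E_al
    is, up to 1/al and a factor A, the integrated k-th coefficient of E_(al,al). This puts the
    homogeneous part of a solution into the form of a convolution with constant forcing. *)
Lemma ML_one al d A i j w : 0 < al < 1 -> (i < d)%nat -> (j < d)%nat ->
  ML d al 1 (mscale w A) i j
  = mid i j + rsum d (fun l => / al * RInt (Mker al d A i l) 0 w * A l j).
Proof.
  intros Ha Hi Hj. unfold ML. apply the_real_series. apply is_series_decr_1. unfold plus, opp; simpl.
  rewrite Rmult_0_r, Rplus_0_l, Gamma_1.
  destruct (Mker_facts al d A Ha) as [D [c [_ [_ H]]]].
  replace (mid i j + rsum d (fun l => / al * RInt (Mker al d A i l) 0 w * A l j) + - (mid i j / 1))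
    with (rsum d (fun l => / al * RInt (Mker al d A i l) 0 w * A l j)) by field.
  apply is_series_ext with (fun k => rsum d (fun l =>
     / al * A l j * (PS_Int (Mser al d A i l) (S k) * w ^ (S k)))).
  - intros k.
    change (mmul d (mscale w A) (mpow d (mscale w A) k) i j) with (mpow d (mscale w A) (S k) i j).
    rewrite mpow_mscale, mpow_comm by auto.
    assert (PG : 0 < Gamma (al * INR k + al)) by (apply Gamma_pos; generalize (pos_INR k); nra).
    assert (EG : Gamma (al * INR (S k) + 1) = al * INR (S k) * Gamma (al * INR k + al)).
    { rewrite Gamma_S by (rewrite S_INR; generalize (pos_INR k); nra).
      do 2 f_equal. rewrite S_INR. ring. }
    change (match k with 0%nat => 1 | S _ => INR k + 1 end) with (INR (S k)).
    rewrite EG. assert (PI : 0 < INR (S k)) by (apply lt_0_INR; lia).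
    unfold Rdiv. rewrite Rmult_comm, <- Rmult_assoc, <- rsum_scal. apply rsum_ext; intros l _.
    unfold PS_Int, Mser. eqR. field. repeat split; lra.
  - apply (is_series_rsum d (fun l k => / al * A l j * (PS_Int (Mser al d A i l) (S k) * w ^ S k))).
    intros l Hl. destruct (H i l Hi Hl) as [CV _].
    replace (/ al * RInt (Mker al d A i l) 0 w * A l j)
      with (/ al * A l j * RInt (Mker al d A i l) 0 w) by ring.
    apply (is_series_scal (/ al * A l j) (fun k => PS_Int (Mser al d A i l) (S k) * w ^ S k)).
    apply (is_series_incr_1 (fun k => PS_Int (Mser al d A i l) k * w ^ k)).
    match goal with |- is_series _ ?x => replace x with (RInt (Mker al d A i l) 0 w) end.
    2:{ unfold plus; simpl. rewrite Rmult_0_l. symmetry; apply Rplus_0_r. }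
    apply (proj1 (is_pseries_R (PS_Int (Mser al d A i l)) w (RInt (Mker al d A i l) 0 w))).
    apply is_pseries_RInt. rewrite CV. exact I.
Qed.

(** The response to the forcing [F] with initial value zero, in the form without singular kernel. *)
Definition Zsol (al : R) (d : nat) (A : nat -> nat -> R) (F : R -> nat -> R) (t : R) (i : nat) : R :=
  rsum d (fun j => convk al (Mker al d A i j) (fun s => F s j) t).

Lemma mvec_ML_one al d A x0 t i : 0 < al < 1 -> 0 < t -> (i < d)%nat ->
  mvec d (ML d al 1 (mscale (Rpower t al) A)) x0 i
  = x0 i + Zsol al d A (fun _ => mvec d A x0) t i.
Proof.
  intros Ha Ht Hi. unfold mvec at 1.
  rewrite (rsum_ext d _ (fun j => mid i j * x0 j
     + rsum d (fun l => / al * RInt (Mker al d A i l) 0 (Rpower t al) * (A l j * x0 j)))).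
  2:{ intros j Hj. rewrite ML_one by auto. rewrite Rmult_plus_distr_r. f_equal.
      rewrite Rmult_comm, <- rsum_scal. apply rsum_ext; intros; ring. }
  rewrite rsum_plus, rsum_mid by auto. f_equal. rewrite rsum_swap. unfold Zsol.
  apply rsum_ext; intros l Hl. rewrite rsum_scal. unfold convk, mvec. rewrite pw_pos by auto.
  destruct (Mker_facts al d A Ha) as [D [c [_ [_ H]]]]. destruct (H i l Hi Hl) as [_ [CM _]].
  rewrite Rmult_assoc. f_equal. rewrite Rmult_comm, <- RInt_Rscal by auto.
  apply RInt_ext; intros; eqR; ring.
Qed.

Lemma cont_Zsol al d A F i : 0 < al < 1 -> (i < d)%nat ->
  (forall j, (j < d)%nat -> cont (fun s => F s j)) -> cont (fun t => Zsol al d A F t i).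
Proof.
  intros Ha Hi HF. unfold Zsol. apply cont_rsum. intros j Hj.
  destruct (Mker_facts al d A Ha) as [D [c [_ [_ H]]]]. destruct (H i j Hi Hj) as [_ [CM _]].
  apply cont_convk; auto; lra.
Qed.

Lemma Zsol_le_0 al d A F i t : t <= 0 -> Zsol al d A F t i = 0.
Proof.
  intros Ht. unfold Zsol. rewrite <- (rsum_0 d). apply rsum_ext; intros. apply convk_le_0, Ht.
Qed.

Lemma Zsol_plus al d A F G t i : 0 < al < 1 -> (i < d)%nat ->
  (forall j, (j < d)%nat -> cont (fun s => F s j)) -> (forall j, (j < d)%nat -> cont (fun s => G s j)) ->
  Zsol al d A (fun s j => F s j + G s j) t i = Zsol al d A F t i + Zsol al d A G t i.
Proof.
  intros Ha Hi HF HG. unfold Zsol. rewrite <- rsum_plus. apply rsum_ext; intros j Hj.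
  destruct (Mker_facts al d A Ha) as [D [c [_ [_ H]]]]. destruct (H i j Hi Hj) as [_ [CM _]].
  unfold convk. rewrite <- Rmult_plus_distr_l. f_equal.
  assert (Cp : cont (fun v => t - pw v (/ al))).
  { apply cont_minus; [apply cont_const|apply cont_pw, Rinv_0_lt_compat; lra]. }
  rewrite <- RInt_Rplus.
  - apply RInt_ext; intros; eqR; ring.
  - apply cont_mult; auto. apply (cont_comp (fun s => F s j)); auto.
  - apply cont_mult; auto. apply (cont_comp (fun s => G s j)); auto.
Qed.

(** On [c, e] inside (0, t) the substitution v = (t - s)^al is smooth and gives (K c - K e)/al with
    a continuous [K]; letting c tend to 0 and e to t yields K 0/al, because K t = 0. *)
Lemma Zsol_is_int_oo al d A f t i : 0 < al < 1 -> 0 < t -> (i < d)%nat ->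
  (forall j, (j < d)%nat -> cont (fun s => f (Rmax 0 s) j)) ->
  is_int_oo (fun s => Rpower (t - s) (al - 1) * mvec d (ML d al al (mscale (Rpower (t - s) al) A)) (f s) i)
    0 t (Zsol al d A (fun s => f (Rmax 0 s)) t i).
Proof.
  intros Ha Ht Hi Hf.
  assert (Hia : 0 < / al) by (apply Rinv_0_lt_compat; lra).
  assert (Cp := cont_pw (/ al) Hia).
  destruct (Mker_facts al d A Ha) as [D [c0 [_ [_ HM]]]].
  set (g := fun s => Rpower (t - s) (al - 1) * mvec d (ML d al al (mscale (Rpower (t - s) al) A)) (f s) i).
  set (h := fun v => rsum d (fun j => Mker al d A i j v * f (Rmax 0 (t - pw v (/ al))) j)).
  assert (Ch1 : forall j, (j < d)%nat -> cont (fun v => Mker al d A i j v * f (Rmax 0 (t - pw v (/ al))) j)).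
  { intros j Hj. destruct (HM i j Hi Hj) as [_ [CM _]]. apply cont_mult; auto.
    apply (cont_comp (fun s => f (Rmax 0 s) j)); auto. ct. }
  assert (Ch : cont h).
  { unfold h. apply (cont_rsum d (fun j v => Mker al d A i j v * f (Rmax 0 (t - pw v (/ al))) j)), Ch1. }
  set (K := fun c => RInt h 0 (pw (t - c) al)).
  assert (CK : cont K).
  { unfold K. apply (cont_comp (fun w => RInt h 0 w)); [apply cont_RInt, Ch|].
    apply (cont_comp (fun w => pw w al)); [apply cont_pw; lra|]. apply (cont_minus (fun _ => t) (fun c => c)); ct. }
  assert (EZ : Zsol al d A (fun s => f (Rmax 0 s)) t i = / al * K 0).
  { unfold Zsol, convk, K. rewrite rsum_scal, Rminus_0_r. f_equal. unfold h.
    assert (W : forall n, (n <= d)%nat -> rsum n (fun j => RInt (fun v => Mker al d A i j v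
         * f (Rmax 0 (t - pw v (/ al))) j) 0 (pw t al))
       = RInt (fun v => rsum n (fun j => Mker al d A i j v * f (Rmax 0 (t - pw v (/ al))) j)) 0 (pw t al)).
    { induction n as [|n IH]; intros Hn; simpl.
      - rewrite RInt_Rconst; ring.
      - rewrite IH by lia. rewrite <- RInt_Rplus; auto.
        + apply (cont_rsum n (fun j v => Mker al d A i j v * f (Rmax 0 (t - pw v (/ al))) j)).
          intros; apply Ch1; lia. }
    apply W; auto. }
  assert (Int : forall c e, 0 < c -> c <= e -> e < t -> is_RInt g c e (/ al * (K c - K e))).
  { intros c e Hc Hce He.
    assert (I1 := is_RInt_comp h (fun s => Rpower (t - s) al) (fun s => - (al * Rpower (t - s) (al - 1))) c e).
    specialize (I1 ltac:(intros; apply Ch)).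
    assert (I2 : is_RInt (fun y => scal (- (al * Rpower (t - y) (al - 1))) (h (Rpower (t - y) al))) c e
       (RInt h (Rpower (t - c) al) (Rpower (t - e) al))).
    { apply I1. intros x Hx. rewrite Rmin_left, Rmax_right in Hx by lra. split.
      - replace (- (al * Rpower (t - x) (al - 1))) with ((-1) * (al * Rpower (t - x) (al - 1))) by ring.
        apply (is_derive_comp (fun w => Rpower w al) (fun s => t - s)).
        + apply is_derive_Rpower; lra.
        + auto_derive; auto.
      - apply (continuous_opp (fun s => al * Rpower (t - s) (al - 1))).
        apply (continuous_scal_r al (fun s => Rpower (t - s) (al - 1))).
        apply (continuous_comp (fun s => t - s) (fun w => Rpower w (al - 1))).
        + apply (cont_minus (fun _ => t) (fun s => s)); ct.
        + apply continuous_Rpower; lra. }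
    apply (is_RInt_scal _ c e (- / al)) in I2.
    replace (/ al * (K c - K e)) with (scal (- / al) (RInt h (Rpower (t - c) al) (Rpower (t - e) al))).
    - apply is_RInt_ext with (2 := I2). intros x Hx. rewrite Rmin_left, Rmax_right in Hx by lra.
      unfold scal; simpl; unfold mult; simpl. unfold g, h, mvec. eqR.
      transitivity (Rpower (t - x) (al - 1) * rsum d (fun j => Mker al d A i j (Rpower (t - x) al)
         * f (Rmax 0 (t - pw (Rpower (t - x) al) (/ al))) j)); [field; lra|].
      f_equal. apply rsum_ext; intros j Hj. rewrite ML_alpha by auto.
      rewrite <- (pw_pos (t - x)), pw_inv, Rmax_right by lra. do 2 f_equal. ring.
    - unfold K. rewrite !pw_pos by lra.
      rewrite <- (RInt_Rchasles h 0 (Rpower (t - c) al) (Rpower (t - e) al)) by auto.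
      unfold scal; simpl; unfold mult; simpl. eqR. ring. }
  intros eps He. rewrite EZ.
  assert (Heps : 0 < al * eps / 2) by (apply Rdiv_lt_0_compat; [apply Rmult_lt_0_compat|]; lra).
  destruct (proj2 (continuity_pt_filterlim _ _) (CK 0) _ Heps) as [d1 [Hd1 H1]].
  destruct (proj2 (continuity_pt_filterlim _ _) (CK t) _ Heps) as [d2 [Hd2 H2]].
  simpl in H1, H2; unfold R_dist in H1, H2.
  exists (Rmin d1 (Rmin d2 t)). split; [repeat apply Rmin_case; lra|].
  intros c e Hc Hee Hce. rewrite Rplus_0_l in Hc.
  assert (M1 := Rmin_l d1 (Rmin d2 t)). assert (M2 := Rmin_r d1 (Rmin d2 t)).
  assert (M3 := Rmin_l d2 t). assert (M4 := Rmin_r d2 t).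
  assert (I := Int c e ltac:(lra) Hce ltac:(lra)).
  exists (ex_RInt_Reals_0 _ _ _ (ex_intro _ _ I)).
  rewrite <- RInt_Reals, (is_RInt_unique (V := R_CompleteNormedModule) _ _ _ _ I).
  assert (X1 : Rabs (K c - K 0) < al * eps / 2).
  { apply H1. split; [split; [exact Logic.I|lra]|]. rewrite Rminus_0_r, Rabs_pos_eq; lra. }
  assert (X2 : Rabs (K e - K t) < al * eps / 2).
  { apply H2. split; [split; [exact Logic.I|lra]|]. rewrite Rabs_left1; lra. }
  assert (Kt : K t = 0) by (unfold K; rewrite Rminus_diag, pw_neg, RInt_Rpoint by lra; auto).
  rewrite Kt, Rminus_0_r in X2.
  replace (/ al * (K c - K e) - / al * K 0) with (/ al * ((K c - K 0) + - K e)) by ring.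
  rewrite Rabs_mult, (Rabs_pos_eq (/ al)) by lra.
  apply Rmult_lt_reg_l with al; [lra|]. rewrite <- Rmult_assoc, Rinv_r, Rmult_1_l by lra.
  apply Rle_lt_trans with (1 := Rabs_triang _ _). rewrite Rabs_Ropp. lra.
Qed.

Lemma is_int_oo_unique g a b l l' : a < b -> is_int_oo g a b l -> is_int_oo g a b l' -> l = l'.
Proof.
  intros Hab H H'. apply NNPP; intros Hn.
  assert (He : 0 < Rabs (l - l') / 2) by (apply Rdiv_lt_0_compat; [apply Rabs_pos_lt|]; lra).
  destruct (H _ He) as [d1 [Hd1 H1]]. destruct (H' _ He) as [d2 [Hd2 H2]].
  set (m := Rmin (Rmin d1 d2) ((b - a) / 2)).
  assert (Hm : 0 < m) by (unfold m; repeat apply Rmin_case; lra).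
  assert (M1 : m <= Rmin d1 d2) by apply Rmin_l. assert (M2 := Rmin_l d1 d2). assert (M3 := Rmin_r d1 d2).
  assert (M4 : m <= (b - a) / 2) by apply Rmin_r.
  destruct (H1 (a + m / 2) (b - m / 2) ltac:(lra) ltac:(lra) ltac:(lra)) as [p1 P1].
  destruct (H2 (a + m / 2) (b - m / 2) ltac:(lra) ltac:(lra) ltac:(lra)) as [p2 P2].
  rewrite (RiemannInt_P5 p2 p1) in P2.
  assert (Rabs (l - l') < Rabs (l - l')); [|lra].
  replace (l - l') with ((RiemannInt p1 - l') + - (RiemannInt p1 - l)) at 1 by ring.
  apply Rle_lt_trans with (1 := Rabs_triang _ _). rewrite Rabs_Ropp. lra.
Qed.

(** The forcing of the equation satisfied by x - x0, extended constantly to negative times. *)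
Definition Ftot (d : nat) (A : nat -> nat -> R) (f : R -> nat -> R) (x0 : nat -> R) (s : R) (j : nat) : R :=
  f (Rmax 0 s) j + mvec d A x0 j.

Lemma is_solution_iff al d A f x0 x : 0 < al < 1 ->
  (forall j, (j < d)%nat -> cont (fun s => f (Rmax 0 s) j)) ->
  is_solution al d A f x0 x <->
  (forall i, (i < d)%nat -> x 0 i = x0 i) /\
  forall t, 0 < t -> forall i, (i < d)%nat -> x t i = x0 i + Zsol al d A (Ftot d A f x0) t i.
Proof.
  intros Ha Hf.
  assert (E : forall t, 0 < t -> forall i, (i < d)%nat ->
     x0 i + Zsol al d A (Ftot d A f x0) t i - mvec d (ML d al 1 (mscale (Rpower t al) A)) x0 i
     = Zsol al d A (fun s => f (Rmax 0 s)) t i).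
  { intros t Ht i Hi. rewrite mvec_ML_one by auto. unfold Ftot.
    rewrite (Zsol_plus al d A (fun s => f (Rmax 0 s)) (fun _ => mvec d A x0)); auto; [ring|].
    intros; apply cont_const. }
  unfold is_solution. split; intros [H0 H]; split; auto; intros t Ht i Hi.
  - assert (U := is_int_oo_unique _ _ _ _ _ Ht (H t Ht i Hi) (Zsol_is_int_oo al d A f t i Ha Ht Hi Hf)).
    specialize (E t Ht i Hi). lra.
  - rewrite H by auto. rewrite E by auto. apply Zsol_is_int_oo; auto.
Qed.

(** Transforming entrywise gives the matrix Phi = q (I + q A + q^2 A^2 + ...) with q = s^(-al).
    Splitting off the first term of the series yields s^al Phi = I + A Phi, hence the algebraic
    equation for Phi Fh. *)
Lemma Zsol_lap al d A F M : 0 < al < 1 -> (forall j, (j < d)%nat -> cont (fun s => F s j)) ->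
  (forall j, (j < d)%nat -> forall t, Rabs (F t j) <= M) ->
  exists s0, 0 < s0 /\ forall s, s0 < s -> forall Fh, (forall j, (j < d)%nat -> lap (fun t => F t j) s (Fh j)) ->
    exists zh, forall i, (i < d)%nat -> lap (fun t => Zsol al d A F t i) s (zh i) /\
      Rpower s al * zh i = mvec d A zh i + Fh i.
Proof.
  intros Ha HF HB. destruct (Mker_facts al d A Ha) as [D [c [HD [Hc HM]]]].
  exists (c + 1). split; [lra|]. intros s Hs Fh HFh.
  set (q := Rpower s (- al)). set (ph := fun i j => q * Series (fun k => mpow d A k i j * q ^ k)).
  exists (fun i => rsum d (fun j => ph i j * Fh j)). intros i Hi. split.
  - unfold Zsol. apply (lap_rsum d (fun j t => convk al (Mker al d A i j) (fun s => F s j) t)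
      (fun j => ph i j * Fh j)).
    + intros j Hj. destruct (HM i j Hi Hj) as [_ [CM _]]. apply cont_convk; auto; lra.
    + intros j Hj. destruct (HM i j Hi Hj) as [_ [CM [BM LM]]].
      apply (convk_lap al (Mker al d A i j) (fun s => F s j) D c M); auto; try lra.
      apply (LM s); lra.
  - assert (Pq : 0 < q) by apply Rpower_pos.
    assert (Eq : Rpower s al * q = 1) by (unfold q; rewrite <- Rpower_plus, Rplus_opp_r; apply Rpower_O; lra).
    assert (Eph : forall j, (j < d)%nat -> Rpower s al * ph i j = mid i j + rsum d (fun l => A i l * ph l j)).
    { intros j Hj. unfold ph at 1. rewrite <- Rmult_assoc, Eq, Rmult_1_l.
      destruct (HM i j Hi Hj) as [_ [_ [_ LM]]]. destruct (LM s ltac:(lra)) as [Ex _].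
      rewrite Series_incr_1 by exact Ex. simpl mpow at 1. rewrite pow_O, Rmult_1_r. f_equal.
      apply is_series_unique.
      apply is_series_ext with (fun k => rsum d (fun l => A i l * (q * (mpow d A k l j * q ^ k)))).
      - intros k. simpl. unfold mmul. eqR.
        rewrite (Rmult_comm (rsum d _)), <- rsum_scal. apply rsum_ext; intros; ring.
      - apply (is_series_rsum d (fun l k => A i l * (q * (mpow d A k l j * q ^ k)))).
        intros l Hl. destruct (HM l j Hl Hj) as [_ [_ [_ LMl]]]. destruct (LMl s ltac:(lra)) as [Exl _].
        apply (is_series_Rscal (A i l) (fun k => q * (mpow d A k l j * q ^ k))).
        apply (is_series_Rscal q (fun k => mpow d A k l j * q ^ k)), Series_correct, Exl. }
    rewrite <- rsum_scal.
    rewrite (rsum_ext d _ (fun j => mid i j * Fh j + rsum d (fun l => A i l * (ph l j * Fh j)))).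
    2:{ intros j Hj. rewrite <- Rmult_assoc, Eph, Rmult_plus_distr_r by auto. f_equal.
        rewrite Rmult_comm, <- rsum_scal. apply rsum_ext; intros; ring. }
    rewrite rsum_plus, rsum_mid, rsum_swap, Rplus_comm by auto. f_equal.
    unfold mvec. apply rsum_ext; intros l _. rewrite rsum_scal. reflexivity.
Qed.

Lemma Zsol_bexp al d A F M : 0 < al < 1 -> (forall j, (j < d)%nat -> cont (fun s => F s j)) ->
  (forall j, (j < d)%nat -> forall t, Rabs (F t j) <= M) ->
  exists b K, 0 <= b /\ 0 <= K /\ forall i, (i < d)%nat -> bexp b K (fun t => Zsol al d A F t i).
Proof.
  intros Ha HF HB. destruct (Mker_facts al d A Ha) as [D [c [HD [Hc HM]]]].
  assert (Hia : 0 < / al) by (apply Rinv_0_lt_compat; lra).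
  (* For d = 0 the hypothesis says nothing about the sign of [M], hence [Rabs M]. *)
  exists (c + 1), (INR d * (/ al * (D * Rabs M))). split; [lra|]. split.
  { apply Rmult_le_pos; [apply pos_INR|]. apply Rmult_le_pos; [lra|]. apply Rmult_le_pos; auto. apply Rabs_pos. }
  intros i Hi t Ht. unfold Zsol. eapply Rle_trans; [apply rsum_abs|].
  rewrite Rmult_assoc, <- rsum_const. apply rsum_le; intros j Hj.
  destruct (HM i j Hi Hj) as [_ [CM [BM _]]].
  apply (convk_bound al (Mker al d A i j) (fun s => F s j) D c (Rabs M)); auto; try lra.
  intros x. apply Rle_trans with (2 := Rle_abs M), HB, Hj.
Qed.

(** * Triangularization of a real matrix over the complex numbers *)

Fixpoint csum (n : nat) (g : nat -> C) : C :=
  match n with O => 0%C | S n => (csum n g + g n)%C end.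

Module ComplexMatrices.
Import all_boot all_order all_algebra complex Rstruct.
Import Order.TTheory GRing.Theory Num.Theory.
Local Open Scope ring_scope.
Local Set Implicit Arguments.
Local Unset Strict Implicit.

(** Both complex number types are pairs of reals; results on matrices over [R[i]] are carried back
    to sums over natural indices through this bijection. *)
Definition toC (z : R[i]) : C := (complex.Re z, complex.Im z).
Definition ofC (z : C) : R[i] := complex.Complex (fst z) (snd z).

Lemma ofCK z : toC (ofC z) = z.
Proof. by case: z. Qed.
Lemma toCK z : ofC (toC z) = z.
Proof. by case: z. Qed.
Lemma toCD z w : toC (z + w) = Cplus (toC z) (toC w).
Proof. by case: z; case: w. Qed.
Lemma toCM z w : toC (z * w) = Cmult (toC z) (toC w).
Proof. by case: z; case: w. Qed.

Lemma toC_sum n (F : 'I_n -> R[i]) (g : nat -> C) :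
  (forall k : 'I_n, toC (F k) = g k) -> toC (\sum_(k < n) F k) = csum n g.
Proof.
elim: n F => [|n IH] F H; first by rewrite big_ord0.
rewrite big_ord_recr toCD /= (IH (fun k => F (widen_ord (leqnSn n) k))) ?H //.
Qed.

Definition mxA n (A : nat -> nat -> R) : 'M[R[i]]_n := \matrix_(i, j) ofC (RtoC (A i j)).
Definition fun_of n (M : 'M[R[i]]_n) (i j : nat) : C :=
  match insub i, insub j with Some i', Some j' => toC (M i' j') | _, _ => RtoC R0 end.
Definition row_of n (v : 'rV[R[i]]_n) (j : nat) : C :=
  match insub j with Some j' => toC (v 0 j') | _ => RtoC R0 end.

Lemma fun_ofE n (M : 'M[R[i]]_n) (i j : 'I_n) : fun_of M i j = toC (M i j).
Proof. by rewrite /fun_of !valK. Qed.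
Lemma row_ofE n (v : 'rV[R[i]]_n) (j : 'I_n) : row_of v j = toC (v 0 j).
Proof. by rewrite /row_of valK. Qed.

Lemma fun_of_mul n (M N : 'M[R[i]]_n) (i j : 'I_n) :
  csum n (fun k => Cmult (fun_of M i k) (fun_of N k j)) = toC ((M *m N) i j).
Proof.
by rewrite mxE; symmetry; apply: toC_sum => k; rewrite toCM !fun_ofE.
Qed.

(** A singular matrix is characterized by a left null vector, so the right eigenvector is found by
    passing to the transpose. *)
Lemma det_eigen n (A : nat -> nat -> R) (t : R[i]) : \det (t%:M - mxA n A) = 0 ->
  exists v : nat -> C, (exists i : 'I_n, v i <> RtoC R0) /\
    forall i : 'I_n, csum n (fun k => Cmult (RtoC (A i k)) (v k)) = Cmult (toC t) (v i).
Proof.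
rewrite -det_tr => /eqP /det0P [v v0 Hv]; exists (row_of v); split.
- have /rV0Pn [i Hi] := v0; exists i; rewrite row_ofE => E.
  by move/eqP: Hi; apply; rewrite -(toCK (v 0 i)) E.
- move=> i; have := congr1 (fun M : 'rV_n => toC (M 0 i)) Hv.
  rewrite raddfB /= tr_scalar_mx mulmxBr mul_mx_scalar !mxE => E.
  rewrite row_ofE -toCM.
  have -> : t * v 0 i = \sum_j v 0 j * (mxA n A)^T j i.
    apply/eqP; rewrite -subr_eq0; apply/eqP.
    by rewrite -[LHS]toCK E.
  symmetry; apply: toC_sum => k.
  by rewrite mulrC toCM !mxE row_ofE ofCK.
Qed.

Lemma eigen_det n (A : nat -> nat -> R) (t : R[i]) (v : 'cV[R[i]]_n) : v != 0 ->
  mxA n A *m v = t *: v -> \det (t%:M - mxA n A) = 0.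
Proof.
move=> v0 Hv; rewrite -det_tr; apply/eqP/det0P; exists v^T; first by rewrite trmx_eq0.
by rewrite -trmx_mul mulmxBl mul_scalar_mx Hv subrr trmx0.
Qed.

(** A right eigenvector makes t - A singular, and a singular matrix also has a left null vector. *)
Lemma left_eigenvector n (A : nat -> nat -> R) (t : C) (v : nat -> C) :
  (exists i : nat, (i < n)%N /\ v i <> RtoC R0) ->
  (forall i : nat, (i < n)%N -> csum n (fun k => Cmult (RtoC (A i k)) (v k)) = Cmult t (v i)) ->
  exists p : nat -> C, (exists i : nat, (i < n)%N /\ p i <> RtoC R0) /\
    forall j : nat, (j < n)%N -> csum n (fun k => Cmult (p k) (RtoC (A k j))) = Cmult t (p j).
Proof.
move=> [i0 [Hi0 v0]] Hv.
pose w : 'cV[R[i]]_n := \col_k ofC (v k).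
have w0 : w != 0.
  apply/eqP => E; apply: v0.
  have := congr1 (fun M : 'cV_n => toC (M (Ordinal Hi0) 0)) E.
  by rewrite !mxE ofCK.
have Hw : mxA n A *m w = ofC t *: w.
  apply/matrixP => i j; rewrite !mxE -[LHS]toCK -[RHS]toCK; congr ofC.
  rewrite toCM !ofCK -Hv //; apply: toC_sum => k.
  by rewrite toCM !mxE !ofCK.
have /eqP/det0P [q q0 Hq] := eigen_det w0 Hw.
exists (row_of q); split.
- have /rV0Pn [i Hi] := q0; exists (val i); split; first exact: ltn_ord.
  rewrite row_ofE => E; move/eqP: Hi; apply; by rewrite -(toCK (q 0 i)) E.
- move=> j Hj; have := congr1 (fun M : 'rV_n => toC (M 0 (Ordinal Hj))) Hq.
  rewrite mulmxBr mul_mx_scalar !mxE => E.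
  have E2 : ofC t * q 0 (Ordinal Hj) = \sum_k q 0 k * mxA n A k (Ordinal Hj).
    by apply/eqP; rewrite -subr_eq0; apply/eqP; rewrite -[LHS]toCK E.
  transitivity (toC (ofC t * q 0 (Ordinal Hj))).
    rewrite E2; symmetry; apply: toC_sum => k.
    by rewrite toCM !mxE row_ofE ofCK.
  by rewrite toCM ofCK -(row_ofE q (Ordinal Hj)).
Qed.

(** Schur's decomposition: a unitary change of basis makes A lower triangular. Every diagonal entry
    of the triangular matrix is an eigenvalue of A, since t - A and t - T have the same determinant
    and the latter has a zero on its diagonal at t = T i i. *)
Lemma triangularization n (A : nat -> nat -> R) :
  exists P Q L : nat -> nat -> C,
   (forall i j : nat, (i < n)%N -> (j < n)%N ->
     csum n (fun k => Cmult (P i k) (RtoC (A k j))) = csum n (fun k => Cmult (L i k) (P k j))) /\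
   (forall i j : nat, (i < n)%N -> (j < n)%N ->
     csum n (fun k => Cmult (Q i k) (P k j)) = RtoC (mid i j)) /\
   (forall i j : nat, (i < n)%N -> (j < n)%N ->
     csum n (fun k => Cmult (P i k) (Q k j)) = RtoC (mid i j)) /\
   (forall i j : nat, (i < j)%N -> (j < n)%N -> L i j = RtoC R0) /\
   (forall i : nat, (i < n)%N -> exists v : nat -> C,
      (exists k : nat, (k < n)%N /\ v k <> RtoC R0) /\
      forall k : nat, (k < n)%N -> csum n (fun l => Cmult (RtoC (A k l)) (v l)) = Cmult (L i i) (v k)).
Proof.
case: n => [|n].
  (* Schur's decomposition asks for positive dimension; for dimension 0 all conditions are empty. *)
  by exists (fun _ _ => RtoC R0), (fun _ _ => RtoC R0), (fun _ _ => RtoC R0).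
have [M Mu MT] := @Schur _ _ (mxA n.+1 A) (ltn0Sn n).
have MU := unitarymx_unit Mu.
have [T [Ttrig HPT]] : exists T, is_trig_mx T /\ M *m mxA n.+1 A = T *m M.
  exists (M *m mxA n.+1 A *m invmx M); split; last by rewrite mulmxKV.
  by move: MT; rewrite /similar_to /= conjumx.
exists (fun_of M), (fun_of (invmx M)), (fun_of T); split; [|split; [|split; [|split]]].
- move=> i j Hi Hj.
  rewrite -[(i)]/(val (Ordinal Hi)) -[(j)]/(val (Ordinal Hj)) fun_of_mul -HPT mxE.
  symmetry; apply: toC_sum => k; by rewrite toCM fun_ofE !mxE ofCK.
- move=> i j Hi Hj.
  rewrite -[(i)]/(val (Ordinal Hi)) -[(j)]/(val (Ordinal Hj)) fun_of_mul mulVmx // mxE.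
  rewrite -val_eqE /mid /=; case: (PeanoNat.Nat.eqb_spec i j) => [->|/eqP/negbTE ->]; by rewrite ?eqxx.
- move=> i j Hi Hj.
  rewrite -[(i)]/(val (Ordinal Hi)) -[(j)]/(val (Ordinal Hj)) fun_of_mul mulmxV // mxE.
  rewrite -val_eqE /mid /=; case: (PeanoNat.Nat.eqb_spec i j) => [->|/eqP/negbTE ->]; by rewrite ?eqxx.
- move=> i j Hij Hj; have Hi := ltn_trans Hij Hj.
  by rewrite -[(i)]/(val (Ordinal Hi)) -[(j)]/(val (Ordinal Hj)) fun_ofE (is_trig_mxP Ttrig).
- move=> i Hi; rewrite -[(i)]/(val (Ordinal Hi)) fun_ofE; set o := Ordinal Hi.
  have [|v [[k Hk] Hv]] := @det_eigen n.+1 A (T o o).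
    (* The similarity in product form; taking determinants and cancelling the nonzero determinant of
       M transfers the characteristic determinant from A to T. *)
    have E : M *m ((T o o)%:M - mxA n.+1 A) = ((T o o)%:M - T) *m M.
      by rewrite mulmxBr mulmxBl HPT scalar_mxC.
    have dM : \det M != 0 by rewrite -unitfE -unitmxE.
    have := congr1 determinant E; rewrite !det_mulmx mulrC => /(mulIf dM) ->.
    rewrite det_trig; last first.
      apply/is_trig_mxP => a b ab; rewrite !mxE (is_trig_mxP Ttrig a b ab).
      have -> : (a == b) = false by apply/eqP => ab'; rewrite ab' ltnn in ab.
      by rewrite mulr0n subr0.
    by rewrite (bigD1 o) //= !mxE eqxx mulr1n subrr mul0r.
  exists v; split; first by exists k; split.
  by move=> l Hl; apply: (Hv (Ordinal Hl)).
Qed.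

Lemma lt_ltn (i n : nat) : Peano.lt i n <-> (i < n)%N.
Proof. by split => /ssrnat.ltP. Qed.
End ComplexMatrices.

Lemma fst_csum n g : fst (csum n g) = rsum n (fun k => fst (g k)).
Proof. induction n as [|n IH]; [reflexivity|]. cbn [csum rsum]. rewrite <- IH. reflexivity. Qed.
Lemma snd_csum n g : snd (csum n g) = rsum n (fun k => snd (g k)).
Proof. induction n as [|n IH]; [reflexivity|]. cbn [csum rsum]. rewrite <- IH. reflexivity. Qed.

Lemma csum_ext n g h : (forall k, (k < n)%nat -> g k = h k) -> csum n g = csum n h.
Proof.
  intros H. apply C_eq; [rewrite !fst_csum|rewrite !snd_csum]; apply rsum_ext; intros k Hk; now rewrite H.
Qed.
Lemma csum_0 n g : (forall k, (k < n)%nat -> g k = RtoC 0) -> csum n g = RtoC 0.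
Proof.
  induction n as [|n IH]; intros H; [reflexivity|]. cbn [csum].
  rewrite IH; [|intros; apply H; lia]. rewrite H; [|lia]. ring.
Qed.
Lemma csum_plus n g h : csum n (fun k => (g k + h k)%C) = (csum n g + csum n h)%C.
Proof. induction n as [|n IH]; cbn [csum]; [ring|]. rewrite IH. ring. Qed.
Lemma csum_scal n (c : C) g : csum n (fun k => (c * g k)%C) = (c * csum n g)%C.
Proof. induction n as [|n IH]; cbn [csum]; [ring|]. rewrite IH. ring. Qed.
Lemma csum_scalr n (c : C) g : csum n (fun k => (g k * c)%C) = (csum n g * c)%C.
Proof. induction n as [|n IH]; cbn [csum]; [ring|]. rewrite IH. ring. Qed.
Lemma csum_swap n m (g : nat -> nat -> C) :
  csum n (fun i => csum m (fun j => g i j)) = csum m (fun j => csum n (fun i => g i j)).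
Proof.
  induction n as [|n IH]; cbn [csum].
  - symmetry. apply csum_0. reflexivity.
  - rewrite IH, csum_plus. reflexivity.
Qed.

Lemma csum_mid n i g : (i < n)%nat -> csum n (fun k => (RtoC (mid i k) * g k)%C) = g i.
Proof.
  induction n as [|n IH]; intros Hi; [lia|]. cbn [csum]. unfold mid at 2.
  destruct (Nat.eqb_spec i n) as [->|Hn].
  - rewrite csum_0; [ring|]. intros k Hk. unfold mid.
    destruct (Nat.eqb_spec n k); [lia|]. ring.
  - rewrite IH; [ring|lia].
Qed.

Lemma eigenvector_iff d A a b :
  is_eigenvalue d A a b <-> exists v : nat -> C, (exists i, (i < d)%nat /\ v i <> RtoC 0) /\
    forall i, (i < d)%nat -> csum d (fun k => (RtoC (A i k) * v k)%C) = (((a, b) : C) * v i)%C.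
Proof.
  split.
  - intros (u & w & (i0 & Hi0 & H0) & H). exists (fun k => (u k, w k)). split.
    + exists i0. split; [exact Hi0|]. intros E. inversion E. lra.
    + intros i Hi. destruct (H i Hi) as [H1 H2]. unfold mvec in *. apply C_eq.
      * rewrite fst_csum. cbn [fst snd Cmult]. rewrite <- H1. apply rsum_ext. intros. cbn. ring.
      * rewrite snd_csum. cbn [fst snd Cmult].
        replace (a * w i + b * u i) with (b * u i + a * w i) by ring.
        rewrite <- H2. apply rsum_ext. intros. cbn. ring.
  - intros (v & (i0 & Hi0 & H0) & H). exists (fun k => fst (v k)), (fun k => snd (v k)). split.
    + exists i0. split; [exact Hi0|]. apply NNPP. intros E. apply H0. apply C_eq; cbn; tauto || lra.
    + intros i Hi. specialize (H i Hi). unfold mvec. split.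
      * apply (f_equal fst) in H. rewrite fst_csum in H. cbn [fst snd Cmult] in H.
        rewrite <- H. apply rsum_ext. intros. cbn. ring.
      * apply (f_equal snd) in H. rewrite snd_csum in H. cbn [fst snd Cmult] in H.
        rewrite Rplus_comm, <- H. apply rsum_ext. intros. cbn. ring.
Qed.

Lemma triangular_form d A : exists P Q L : nat -> nat -> C,
  (forall i j, (i < d)%nat -> (j < d)%nat ->
     csum d (fun k => (P i k * RtoC (A k j))%C) = csum d (fun k => (L i k * P k j)%C)) /\
  (forall i j, (i < d)%nat -> (j < d)%nat ->
     csum d (fun k => (Q i k * P k j)%C) = RtoC (mid i j)) /\
  (forall i j, (i < d)%nat -> (j < d)%nat ->
     csum d (fun k => (P i k * Q k j)%C) = RtoC (mid i j)) /\
  (forall i j, (i < j)%nat -> (j < d)%nat -> L i j = RtoC 0) /\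
  (forall i, (i < d)%nat -> is_eigenvalue d A (fst (L i i)) (snd (L i i))).
Proof.
  destruct (ComplexMatrices.triangularization d A) as (P & Q & L & H1 & H2 & H2' & H3 & H4).
  exists P, Q, L. repeat split.
  - intros i j Hi%ComplexMatrices.lt_ltn Hj%ComplexMatrices.lt_ltn. auto.
  - intros i j Hi%ComplexMatrices.lt_ltn Hj%ComplexMatrices.lt_ltn. auto.
  - intros i j Hi%ComplexMatrices.lt_ltn Hj%ComplexMatrices.lt_ltn. auto.
  - intros i j Hi%ComplexMatrices.lt_ltn Hj%ComplexMatrices.lt_ltn. auto.
  - intros i Hi%ComplexMatrices.lt_ltn. destruct (H4 i Hi) as (v & (k & Hk & Hv) & H).
    apply eigenvector_iff. exists v. split.
    + exists k. split; [apply ComplexMatrices.lt_ltn|]; assumption.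
    + intros j Hj%ComplexMatrices.lt_ltn. rewrite H; [|exact Hj]. now destruct (L i i).
Qed.

Lemma left_eigenvector d A a b : is_eigenvalue d A a b ->
  exists p : nat -> C, (exists i, (i < d)%nat /\ p i <> RtoC 0) /\
    forall j, (j < d)%nat -> csum d (fun k => (p k * RtoC (A k j))%C) = (((a, b) : C) * p j)%C.
Proof.
  intros (v & (i0 & Hi0%ComplexMatrices.lt_ltn & H0) & H)%eigenvector_iff.
  destruct (@ComplexMatrices.left_eigenvector d A (a, b) v) as (p & (i & Hi%ComplexMatrices.lt_ltn & Hp) & Hl).
  - now exists i0.
  - intros i Hi%ComplexMatrices.lt_ltn. now apply H.
  - exists p. split; [now exists i|]. intros j Hj%ComplexMatrices.lt_ltn. now apply Hl.
Qed.

(** * Polar form and resolvents at large real arguments *)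

Lemma polar_form a b : a <> 0 \/ b <> 0 ->
  -PI < carg a b <= PI /\ exists l, ((a, b) : C) = cexp l (carg a b).
Proof.
  intros H.
  assert (K : forall phi r, 0 < r -> a = r * cos phi -> b = r * sin phi ->
    exists l, ((a, b) : C) = cexp l phi).
  { intros phi r Hr Ea Eb. exists (ln r). unfold cexp. rewrite exp_ln by exact Hr. congruence. }
  pose proof PI_RGT_0 as HPI. pose proof (atan_bound (b / a)) as Hb.
  assert (Hs : 0 < sqrt (1 + (b / a)²)).
  { apply sqrt_lt_R0. pose proof (Rle_0_sqr (b / a)). lra. }
  unfold carg. destruct (Rlt_dec 0 a) as [Ha|Ha]; [|destruct (Rlt_dec a 0) as [Ha'|Ha']].
  - split; [lra|]. apply (K _ (a * sqrt (1 + (b / a)²))).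
    + now apply Rmult_lt_0_compat.
    + rewrite cos_atan. field. lra.
    + rewrite sin_atan. field. lra.
  - assert (E : a = - a * sqrt (1 + (b / a)²) * - cos (atan (b / a)) /\
                b = - a * sqrt (1 + (b / a)²) * - sin (atan (b / a))).
    { rewrite cos_atan, sin_atan. split; field; lra. }
    assert (Hr : 0 < - a * sqrt (1 + (b / a)²)) by (apply Rmult_lt_0_compat; lra).
    destruct (Rle_dec 0 b) as [H0|H0].
    + split.
      * assert (H1 : b / a <= 0) by (assert (/ a < 0) by (now apply Rinv_lt_0_compat); unfold Rdiv; nra).
        assert (atan (b / a) <= 0); [|lra].
        rewrite <- atan_0. destruct (Rle_lt_or_eq_dec _ _ H1) as [H2|H2];
          [left; now apply atan_increasing|rewrite H2; apply Rle_refl].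
      * apply (K _ _ Hr); [rewrite neg_cos|rewrite neg_sin]; apply E.
    + split.
      * assert (0 < b / a); [|pose proof (atan_increasing 0 (b / a)); rewrite atan_0 in *; lra].
        assert (/ a < 0) by now apply Rinv_lt_0_compat.
        unfold Rdiv. nra.
      (* The angle differs by a full turn from the one with + PI, so the formulas of the previous
         case apply. *)
      * replace (atan (b / a) - PI) with (atan (b / a) + PI - 2 * PI) by ring.
        apply (K _ _ Hr).
        -- rewrite cos_minus, cos_2PI, sin_2PI, neg_cos. lra.
        -- rewrite sin_minus, cos_2PI, sin_2PI, neg_sin. lra.
  - assert (a = 0) by lra. destruct (Rlt_dec 0 b) as [Hb'|Hb']; [|destruct (Rlt_dec b 0) as [Hb2|Hb2]].
    + split; [lra|]. apply (K _ b Hb'); [rewrite cos_PI2|rewrite sin_PI2]; lra.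
    + split; [lra|]. apply (K _ (- b)); [lra|rewrite cos_neg, cos_PI2|rewrite sin_neg, sin_PI2]; lra.
    + lra.
Qed.

Lemma finite_uniform d (P : nat -> R -> Prop) :
  (forall i M M', M <= M' -> P i M -> P i M') ->
  (forall i, (i < d)%nat -> exists M, P i M) -> exists M, 0 <= M /\ forall i, (i < d)%nat -> P i M.
Proof.
  intros HP H. induction d as [|d IH]; [exists 0; split; [lra|intros; lia]|].
  destruct IH as (M & HM & H1); [intros; apply H; lia|]. destruct (H d) as (M' & H2); [lia|].
  exists (Rmax M M'). split; [apply Rle_trans with (1 := HM), Rmax_l|]. intros i Hi.
  destruct (Nat.eq_dec i d) as [->|Hn]; [apply HP with (2 := H2), Rmax_r|].
  apply HP with M; [apply Rmax_l|]. apply H1. lia.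
Qed.

Lemma fun_choice_lt {B : Type} d (P : nat -> B -> Prop) : inhabited B ->
  (forall k, (k < d)%nat -> exists y, P k y) -> exists f, forall k, (k < d)%nat -> P k (f k).
Proof.
  intros [b] H. apply (fun_choice (fun k y => (k < d)%nat -> P k y)). intros k.
  destruct (Compare_dec.lt_dec k d) as [Hk|Hk]; [|exists b; tauto].
  destruct (H k Hk) as (y & Hy). now exists y.
Qed.

Lemma Rpower_large a K : 0 < a -> exists s0, 0 < s0 /\ forall s, s0 < s -> K < Rpower s a.
Proof.
  intros Ha. exists (Rpower (Rmax 1 K) (/ a)). split; [apply Rpower_pos|]. intros s Hs.
  assert (H1 := Rmax_l 1 K). assert (H2 := Rmax_r 1 K).
  apply Rle_lt_trans with (1 := H2).
  replace (Rmax 1 K) with (Rpower (Rpower (Rmax 1 K) (/ a)) a).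
  - apply Rlt_Rpower_l; [exact Ha|]. split; [apply Rpower_pos|exact Hs].
  - rewrite Rpower_mult, Rinv_l by lra. apply Rpower_1. lra.
Qed.

Lemma resolvent_neq0 a (lam : C) : 0 < a ->
  exists s0, 0 < s0 /\ forall s, s0 < s -> (RtoC (Rpower s a) - lam)%C <> RtoC 0.
Proof.
  intros Ha. destruct (Rpower_large a (Cmod lam) Ha) as (s0 & Hs0 & H). exists s0. split; [exact Hs0|].
  intros s Hs E. specialize (H s Hs). assert (E' : RtoC (Rpower s a) = lam).
  { replace (RtoC (Rpower s a)) with (RtoC (Rpower s a) - lam + lam)%C by ring. rewrite E. ring. }
  rewrite <- E', Cmod_R, Rabs_pos_eq in H by apply Rlt_le, Rpower_pos. lra.
Qed.

Lemma rsum_ge_term n f i : (forall k, (k < n)%nat -> 0 <= f k) -> (i < n)%nat -> f i <= rsum n f.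
Proof.
  induction n as [|n IH]; intros H Hi; [lia|]. cbn [rsum].
  assert (0 <= rsum n f).
  { rewrite <- (rsum_0 n). apply rsum_le. intros; apply H; lia. }
  assert (0 <= f n) by (apply H; lia).
  destruct (Nat.eq_dec i n) as [->|Hn]; [lra|].
  assert (f i <= rsum n f) by (apply IH; [intros; apply H|]; lia). lra.
Qed.

(** For the sum S of the moduli of the differences one gets r S <= d a S with [a] a bound for the
    row sums, so S = 0 once r > d a. It identifies the transform of the constructed bounded function
    with that of the true solution. *)
Lemma resolvent_unique d A : exists K, forall r, K < r -> forall F z w : nat -> R,
  (forall i, (i < d)%nat -> r * z i = mvec d A z i + F i) ->
  (forall i, (i < d)%nat -> r * w i = mvec d A w i + F i) ->
  forall i, (i < d)%nat -> z i = w i.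
Proof.
  destruct (row_bound d A) as (a & Ha & HA). exists (INR d * a). intros r Hr F z w Hz Hw.
  assert (Hd : 0 <= INR d * a) by (apply Rmult_le_pos; [apply pos_INR|lra]).
  set (S := rsum d (fun j => Rabs (z j - w j))).
  assert (HS : 0 <= S).
  { rewrite <- (rsum_0 d). apply rsum_le. intros; apply Rabs_pos. }
  assert (E : forall i, (i < d)%nat -> r * Rabs (z i - w i) <= a * S).
  { intros i Hi. rewrite <- (Rabs_pos_eq r) by lra. rewrite <- Rabs_mult.
    replace (r * (z i - w i)) with (rsum d (fun j => A i j * (z j - w j))).
    - apply Rle_trans with (1 := rsum_abs _ _). unfold S. rewrite <- rsum_scal.
      apply rsum_le. intros j Hj. rewrite Rabs_mult. apply Rmult_le_compat_r; [apply Rabs_pos|].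
      apply Rle_trans with (2 := HA i Hi).
      apply (rsum_ge_term d (fun j => Rabs (A i j))); [intros; apply Rabs_pos|exact Hj].
    - assert (H1 := Hz i Hi). assert (H2 := Hw i Hi). unfold mvec in *.
      rewrite (rsum_ext d _ (fun j => A i j * z j + (-1) * (A i j * w j))) by (intros; ring).
      rewrite rsum_plus, rsum_scal. lra. }
  assert (ES : r * S <= INR d * (a * S)).
  { unfold S at 1. rewrite <- rsum_scal, <- rsum_const. apply rsum_le, E. }
  assert (S0 : S = 0) by nra.
  intros i Hi. specialize (E i Hi). rewrite S0 in E.
  assert (Rabs (z i - w i) = 0) by (assert (H := Rabs_pos (z i - w i)); nra).
  assert (z i - w i = 0); [|lra]. destruct (Req_dec (z i - w i) 0) as [H0|H0]; [exact H0|].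
  apply Rabs_pos_lt in H0. lra.
Qed.

Lemma cont_clamp (u : R -> R) :
  (forall t, 0 <= t -> forall eps, 0 < eps -> exists delta, 0 < delta /\
     forall s, 0 <= s -> Rabs (s - t) < delta -> Rabs (u s - u t) < eps) ->
  cont (fun s => u (Rmax 0 s)).
Proof.
  intros H x. apply continuity_pt_filterlim. intros eps Heps.
  destruct (H (Rmax 0 x) (Rmax_l _ _) eps Heps) as (delta & Hd & Hs).
  exists delta. split; [exact Hd|]. intros y [_ Hy]. cbn [dist R_met] in *. unfold Rdist in *.
  apply Hs; [apply Rmax_l|]. apply Rle_lt_trans with (2 := Hy).
  unfold Rmax. destruct (Rle_dec 0 y), (Rle_dec 0 x); unfold Rabs; repeat destruct (Rcase_abs _); lra.
Qed.

Lemma Ftot_facts d A f x0 : Cinf d f ->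
  (forall j, (j < d)%nat -> cont (fun s => f (Rmax 0 s) j)) /\
  (forall j, (j < d)%nat -> cont (fun s => Ftot d A f x0 s j)) /\
  exists M, (forall j, (j < d)%nat -> forall t, Rabs (f (Rmax 0 t) j) <= M) /\
    forall j, (j < d)%nat -> forall t, Rabs (Ftot d A f x0 t j) <= M.
Proof.
  intros [H1 [M HM]].
  assert (C1 : forall j, (j < d)%nat -> cont (fun s => f (Rmax 0 s) j)).
  { intros j Hj. apply (cont_clamp (fun s => f s j)), H1, Hj. }
  split; [exact C1|]. split.
  - intros j Hj. unfold Ftot. apply (cont_plus (fun s => f (Rmax 0 s) j)); [auto|apply cont_const].
  - destruct (finite_uniform d (fun j M' => Rabs (mvec d A x0 j) <= M')) as (M' & HM' & HB).
    + intros; lra.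
    + intros j _. exists (Rabs (mvec d A x0 j)). lra.
    + exists (M + M'). split.
      * intros j Hj t. assert (X := HM (Rmax 0 t) (Rmax_l _ _) j Hj). lra.
      * intros j Hj t. unfold Ftot. apply Rle_trans with (1 := Rabs_triang _ _).
        apply Rplus_le_compat; [apply HM; [apply Rmax_l|exact Hj]|auto].
Qed.

(** * Sufficiency: solving the triangular system *)

Lemma ccont_csum n (g : nat -> R -> C) : (forall j, (j < n)%nat -> ccont (g j)) ->
  ccont (fun t => csum n (fun j => g j t)).
Proof.
  induction n as [|n IH]; intros H; cbn [csum]; [apply ccont_const|].
  apply (ccont_plus (fun t => csum n (fun j => g j t)) (g n)); [apply IH; intros|]; apply H; lia.
Qed.

Lemma lap_zero s : lap (fun _ => 0) s 0.
Proof.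
  apply is_lim_ext with (fun _ => 0); [|apply is_lim_const]. intros T.
  rewrite (RInt_ext _ (fun _ => 0)) by (intros; eqR; ring). rewrite RInt_Rconst. eqR; ring.
Qed.

Lemma clap_RtoC u s l : lap u s l -> clap (fun t => RtoC (u t)) s (RtoC l).
Proof. intros H. split; [exact H|apply lap_zero]. Qed.

Lemma clap_csum n (g : nat -> R -> C) (l : nat -> C) s : (forall j, (j < n)%nat -> ccont (g j)) ->
  (forall j, (j < n)%nat -> clap (g j) s (l j)) ->
  clap (fun t => csum n (fun j => g j t)) s (csum n l).
Proof.
  induction n as [|n IH]; intros C1 H; cbn [csum]; [apply clap_RtoC, lap_zero|].
  apply (clap_plus (fun t => csum n (fun j => g j t)) (g n)); auto.
  apply ccont_csum. auto.
Qed.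

Lemma cbounded_csum n (g : nat -> R -> C) : (forall j, (j < n)%nat -> exists B, cbounded B (g j)) ->
  exists B, cbounded B (fun t => csum n (fun j => g j t)).
Proof.
  induction n as [|n IH]; intros H.
  - exists 0. intros t _. cbn [csum]. rewrite Cmod_0. lra.
  - destruct IH as (B & HB); [intros; apply H; lia|]. destruct (H n) as (B' & HB'); [lia|].
    exists (B + B'). intros t Ht. cbn [csum]. apply Rle_trans with (1 := Cmod_triangle _ _).
    apply Rplus_le_compat; auto.
Qed.

Lemma cbounded_scal (c : C) B g : cbounded B g -> cbounded (Cmod c * B) (fun t => (c * g t)%C).
Proof. intros H t Ht. rewrite Cmod_mult. apply Rmult_le_compat_l; [apply Cmod_ge_0|auto]. Qed.

Lemma ccont_scal (c : C) g : ccont g -> ccont (fun t => (c * g t)%C).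
Proof. intros H. apply (ccont_mult (fun _ => c)); [apply ccont_const|exact H]. Qed.

Lemma csum_lower n d g : (n <= d)%nat -> (forall k, (n <= k)%nat -> (k < d)%nat -> g k = RtoC 0) ->
  csum d g = csum n g.
Proof.
  induction d as [|d IH]; intros Hn H; [replace n with 0%nat by lia; reflexivity|].
  destruct (Nat.eq_dec n (S d)) as [->|Hne]; [reflexivity|]. cbn [csum].
  rewrite IH, (H d); [ring|lia|lia|lia|intros; apply H; lia].
Qed.

(* The constants [c i] are those which remove the exponentially growing modes of the i-th row. *)
Lemma triangular_system al d (L : nat -> nat -> C) (g : nat -> R -> C) : 0 < al < 1 ->
  (forall i, (i < d)%nat -> exists l phi, - PI < phi <= PI /\ Rabs phi <> al * PI / 2 /\ L i i = cexp l phi) ->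
  (forall i, (i < d)%nat -> ccont (g i)) ->
  (forall i, (i < d)%nat -> exists M, cbounded M (g i)) ->
  forall n, (n <= d)%nat -> exists (c : nat -> C) (z : nat -> R -> C) (s0 : R), 0 < s0 /\
    (forall i, (i < n)%nat -> ccont (z i)) /\ (forall i, (i < n)%nat -> exists B, cbounded B (z i)) /\
    forall s, s0 < s -> forall gh zh : nat -> C, (forall i, (i < n)%nat -> clap (g i) s (gh i)) ->
      (forall i, (i < n)%nat -> clap (z i) s (zh i)) -> forall i, (i < n)%nat ->
      (RtoC (Rpower s al) * zh i)%C = (gh i + csum (S i) (fun j => L i j * (c j * / s + zh j)))%C.
Proof.
  intros Ha HL Hg HM. induction n as [|n IH]; intros Hn.
  { exists (fun _ => RtoC 0), (fun _ _ => RtoC 0), 1. repeat split; intros; lia || lra. }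
  destruct IH as (c & z & s0 & Hs0 & Cz & Bz & Hz); [lia|].
  destruct (HL n) as (l & phi & Hp & Hcrit & EL); [lia|].
  (* As L is lower triangular, the rows already solved act on row n as a known bounded forcing; c j
     + z j is the whole j-th component, initial value included. *)
  set (G := fun t => (g n t + csum n (fun j => L n j * (c j + z j t)))%C).
  assert (Cc : forall j, (j < n)%nat -> ccont (fun t => (L n j * (c j + z j t))%C)).
  { intros j Hj. apply ccont_scal, (ccont_plus (fun _ => c j)); [apply ccont_const|auto]. }
  assert (CG : ccont G).
  { apply (ccont_plus (g n)); [apply Hg; lia|]. apply (ccont_csum n (fun j t => (L n j * (c j + z j t))%C)), Cc. }
  assert (BG : exists M, cbounded M G).
  { destruct (HM n) as (M & HMn); [lia|].
    destruct (cbounded_csum n (fun j t => (L n j * (c j + z j t))%C)) as (M' & HM').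
    - intros j Hj. destruct (Bz j Hj) as (B & HB). exists (Cmod (L n j) * (Cmod (c j) + B)).
      apply (cbounded_scal (L n j) _ (fun t => (c j + z j t)%C)). intros t Ht.
      apply Rle_trans with (1 := Cmod_triangle _ _). apply Rplus_le_compat; [lra|auto].
    - exists (M + M'). intros t Ht. apply Rle_trans with (1 := Cmod_triangle _ _).
      apply Rplus_le_compat; auto. }
  destruct BG as (M & BG).
  destruct (scalar_bounded al l phi G M Ha Hp Hcrit CG BG) as (c0 & zn & B & s1 & Czn & Bzn & Hzn).
  destruct (resolvent_neq0 al (cexp l phi)) as (s2 & Hs2 & Hlarge); [lra|].
  exists (fun j => if Nat.eqb j n then c0 else c j), (fun j => if Nat.eqb j n then zn else z j),
    (Rmax s0 (Rmax s1 s2)).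
  assert (M1 := Rmax_l s0 (Rmax s1 s2)). assert (M2 := Rmax_r s0 (Rmax s1 s2)).
  assert (M3 := Rmax_l s1 s2). assert (M4 := Rmax_r s1 s2).
  split; [lra|]. split; [|split].
  - intros i Hi. destruct (Nat.eqb_spec i n); [exact Czn|apply Cz; lia].
  - intros i Hi. destruct (Nat.eqb_spec i n); [exists B; exact Bzn|apply Bz; lia].
  - intros s Hs gh zh Hgh Hzh.
    assert (Hzh' : forall i, (i < n)%nat -> clap (z i) s (zh i)).
    { intros i Hi. assert (X := Hzh i ltac:(lia)). destruct (Nat.eqb_spec i n); [lia|exact X]. }
    assert (E : forall i, (i <= n)%nat ->
      csum i (fun j => L i j * ((if Nat.eqb j n then c0 else c j) * / s + zh j))%C
      = csum i (fun j => L i j * (c j * / s + zh j))%C).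
    { intros i Hi. apply csum_ext. intros k Hk. destruct (Nat.eqb_spec k n); [lia|reflexivity]. }
    intros i Hi. cbn [csum]. rewrite E by lia. destruct (Nat.eqb_spec i n) as [->|Hne].
    + assert (X := Hzh n ltac:(lia)). rewrite Nat.eqb_refl in X.
      assert (HG : clap G s (gh n + csum n (fun j => L n j * (c j * / s + zh j)))%C).
      { apply (clap_plus (g n)); [apply Hg; lia| |apply Hgh; lia|].
        - apply (ccont_csum n (fun j t => (L n j * (c j + z j t))%C)), Cc.
        - apply (clap_csum n (fun j t => (L n j * (c j + z j t))%C)); [exact Cc|]. intros j Hj.
          apply (clap_scal (L n j) (fun t => (c j + z j t)%C));
            [apply (ccont_plus (fun _ => c j)); [apply ccont_const|auto]|].
          apply (clap_plus (fun _ => c j)); [apply ccont_const|auto|apply clap_const; lra|auto]. }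
      assert (Hs1 : s1 < s) by lra.
      rewrite (clap_unique _ _ _ _ X (Hzn s _ Hs1 HG)), EL.
      assert (N := Hlarge s ltac:(lra)).
      assert (Ns : RtoC s <> RtoC 0) by (intros Z; injection Z; lra).
      field. split; assumption.
    + rewrite (Hz s ltac:(lra) gh zh) by (try (intros; apply Hgh); auto; lia). reflexivity.
Qed.

Lemma csum_assoc n (M N : nat -> nat -> C) v i :
  csum n (fun k => M i k * csum n (fun j => N k j * v j))%C
  = csum n (fun j => csum n (fun k => M i k * N k j) * v j)%C.
Proof.
  rewrite (csum_ext n _ (fun k => csum n (fun j => M i k * (N k j * v j))%C))
    by (intros; symmetry; apply csum_scal).
  rewrite csum_swap. apply csum_ext. intros j Hj. rewrite <- csum_scalr.
  apply csum_ext. intros; ring.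
Qed.

(** Put Y = Q y, so that y = P Y. Then L y = L P Y = P A Y, and Q (P w + L y) = w + A Y. *)
Lemma conjugate_system d (A : nat -> nat -> R) (P Q L : nat -> nat -> C) y w i :
  (forall i j, (i < d)%nat -> (j < d)%nat ->
     csum d (fun k => (P i k * RtoC (A k j))%C) = csum d (fun k => (L i k * P k j)%C)) ->
  (forall i j, (i < d)%nat -> (j < d)%nat -> csum d (fun k => (Q i k * P k j)%C) = RtoC (mid i j)) ->
  (forall i j, (i < d)%nat -> (j < d)%nat -> csum d (fun k => (P i k * Q k j)%C) = RtoC (mid i j)) ->
  (i < d)%nat ->
  csum d (fun k => Q i k * (csum d (fun m => P k m * w m) + csum d (fun j => L k j * y j)))%C
  = (w i + csum d (fun m => A i m * csum d (fun k => Q m k * y k)))%C.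
Proof.
  intros PA QP PQ Hi. set (Y := fun m => csum d (fun k => Q m k * y k)%C).
  assert (Ey : forall j, (j < d)%nat -> y j = csum d (fun m => P j m * Y m)%C).
  { intros j Hj. unfold Y. rewrite csum_assoc.
    rewrite (csum_ext d _ (fun k => RtoC (mid j k) * y k)%C) by (intros; now rewrite PQ).
    symmetry. now apply csum_mid. }
  assert (Inv : forall v, csum d (fun k => Q i k * csum d (fun m => P k m * v m))%C = v i).
  { intros v. rewrite csum_assoc.
    rewrite (csum_ext d _ (fun k => RtoC (mid i k) * v k)%C) by (intros; now rewrite QP).
    now apply csum_mid. }
  assert (I2 := Inv (fun l => csum d (fun m => A l m * Y m)%C)). cbv beta in I2.
  change (csum d (fun m => A i m * csum d (fun k => Q m k * y k))%C)
    with (csum d (fun m => A i m * Y m)%C).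
  rewrite <- (Inv w), <- I2, <- csum_plus.
  apply csum_ext. intros k Hk. rewrite <- Cmult_plus_distr_l. f_equal. f_equal.
  rewrite (csum_ext d _ (fun j => L k j * csum d (fun m => P j m * Y m))%C)
    by (intros; f_equal; now apply Ey).
  rewrite !csum_assoc. apply csum_ext. intros m Hm. now rewrite PA.
Qed.

(** Undoing the triangular change of basis turns the bounded complex functions [z] into a bounded
    candidate for x - x0. Its transform satisfies the same algebraic equation as that of [Zsol], so
    Lerch's theorem identifies the two and the true solution inherits the bound. *)
Lemma bounded_solution_exists al d A f : 0 < al < 1 -> Cinf d f ->
  (forall a b, is_eigenvalue d A a b -> in_Lambda_u al a b \/ in_Lambda_s al a b) ->
  exists x0 x, is_solution al d A f x0 x /\ bounded_on_nonneg d x.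
Proof.
  intros Ha Hf Heig.
  destruct (triangular_form d A) as (P & Q & L & PA & QP & PQ & LT0 & LE).
  destruct (Ftot_facts d A f (fun _ => 0) Hf) as (Cf & _ & M0 & Bf & _).
  set (g := fun i t => csum d (fun k => P i k * RtoC (f (Rmax 0 t) k))%C).
  assert (Cfe : forall k, (k < d)%nat -> ccont (fun t => RtoC (f (Rmax 0 t) k)))
    by (intros k Hk; apply ccont_RtoC, Cf, Hk).
  destruct (triangular_system al d L g Ha) with (n := d) as (c & z & s0 & Hs0 & Cz & Bz & Hz); [| | |lia|].
  { intros i Hi. destruct (L i i) as [a b] eqn:E. specialize (LE i Hi). rewrite E in LE. cbn [fst snd] in LE.
    assert (Hab : a <> 0 \/ b <> 0) by (destruct (Heig a b LE) as [[H _]|[H _]]; exact H).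
    destruct (polar_form a b Hab) as (Hp & l & El). exists l, (carg a b).
    split; [exact Hp|]. split; [|exact El].
    destruct (Heig a b LE) as [[_ H]|[_ H]]; lra. }
  { intros i Hi. apply (ccont_csum d (fun k t => P i k * RtoC (f (Rmax 0 t) k))%C).
    intros k Hk. apply ccont_scal, Cfe, Hk. }
  { intros i Hi. apply (cbounded_csum d (fun k t => P i k * RtoC (f (Rmax 0 t) k))%C).
    intros k Hk. exists (Cmod (P i k) * M0). apply (cbounded_scal (P i k) M0 (fun t => RtoC (f (Rmax 0 t) k))).
    intros t _. rewrite Cmod_R. now apply Bf. }
  (* Real parts may be taken because A and f are real: the real part of a complex solution solves
     the real system with the real part of the initial value. *)
  set (x0 := fun i => fst (csum d (fun k => Q i k * c k)%C)).
  set (zr := fun i t => fst (csum d (fun k => Q i k * z k t)%C)).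
  assert (CQ : forall i k, (k < d)%nat -> ccont (fun t => Q i k * z k t)%C)
    by (intros; apply ccont_scal; auto).
  assert (Czr : forall i, (i < d)%nat -> cont (zr i)).
  { intros i Hi. apply (ccont_csum d (fun k t => Q i k * z k t)%C). auto. }
  assert (Bzr : exists B, 0 <= B /\ forall i, (i < d)%nat -> forall t, 0 <= t -> Rabs (zr i t) <= B).
  { apply (finite_uniform d (fun i M => forall t, 0 <= t -> Rabs (zr i t) <= M)); [intros i M M' HM H t Ht; specialize (H t Ht); lra|]. intros i Hi.
    destruct (cbounded_csum d (fun k t => Q i k * z k t)%C) as (B & HB).
    - intros k Hk. destruct (Bz k Hk) as (B & HB). exists (Cmod (Q i k) * B). now apply cbounded_scal.
    - exists B. intros t Ht. apply Rle_trans with (2 := HB t Ht). unfold zr.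
      apply Rabs_fst_Cmod. }
  destruct Bzr as (B & HB0 & Bzr).
  destruct (Ftot_facts d A f x0 Hf) as (_ & CF & M & _ & BF).
  destruct (Zsol_bexp al d A (Ftot d A f x0) M Ha CF BF) as (b & K & Hb & HK & HZ).
  destruct (Zsol_lap al d A (Ftot d A f x0) M Ha CF BF) as (s1 & Hs1 & HL).
  destruct (resolvent_unique d A) as (K2 & Huniq).
  destruct (Rpower_large al K2) as (s2 & Hs2 & Hlarge); [lra|].
  assert (Main : forall i, (i < d)%nat -> forall t, 0 <= t -> Zsol al d A (Ftot d A f x0) t i = zr i t).
  { assert (CZ : forall i, (i < d)%nat -> cont (fun t => Zsol al d A (Ftot d A f x0) t i))
      by (intros; apply cont_Zsol; auto).
    intros i Hi t Ht. apply Rminus_diag_uniq. revert t Ht.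
    apply (lerch (fun t => Zsol al d A (Ftot d A f x0) t i - zr i t) b (K + B) (Rmax s0 (Rmax s1 s2))).
    - apply (cont_minus (fun t => Zsol al d A (Ftot d A f x0) t i) (zr i)); auto.
    - intros t Ht. apply Rle_trans with (1 := Rabs_triang _ _). rewrite Rabs_Ropp.
      assert (1 <= exp (b * t)) by (rewrite <- exp_0; apply exp_le; nra).
      assert (X := HZ i Hi t Ht). assert (Y := Bzr i Hi t Ht). cbv beta in X. nra.
    - intros s Hs. assert (N1 := Rmax_l s0 (Rmax s1 s2)). assert (N2 := Rmax_r s0 (Rmax s1 s2)).
      assert (N3 := Rmax_l s1 s2). assert (N4 := Rmax_r s1 s2).
      assert (Ex : exists fh, forall k, (k < d)%nat -> lap (fun t => f (Rmax 0 t) k) s (fh k)).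
      { apply (fun_choice_lt d (fun k l => lap (fun t => f (Rmax 0 t) k) s l) (inhabits 0)). intros k Hk.
        destruct (lap_ex (fun t => f (Rmax 0 t) k) 0 M0 s) as (l & Hl & _); [auto| |lra|exists l; exact Hl].
        apply bexp_bounded. intros; now apply Bf. }
      destruct Ex as (fh & Hfh).
      assert (Ez : exists zh, forall k, (k < d)%nat -> clap (z k) s (zh k)).
      { apply (fun_choice_lt d (fun k l => clap (z k) s l) (inhabits (RtoC 0))). intros k Hk. destruct (Bz k Hk) as (B' & HB').
        apply clap_ex with B'; auto. lra. }
      destruct Ez as (zh & Hzh).
      destruct (HL s ltac:(lra) (fun j => fh j + mvec d A x0 j * / s)) as (wh & Hwh).
      { intros j Hj. unfold Ftot. apply (lap_plus (fun t => f (Rmax 0 t) j)); auto.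
        - apply cont_const.
        - apply lap_const. lra. }
      set (Zh := fun i => csum d (fun k => Q i k * zh k)%C).
      assert (Hzr : forall i, (i < d)%nat -> lap (zr i) s (fst (Zh i))).
      { intros j Hj. refine (proj1 (clap_csum d (fun k t => Q j k * z k t)%C (fun k => Q j k * zh k)%C s (CQ j) _)).
        intros k Hk. apply clap_scal; auto. }
      replace 0 with (wh i - fst (Zh i)).
      + apply lap_minus; auto. now apply Hwh.
      (* Both vectors solve the same linear system with parameter s^al, which has only one solution
         for large s. *)
      + apply Rminus_diag_eq.
        apply (Huniq (Rpower s al) (Hlarge s ltac:(lra)) (fun j => fh j + mvec d A x0 j * / s) wh (fun i => fst (Zh i)));
          [intros; now apply Hwh| |exact Hi].
        clear i Hi. intros i Hi.
        set (y := fun k => (c k * / s + zh k)%C).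
        assert (E := conjugate_system d A P Q L y (fun k => RtoC (fh k)) i PA QP PQ Hi).
        assert (EY : forall m, csum d (fun k => Q m k * y k)%C = (csum d (fun k => Q m k * c k) * / s + Zh m)%C).
        { intros m. unfold y, Zh. rewrite <- csum_scalr, <- csum_plus. apply csum_ext. intros; ring. }
        rewrite (csum_ext d _ (fun k => RtoC (Rpower s al) * (Q i k * zh k))%C) in E.
        2:{ intros k Hk. cbv beta.
            (* Beyond index k the entries of row k of L vanish, so the full sum agrees with the
               partial sum delivered by the triangular system. *)
            rewrite (csum_lower (S k) d (fun j => L k j * y j)%C)
              by (try lia; intros; rewrite LT0 by lia; ring).
            transitivity (Q i k * (RtoC (Rpower s al) * zh k))%C; [|ring]. f_equal.
            symmetry. apply (Hz s ltac:(lra) (fun k => csum d (fun m => P k m * RtoC (fh m))%C) zh); auto.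
            intros j Hj. apply (clap_csum d (fun k t => P j k * RtoC (f (Rmax 0 t) k))%C).
            - intros l Hl. apply ccont_scal, Cfe, Hl.
            - intros l Hl. apply clap_scal; [apply Cfe, Hl|]. apply clap_RtoC, Hfh, Hl. }
        rewrite csum_scal in E. apply (f_equal fst) in E.
        fold (Zh i) in E. unfold Cplus in E. cbn [fst snd] in E. rewrite fst_csum in E.
        replace (fst (RtoC (Rpower s al) * Zh i)%C) with (Rpower s al * fst (Zh i)) in E
          by (cbn [fst snd Cmult RtoC]; ring).
        rewrite E. cbn [fst RtoC]. unfold mvec.
        rewrite (rsum_ext d _ (fun m => A i m * fst (Zh m) + / s * (A i m * x0 m))).
        * rewrite rsum_plus, rsum_scal. ring.
        * intros m Hm. rewrite EY, <- RtoC_inv by lra. unfold x0. cbn [fst snd Cmult Cplus RtoC]. ring. }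
  exists x0, (fun t i => x0 i + Zsol al d A (Ftot d A f x0) t i). split.
  - apply is_solution_iff; auto. split; [|reflexivity]. intros i Hi. rewrite Zsol_le_0 by lra. ring.
  - destruct (finite_uniform d (fun i M' => Rabs (x0 i) <= M')) as (M' & HM' & HX).
    + intros; lra.
    + intros i _. exists (Rabs (x0 i)). lra.
    + exists (M' + B). intros t Ht i Hi. apply Rle_trans with (1 := Rabs_triang _ _).
      apply Rplus_le_compat; [auto|]. rewrite Main by auto. auto.
Qed.

(** * Necessity: projection on a left eigenvector *)

Lemma Cinf_mid d i0 (h : R -> R) M : cont h -> (forall t, Rabs (h t) <= M) ->
  Cinf d (fun t j => mid i0 j * h t).
Proof.
  intros Hh HM. split.
  - intros i _ t _ eps Heps.
    assert (Hc : continuous (fun s => mid i0 i * h s) t)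
      by (apply (cont_mult (fun _ => mid i0 i) h); [apply cont_const|exact Hh]).
    apply filterlim_locally with (eps := mkposreal eps Heps) in Hc. destruct Hc as [delta Hd].
    exists delta. split; [apply cond_pos|]. intros s _ Hs. exact (Hd s Hs).
  - exists M. intros t _ i _. apply Rle_trans with (2 := HM t). unfold mid.
    destruct (Nat.eqb i0 i); [rewrite Rmult_1_l; lra|].
    rewrite Rmult_0_l, Rabs_R0. apply Rabs_pos.
Qed.

Lemma RtoC_rsum n f : RtoC (rsum n f) = csum n (fun k => RtoC (f k)).
Proof. induction n as [|n IH]; cbn [rsum csum]; [reflexivity|]. now rewrite RtoC_plus, IH. Qed.

(** Pairing x - x0 with a left eigenvector p collapses the system to one scalar equation. The
    forcing becomes p i0 times h plus the constant lambda q, where q is the pairing of p with the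
    unknown initial value. *)
Lemma eigenmode al d A a b p i0 h M : 0 < al < 1 ->
  (forall j, (j < d)%nat -> csum d (fun k => (p k * RtoC (A k j))%C) = (((a, b) : C) * p j)%C) ->
  (i0 < d)%nat -> cont h -> (forall t, Rabs (h t) <= M) ->
  (exists x0 x, is_solution al d A (fun t j => mid i0 j * h t) x0 x /\ bounded_on_nonneg d x) ->
  exists (q : C) Z B s0, ccont Z /\ cbounded B Z /\ forall s g, s0 < s ->
    clap (fun t => ((a, b) : C) * q + p i0 * RtoC (h t))%C s g ->
    clap Z s (g * / (RtoC (Rpower s al) - ((a, b) : C)))%C.
Proof.
  intros Ha Hp Hi0 Hh HM (x0 & x & Hsol & Bx & HBx).
  set (f := fun t j => mid i0 j * h t) in *. set (lam := ((a, b) : C)) in *.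
  assert (Hf : Cinf d f) by now apply Cinf_mid with M.
  destruct (Ftot_facts d A f x0 Hf) as (Cf & CF & M' & _ & BF).
  apply is_solution_iff in Hsol; auto. destruct Hsol as [Hx0 Hx].
  destruct (Zsol_lap al d A (Ftot d A f x0) M' Ha CF BF) as (s1 & Hs1 & HL).
  destruct (resolvent_neq0 al lam) as (s2 & Hs2 & Hnz); [lra|].
  set (z := fun k t => Zsol al d A (Ftot d A f x0) t k).
  assert (Cz : forall k, (k < d)%nat -> cont (z k)) by (intros k Hk; exact (cont_Zsol al d A _ k Ha Hk CF)).
  assert (Cpz : forall k, (k < d)%nat -> ccont (fun t => p k * RtoC (z k t))%C)
    by (intros; apply ccont_scal, ccont_RtoC; auto).
  destruct (cbounded_csum d (fun k t => p k * RtoC (z k t))%C) as (B & HB).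
  { intros k Hk. exists (Cmod (p k) * (Bx + Rabs (x0 k))).
    apply (cbounded_scal (p k) _ (fun t => RtoC (z k t))). intros t Ht. rewrite Cmod_R. unfold z.
    assert (Y := HBx t Ht k Hk).
    destruct (Req_dec t 0) as [->|Hn].
    - rewrite Zsol_le_0, Rabs_R0 by lra. assert (X := Rabs_pos (x 0 k)). assert (X' := Rabs_pos (x0 k)). lra.
    - assert (X := Hx t ltac:(lra) k Hk).
      replace (Zsol al d A (Ftot d A f x0) t k) with (x t k + - x0 k) by lra.
      apply Rle_trans with (1 := Rabs_triang _ _). rewrite Rabs_Ropp. lra. }
  exists (csum d (fun k => p k * RtoC (x0 k))%C), (fun t => csum d (fun k => p k * RtoC (z k t))%C), B, (Rmax s1 s2).
  split; [now apply (ccont_csum d (fun k t => p k * RtoC (z k t))%C)|]. split; [exact HB|].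
  intros s g Hs Hg. assert (N1 := Rmax_l s1 s2). assert (N2 := Rmax_r s1 s2).
  destruct (fun_choice_lt d (fun k l => lap (fun t => Ftot d A f x0 t k) s l) (inhabits 0)) as (Fh & HFh).
  { intros k Hk. destruct (lap_ex (fun t => Ftot d A f x0 t k) 0 M' s) as (l & Hl & _);
      [auto| |lra|exists l; exact Hl]. apply bexp_bounded. intros; now apply BF. }
  destruct (HL s ltac:(lra) Fh HFh) as (zh & Hzh).
  set (zc := csum d (fun k => p k * RtoC (zh k))%C).
  assert (Lz : clap (fun t => csum d (fun k => p k * RtoC (z k t))%C) s zc).
  { apply (clap_csum d (fun k t => p k * RtoC (z k t))%C); auto. intros k Hk.
    apply clap_scal; [apply ccont_RtoC; auto|]. apply clap_RtoC. now apply Hzh. }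
  assert (Left : forall v : nat -> R,
    csum d (fun k => p k * RtoC (mvec d A v k))%C = (lam * csum d (fun k => p k * RtoC (v k)))%C).
  { intros v. unfold mvec.
    rewrite (csum_ext d _ (fun k => p k * csum d (fun j => RtoC (A k j) * RtoC (v j)))%C).
    - rewrite (csum_assoc d (fun _ => p) (fun k j => RtoC (A k j)) (fun j => RtoC (v j)) O), <- csum_scal.
      apply csum_ext. intros j Hj. rewrite Hp by exact Hj. ring.
    - intros k Hk. rewrite RtoC_rsum. f_equal. apply csum_ext. intros. apply RtoC_mult. }
  assert (Eg : g = csum d (fun k => p k * RtoC (Fh k))%C).
  { apply (clap_unique _ _ _ _ Hg).
    apply clap_ext with (fun t => csum d (fun k => p k * RtoC (Ftot d A f x0 t k))%C).
    - intros t Ht. unfold Ftot, f.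
      rewrite (csum_ext d _ (fun k => RtoC (mid i0 k) * (p k * RtoC (h t)) + p k * RtoC (mvec d A x0 k))%C).
      + rewrite csum_plus, Left, csum_mid by exact Hi0. ring.
      + intros k Hk. rewrite (Rmax_right 0 t) by exact Ht. rewrite RtoC_plus, RtoC_mult. ring.
    - apply (clap_csum d (fun k t => p k * RtoC (Ftot d A f x0 t k))%C).
      + intros k Hk. apply ccont_scal, ccont_RtoC; auto.
      + intros k Hk. apply clap_scal; [apply ccont_RtoC; auto|]. apply clap_RtoC; auto. }
  assert (N := Hnz s ltac:(lra)).
  replace (g * / (RtoC (Rpower s al) - lam))%C with zc; [exact Lz|].
  assert (E : (RtoC (Rpower s al) * zc = lam * zc + g)%C).
  { unfold zc. rewrite Eg, <- Left, <- csum_plus, <- csum_scal. apply csum_ext. intros k Hk.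
    destruct (Hzh k Hk) as [_ E]. rewrite <- Cmult_plus_distr_l, <- RtoC_plus, <- E, RtoC_mult. ring. }
  replace g with ((RtoC (Rpower s al) - lam) * zc)%C; [field; exact N|].
  replace ((RtoC (Rpower s al) - lam) * zc)%C with (RtoC (Rpower s al) * zc - lam * zc)%C by ring.
  rewrite E. ring.
Qed.

(** t^al is al times the convolution of t^(al - 1) with 1, whose kernel in the variable v = t^al is
    constant; the transform is the case k = 0 of the Gamma integral. *)
Lemma lap_power al s : 0 < al < 1 -> 1 < s ->
  lap (fun t => pw t al) s (al * (Gamma al * Rpower s (- al) * / s)).
Proof.
  intros Ha Hs.
  apply lap_ext with (fun t => al * convk al (fun _ => 1) (fun _ => 1) t).
  - intros t Ht. unfold convk.
    rewrite (RInt_ext _ (fun _ => 1)) by (intros; eqR; ring). rewrite RInt_Rconst. field. lra.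
  - apply lap_scal; [apply cont_convk; [lra|apply cont_const|apply cont_const]|].
    apply (convk_lap al (fun _ => 1) (fun _ => 1) 1 0 1); try apply cont_const; try lra.
    + intros v Hv. rewrite Rmult_0_l, exp_0, Rabs_R1. lra.
    + intros t. rewrite Rabs_R1. lra.
    + replace (Gamma al * Rpower s (- al))
        with (Gamma (al * (INR 0 + 1)) * Rpower s (- (al * (INR 0 + 1))))
        by (cbn [INR]; f_equal; f_equal; ring).
      apply gamma_laplace with (k := O); lra.
    + replace (/ s) with (1 * / s) by ring. apply lap_const. lra.
Qed.

(** For lambda = 0 the transform of Z is p/(s s^al), that of p t^al/Gamma(al + 1). Multiplication by
    k = al Gamma(al)/p normalizes it, and Lerch's theorem forces k Z to have the real part t^al,
    which is unbounded. *)
Lemma integrator_unbounded al (p : C) Z B s1 : 0 < al < 1 -> p <> RtoC 0 -> ccont Z -> cbounded B Z ->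
  (forall s g, s1 < s -> clap (fun _ => p) s g -> clap Z s (g * / RtoC (Rpower s al))%C) -> False.
Proof.
  intros Ha Np CZ BZ HZ.
  assert (G0 : 0 < Gamma al) by (apply Gamma_pos; lra).
  set (k := (RtoC (al * Gamma al) * / p)%C).
  assert (E : forall t, 0 <= t -> pw t al - fst (k * Z t)%C = 0).
  { assert (CkZ := ccont_scal k Z CZ). assert (BkZ := cbounded_scal k B Z BZ).
    apply (lerch (fun t => pw t al - fst (k * Z t)%C) 1 (1 + Cmod k * B) (Rmax 1 s1)).
    - apply (cont_minus (fun t => pw t al) (fun t => fst (k * Z t)%C)); [apply cont_pw; lra|apply CkZ].
    - intros t Ht. apply Rle_trans with (1 := Rabs_triang _ _). rewrite Rabs_Ropp.
      assert (X := pw_le_exp t al Ha Ht). assert (Y := pw_ge_0 t al).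
      assert (U := Rle_trans _ _ _ (Rabs_fst_Cmod _) (BkZ t Ht)). assert (V := Rabs_pos (fst (k * Z t)%C)).
      assert (E1 : exp 0 <= exp t) by (apply exp_le; lra). rewrite exp_0 in E1.
      rewrite (Rabs_pos_eq (pw t al)) by exact Y. rewrite (Rmult_1_l t). nra.
    - intros s Hs. assert (N1 := Rmax_l 1 s1). assert (N2 := Rmax_r 1 s1).
      assert (X := HZ s _ ltac:(lra) (clap_const p s ltac:(lra))).
      apply (clap_scal k) in X; [|exact CZ]. destruct X as [X _].
      replace 0 with (al * (Gamma al * Rpower s (- al) * / s)
        - fst (k * (p * / RtoC s * / RtoC (Rpower s al)))%C).
      + apply (lap_minus (fun t => pw t al) (fun t => fst (k * Z t)%C));
          [apply cont_pw; lra|apply CkZ|apply lap_power; lra|exact X].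
      + assert (Ps := Rpower_pos s al).
        replace (k * (p * / RtoC s * / RtoC (Rpower s al)))%C
          with (RtoC (al * Gamma al * / s * / Rpower s al)).
        * cbn [fst RtoC]. rewrite Rpower_Ropp. ring.
        * unfold k. rewrite !RtoC_mult, !RtoC_inv by lra. field. repeat split; auto;
            intros H; injection H; lra. }
  destruct (Rpower_large al (Cmod k * B)) as (s0 & Hs0 & H); [lra|].
  specialize (H (s0 + 1) ltac:(lra)). specialize (E (s0 + 1) ltac:(lra)). rewrite pw_pos in E by lra.
  assert (U := Rle_trans _ _ _ (Rabs_fst_Cmod _) (cbounded_scal k B Z BZ (s0 + 1) ltac:(lra))).
  apply Rabs_le_between in U. lra.
Qed.

Theorem mainTheorem10 (alpha : R) (d : nat) (A : nat -> nat -> R)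
  (Halpha : 0 < alpha < 1) :
  (forall f : R -> nat -> R, Cinf d f ->
     exists (x0 : nat -> R) (x : R -> nat -> R),
       is_solution alpha d A f x0 x /\ bounded_on_nonneg d x)
  <->
  (forall a b : R, is_eigenvalue d A a b ->
     in_Lambda_u alpha a b \/ in_Lambda_s alpha a b).
Proof.
  split; [|intros H f Hf; now apply bounded_solution_exists].
  intros H a b Hab. destruct (left_eigenvector d A a b Hab) as (p & (i0 & Hi0 & Np) & Hp).
  apply NNPP. intros Hn.
  (* An eigenvalue in neither sector is either 0 or has an argument of modulus exactly al PI/2. *)
  destruct (classic (a <> 0 \/ b <> 0)) as [Hnz|Hz].
  - assert (Hcrit : Rabs (carg a b) = alpha * PI / 2).
    { destruct (Rtotal_order (Rabs (carg a b)) (alpha * PI / 2)) as [Hlt|[He|Hgt]];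
        [|exact He|]; exfalso; apply Hn; [left|right]; split; auto. }
    destruct (polar_form a b Hnz) as (Hphi & l & El).
    (* The forcing oscillates with the frequency Im mu of the undamped mode, in a coordinate
       direction i0 to which the left eigenvector is not orthogonal. *)
    set (w := snd (mu_of alpha l (carg a b))).
    assert (Cc : cont (fun t => cos (w * t))) by ct.
    assert (Bc : forall t, Rabs (cos (w * t)) <= 1) by (intros; apply Rabs_le, COS_bound).
    destruct (eigenmode alpha d A a b p i0 (fun t => cos (w * t)) 1 Halpha Hp Hi0 Cc Bc)
      as (q & Z & B & s0 & CZ & BZ & HZ).
    { apply H. now apply Cinf_mid with 1. }
    rewrite El in HZ. exact (resonance_unbounded alpha l (carg a b) (p i0) _ Z B s0 Halpha Hphi Hcrit Np CZ BZ HZ).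
  - destruct (eigenmode alpha d A a b p i0 (fun _ => 1) 1 Halpha Hp Hi0)
      as (q & Z & B & s0 & CZ & BZ & HZ).
    { apply cont_const. } { intros; rewrite Rabs_R1; lra. }
    { apply H. apply Cinf_mid with 1; [apply cont_const|intros; rewrite Rabs_R1; lra]. }
    (* With lambda = 0 the term lambda q disappears, so the initial value has no influence and the
       forcing is the constant p i0. *)
    assert (Ez : ((a, b) : C) = RtoC 0).
    { apply C_eq; cbn [fst snd RtoC]; apply NNPP; intros E; apply Hz; auto. }
    rewrite Ez in HZ.
    apply (integrator_unbounded alpha (p i0) Z B s0 Halpha Np CZ BZ). intros s g Hs Hg.
    replace (RtoC (Rpower s alpha)) with (RtoC (Rpower s alpha) - RtoC 0)%C by ring.
    apply HZ; [exact Hs|]. apply clap_ext with (2 := Hg). intros t _. ring.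
Qed.
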